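(* $\mathbf{PSPACE}\cap\mathcal{EXT}=\mathrm{NPSA}(1)$ and $\mathbf{NP}\cap\mathcal{EXT}=\mathrm{NPSB}(1)$ (as classes of problems over arbitrary signatures, on the class of all finite structures).
   Context: All structures are finite with at least two elements; problems are isomorphism-closed classes of finite structures over a signature; a problem is in a complexity class if its encoding is. For $\sigma$-structures, $\mathcal A\subseteq\mathcal B$ means $\mathcal A$ is a substructure of $\mathcal B$ (universe contained, relations restricted, constants equal). $\mathcal{EXT}$ is the class of problems $\Omega$ closed under extensions: $\mathcal A\subseteq\mathcal B$ and $\mathcal A\in\Omega$ imply $\mathcal B\in\Omega$. Program schemes of $\mathrm{NPSA}(1)$ over $\sigma$: variables $x_1,\dots,x_k$, array symbols; instructions $\mathtt{input}(x_1,\dots,x_k)$ first, $\mathtt{output}(x_1,\dots,x_k)$ last, others assignments $x_i:=y$, $x_i:=A[y_1,\dots,y_d]$, $A[y_1,\dots,y_d]:=y_0$ ($y_j$ variables, constants of $\sigma$, or special constants $0,max$), guesses $\mathtt{guess}\ x_i$, and while instructions with quantifier-free first-order tests over $\sigma\cup\{0,max\}$. Semantics: $0,max$ arbitrary distinct elements (acceptance must be independent of the choice); variables and arrays start at $0$; guesses nondeterministic; acceptance iff some computation reaches the output instruction with all variables equal to $max$. $\mathrm{NPSB}(1)$ is the subclass in which every assignment to an array element has the form $A[y_1,\dots,y_d]:=max$. No built-in order or successor is present. *)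

(* Defs.v *)
From HB Require Import structures.
From mathcomp Require Import all_boot all_algebra.

Set Implicit Arguments.
Unset Strict Implicit.
Unset Printing Implicit Defensive.

Record signature := Signature {
  nrel : nat;
  arity : 'I_nrel -> nat;
  ncst : nat }.

Record interp (sg : signature) (U : Type) := Interp {
  rel_of : forall i : 'I_(nrel sg), (arity i).-tuple U -> bool;
  cst_of : 'I_(ncst sg) -> U }.

Record structure (sg : signature) := Structure {
  univ :> finType;
  univ_gt1 : 1 < #|univ|;
  itp : interp sg univ }.

Definition isomorphic sg (A B : structure sg) : Prop :=
  exists f : A -> B,
    [/\ bijective f,
        forall i (t : (arity i).-tuple A),
          rel_of (itp B) (map_tuple f t) = rel_of (itp A) t
      & forall j, f (cst_of (itp A) j) = cst_of (itp B) j].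

Record problem (sg : signature) := Problem {
  member :> structure sg -> Prop;
  iso_closed : forall A B, isomorphic A B -> member A -> member B }.

Lemma card_sub_gt1 (U : finType) (S : {set U}) :
  1 < #|S| -> 1 < #|{: {x | x \in S}}|.
Proof. by rewrite card_sig. Qed.

Definition induced_interp sg (U : finType) (I : interp sg U) (S : {set U})
    (cS : forall j, cst_of I j \in S) : interp sg {x | x \in S} :=
  @Interp sg {x | x \in S}
    (fun i t => rel_of I (map_tuple val t))
    (fun j => exist _ (cst_of I j) (cS j)).

(** The substructures of [B] are the structures induced on the subsets [S] that
    contain the constants and, like every universe, have at least two elements. *)
Definition substructure sg (B : structure sg) (S : {set B}) (S_gt1 : 1 < #|S|)
    (cS : forall j, cst_of (itp B) j \in S) : structure sg :=
  @Structure sg {x | x \in S} (card_sub_gt1 S_gt1) (induced_interp cS).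

Definition EXT sg (Om : problem sg) : Prop :=
  forall (B : structure sg) (S : {set B}) (S_gt1 : 1 < #|S|)
         (cS : forall j, cst_of (itp B) j \in S),
    Om (substructure S_gt1 cS) -> Om B.

(** All [d]-tuples over {0,...,n-1}, in lexicographic order. *)
Fixpoint lex_tuples (n d : nat) : seq (d.-tuple 'I_n) :=
  if d is d'.+1
  then [seq cons_tuple x t | x <- enum 'I_n, t <- lex_tuples n d']
  else [:: nil_tuple 'I_n].

(** 1^n 0, then the truth table of each relation, then the characteristic
    vector of each constant.  The prefix makes [n] readable even from the
    encoding of a structure over a signature without symbols. *)
Definition encode sg n (I : interp sg 'I_n) : seq bool :=
  rcons (nseq n true) false
  ++ flatten [seq [seq rel_of I t | t <- lex_tuples n (arity i)]
             | i <- enum 'I_(nrel sg)]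
  ++ flatten [seq [seq x == cst_of I j | x <- enum 'I_n]
             | j <- enum 'I_(ncst sg)].

Definition language := seq bool -> Prop.

(** A problem being isomorphism-closed, structures on {0,...,n-1} suffice. *)
Definition encoding sg (Om : problem sg) : language :=
  fun w => exists n (n_gt1 : 1 < #|'I_n|) (I : interp sg 'I_n),
    Om (@Structure sg 'I_n n_gt1 I) /\ w = encode I.

Fixpoint nsteps (T : Type) (R : T -> T -> Prop) (n : nat) (x y : T) : Prop :=
  if n is n'.+1 then exists z, R x z /\ nsteps R n' z y else x = y.

Definition reaches (T : Type) (R : T -> T -> Prop) (x y : T) : Prop :=
  exists n, nsteps R n x y.

Inductive move := MoveL | Stay | MoveR.

Definition move_code (m : move) : option bool :=
  match m with MoveL => Some false | Stay => None | MoveR => Some true end.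
Definition move_decode (o : option bool) : move :=
  match o with Some false => MoveL | None => Stay | Some true => MoveR end.
Lemma move_codeK : cancel move_code move_decode. Proof. by case. Qed.
HB.instance Definition _ := Finite.copy move (can_type move_codeK).

(** Nondeterministic machines with [(ntape M).+1] one-way infinite read-write
    tapes; tape [ord0] initially holds the input, the other ones are blank. *)
Record tm := TM {
  ntape : nat;
  state : finType;
  sym : finType;
  blank : sym;
  bit : bool -> sym;
  bit_inj : injective bit;
  bit_neq_blank : forall b, bit b != blank;
  start : state;
  accepting : pred state;
  trans : state -> {ffun 'I_ntape.+1 -> sym} ->
          {set state * {ffun 'I_ntape.+1 -> sym} * {ffun 'I_ntape.+1 -> move}} }.

Definition deterministic (M : tm) : Prop :=
  forall (q : state M) s, #|trans q s| <= 1.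

Record config (M : tm) := Config {
  cstate : state M;
  ctape : 'I_(ntape M).+1 -> nat -> sym M;
  chead : 'I_(ntape M).+1 -> nat }.

Definition init_config (M : tm) (w : seq bool) : config M :=
  Config (start M)
    (fun i p => if i == ord0 then nth (blank M) (map (@bit M) w) p
                else blank M)
    (fun=> 0).

Definition scanned (M : tm) (c : config M) : {ffun 'I_(ntape M).+1 -> sym M} :=
  [ffun i => ctape c i (chead c i)].

(** A left move from cell 0 leaves the head in place. *)
Definition do_move (m : move) (p : nat) : nat :=
  match m with MoveL => p.-1 | Stay => p | MoveR => p.+1 end.

Definition tm_step (M : tm) (c c' : config M) : Prop :=
  exists q s m, (q, s, m) \in trans (cstate c) (scanned c) /\
    c' = Config q
           (fun i p => if p == chead c i then s i else ctape c i p)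
           (fun i => do_move (m i) (chead c i)).

Definition halted (M : tm) (c : config M) : Prop :=
  trans (cstate c) (scanned c) = set0.

Definition tm_accepts (M : tm) (w : seq bool) : Prop :=
  exists c, [/\ reaches (@tm_step M) (init_config M w) c, halted c
              & accepting (cstate c)].

Definition lang_PSPACE (L : language) : Prop :=
  exists (M : tm) (p : {poly nat}), deterministic M /\
    forall w,
      [/\ forall c, reaches (@tm_step M) (init_config M w) c ->
            forall i, chead c i < (p.[size w])%R,
          exists c, reaches (@tm_step M) (init_config M w) c /\ halted c
        & L w <-> tm_accepts M w].

Definition lang_NP (L : language) : Prop :=
  exists (M : tm) (p : {poly nat}),
    forall w,
      (forall t c, nsteps (@tm_step M) t (init_config M w) c ->
         t <= (p.[size w])%R) /\
      (L w <-> tm_accepts M w).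

Definition PSPACE sg (Om : problem sg) : Prop := lang_PSPACE (encoding Om).
Definition NP sg (Om : problem sg) : Prop := lang_NP (encoding Om).

(** [k] is the number of variables; [Zero] and [Max] are the special
    constants 0 and max. *)
Inductive term (sg : signature) (k : nat) :=
  | Var of 'I_k
  | Cst of 'I_(ncst sg)
  | Zero
  | Max.

Inductive test (sg : signature) (k : nat) :=
  | TRel (i : 'I_(nrel sg)) of (arity i).-tuple (term sg k)
  | TEq of term sg k & term sg k
  | TNot of test sg k
  | TAnd of test sg k & test sg k
  | TOr of test sg k & test sg k.

(** [m] is the number of array symbols, of dimensions [dim]. *)
Inductive instr (sg : signature) (k m : nat) (dim : 'I_m -> nat) :=
  | Assign of 'I_k & term sg k
  | ReadArr (x : 'I_k) (a : 'I_m) of (dim a).-tuple (term sg k)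
  | WriteArr (a : 'I_m) of (dim a).-tuple (term sg k) & term sg k
  | Guess of 'I_k
  | While of test sg k & seq (instr sg k dim).

Arguments Var {sg k}. Arguments Cst {sg k}.
Arguments Zero {sg k}. Arguments Max {sg k}.
Arguments Assign {sg k m dim}. Arguments Guess {sg k m dim}.

(** [body] is what stands between the input and the output instruction. *)
Record scheme (sg : signature) := Scheme {
  nvar : nat;
  nvar_gt0 : 0 < nvar;
  narr : nat;
  adim : 'I_narr -> nat;
  adim_gt0 : forall a, 0 < adim a;
  body : seq (instr sg nvar adim) }.

(** Values of the variables, and values of the array elements. *)
Definition store (U : finType) (k m : nat) (dim : 'I_m -> nat) : Type :=
  {ffun 'I_k -> U} * {ffun {a : 'I_m & (dim a).-tuple U} -> U}.

Section Semantics.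
(** [z] and [mx] interpret 0 and max. *)
Variables (sg : signature) (A : structure sg) (z mx : A).
Variables (k m : nat) (dim : 'I_m -> nat).
Implicit Types (s : store A k dim) (r : seq (instr sg k dim)).

Definition eval_term s (t : term sg k) : A :=
  match t with
  | Var x => s.1 x
  | Cst j => cst_of (itp A) j
  | Zero => z
  | Max => mx
  end.

Fixpoint eval_test s (b : test sg k) : bool :=
  match b with
  | TRel i ts => rel_of (itp A) (map_tuple (eval_term s) ts)
  | TEq t u => eval_term s t == eval_term s u
  | TNot b => ~~ eval_test s b
  | TAnd b c => eval_test s b && eval_test s c
  | TOr b c => eval_test s b || eval_test s c
  end.

Definition cell s (a : 'I_m) (ts : (dim a).-tuple (term sg k)) :
    {a : 'I_m & (dim a).-tuple A} :=
  Tagged (fun a => (dim a).-tuple A) (map_tuple (eval_term s) ts).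

Definition set_var s (x : 'I_k) (u : A) : store A k dim :=
  ([ffun y => if y == x then u else s.1 y], s.2).

Definition set_cell s (c : {a : 'I_m & (dim a).-tuple A}) (u : A) :
    store A k dim :=
  (s.1, [ffun d => if d == c then u else s.2 d]).

(** The first component is the list of instructions still to be executed
    before the output instruction. *)
Inductive ps_step :
    seq (instr sg k dim) * store A k dim ->
    seq (instr sg k dim) * store A k dim -> Prop :=
  | StepAssign x t r s :
      ps_step (Assign x t :: r, s) (r, set_var s x (eval_term s t))
  | StepRead x a ts r s :
      ps_step (ReadArr x ts :: r, s) (r, set_var s x (s.2 (@cell s a ts)))
  | StepWrite a ts t r s :
      ps_step (WriteArr ts t :: r, s)
              (r, set_cell s (@cell s a ts) (eval_term s t))
  | StepGuess x u r s :
      ps_step (Guess x :: r, s) (r, set_var s x u)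
  | StepWhile b l r s :
      ps_step (While b l :: r, s)
              (if eval_test s b then l ++ While b l :: r else r, s).

Definition init_store : store A k dim := ([ffun=> z], [ffun=> z]).

End Semantics.

Definition ps_accepts sg (P : scheme sg) (A : structure sg) (z mx : A) : Prop :=
  exists s, reaches (@ps_step sg A z mx _ _ _)
              (body P, init_store z (nvar P) (@adim _ P)) ([::], s) /\
            forall x, s.1 x = mx.

Definition choice_independent sg (P : scheme sg) : Prop :=
  forall (A : structure sg) (z mx z' mx' : A), z != mx -> z' != mx' ->
    (ps_accepts P z mx <-> ps_accepts P z' mx').

Definition defines sg (P : scheme sg) (Om : problem sg) : Prop :=
  choice_independent P /\
  forall A : structure sg,
    Om A <-> exists z mx : A, z != mx /\ ps_accepts P z mx.

Definition NPSA1 sg (Om : problem sg) : Prop :=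
  exists P : scheme sg, defines P Om.

Fixpoint writes_only_max sg k m (dim : 'I_m -> nat)
    (c : instr sg k dim) : bool :=
  match c with
  | WriteArr _ _ Max => true
  | WriteArr _ _ _ => false
  | While _ l => all (@writes_only_max sg k m dim) l
  | _ => true
  end.

Definition NPSB1 sg (Om : problem sg) : Prop :=
  exists P : scheme sg, all (@writes_only_max _ _ _ _) (body P) /\ defines P Om.

(* Main.v *)
(** Acceptance is described by first-order formulas over an ordered initial
    segment [0, n ^ K).  Call a transition system first-order when its
    configurations are relations on that segment and its initial, final and step
    conditions are first-order.  A run of length below [n ^ K] is then a single
    relation satisfying a first-order formula; for runs of length [2 ^ (n ^ K)],
    Savitch's midpoint recursion, with the tested branches and the midpoints read
    off one word of quantified bits, gives a quantified Boolean formula with a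
    first-order kernel.  Machines with unary counters evaluate both, in NP and in
    PSPACE.  The NP machine never overwrites a cell, so it is polynomially fast:
    between two writes a terminating run cannot repeat a state together with its
    head positions.

    A scheme is a first-order system because it has finitely many continuations.
    If it writes only [max], its arrays grow along a run, so shortest accepting
    runs are polynomially long.  An accepting run on a substructure can be replayed
    in every extension, hence the closure under extensions.

    Conversely a machine is a first-order system too.  As no order is available,
    the scheme guesses a chain from 0 to [max] through all the constants, storing
    it by writing [max] only; universal quantifiers become walks along the chain.
    The chain need not exhaust the universe, but then the scheme accepts because a
    substructure is in the problem, and so is the whole structure since the problem
    is closed under extensions.  If only [max] may be written, the whole run of the
    machine is guessed at once; otherwise each configuration overwrites the
    previous one. *)

Require Import Defs.
From mathcomp Require Import all_boot all_algebra.
From mathcomp Require Import boolp.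
From mathcomp Require Import zify.
Set Implicit Arguments.
Unset Strict Implicit.
Unset Printing Implicit Defensive.

(** * Digits *)

(** Times, head positions and levels are all measured by one number [N = n ^ K], so a single
    exponent per scheme or machine suffices, and a place in a word is a string of digits in base
    [N]. Formulas name a configuration by a variable; hence the same [STEP] serves for consecutive
    times inside one relation, for the two ends of a segment in Savitch's recursion, and for the two
    slots of a scheme that holds only the current configuration. Three obstacles shape the details.
    A failed test of a scheme never ends, so a truth value cannot be returned by failing: checks
    come in both polarities, and copying is guessing followed by comparing. The input of a machine
    has to be described from the structure without arithmetic: a table of positions is guessed along
    with the initial configuration and pinned down by its own recursion. Finally, an encoding does
    not by itself determine a machine configuration, whose tapes extend beyond [N]; the
    correspondence is always between a relation and some configuration that it encodes. *)

Fixpoint val_of (n : nat) (ds : seq nat) : nat :=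
  if ds is d :: ds' then d * n ^ size ds' + val_of n ds' else 0.

Fixpoint digits (n K x : nat) : seq nat :=
  if K is K'.+1 then x %/ n ^ K' :: digits n K' (x %% n ^ K') else [::].

Lemma val_of_rcons n ds d : val_of n (rcons ds d) = val_of n ds * n + d.
Proof.
elim: ds => [|e ds IH] /=; first by rewrite expn0 muln1 addn0 mul0n.
by rewrite IH size_rcons expnSr mulnDl mulnA addnA.
Qed.

Lemma val_of_cat n ds es :
  val_of n (ds ++ es) = val_of n ds * n ^ size es + val_of n es.
Proof.
elim: ds => [|d ds IH] //=.
by rewrite IH size_cat expnD mulnDl mulnA addnA.
Qed.

Lemma val_of_lt n ds : all (gtn n) ds -> val_of n ds < n ^ size ds.
Proof.
elim: ds => [|d ds IH] //= /andP[dn /IH vn].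
rewrite expnS; apply: (@leq_trans (d.+1 * n ^ size ds)).
  by rewrite mulSn addnC ltn_add2r.
by rewrite leq_mul2r dn orbT.
Qed.

Lemma size_digits n K x : size (digits n K x) = K.
Proof. by elim: K x => //= K IH x; rewrite IH. Qed.

Lemma digits_lt n K x : x < n ^ K -> all (gtn n) (digits n K x).
Proof.
elim: K x => [|K IH] x //= xn.
have n0 : 0 < n by case: n xn {IH} => //; rewrite exp0n.
rewrite IH ?ltn_mod ?expn_gt0 ?n0 // andbT.
by rewrite ltn_divLR ?expn_gt0 ?n0 // -expnS.
Qed.

Lemma val_digits n K x : 0 < n -> x < n ^ K -> val_of n (digits n K x) = x.
Proof.
move=> n0; elim: K x => [|K IH] x /=; first by rewrite expn0; case: x.
by move=> xn; rewrite size_digits IH ?ltn_mod ?expn_gt0 ?n0 // -divn_eq.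
Qed.

Lemma digits_val n ds : all (gtn n) ds -> digits n (size ds) (val_of n ds) = ds.
Proof.
elim: ds => [|d ds IH] //= /andP[dn ad].
have n0 : 0 < n by apply: leq_trans dn.
have vn := val_of_lt ad.
rewrite divnMDl ?expn_gt0 ?n0 // divn_small ?addn0 ?modnMDl ?modn_small //.
by rewrite IH.
Qed.

Lemma val_of_nseq0 n k : val_of n (nseq k 0) = 0.
Proof. by elim: k => //= k ->; rewrite mul0n. Qed.

Lemma digits_small n K x : 0 < n -> x < n -> digits n K.+1 x = rcons (nseq K 0) x.
Proof.
move=> n0 xn.
have a : all (gtn n) (rcons (nseq K 0) x).
  by rewrite all_rcons /= xn all_nseq /= n0 orbT.
rewrite -{1}(_ : val_of n (rcons (nseq K 0) x) = x); last first.
  by rewrite val_of_rcons val_of_nseq0.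
by rewrite -[K.+1](_ : size (rcons (nseq K 0) x) = _) ?digits_val // size_rcons size_nseq.
Qed.

(** Entry [x] is the digit string of [x], so the place of a tuple in a truth table is its value and
    table lookup becomes arithmetic. *)
Definition tuples_lt (n d : nat) : seq (seq nat) :=
  [seq digits n d x | x <- iota 0 (n ^ d)].

Lemma iotaM a b : iota 0 (a * b) = [seq x * b + y | x <- iota 0 a, y <- iota 0 b].
Proof.
elim: a => [|a IH] //.
rewrite mulSn addnC iotaD add0n -[a.+1]addn1 iotaD map_cat flatten_cat /= -IH.
rewrite cats0 add0n; congr cat.
by rewrite -{1}[a * b]addn0 iotaDl.
Qed.

Lemma tuples_ltS n d : 0 < n ->
  tuples_lt n d.+1 = [seq x :: t | x <- iota 0 n, t <- tuples_lt n d].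
Proof.
move=> n0; rewrite /tuples_lt expnS iotaM map_allpairs allpairs_mapr.
apply/eq_in_allpairs => x y; rewrite !mem_iota /= !add0n => xn yn.
by rewrite divnMDl ?expn_gt0 ?n0 // divn_small // addn0 modnMDl modn_small.
Qed.

Lemma lex_tuplesE n d : 0 < n ->
  [seq map val (val t) | t <- lex_tuples n d] = tuples_lt n d.
Proof.
move=> n0; elim: d => [|d IH]; first by [].
rewrite tuples_ltS // -IH -val_enum_ord /= map_allpairs allpairs_mapl allpairs_mapr.
by apply: eq_allpairs.
Qed.

(** * The encoding as a list of truth tables *)

Definition nblk (sg : signature) := nrel sg + ncst sg.

(** A constant counts as a block of arity 1, its characteristic vector being the table of a unary
    relation; relations and constants are then treated alike. *)
Definition arities (sg : signature) : seq nat :=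
  [seq arity i | i <- enum 'I_(nrel sg)] ++ nseq (ncst sg) 1.

Definition ar_of sg b := nth 0 (arities sg) b.

Lemma size_arities sg : size (arities sg) = nblk sg.
Proof. by rewrite size_cat size_map size_enum_ord size_nseq. Qed.

Definition ordn n (o : 'I_n) (x : nat) : 'I_n := insubd o x.

Lemma val_ordn n (o : 'I_n) x : x < n -> ordn o x = x :> nat.
Proof. by move=> xn; rewrite /ordn val_insubd xn. Qed.

Lemma ordn_val n (o x : 'I_n) : ordn o x = x.
Proof. by apply: ord_inj; rewrite val_ordn. Qed.

(** Blocks act on lists of integers, which gives the tables of all arities one type; [o] replaces
    arguments of relations that lie outside the universe. *)
Definition blocks sg n (o : 'I_n) (I : interp sg 'I_n) : seq (seq nat -> bool) :=
  [seq fun l => rel_of I [tuple ordn o (nth 0 l k) | k < arity i]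
     | i <- enum 'I_(nrel sg)] ++
  [seq fun l => nth 0 l 0 == cst_of I j | j <- enum 'I_(ncst sg)].

Definition blk sg n (o : 'I_n) (I : interp sg 'I_n) (b : nat) : seq nat -> bool :=
  nth (fun=> false) (blocks o I) b.

Lemma size_blocks sg n (o : 'I_n) (I : interp sg 'I_n) : size (blocks o I) = nblk sg.
Proof. by rewrite size_cat size_map size_enum_ord size_map size_enum_ord. Qed.

Lemma blk_rel sg n (o : 'I_n) (I : interp sg 'I_n) (i : 'I_(nrel sg)) l :
  blk o I i l = rel_of I [tuple ordn o (nth 0 l k) | k < arity i].
Proof.
rewrite /blk nth_cat size_map size_enum_ord ltn_ord.
by rewrite (nth_map i) ?size_enum_ord ?ltn_ord // nth_ord_enum.
Qed.

Lemma blk_cst sg n (o : 'I_n) (I : interp sg 'I_n) (j : 'I_(ncst sg)) l :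
  blk o I (nrel sg + j) l = (nth 0 l 0 == cst_of I j).
Proof.
rewrite /blk nth_cat size_map size_enum_ord ltnNge leq_addr /= addKn.
by rewrite (nth_map j) ?size_enum_ord ?ltn_ord // nth_ord_enum.
Qed.

Lemma ar_rel sg (i : 'I_(nrel sg)) : ar_of sg i = arity i.
Proof.
rewrite /ar_of nth_cat size_map size_enum_ord ltn_ord.
by rewrite (nth_map i) ?size_enum_ord ?ltn_ord // nth_ord_enum.
Qed.

Lemma ar_cst sg (j : 'I_(ncst sg)) : ar_of sg (nrel sg + j) = 1.
Proof.
rewrite /ar_of nth_cat size_map size_enum_ord ltnNge leq_addr /= addKn.
by rewrite nth_nseq ltn_ord.
Qed.

Definition table n (a : nat) (f : seq nat -> bool) : seq bool :=
  [seq f l | l <- tuples_lt n a].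

Lemma size_table n a f : size (table n a f) = n ^ a.
Proof. by rewrite !size_map size_iota. Qed.

Lemma nth_table n a f l : all (gtn n) l -> size l = a ->
  nth false (table n a f) (val_of n l) = f l.
Proof.
move=> ln <-; have vl := val_of_lt ln.
rewrite (nth_map [::]) ?size_map ?size_iota // (nth_map 0) ?size_iota //.
by rewrite nth_iota // add0n digits_val.
Qed.

Definition tables sg n (F : nat -> seq nat -> bool) : seq (seq bool) :=
  [seq table n (ar_of sg b) (F b) | b <- iota 0 (nblk sg)].

Lemma encodeE sg n (o : 'I_n) (I : interp sg 'I_n) :
  encode I = nseq n true ++ false :: flatten (tables sg n (blk o I)).
Proof.
have n0 : 0 < n by case: o => x xn; apply: leq_trans xn.
rewrite /encode cat_rcons -flatten_cat /tables /nblk iotaD map_cat add0n.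
congr (_ ++ _ :: flatten (_ ++ _)).
  rewrite -[in RHS]val_enum_ord -map_comp; apply: eq_map => i /=.
  rewrite /table ar_rel -lex_tuplesE // -map_comp; apply: eq_map => t /=.
  rewrite blk_rel; congr rel_of; apply: eq_from_tnth => k.
  rewrite tnth_mktuple (nth_map (tnth t k)) ?size_tuple //.
  by rewrite -tnth_nth ordn_val.
rewrite -[X in iota X _]addn0 iotaDl -map_comp -[in RHS]val_enum_ord -map_comp.
apply: eq_map => j /=; rewrite /table ar_cst /tuples_lt expn1.
rewrite -val_enum_ord -!map_comp; apply: eq_map => x /=.
by rewrite blk_cst /= expn0 divn1.
Qed.

Lemma flatten_inj_shape (T : Type) (ss1 ss2 : seq (seq T)) :
  shape ss1 = shape ss2 -> flatten ss1 = flatten ss2 -> ss1 = ss2.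
Proof. by move=> sh fl; rewrite -[ss1]flattenK -[ss2]flattenK sh fl. Qed.

Lemma nseq_false_inj n1 n2 (r1 r2 : seq bool) :
  nseq n1 true ++ false :: r1 = nseq n2 true ++ false :: r2 -> n1 = n2 /\ r1 = r2.
Proof.
elim: n1 n2 => [|n1 IH] [|n2] //=; first by case=> ->.
by case=> /IH [-> ->].
Qed.

Lemma shape_tables sg n F : shape (tables sg n F) = [seq n ^ a | a <- arities sg].
Proof.
rewrite /shape /tables -map_comp -size_arities.
apply: (@eq_from_nth _ 0); first by rewrite !size_map size_iota.
move=> b; rewrite size_map size_iota => bl.
by rewrite (nth_map 0) ?size_iota // (nth_map 0) // nth_iota //= size_table.
Qed.

(** The lengths of the tables depend on [n] and the signature alone, so the concatenated bits can be
    cut in one way only. *)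
Lemma encode_inj sg n (I1 I2 : interp sg 'I_n) : 0 < n -> encode I1 = encode I2 ->
  (forall i (t : (arity i).-tuple 'I_n), rel_of I1 t = rel_of I2 t) /\ (forall j, cst_of I1 j = cst_of I2 j).
Proof.
move=> n0; pose o := Ordinal n0.
rewrite !(encodeE o) => /nseq_false_inj [_] /flatten_inj_shape.
rewrite !shape_tables => /(_ erefl) E.
have F b l : b < nblk sg -> all (gtn n) l -> size l = ar_of sg b -> blk o I1 b l = blk o I2 b l.
  move=> bl ln sl; rewrite -(nth_table (blk o I1 b) ln sl) -(nth_table (blk o I2 b) ln sl).
  have := congr1 (fun s => nth [::] s b) E.
  by rewrite !(nth_map 0) ?size_iota // nth_iota // add0n => ->.
split=> [i t|j].
  have := F i (map val t); rewrite ltn_addr // !blk_rel ar_rel size_map size_tuple.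
  have -> : [tuple ordn o (nth 0 (map val t) k) | k < arity i] = t.
    apply: eq_from_tnth => k; rewrite tnth_mktuple (nth_map (tnth t k)) ?size_tuple //.
    by rewrite -tnth_nth ordn_val.
  by apply=> //; apply/allP => _ /mapP [x _ ->] /=.
apply: val_inj; have := F (nrel sg + j) [:: val (cst_of I1 j)].
rewrite ltn_add2l ltn_ord !blk_cst ar_cst /= eqxx => /(_ erefl).
by rewrite ltn_ord => /(_ erefl erefl) /esym /eqP.
Qed.

(** * First-order formulas over an ordered initial segment of the integers *)

(** [ABlk b] is the [b]-th block of the encoding and [AX t] a second-order
    relation; arguments are de Bruijn indices. *)
Inductive atom (T : Type) := ALt | ASmall | ABlk of nat | AX of T.
Arguments ALt {T}. Arguments ASmall {T}. Arguments ABlk {T}.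

Inductive fo (T : Type) :=
  | Atom of atom T & seq nat
  | Neg of fo T
  | Conj of fo T & fo T
  | Ex of fo T.
Arguments Atom {T}.

(** Quantifiers may range beyond the universe, so blocks are made false outside it. [ALt] and
    [ASmall] with a wrong number of arguments are false, which gives every formula a value. *)
Definition interp_atom (T : Type) (n : nat) (Bk : nat -> seq nat -> bool)
    (X : T -> seq nat -> bool) (a : atom T) (l : seq nat) : bool :=
  match a with
  | ALt => if l is [:: x; y] then x < y else false
  | ASmall => if l is [:: x] then x < n else false
  | ABlk b => all (gtn n) l && Bk b l
  | AX t => X t l
  end.

Fixpoint ev (T : Type) (N : nat) (I : atom T -> seq nat -> bool) (e : seq nat)
    (f : fo T) : bool :=
  match f with
  | Atom a l => I a [seq nth 0 e i | i <- l]
  | Neg g => ~~ ev N I e g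
  | Conj g h => ev N I e g && ev N I e h
  | Ex g => has (fun v => ev N I (v :: e) g) (iota 0 N)
  end.

Fixpoint exs (T : Type) k (f : fo T) : fo T :=
  if k is k'.+1 then exs k' (Ex f) else f.

Section Macros.
Variable T : Type.
Implicit Types (f g : fo T) (x y i : nat).

Definition FLt x y : fo T := Atom ALt [:: x; y].
Definition FSmall x : fo T := Atom ASmall [:: x].
Definition FF : fo T := FLt 0 0.
Definition TT : fo T := Neg FF.
Definition Disj f g := Neg (Conj (Neg f) (Neg g)).
Definition Imp f g := Neg (Conj f (Neg g)).
Definition Iff f g := Conj (Imp f g) (Imp g f).
Definition All f := Neg (Ex (Neg f)).
Definition alls k f := Neg (exs k (Neg f)).
Definition FEq x y : fo T := Conj (Neg (FLt x y)) (Neg (FLt y x)).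
Definition FSucc x y : fo T := Conj (FLt x y) (Neg (Ex (Conj (FLt x.+1 0) (FLt 0 y.+1)))).
Definition FFirst x : fo T := Neg (Ex (FLt 0 x.+1)).
Definition FOne x : fo T := Ex (Conj (FFirst 0) (FSucc 0 x.+1)).
Definition conjs (s : seq (fo T)) := foldr (@Conj T) TT s.
Definition disjs (s : seq (fo T)) := foldr Disj FF s.
Definition Cond (b : bool) f := if b then f else FF.

Fixpoint FLex (xs ys : seq nat) : fo T :=
  match xs, ys with
  | x :: xs', y :: ys' => Disj (FLt x y) (Conj (FEq x y) (FLex xs' ys'))
  | _, _ => FF
  end.

Variables (N n : nat) (Bk : nat -> seq nat -> bool) (X : T -> seq nat -> bool).
Notation I := (interp_atom n Bk X).
Implicit Type e : seq nat.

Local Notation okenv e := (all (gtn N) e).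

Lemma okenv_nth e x : 0 < N -> okenv e -> nth 0 e x < N.
Proof.
move=> N0 /allP oke; have [xe|xe] := ltnP x (size e); last by rewrite nth_default.
exact/oke/mem_nth.
Qed.

Lemma ev_Neg e f : ev N I e (Neg f) = ~~ ev N I e f. Proof. by []. Qed.
Lemma ev_Conj e f g : ev N I e (Conj f g) = ev N I e f && ev N I e g. Proof. by []. Qed.
Lemma ev_Lt e x y : ev N I e (FLt x y) = (nth 0 e x < nth 0 e y). Proof. by []. Qed.
Lemma ev_Small e x : ev N I e (FSmall x) = (nth 0 e x < n). Proof. by []. Qed.
Lemma ev_FF e : ev N I e FF = false. Proof. by rewrite /= ltnn. Qed.
Lemma ev_TT e : ev N I e TT = true. Proof. by rewrite /= ltnn. Qed.
Lemma ev_Disj e f g : ev N I e (Disj f g) = ev N I e f || ev N I e g.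
Proof. by rewrite /= negb_and !negbK. Qed.
Lemma ev_Imp e f g : ev N I e (Imp f g) = (ev N I e f ==> ev N I e g).
Proof. by rewrite /= negb_and negbK implybE. Qed.
Lemma ev_Iff e f g : ev N I e (Iff f g) = (ev N I e f == ev N I e g).
Proof. by rewrite ev_Conj !ev_Imp; case: ev; case: ev. Qed.
Lemma ev_Cond e b f : ev N I e (Cond b f) = b && ev N I e f.
Proof. by case: b => //=; rewrite ltnn. Qed.

Lemma ev_Ex e f : reflect (exists2 v, v < N & ev N I (v :: e) f) (ev N I e (Ex f)).
Proof.
apply: (iffP hasP) => [[v]|[v vN fv]].
  by rewrite mem_iota add0n => /= vN fv; exists v.
by exists v => //; rewrite mem_iota add0n.
Qed.

Lemma ev_All e f : reflect (forall v, v < N -> ev N I (v :: e) f) (ev N I e (All f)).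
Proof.
rewrite /All ev_Neg; apply: (iffP idP) => [/ev_Ex nf v vN|fv].
  by apply/negPn/negP => fv; apply: nf; exists v.
by apply/ev_Ex => -[v vN] /=; rewrite fv.
Qed.

Lemma ev_exs k e f :
  reflect (exists ds, [/\ size ds = k, all (gtn N) ds & ev N I (ds ++ e) f])
          (ev N I e (exs k f)).
Proof.
elim: k f => [|k IH] f /=.
  by apply: (iffP idP) => [fe|[[|v s] [] //]]; exists [::].
apply: (iffP (IH _)) => [[ds [sd ad]] /ev_Ex [v vN fv]|[[|v ds] [//= [sd] /andP[vN ad] fv]]].
  by exists (v :: ds); rewrite /= sd vN.
by exists ds; split=> //; apply/ev_Ex; exists v.
Qed.

Lemma ev_alls k e f :
  reflect (forall ds, size ds = k -> all (gtn N) ds -> ev N I (ds ++ e) f)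
          (ev N I e (alls k f)).
Proof.
rewrite /alls ev_Neg; apply: (iffP idP) => [/ev_exs nf ds sd ad|fv].
  by apply/negPn/negP => fv; apply: nf; exists ds.
by apply/ev_exs => -[ds [sd ad]] /=; rewrite fv.
Qed.

Lemma ev_Eq e x y : ev N I e (FEq x y) = (nth 0 e x == nth 0 e y).
Proof. by rewrite ev_Conj !ev_Neg !ev_Lt -!leqNgt eqn_leq andbC. Qed.

Lemma ev_Succ e x y : 0 < N -> okenv e ->
  ev N I e (FSucc x y) = (nth 0 e y == (nth 0 e x).+1).
Proof.
move=> N0 oke; have yN := okenv_nth y N0 oke.
apply/idP/eqP => [|E].
  rewrite ev_Conj ev_Neg ev_Lt => /andP[xy] /ev_Ex h; apply/eqP.
  rewrite eqn_leq xy andbT leqNgt; apply/negP => xy1; apply: h.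
  by exists (nth 0 e x).+1; [apply: ltn_trans yN|rewrite ev_Conj !ev_Lt /= ltnSn].
rewrite ev_Conj ev_Neg ev_Lt E ltnSn andTb; apply/ev_Ex => -[v _].
by rewrite ev_Conj !ev_Lt /= E ltnS; case: ltngtP.
Qed.

Lemma ev_First e x : 0 < N -> okenv e -> ev N I e (FFirst x) = (nth 0 e x == 0).
Proof.
move=> N0 oke; rewrite /FFirst ev_Neg -[RHS]negbK -lt0n; congr negb.
apply/ev_Ex/idP => [[v _]|x0]; first by rewrite ev_Lt /=; case: nth.
by exists 0; rewrite ?ev_Lt.
Qed.

Lemma ev_One e x : 1 < N -> okenv e -> ev N I e (FOne x) = (nth 0 e x == 1).
Proof.
move=> N1 oke; have N0 : 0 < N by apply: ltn_trans N1.
apply/ev_Ex/eqP => [[v vN]|x1].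
  rewrite ev_Conj ev_First ?ev_Succ //= ?vN // => /andP[/eqP -> /eqP -> //].
exists 0 => //.
by rewrite ev_Conj ev_First ?ev_Succ //= ?N0 //= x1.
Qed.

Lemma ev_conjs e s : ev N I e (conjs s) = all (ev N I e) s.
Proof. by elim: s => [|f s IH]; rewrite ?ev_TT //= IH. Qed.

Lemma ev_disjs e s : ev N I e (disjs s) = has (ev N I e) s.
Proof. by elim: s => [|f s IH]; rewrite ?ev_FF //= -IH negb_and !negbK. Qed.

Lemma ev_conjs_map (J : Type) (s : seq J) F e :
  ev N I e (conjs [seq F j | j <- s]) = all (fun j => ev N I e (F j)) s.
Proof. by rewrite ev_conjs all_map. Qed.

Lemma ev_disjs_map (J : Type) (s : seq J) F e :
  ev N I e (disjs [seq F j | j <- s]) = has (fun j => ev N I e (F j)) s.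
Proof. by rewrite ev_disjs has_map. Qed.

(** The leading digits decide unless they are equal, because the remaining digits contribute less
    than one unit of that weight. The base [b] is independent of the range [N] of the
    quantifiers. *)
Lemma ev_Lex b xs ys e : size xs = size ys ->
  all (gtn b) [seq nth 0 e x | x <- xs] -> all (gtn b) [seq nth 0 e y | y <- ys] ->
  ev N I e (FLex xs ys) =
    (val_of b [seq nth 0 e x | x <- xs] < val_of b [seq nth 0 e y | y <- ys]).
Proof.
elim: xs ys => [|x xs IH] [|y ys] //=; first by rewrite !ltnn.
move=> [sxy] /andP[xb xsb] /andP[yb ysb].
have vx := val_of_lt xsb; have vy := val_of_lt ysb.
rewrite -/(Disj _ _) -!/(FLt _ _) -/(FEq x y) negb_and !negbK.
have -> : ev N I e (FLex xs ys) = (val_of b [seq nth 0 e i | i <- xs] <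
   val_of b [seq nth 0 e y0 | y0 <- ys]) by apply: IH.
rewrite !size_map in vx vy *; rewrite sxy in vx *.
set B := b ^ _ in vx vy *.
case: (ltngtP (nth 0 e x) (nth 0 e y)) => h /=.
- apply/esym; apply: (@leq_trans ((nth 0 e x).+1 * B)).
    by rewrite mulSn addnC ltn_add2r.
  by apply: leq_trans (leq_addr _ _); rewrite leq_mul2r h orbT.
- apply/esym/negbTE; rewrite -leqNgt ltnW //.
  apply: (@leq_trans ((nth 0 e y).+1 * B)).
    by rewrite mulSn addnC ltn_add2r.
  by apply: leq_trans (leq_addr _ _); rewrite leq_mul2r h orbT.
- by rewrite h ltn_add2l.
Qed.

End Macros.

(** Quantifiers over [n ^ K] become blocks of [K] quantifiers over [n]. *)
Fixpoint tr (T T' : Type) (K : nat) (sub : atom T -> seq nat -> fo T') (f : fo T) : fo T' :=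
  match f with
  | Atom a l => sub a l
  | Neg g => Neg (tr K sub g)
  | Conj g h => Conj (tr K sub g) (tr K sub h)
  | Ex g => exs K (tr K sub g)
  end.

(** An environment of numbers becomes the concatenation of their digit strings, so a block of [K]
    quantifiers binds exactly the digits of one number; what becomes of atoms is left to [sub]. *)
Lemma ev_tr T T' n K (sub : atom T -> seq nat -> fo T') I n' Bk X (f : fo T) e :
  0 < n ->
  (forall a l e, all (gtn (n ^ K)) e ->
     ev n (interp_atom n' Bk X) (flatten [seq digits n K x | x <- e]) (sub a l) =
     I a [seq nth 0 e i | i <- l]) ->
  all (gtn (n ^ K)) e ->
  ev n (interp_atom n' Bk X) (flatten [seq digits n K x | x <- e]) (tr K sub f) =
  ev (n ^ K) I e f.
Proof.
move=> n0 H; elim: f e => [a l|f IH|f IHf g IHg|f IH] e oke /=; rewrite ?H ?IH ?IHf ?IHg //.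
apply/ev_exs/hasP => [[ds [sd ad fd]]|[v]].
  have vK : val_of n ds < n ^ K by rewrite -sd val_of_lt.
  exists (val_of n ds); first by rewrite mem_iota.
  by rewrite -IH /= ?vK // -{1}sd digits_val.
rewrite mem_iota add0n => /= vK fv; exists (digits n K v).
by rewrite size_digits digits_lt // -[_ ++ _]/(flatten [seq digits n K x | x <- v :: e]) IH //= vK.
Qed.

Lemma ev_Atom T N I e (a : atom T) l : ev N I e (Atom a l) = I a [seq nth 0 e i | i <- l].
Proof. by []. Qed.

Arguments ev : simpl never.

(** * First-order transition systems *)

(** The first argument of a relation names a configuration: a time, a level of recursion or a slot.
    A whole family of configurations is thereby one interpretation. *)
Definition leveled (T : Type) (XX : nat -> T -> seq nat -> bool) (t : T) (l : seq nat) :=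
  if l is x :: l' then XX x t l' else false.

Notation lev n Bk XX := (interp_atom n Bk (leveled XX)).

(** Formulas naming configurations by a variable: [INIT l], [STEP l l'],
    [FINAL l] speak about the relations [XX l] and [XX l']. *)
Record sysf (T : Type) := Sysf {
  INIT : nat -> fo T;
  STEP : nat -> nat -> fo T;
  FINAL : nat -> fo T }.

Section Encoding.
Variables (T : finType) (ar : T -> nat) (rl : pred T) (N : nat).

(** Tags outside [rl] are left free, so that a relation can carry data besides the configuration,
    such as the side bit of Savitch's recursion. *)
Definition encodes (C : Type) (encf : C -> T -> seq nat -> bool) (c : C)
    (x : T -> seq nat -> bool) : Prop :=
  forall t ds, rl t -> size ds = ar t -> all (gtn N) ds -> x t ds = encf c t ds.

(** Under the [ar t] quantifiers the arguments are the first [ar t] indices, and the name [l] has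
    moved to [l + ar t]. *)
Definition FDef (l : nat) (F : T -> fo T) : fo T :=
  conjs [seq alls (ar t) (Iff (Atom (AX t) (l + ar t :: iota 0 (ar t))) (F t))
        | t <- enum T & rl t].

Definition FSame (l l' : nat) : fo T :=
  FDef l' (fun t => Atom (AX t) (l + ar t :: iota 0 (ar t))).

Lemma nth_env_map (ds e : seq nat) k : size ds = k ->
  [seq nth 0 (ds ++ e) i | i <- iota 0 k] = ds.
Proof.
move=> <-; rewrite -[RHS](mkseq_nth 0); apply/eq_in_map => i.
by rewrite mem_iota add0n nth_cat => /= ->.
Qed.

Lemma nth_env_shift (ds e : seq nat) k l : size ds = k ->
  nth 0 (ds ++ e) (l + k) = nth 0 e l.
Proof. by move=> <-; rewrite nth_cat ltnNge leq_addl /= addnK. Qed.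

Variables (n : nat) (Bk : nat -> seq nat -> bool) (XX : nat -> T -> seq nat -> bool).
Notation I := (lev n Bk XX).

Lemma ev_AX ds e t l : size ds = ar t ->
  ev N I (ds ++ e) (Atom (AX t) (l + ar t :: iota 0 (ar t))) = XX (nth 0 e l) t ds.
Proof. by move=> sd; rewrite ev_Atom /= nth_env_map // nth_env_shift. Qed.

Lemma ev_FDef e l F :
  reflect (forall t ds, rl t -> size ds = ar t -> all (gtn N) ds ->
             XX (nth 0 e l) t ds = ev N I (ds ++ e) (F t))
          (ev N I e (FDef l F)).
Proof.
rewrite ev_conjs_map; apply: (iffP allP) => [H t ds rt sd ad|H t].
  have := H t; rewrite mem_filter mem_enum rt => /(_ isT) /ev_alls /(_ ds sd ad).
  by rewrite ev_Iff ev_AX // => /eqP.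
rewrite mem_filter => /andP[rt _]; apply/ev_alls => ds sd ad.
by rewrite ev_Iff ev_AX // H.
Qed.

Lemma ev_FDef_enc C (encf : C -> T -> seq nat -> bool) c e l F :
  (forall t ds, rl t -> size ds = ar t -> all (gtn N) ds ->
     ev N I (ds ++ e) (F t) = encf c t ds) ->
  reflect (encodes encf c (XX (nth 0 e l))) (ev N I e (FDef l F)).
Proof.
move=> H; apply: (iffP (ev_FDef _ _ _)) => E t ds rt sd ad.
  by rewrite E // H.
by rewrite H // E.
Qed.

Lemma ev_FSame C (encf : C -> T -> seq nat -> bool) c e l l' :
  encodes encf c (XX (nth 0 e l)) ->
  reflect (encodes encf c (XX (nth 0 e l'))) (ev N I e (FSame l l')).
Proof.
by move=> E; apply: ev_FDef_enc => t ds rt sd ad; rewrite ev_AX // E.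
Qed.

End Encoding.

(** [sim_step] asks that [STEP] pin the target relation down up to [encodes], because targets are
    guessed and only checked. [good] collects what the formulas presuppose: a known continuation for
    schemes, reachability and hence bounded heads for machines. *)
Record simulates (T : finType) (ar : T -> nat) (rl : pred T) (N n : nat)
    (Bk : nat -> seq nat -> bool) (S : sysf T) (C : Type)
    (encf : C -> T -> seq nat -> bool) (ini fin good : C -> Prop)
    (stp : C -> C -> Prop) : Prop := Simulates {
  sim_good_ini : forall c, ini c -> good c;
  sim_good_stp : forall c c', good c -> stp c c' -> good c';
  sim_init : forall XX e l, all (gtn N) e ->
    (ev N (lev n Bk XX) e (INIT S l) <->
     exists c, ini c /\ encodes ar rl N encf c (XX (nth 0 e l)));
  sim_step : forall XX e l l' c, all (gtn N) e -> good c ->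
    encodes ar rl N encf c (XX (nth 0 e l)) ->
    (ev N (lev n Bk XX) e (STEP S l l') <->
     exists c', stp c c' /\ encodes ar rl N encf c' (XX (nth 0 e l')));
  sim_final : forall XX e l c, all (gtn N) e -> good c ->
    encodes ar rl N encf c (XX (nth 0 e l)) ->
    (ev N (lev n Bk XX) e (FINAL S l) <-> fin c) }.

(** ** Runs of bounded length *)

(** In the innermost scope the indices 1 and 0 are consecutive times and 2 is the final time. Levels
    after the final time are left free, so shorter runs fit as well. *)
Definition psiB (T : finType) (S : sysf T) : fo T :=
  Conj (Ex (Conj (FFirst T 0) (INIT S 0)))
       (Ex (Conj (FINAL S 0)
          (All (All (Imp (Conj (FSucc T 1 0) (Neg (FLt T 2 0))) (STEP S 1 0)))))).

Section ClassB.
Variables (T : finType) (ar : T -> nat) (rl : pred T) (N n : nat).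
Variables (Bk : nat -> seq nat -> bool) (S : sysf T) (C : Type).
Variables (encf : C -> T -> seq nat -> bool) (ini fin good : C -> Prop).
Variable stp : C -> C -> Prop.
Hypothesis sim : simulates ar rl N n Bk S encf ini fin good stp.
Hypothesis N0 : 0 < N.

Lemma psiB_sound XX : ev N (lev n Bk XX) [::] (psiB S) ->
  exists c c', [/\ ini c, reaches stp c c' & fin c'].
Proof.
rewrite ev_Conj => /andP[/ev_Ex [z zN]].
have okz : all (gtn N) [:: z] by rewrite /= zN.
rewrite ev_Conj ev_First // => /andP[/eqP /= z0] /(sim_init sim XX 0 okz) [c0 []].
rewrite /= z0 => ic0 e0 /ev_Ex [t tN].
rewrite ev_Conj => /andP[ft /ev_All st].
have H k : k <= t -> exists c, [/\ nsteps stp k c0 c, good c & encodes ar rl N encf c (XX k)].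
  elim: k => [|k IH] kt.
    by exists c0; split=> //=; apply: (sim_good_ini sim).
  have [c [sc gc ec]] := IH (ltnW kt).
  have kN : k < N by apply: leq_trans tN; rewrite ltnW.
  have k1N : k.+1 < N by apply: leq_ltn_trans tN.
  have := st k kN => /ev_All /(_ _ k1N).
  rewrite ev_Imp ev_Conj ev_Succ ?ev_Neg ?ev_Lt //=; last by rewrite k1N kN tN.
  rewrite eqxx -leqNgt kt /=.
  have ok3 : all (gtn N) [:: k.+1; k; t] by rewrite /= k1N kN tN.
  move=> /(sim_step sim (l := 1) 0 ok3 gc ec) [c' [cc' ec']].
  exists c'; split=> //; last exact: (sim_good_stp sim gc cc').
  elim: (k) c0 c sc cc' {ic0 e0 IH gc ec} => [|j IHj] a b /=.
    by move=> -> ab; exists c'.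
  by move=> [d [ad db]] bc; exists d; split=> //; apply: IHj db bc.
have [c [sc gc ec]] := H t (leqnn t).
exists c0, c; split=> //; first by exists t.
by move: ft => /(sim_final sim); apply; rewrite //= tN.
Qed.

Lemma nsteps_seq (A : Type) (R : A -> A -> Prop) k x y :
  nsteps R k x y -> exists f : nat -> A,
  [/\ f 0 = x, f k = y & forall i, i < k -> R (f i) (f i.+1)].
Proof.
elim: k x => [|k IH] x /=; first by move=> ->; exists (fun=> y).
move=> [z [xz /IH [f [f0 fk fs]]]].
exists (fun i => if i is j.+1 then f j else x); split=> // -[|i] //=.
  by rewrite f0.
exact: fs.
Qed.

(** The sequence [f] is fixed before the relation, because one use writes it into a word and the
    other into the arrays of a scheme. *)
Lemma psiB_complete c c' k : ini c -> nsteps stp k c c' -> fin c' -> k < N ->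
  exists f : nat -> C, forall XX,
    (forall l, l < N -> encodes ar rl N encf (f l) (XX l)) ->
    ev N (lev n Bk XX) [::] (psiB S).
Proof.
move=> ic ck fc' kN; have [f [f0 fk fs]] := nsteps_seq ck.
exists f => XX eX.
have gf l : l <= k -> good (f l).
  elim: l => [|l IH] lk; first by rewrite f0; apply: (sim_good_ini sim).
  by apply: (sim_good_stp sim) (fs _ lk); apply/IH/ltnW.
rewrite ev_Conj; apply/andP; split; apply/ev_Ex.
  have ok1 : all (gtn N) [:: 0] by rewrite /= N0.
  exists 0 => //; rewrite ev_Conj ev_First //=.
  by apply/(sim_init sim XX 0 ok1); exists c; rewrite -f0; split; [rewrite f0|apply: eX].
exists k => //; rewrite ev_Conj; apply/andP; split.
  have ok1 : all (gtn N) [:: k] by rewrite /= kN.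
  by apply/(sim_final sim (l := 0) ok1 (gf _ (leqnn k)) (eX k kN)); rewrite fk.
apply/ev_All => s sN; apply/ev_All => s' s'N.
rewrite ev_Imp; apply/implyP.
rewrite ev_Conj ev_Succ ?ev_Neg ?ev_Lt //=; last by rewrite s'N sN kN.
rewrite -leqNgt => /andP[/eqP -> sk].
have s1N := leq_ltn_trans sk kN.
have ok3 : all (gtn N) [:: s.+1; s; k] by rewrite /= s1N sN kN.
have gs : good (f s) by apply/gf/ltnW.
apply/(sim_step sim (l := 1) 0 ok3 gs (eX s sN)).
by exists (f s.+1); split; [apply: fs|apply: eX].
Qed.

End ClassB.

(** ** Savitch's theorem as a quantified Boolean formula *)

(** In [qs], [true] is a universal and [false] an existential quantifier; the kernel [P] reads the
    word of all chosen bits. *)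
Fixpoint qval (P : seq bool -> bool) (qs W : seq bool) : bool :=
  if qs is q :: qs' then
    if q then qval P qs' (rcons W false) && qval P qs' (rcons W true)
    else qval P qs' (rcons W false) || qval P qs' (rcons W true)
  else P W.

Lemma qval_ex P k qs W :
  reflect (exists2 M, size M = k & qval P qs (W ++ M)) (qval P (nseq k false ++ qs) W).
Proof.
elim: k W => [|k IH] W /=.
  apply: (iffP idP) => [H|[[|//] _]]; last by rewrite cats0.
  by exists [::]; rewrite ?cats0.
apply: (iffP orP) => [[] /IH [M sM H]|[[|b M] //= [sM]]].
- by exists (false :: M); rewrite /= ?sM // -cat_rcons.
- by exists (true :: M); rewrite /= ?sM // -cat_rcons.
- by rewrite -cat_rcons; case: b => H; [right|left]; apply/IH; exists M.
Qed.

Lemma qval_all P k qs W :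
  reflect (forall M, size M = k -> qval P qs (W ++ M)) (qval P (nseq k true ++ qs) W).
Proof.
elim: k W => [|k IH] W /=.
  apply: (iffP idP) => [H [|//] _|/(_ [::] erefl)]; by rewrite cats0.
apply: (iffP andP) => [[/IH H0 /IH H1] [|b M] //= [sM]|H].
  by rewrite -cat_rcons; case: b; [apply: H1|apply: H0].
by split; apply/IH => M sM; rewrite cat_rcons; apply: H; rewrite /= sM.
Qed.

Section Words.
Variables (T : finType) (ar : T -> nat) (tb : T) (N D : nat).
Hypotheses (TN : #|T| <= N) (arD : forall t, ar t <= D) (N1 : 1 < N).

Definition word_index (t : T) (l : nat) (args : seq nat) : seq nat :=
  if t == tb then l :: 1 :: nseq D.+1 0
  else l :: 0 :: (enum_rank t : nat) :: args ++ nseq (D - size args) 0.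

Definition word_rel (W : seq bool) (l : nat) (t : T) (args : seq nat) : bool :=
  nth false W (val_of N (word_index t l args)).

Definition word_of (x : T -> seq nat -> bool) : seq bool :=
  [seq if nth None [seq Some t | t <- enum T] (head 0 l) is Some t
       then x t (take (ar t) (behead l)) else false
  | l <- tuples_lt N D.+1].

Definition mainlen := N ^ D.+1.
(** This length of the universal part makes a level occupy [N ^ D.+2] bits, a power of [N]. Its
    first bit, right after the data, is the side bit. *)
Definition sidelen := N.-1 * N ^ D.+1.

Definition quants := nseq mainlen false ++ nseq sidelen true.

Lemma size_word_of x : size (word_of x) = mainlen.
Proof. by rewrite !size_map size_iota. Qed.

Lemma block_len : mainlen + sidelen = N ^ D.+2.
Proof. by rewrite /mainlen /sidelen -mulSn prednK ?expnS // ltnW. Qed.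

Lemma size_padded (s : seq nat) : size s <= D -> size (s ++ nseq (D - size s) 0) = D.
Proof. by move=> sD; rewrite size_cat size_nseq subnKC. Qed.

Lemma nth_word_of x t args : size args = ar t -> all (gtn N) args ->
  nth false (word_of x) (val_of N ((enum_rank t : nat) :: args ++ nseq (D - size args) 0)) =
  x t args.
Proof.
move=> sa aN; set ds := _ :: _.
have sD : size args <= D by rewrite sa arD.
have sds : size ds = D.+1 by rewrite /= size_padded.
have ads : all (gtn N) ds.
  rewrite /= all_cat aN all_nseq /= (ltnW N1) orbT andbT.
  by apply: leq_trans TN; apply: ltn_ord.
have vl : val_of N ds < N ^ D.+1 by rewrite -sds val_of_lt.
rewrite (nth_map [::]) ?size_map ?size_iota // (nth_map 0) ?size_iota //.
rewrite nth_iota // add0n -sds digits_val //=.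
rewrite (nth_map t) -?cardE ?ltn_ord // nth_enum_rank.
by rewrite -sa take_size_cat.
Qed.

Lemma word_rel_cat W M B l t args : t != tb -> size args = ar t -> all (gtn N) args ->
  size W = l * N ^ D.+2 -> size M = mainlen ->
  word_rel (W ++ M ++ B) l t args =
  nth false M (val_of N ((enum_rank t : nat) :: args ++ nseq (D - size args) 0)).
Proof.
move=> /negbTE ttb sa aN sW sM; rewrite /word_rel /word_index ttb.
have sD : size args <= D by rewrite sa arD.
pose ds : seq nat := (enum_rank t : nat) :: args ++ nseq (D - size args) 0.
rewrite -/ds.
have sds : size ds = D.+1 by rewrite /= size_padded.
have ads : all (gtn N) ds.
  rewrite /= all_cat aN all_nseq /= (ltnW N1) orbT andbT.
  by apply: leq_trans TN; apply: ltn_ord.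
have vl : val_of N ds < mainlen by rewrite /mainlen -sds val_of_lt.
rewrite [val_of _ _]/= mul0n add0n -[_ * _ ^ size _ + _]/(val_of N ds).
rewrite [(size _).+2](_ : _ = D.+2); last by case: sds => ->.
by rewrite nth_cat sW ltnNge leq_addr addKn nth_cat sM vl.
Qed.

(** No address of level [l] leaves the first [l.+1] blocks, so bits chosen for later levels cannot
    change it. *)
Lemma word_rel_prefix W V L l t args : size args = ar t -> all (gtn N) args ->
  size W = L * N ^ D.+2 -> l < L -> word_rel (W ++ V) l t args = word_rel W l t args.
Proof.
move=> sa aN sW lL; rewrite /word_rel nth_cat.
suff -> : val_of N (word_index t l args) < size W by [].
rewrite sW; apply: (@leq_trans (l.+1 * N ^ D.+2)); last by rewrite leq_mul2r lL orbT.
rewrite mulSn addnC; have sD : size args <= D by rewrite sa arD.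
rewrite /word_index; case: eqP => _ /=; rewrite ?size_nseq ?size_padded //.
  by rewrite val_of_nseq0 mul0n !addn0 mul1n ltn_add2l ltn_exp2l.
have ads : all (gtn N) ((enum_rank t : nat) :: args ++ nseq (D - size args) 0).
  rewrite /= all_cat aN all_nseq /= (ltnW N1) orbT andbT.
  by apply: leq_trans TN; apply: ltn_ord.
have := val_of_lt ads; rewrite /= size_padded // => v.
rewrite mul0n add0n ltn_add2l; apply: leq_trans v _.
by rewrite leq_exp2l.
Qed.

Lemma word_rel_side W M B l : size W = l * N ^ D.+2 -> size M = mainlen ->
  word_rel (W ++ M ++ B) l tb [::] = head false B.
Proof.
move=> sW sM; rewrite /word_rel /word_index eqxx [val_of _ _]/=.
rewrite size_nseq nth_cat sW ltnNge leq_addr addKn nth_cat sM.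
by rewrite val_of_nseq0 mul0n !addn0 mul1n -/mainlen ltnn subnn nth0.
Qed.

End Words.

Section Savitch.
Variables (T : finType) (ar : T -> nat) (rl : pred T) (tb : T) (N D n : nat).
Variables (Bk : nat -> seq nat -> bool) (S : sysf T) (C : Type).
Variables (encf : C -> T -> seq nat -> bool) (ini fin good : C -> Prop).
Variable stp : C -> C -> Prop.
Hypothesis sim : simulates ar rl N n Bk S encf ini fin good stp.
Hypotheses (TN : #|T| <= N) (arD : forall t, ar t <= D) (N1 : 1 < N).
Hypotheses (tbrl : ~~ rl tb) (ar_tb : ar tb = 0).

(** The side is fixed to true at level 0 and to false at level 1, which makes the first and the last
    configuration the initial left and right ends. *)
Definition FSide (l : nat) : fo T :=
  Disj (FFirst T l) (Conj (Neg (FOne T l)) (Atom (AX tb) [:: l])).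

(** Levels 0 and 1 hold the first and the last configuration; level [l >= 2]
    holds a midpoint, and its bit tells which half of the run is inspected. *)
Definition psiA : fo T :=
  Conj (Ex (Conj (FFirst T 0) (INIT S 0)))
  (Conj (Ex (Conj (FOne T 0) (FINAL S 0)))
   (Ex (Ex (Conj (Conj (Conj (FSide 1) (All (Imp (FLt T 2 0) (Neg (FSide 0)))))
                       (Conj (Neg (FSide 0)) (All (Imp (FLt T 1 0) (FSide 0)))))
                 (Disj (STEP S 1 0) (FSame ar rl 1 0)))))).

Definition phiA (W : seq bool) : bool := ev N (lev n Bk (word_rel tb N D W)) [::] psiA.

Definition side_of (XX : nat -> T -> seq nat -> bool) l :=
  (l == 0) || (l != 1) && XX l tb [::].

(** The latest level on side [b]: for [true] the left end, for [false] the right end of the segment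
    selected so far. A midpoint on side [true] becomes the new left end, so the second half is
    inspected. *)
Fixpoint last_side (sd : nat -> bool) (b : bool) (L : nat) : nat :=
  if L is L'.+1 then (if sd L' == b then L' else last_side sd b L') else 0.

Lemma last_sideP (sd : nat -> bool) b L a : (exists2 i, i < L & sd i = b) ->
  (a = last_side sd b L <->
   [/\ a < L, sd a = b & forall l, l < L -> a < l -> sd l = ~~ b]).
Proof.
move=> [i]; elim: L i a => [|L IH] i a //.
rewrite ltnS /=; case: (sd L =P b) => sL iL si.
  split=> [->|[aL sa H]].
    by split=> // l; rewrite ltnS; case: ltngtP.
  apply/eqP; rewrite eqn_leq -ltnS aL /= leqNgt; apply/negP => /(H _ (ltnSn L)).
  by rewrite sL; case: b {sL si sa H IH}.
have iL' : i < L by rewrite ltn_neqAle iL andbT; apply/eqP => E; apply: sL; rewrite -E.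
split=> [/(IH i _ iL' si) [aL sa H]|[aL sa H]].
  split=> //; first by rewrite ltnS ltnW.
  move=> l; rewrite ltnS leq_eqVlt => /orP[/eqP ->|lL]; last exact: H.
  by move: sL; case: (sd L); case: b {IH si H sa}.
apply/(IH i _ iL' si); split=> //.
  by move: aL; rewrite ltnS ltn_neqAle => ->; rewrite andbT; apply/eqP => E; apply: sL; rewrite -E.
by move=> l lL; apply: H; rewrite ltnS ltnW.
Qed.

Lemma last_side_lt sd b L : 0 < L -> last_side sd b L < L.
Proof. by case: L => // L _; elim: L => [|L IH] /=; case: eqP => // _; apply: ltn_trans IH _. Qed.

Lemma eq_last_side sd sd' b L : (forall l, l < L -> sd l = sd' l) ->
  last_side sd b L = last_side sd' b L.
Proof.
by elim: L => //= L IH H; rewrite H // IH // => l lL; apply: H; rewrite ltnS ltnW.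
Qed.

Lemma ev_Side XX e l : all (gtn N) e ->
  ev N (lev n Bk XX) e (FSide l) = side_of XX (nth 0 e l).
Proof.
move=> oke; rewrite ev_Disj ev_Conj ev_Neg ev_First ?ev_One ?ev_Atom //.
exact: ltnW.
Qed.

Notation enc c x := (encodes ar rl N encf c x).

(** The two quantified levels of [psiA] are uniquely determined, being the latest on either side,
    and so can be replaced by [a] and [c]. *)
Lemma psiAP XX (sd := side_of XX) (a := last_side sd true N) (c := last_side sd false N) :
  ev N (lev n Bk XX) [::] psiA <->
  [/\ exists c0, ini c0 /\ enc c0 (XX 0),
      ev N (lev n Bk XX) [:: 1] (FINAL S 0) &
      ev N (lev n Bk XX) [:: c; a] (STEP S 1 0) ||
      ev N (lev n Bk XX) [:: c; a] (FSame ar rl 1 0)].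
Proof.
have N0 := ltnW N1.
have h1 : exists2 i, i < N & sd i = true by exists 0.
have h0 : exists2 i, i < N & sd i = false by exists 1.
have aN : a < N by apply: last_side_lt.
have cN : c < N by apply: last_side_lt.
have ok2 v w : v < N -> w < N -> all (gtn N) [:: v; w] by move=> /= -> ->.
have ok3 u v w : u < N -> v < N -> w < N -> all (gtn N) [:: u; v; w] by move=> /= -> -> ->.
have okv v : v < N -> all (gtn N) [:: v] by move=> /= ->.
split.
  rewrite !ev_Conj => /and3P[/ev_Ex [z zN] + /ev_Ex [o oN] + /ev_Ex [a' aN'] /ev_Ex [c' cN']].
  rewrite ev_Conj ev_First ?okv // => /andP[/eqP /= z0] /(sim_init sim XX 0 (okv _ zN)).
  rewrite /= z0 => Hi.
  rewrite ev_Conj ev_One ?okv // => /andP[/eqP /= ->] Hf.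
  rewrite !ev_Conj ev_Neg !ev_Side ?ok2 //= => /andP[/andP[/andP[sa /ev_All Ha] /andP[sc /ev_All Hc]]].
  have -> : a' = a.
    apply/(last_sideP _ h1); split=> // l lN al; have := Ha l lN.
    rewrite ev_Imp ev_Neg ev_Lt ev_Side ?ok3 //= al /=; exact: negbTE.
  have -> : c' = c.
    apply/(last_sideP _ h0); split=> //; first exact: negbTE.
    by move=> l lN al; have := Hc l lN; rewrite ev_Imp ev_Lt ev_Side ?ok3 //= al.
  by rewrite ev_Disj.
move=> [Hi Hf Hs]; rewrite !ev_Conj; apply/and3P; split; apply/ev_Ex.
- exists 0 => //; rewrite ev_Conj ev_First ?okv //=.
  by apply/(sim_init sim XX 0 (okv _ N0)).
- by exists 1 => //; rewrite ev_Conj ev_One ?okv.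
exists a => //; apply/ev_Ex; exists c => //.
have [_ sa Ha] : [/\ a < N, sd a = true & forall l, l < N -> a < l -> sd l = ~~ true].
  by apply/last_sideP.
have [_ sc Hc] : [/\ c < N, sd c = false & forall l, l < N -> c < l -> sd l = ~~ false].
  by apply/last_sideP.
rewrite ev_Conj ev_Disj Hs andbT !ev_Conj ev_Neg !ev_Side ?ok2 //= -/sd sa sc /=.
apply/andP; split; apply/ev_All => l lN; rewrite ev_Imp.
  by rewrite ev_Neg ev_Lt ev_Side ?ok3 //=; apply/implyP => /(Ha l lN); rewrite -/sd => ->.
by rewrite ev_Lt ev_Side ?ok3 //=; apply/implyP => /(Hc l lN); rewrite -/sd => ->.
Qed.

Notation block := (N ^ D.+2).
Notation XW := (word_rel tb N D).
Notation qs := (quants N D).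

Lemma rl_tb t : rl t -> t != tb. Proof. by apply: contraTneq => ->. Qed.

Lemma enc_prefix c W V L l : size W = L * block -> l < L ->
  enc c (XW (W ++ V) l) <-> enc c (XW W l).
Proof.
by move=> sW lL; split=> E t ds rt sd ad; rewrite -E // (word_rel_prefix tb TN arD N1 _ sd ad sW lL).
Qed.

Lemma enc_block c W M B B' l : size W = l * block -> size M = mainlen N D ->
  enc c (XW (W ++ M ++ B) l) -> enc c (XW (W ++ M ++ B') l).
Proof.
move=> sW sM E t ds rt sd ad; rewrite -E //.
by rewrite !(word_rel_cat TN arD N1 _ (rl_tb rt) sd ad sW sM).
Qed.

Lemma enc_word c W B l : size W = l * block ->
  enc c (XW (W ++ word_of ar N D (encf c) ++ B) l).
Proof.
move=> sW t ds rt sd ad.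
by rewrite (word_rel_cat TN arD N1 _ (rl_tb rt) sd ad sW (size_word_of _ _ _ _)) nth_word_of.
Qed.

Lemma size_ext (W M B : seq bool) l : size W = l * block -> size M = mainlen N D ->
  size B = sidelen N D -> size (W ++ M ++ B) = l.+1 * block.
Proof. by move=> sW sM sB; rewrite !size_cat sW sM sB block_len // mulSn addnC. Qed.

Lemma last_side_ext W M B l b : 1 < l -> size W = l * block -> size M = mainlen N D ->
  last_side (side_of (XW (W ++ M ++ B))) b l.+1 =
  if head false B == b then l else last_side (side_of (XW W)) b l.
Proof.
move=> l1 sW sM; rewrite /=.
have -> : side_of (XW (W ++ M ++ B)) l = head false B.
  by rewrite /side_of (word_rel_side tb _ sW sM); case: l l1 {sW} => [|[]].
case: ifP => // _; apply: eq_last_side => i il.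
by rewrite /side_of (@word_rel_prefix T ar tb N D TN arD N1 W _ l i tb [::] (esym ar_tb) isT sW il).
Qed.

(** The start is quantified universally because an encoding need not determine its configuration; in
    this form two segments that share a midpoint relation can be joined. *)
Definition follows x y := forall c, good c -> enc c x ->
  exists c', [/\ reaches stp c c', good c' & enc c' y].

Lemma nsteps_add (A : Type) (R : A -> A -> Prop) i j x z :
  nsteps R (i + j) x z <-> exists y, nsteps R i x y /\ nsteps R j y z.
Proof.
elim: i x => [|i IH] x /=; first by split=> [H|[y [-> //]]]; exists x.
split=> [[y [xy /IH [w [yw wz]]]]|[w [[y [xy yw]] wz]]].
  by exists w; split=> //; exists y.
by exists y; split=> //; apply/IH; exists w.
Qed.

Lemma reaches_trans (A : Type) (R : A -> A -> Prop) x y z :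
  reaches R x y -> reaches R y z -> reaches R x z.
Proof. by move=> [i xy] [j yz]; exists (i + j); apply/nsteps_add; exists y. Qed.

Lemma reaches_refl (A : Type) (R : A -> A -> Prop) x : reaches R x x.
Proof. by exists 0. Qed.

Lemma reaches1 (A : Type) (R : A -> A -> Prop) x y : R x y -> reaches R x y.
Proof. by move=> xy; exists 1, y. Qed.

Lemma good_reaches k c c' : good c -> nsteps stp k c c' -> good c'.
Proof.
elim: k c => [|k IH] c gc /=; first by move=> <-.
by move=> [d [cd]]; apply: IH; apply: (sim_good_stp sim) cd.
Qed.

(** Induction on the number [L] of levels still to be chosen. The universal bits admit both values
    of the side bit, which give the run up to the chosen midpoint and the run from it. *)
Lemma qval_sound L l W : l + L = N -> 1 < l -> size W = l * block ->
  qval phiA (flatten (nseq L qs)) W ->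
  let sd := side_of (XW W) in
  [/\ exists c0, ini c0 /\ enc c0 (XW W 0),
      forall c, good c -> enc c (XW W 1) -> fin c &
      follows (XW W (last_side sd true l)) (XW W (last_side sd false l))].
Proof.
elim: L l W => [|L IH] l W lN l1 sW /=.
  rewrite addn0 in lN; subst l; rewrite /phiA => /psiAP [Hi Hf Hs]; split=> //.
    have ok1 : all (gtn N) [:: 1] by rewrite /= N1.
    by move=> c gc ec; apply/(sim_final sim (XX := XW W) (e := [:: 1]) (l := 0) ok1 gc ec).
  move=> c gc ec; set a := last_side _ true N in Hs ec; set b := last_side _ false N in Hs *.
  have aN : a < N by apply: last_side_lt; apply: ltnW.
  have bN : b < N by apply: last_side_lt; apply: ltnW.
  have ok2 : all (gtn N) [:: b; a] by rewrite /= aN bN.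
  case/orP: Hs => [/(sim_step sim (l := 1) 0 ok2 gc ec) [c' [cc' ec']]|].
    by exists c'; split=> //; [apply: reaches1|apply: (sim_good_stp sim) cc'].
  by move=> /(@ev_FSame _ _ _ _ n Bk (XW W) _ _ _ [:: b; a] 1 0 ec) ec'; exists c; split=> //; apply: reaches_refl.
rewrite -catA => /qval_ex [M sM /qval_all H].
pose B b := b :: nseq (sidelen N D).-1 false.
have s0 : 0 < sidelen N D by rewrite /sidelen muln_gt0 expn_gt0 (ltnW N1) andbT -subn1 subn_gt0.
have sB b : size (B b) = sidelen N D by rewrite /= size_nseq prednK.
have Hb b := IH l.+1 (W ++ M ++ B b) _ _ (size_ext sW sM (sB b)) _.
have lN' : l.+1 + L = N by rewrite -lN addSnnS.
have l1' : 1 < l.+1 by apply: ltnW.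
have Wb b : qval phiA (flatten (nseq L qs)) (W ++ M ++ B b).
  by rewrite catA; apply: H.
have l0 := ltnW l1.
have [] := Hb lN' l1' Wb true; have [] := Hb lN' l1' Wb false.
rewrite !last_side_ext //= => -[c0 [ic0 ec0]] Hf Ff _ _ Ft; split.
- by exists c0; split=> //; apply: (enc_prefix _ _ sW l0).1 ec0.
- by move=> c gc ec; apply: Hf => //; apply: (enc_prefix _ _ sW l1).2.
move=> c gc ec.
have aN : last_side (side_of (XW W)) true l < l by apply: last_side_lt.
have cN : last_side (side_of (XW W)) false l < l by apply: last_side_lt.
have [|m [cm gm em]] := Ff c gc; first exact: (enc_prefix _ _ sW aN).2.
have [|c' [mc' gc' ec']] := Ft m gm; first exact: enc_block em.
exists c'; split=> //; first exact: reaches_trans cm mc'.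
exact: (enc_prefix _ _ sW cN).1 ec'.
Qed.

Lemma savitch_sound : qval phiA (flatten (nseq N qs)) [::] ->
  exists c c', [/\ ini c, reaches stp c c' & fin c'].
Proof.
case EN: {1}N => [|[|N']]; [by move: N1; rewrite EN|by move: N1; rewrite EN|].
rewrite -[nseq N'.+2 qs]/(qs :: qs :: nseq N' qs) [flatten _]/= -!catA.
move=> /qval_ex [M0 sM0 /qval_all /(_ (nseq (sidelen N D) false))].
rewrite size_nseq => /(_ erefl) /qval_ex [M1 sM1 /qval_all /(_ (nseq (sidelen N D) false))].
rewrite size_nseq => /(_ erefl).
set W := _ ++ _ => H.
have sW : size W = 2 * block.
  rewrite /W !size_cat size_nseq sM0 sM1 -(block_len D N1) [size [::]]/=; lia.
have lN : 2 + N' = N by rewrite EN.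
have [[c [ic ec]] Hf Hs] := qval_sound lN (ltnSn 1) sW H.
have [|c' [cc' gc' ec']] := Hs c (sim_good_ini sim ic); first exact: ec.
exists c, c'; split=> //; exact: Hf.
Qed.

Lemma qval_complete L l W c0 cf cA cC k (sd := side_of (XW W)) :
  l + L = N -> 1 < l -> size W = l * block ->
  ini c0 -> enc c0 (XW W 0) -> good cf -> fin cf -> enc cf (XW W 1) -> good cA ->
  enc cA (XW W (last_side sd true l)) -> enc cC (XW W (last_side sd false l)) ->
  nsteps stp k cA cC -> k <= 2 ^ L -> qval phiA (flatten (nseq L qs)) W.
Proof.
move=> lN l1 sW i0 e0 gf ff ef; rewrite {}/sd.
elim: L l W cA cC k lN l1 sW e0 ef => [|L IH] l W cA cC k lN l1 sW e0 ef gA eA eC nk kL /=.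
  rewrite addn0 in lN; subst l; apply/psiAP; split; first by exists c0.
    have ok1 : all (gtn N) [:: 1] by rewrite /= N1.
    by apply/(sim_final sim (XX := XW W) (e := [:: 1]) (l := 0) ok1 gf ef).
  set a := last_side _ true N in eA *; set b := last_side _ false N in eC *.
  have aN : a < N by apply: last_side_lt; apply: ltnW.
  have bN : b < N by apply: last_side_lt; apply: ltnW.
  have ok2 : all (gtn N) [:: b; a] by rewrite /= aN bN.
  (* With no level left at most one step remains; [FSame] covers the segment without any step. *)
  case: k nk kL => [/= E _|[|//] [c [Ac /= E]] _]; apply/orP.
    by right; apply/(@ev_FSame _ _ _ _ n Bk (XW W) _ _ _ [:: b; a] 1 0 eA) => /=; rewrite E.
  left; apply: (sim_step sim (XX := XW W) (e := [:: b; a]) (l := 1) 0 ok2 gA eA).2.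
  by exists c; split=> //; rewrite E.
(* The midpoint lies [2 ^ L] steps from the start, or at the end if the segment is shorter; either
   way both parts have at most [2 ^ L] steps. *)
pose k1 := minn k (2 ^ L).
have [m [Am mC]] : exists m, nsteps stp k1 cA m /\ nsteps stp (k - k1) m cC.
  by apply/nsteps_add; rewrite subnKC // geq_minl.
have k1L : k1 <= 2 ^ L by apply: geq_minr.
have k2L : k - k1 <= 2 ^ L by move: kL; rewrite expnS /k1; lia.
have gm := good_reaches gA Am.
rewrite -catA; apply/qval_ex; exists (word_of ar N D (encf m)); first exact: size_word_of.
apply/qval_all => B sB; rewrite -catA.
have sM : size (word_of ar N D (encf m)) = mainlen N D by apply: size_word_of.
have l0 := ltnW l1.
have lN' : l.+1 + L = N by rewrite -lN addSnnS.
have aN : last_side (side_of (XW W)) true l < l by apply: last_side_lt.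
have cN : last_side (side_of (XW W)) false l < l by apply: last_side_lt.
have P c i V : i < l -> enc c (XW W i) -> enc c (XW (W ++ V) i).
  by move=> il; apply: (enc_prefix _ _ sW il).2.
case Eb: (head false B).
  apply: (IH l.+1 _ m cC (k - k1)) => //; rewrite ?last_side_ext ?Eb //=.
  - exact: size_ext. - exact: P. - exact: P. - exact: enc_word. - exact: P.
apply: (IH l.+1 _ cA m k1) => //; rewrite ?last_side_ext ?Eb //=.
- exact: size_ext. - exact: P. - exact: P. - exact: P. - exact: enc_word.
Qed.

(** Two of the [N] levels hold the end configurations, so [N - 2] halvings remain for the length of
    the run. *)
Lemma savitch_complete c c' k : ini c -> nsteps stp k c c' -> fin c' -> k <= 2 ^ (N - 2) ->
  qval phiA (flatten (nseq N qs)) [::].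
Proof.
move=> ic nk fc' kN.
case EN: {1}N => [|[|N']]; [by move: N1; rewrite EN|by move: N1; rewrite EN|].
rewrite -[nseq N'.+2 qs]/(qs :: qs :: nseq N' qs) [flatten _]/= -!catA.
have gc := sim_good_ini sim ic; have gc' := good_reaches gc nk.
apply/qval_ex; exists (word_of ar N D (encf c)); first exact: size_word_of.
apply/qval_all => B0 sB0; apply/qval_ex; exists (word_of ar N D (encf c')); first exact: size_word_of.
apply/qval_all => B1 sB1; pose W0 := word_of ar N D (encf c) ++ B0.
rewrite (_ : _ ++ B1 = W0 ++ word_of ar N D (encf c') ++ B1); last by rewrite /W0 -!catA.
have sW0 : size W0 = 1 * block by rewrite size_cat size_word_of sB0 block_len // mul1n.
have e0 : enc c (XW W0 0) by apply: (@enc_word c [::] B0 0).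
have e1 : enc c' (XW (W0 ++ word_of ar N D (encf c') ++ B1) 1) by apply: enc_word.
have sW1 := size_ext sW0 (size_word_of ar N D (encf c')) sB1.
apply: (@qval_complete N' 2 _ c c' c c' k) => //.
- exact: (enc_prefix _ _ sW0 _).2.
- exact: (enc_prefix _ _ sW0 _).2.
- by move: kN; rewrite EN subSS subSS subn0.
Qed.

End Savitch.

(** * While programs on tapes *)

Definition upd (A : Type) (f : nat -> A) (i : nat) (v : A) : nat -> A :=
  fun j => if j == i then v else f j.

Arguments upd : simpl never.

Lemma upd_same A (f : nat -> A) i v : upd f i v i = v.
Proof. by rewrite /upd eqxx. Qed.

Lemma upd_neq A (f : nat -> A) i v j : j != i -> upd f i v j = f j.
Proof. by rewrite /upd => /negbTE ->. Qed.

Lemma upd_upd A (f : nat -> A) i v w : upd (upd f i v) i w = upd f i w.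
Proof. by apply: funext => j; rewrite /upd; case: eqP. Qed.

Lemma upd_comm A (f : nat -> A) i j v w : i != j ->
  upd (upd f i v) j w = upd (upd f j w) i v.
Proof.
move=> /eqP ij; apply: funext => k; rewrite /upd.
by case: eqP => // ->; case: eqP => // E; case: ij.
Qed.

Lemma upd_id A (f : nat -> A) i v : f i = v -> upd f i v = f.
Proof. by move=> <-; apply: funext => j; rewrite /upd; case: eqP => [->|]. Qed.

Ltac upd_cases := rewrite /upd /=;
  repeat match goal with |- context [if ?a == ?b then _ else _] => case: (a =P b) => ? end;
  subst.
Ltac upd_eq := congr pair; apply: funext => ?; upd_cases; try done; try congruence; lia.

(** A tape doubles as a counter whose value is the position of its head: [CZero] tests the counter,
    [CSym] the scanned cell. *)
Inductive cond :=
  | CZero of nat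
  | CSym of nat & option bool
  | CNot of cond
  | CAnd of cond & cond.

(** [Mv i true] moves right on tape [i]; [Gs i] writes a guessed bit. *)
Inductive prog :=
  | Skip
  | Mv of nat & bool
  | Wr of nat & bool
  | Gs of nat
  | Seq of prog & prog
  | If of cond & prog & prog
  | Wh of cond & prog.

Definition memory := ((nat -> nat -> option bool) * (nat -> nat))%type.
Definition pconf := (seq prog * memory)%type.

Fixpoint holds (c : cond) (s : memory) : bool :=
  match c with
  | CZero i => s.2 i == 0
  | CSym i o => s.1 i (s.2 i) == o
  | CNot c => ~~ holds c s
  | CAnd c d => holds c s && holds d s
  end.

Definition write (s : memory) i b : memory :=
  (upd s.1 i (upd (s.1 i) (s.2 i) (Some b)), s.2).

(** [g] is the guessed bit, used by [Gs] only. *)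
Definition step1 (g : bool) (x : pconf) : option pconf :=
  let s := x.2 in
  match x.1 with
  | [::] => None
  | Skip :: r => Some (r, s)
  | Mv i d :: r => Some (r, (s.1, upd s.2 i (if d then (s.2 i).+1 else (s.2 i).-1)))
  | Wr i b :: r => Some (r, write s i b)
  | Gs i :: r => Some (r, write s i g)
  | Seq p q :: r => Some (p :: q :: r, s)
  | If c p q :: r => Some ((if holds c s then p else q) :: r, s)
  | Wh c p :: r => Some (if holds c s then p :: Wh c p :: r else r, s)
  end.

Section Exec.
(** [B] bounds the head positions; [mono] forbids overwriting. *)
Variables (mono : bool) (B : nat).

(** Heads that do not advance may be anywhere, so the condition preserves the bound [B] without
    presupposing it. *)
Definition allowed (s s' : memory) : Prop :=
  (forall i, s'.2 i < B \/ s'.2 i <= s.2 i) /\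
  (mono -> forall i p, s.1 i p != None -> s'.1 i p = s.1 i p).

(** The step is the same for both values of the guessed bit, so where a [dstep] exists no
    computation can do anything else. *)
Definition dstep (x y : pconf) : Prop :=
  (forall g, step1 g x = Some y) /\ allowed x.2 y.2.

Definition exec (p : prog) (s s' : memory) : Prop :=
  forall r, reaches dstep (p :: r, s) (r, s').

Lemma allowed_refl s : allowed s s.
Proof. by split=> // i; right. Qed.

Lemma exec_skip s : exec Skip s s.
Proof. by move=> r; apply: reaches1; split=> //; apply: allowed_refl. Qed.

Lemma exec_mvR c h i : (h i).+1 < B -> exec (Mv i true) (c, h) (c, upd h i (h i).+1).
Proof.
move=> hB r; apply: reaches1; split=> //; split=> //= j.
by rewrite /upd; case: eqP => _; [left|right].
Qed.

Lemma exec_mvL c h i : exec (Mv i false) (c, h) (c, upd h i (h i).-1).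
Proof.
move=> r; apply: reaches1; split=> //; split=> //= j.
by rewrite /upd; case: eqP => [->|_]; right; rewrite ?leq_pred.
Qed.

Lemma exec_wr c h i b : (mono -> c i (h i) = None) ->
  exec (Wr i b) (c, h) (write (c, h) i b).
Proof.
move=> m r; apply: reaches1; split=> //; split=> [j|/m E j p] /=; first by right.
have [->|ji] := eqVneq j i; last by rewrite upd_neq.
by rewrite upd_same /upd; case: (p =P h i) => // ->; rewrite E.
Qed.

Lemma exec_seq p q s1 s2 s3 : exec p s1 s2 -> exec q s2 s3 -> exec (Seq p q) s1 s3.
Proof.
move=> pq qs r; apply: (@reaches_trans _ _ _ (p :: q :: r, s1)).
  by apply: reaches1; split=> //; apply: allowed_refl.
exact: reaches_trans (pq _) (qs _).
Qed.

Lemma exec_if c p q s s' : exec (if holds c s then p else q) s s' -> exec (If c p q) s s'.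
Proof.
move=> H r; apply: (@reaches_trans _ _ _ ((if holds c s then p else q) :: r, s)) (H r).
by apply: reaches1; split=> //; apply: allowed_refl.
Qed.

Lemma exec_wh_false c p s : ~~ holds c s -> exec (Wh c p) s s.
Proof.
move=> /negbTE H r; apply: reaches1; split; last exact: allowed_refl.
by rewrite /step1 /= H.
Qed.

Lemma exec_wh_true c p s s' s'' : holds c s -> exec p s s' -> exec (Wh c p) s' s'' ->
  exec (Wh c p) s s''.
Proof.
move=> H pH wH r; apply: (@reaches_trans _ _ _ (p :: Wh c p :: r, s)).
  by apply: reaches1; split; [rewrite /step1 /= H|apply: allowed_refl].
exact: reaches_trans (pH _) (wH _).
Qed.

(** Loop rule in which the memory [S k] after [k] rounds is given explicitly, in place of an
    invariant. *)
Lemma exec_wh c p s s' (S : nat -> memory) m : s = S 0 -> s' = S m ->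
  (forall k, k < m -> holds c (S k)) -> ~~ holds c (S m) ->
  (forall k, k < m -> exec p (S k) (S k.+1)) -> exec (Wh c p) s s'.
Proof.
move=> -> ->; elim: m S => [|m IH] S ht hf hp; first exact: exec_wh_false.
apply: exec_wh_true (ht 0 _) (hp 0 _) _ => //.
by apply: (IH (fun k => S k.+1)) => // k km; [apply: ht|apply: hp].
Qed.

Lemma exec_eq p s s' s'' : s' = s'' -> exec p s s' -> exec p s s''.
Proof. by move=> ->. Qed.

(** ** Counters *)

Definition nz i := CNot (CZero i).
Definition clr i := Wh (nz i) (Mv i false).

Lemma exec_clr c h i : exec (clr i) (c, h) (c, upd h i 0).
Proof.
apply: (@exec_wh _ _ _ _ (fun k => (c, upd h i (h i - k))) (h i)) => /=.
- by rewrite subn0 upd_id.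
- by rewrite subnn.
- by move=> k km; rewrite upd_same; lia.
- by rewrite upd_same subnn.
by move=> k km; apply: exec_eq (exec_mvL _ _ _); upd_eq.
Qed.

Fixpoint seqs (ps : seq prog) : prog :=
  if ps is p :: ps' then Seq p (seqs ps') else Skip.

Definition move1 i a := Wh (nz i) (seqs [:: Mv i false; Mv a true]).
Definition move2 i a j := Wh (nz i) (seqs [:: Mv i false; Mv a true; Mv j true]).

Lemma exec_move1 c h (i a : nat) : i != a -> h a + h i < B ->
  exec (move1 i a) (c, h) (c, upd (upd h i 0) a (h a + h i)).
Proof.
move=> ia hB.
apply: (@exec_wh _ _ _ _ (fun k => (c, upd (upd h i (h i - k)) a (h a + k))) (h i)) => /=.
- by upd_eq.
- by upd_eq.
- by move=> k km; upd_cases; lia.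
- by upd_cases; lia.
move=> k km; apply: exec_seq (exec_mvL _ _ _) _.
apply: exec_seq (exec_mvR _ _) _; first by upd_cases; lia.
apply: exec_eq (exec_skip _); upd_eq.
Qed.

Lemma exec_move2 c h (i a j : nat) : i != a -> i != j -> a != j -> h a + h i < B -> h j + h i < B ->
  exec (move2 i a j) (c, h) (c, upd (upd (upd h i 0) a (h a + h i)) j (h j + h i)).
Proof.
move=> ia ij aj haB hjB.
apply: (@exec_wh _ _ _ _ (fun k => (c, upd (upd (upd h i (h i - k)) a (h a + k)) j (h j + k))) (h i)) => /=.
- by upd_eq.
- by upd_eq.
- by move=> k km; upd_cases; lia.
- by upd_cases; lia.
move=> k km; apply: exec_seq (exec_mvL _ _ _) _.
apply: exec_seq (exec_mvR _ _) _; first by upd_cases; lia.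
apply: exec_seq (exec_mvR _ _) _; first by upd_cases; lia.
apply: exec_eq (exec_skip _); upd_eq.
Qed.

End Exec.

(** ** Evaluating formulas with counters *)

(** Roles of the tapes: 0 holds the input, [res] counts 0 or 1 as a truth value, [bad] flags an
    input that ends too early, [aux] is scratch, [sz] measures [n] and [N], [zr] stands for the
    number 0, [Xt] holds the word of chosen bits, [Qt] the quantifiers, [md] the phase of the
    search. Tapes for the blocks and the variables follow. *)
Definition res := 1.
Definition bad := 2.
Definition aux := 3.
Definition sz := 4.
Definition zr := 5.
Definition Xt := 6.
Definition Qt := 7.
Definition md := 8.
Definition blkt (b : nat) := 9 + b.
Definition vart (nb i : nat) := 9 + nb + i.

(** Reading a counter empties it, so [x] is poured into [aux] and [j] at once and then refilled from
    [aux]. *)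
Definition add_var j x := Seq (move2 x aux j) (move1 aux x).

(** The base is not kept in a counter: it is the length of a part of tape [sz], found by walking
    until [cnd] fails. The same code thus multiplies by [n] and by [N]. *)
Definition mulb j cnd :=
  Seq (Wh (nz j) (seqs [:: Mv j false; Wh cnd (seqs [:: Mv sz true; Mv aux true]); clr sz]))
      (move1 aux j).

Definition add_dig j (d : nat + nat) :=
  match d with inl x => add_var j x | inr k => seqs (nseq k (Mv j true)) end.

Fixpoint goto j cnd (ds : seq (nat + nat)) : prog :=
  if ds is d :: ds' then Seq (mulb j cnd) (Seq (add_dig j d) (goto j cnd ds')) else Skip.

Definition dval (h : nat -> nat) (d : nat + nat) : nat :=
  match d with inl x => h x | inr k => k end.

Definition horner b a (ds : seq nat) := foldl (fun a d => a * b + d) a ds.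

Lemma horner_val b ds : horner b 0 ds = val_of b ds.
Proof.
elim/last_ind: ds => // ds d IH.
by rewrite /horner foldl_rcons -/(horner _ _ _) IH val_of_rcons.
Qed.

Lemma leq_horner b a ds : 0 < b -> a <= horner b a ds.
Proof.
move=> b0; elim: ds a => //= d ds IH a; apply: leq_trans (IH _).
by apply: leq_trans (leq_addr _ _); rewrite leq_pmulr.
Qed.

Section Goto.
Variables (mono : bool) (B : nat).
Notation exec := (exec mono B).

Lemma exec_add_var c h j x : x != aux -> j != aux -> x != j -> h aux = 0 ->
  h x < B -> h j + h x < B -> exec (add_var j x) (c, h) (c, upd h j (h j + h x)).
Proof.
move=> xa ja xj ha hx hj.
apply: exec_seq (exec_move2 _ _ _ _ _ _ _) _ => //; rewrite ?ha ?add0n // 1?eq_sym //.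
apply: exec_eq (exec_move1 _ _ _ _); last first.
- by upd_cases; lia.
- by rewrite eq_sym.
by upd_eq.
Qed.

Lemma exec_mulb c h j cnd b : j != aux -> j != sz -> h aux = 0 -> h sz = 0 ->
  (forall h', h' sz <= b -> holds cnd (c, h') = (h' sz < b)) ->
  b < B -> h j * b < B -> exec (mulb j cnd) (c, h) (c, upd h j (h j * b)).
Proof.
move=> ja js ha hs hc bB hB.
apply: exec_seq (_ : exec _ _ (c, upd (upd h j 0) aux (h j * b))) _; last first.
  apply: exec_eq (exec_move1 _ _ _ _); last first.
  - by upd_cases; lia.
  - by rewrite eq_sym.
  by upd_eq.
apply: (@exec_wh _ _ _ _ _ _ (fun k => (c, upd (upd h j (h j - k)) aux (k * b))) (h j)) => /=.
- by upd_eq.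
- by upd_eq.
- by move=> k km; upd_cases; lia.
- by upd_cases; lia.
move=> k km.
have kb : k.+1 * b < B by apply: leq_ltn_trans hB; rewrite leq_mul2r km orbT.
apply: exec_seq (exec_mvL _ _ _ _ _) _.
pose h1 k' := upd (upd (upd h j (h j - k.+1)) aux (k * b + k')) sz k'.
apply: exec_seq (_ : exec _ _ (c, h1 b)) _.
  apply: (@exec_wh _ _ _ _ _ _ (fun k' => (c, h1 k')) b) => /=.
  - by rewrite /h1; upd_eq.
  - by [].
  - by move=> k' k'b; rewrite hc /h1 upd_same // ltnW.
  - by rewrite hc /h1 upd_same // ltnn.
  move=> k' k'b; rewrite /h1.
  apply: exec_seq (exec_mvR _ _ _) _; first by rewrite upd_same; lia.
  apply: exec_seq (exec_mvR _ _ _) _; first by upd_cases; lia.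
  by apply: exec_eq (exec_skip _ _ _); upd_eq.
apply: exec_seq (exec_clr _ _ _ _ _) _.
by apply: exec_eq (exec_skip _ _ _); rewrite /h1; upd_eq.
Qed.

Lemma exec_mvRs c h j k : h j + k < B ->
  exec (seqs (nseq k (Mv j true))) (c, h) (c, upd h j (h j + k)).
Proof.
elim: k h => [|k IH] h hB /=.
  by apply: exec_eq (exec_skip _ _ _); upd_eq.
apply: exec_seq (exec_mvR _ _ _) _; first by lia.
by apply: exec_eq (IH _ _); [upd_eq|upd_cases; lia].
Qed.

Lemma exec_goto c h j cnd b ds : j != aux -> j != sz -> h aux = 0 -> h sz = 0 ->
  (forall h', h' sz <= b -> holds cnd (c, h') = (h' sz < b)) ->
  all (fun d => if d is inl x then (x != aux) && (x != j) && (h x < B) else true) ds ->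
  0 < b -> b < B -> horner b (h j) [seq dval h d | d <- ds] < B ->
  exec (goto j cnd ds) (c, h) (c, upd h j (horner b (h j) [seq dval h d | d <- ds])).
Proof.
move=> ja js ha hs hc + b0 bB.
elim: ds h ha hs => [|d ds IH] h ha hs /=.
  by move=> _ _; apply: exec_eq (exec_skip _ _ _); upd_eq.
case/andP => dok dsok hB.
have B1 : h j * b + dval h d < B by apply: leq_ltn_trans hB; apply: leq_horner.
have B0 : h j * b < B by apply: leq_ltn_trans B1; apply: leq_addr.
apply: exec_seq (exec_mulb _ _ _ _ hc bB B0) _ => //.
set h1 := upd h j (h j * b).
have E1 : dval h1 d = dval h d.
  by case: d dok {hB B1} => //= x /andP[/andP[_ xj] _]; rewrite /h1 upd_neq.
have h1j : h1 j = h j * b by rewrite /h1 upd_same.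
apply: exec_seq (_ : exec _ _ (c, upd h1 j (h1 j + dval h1 d))) _.
  case: d dok B1 E1 {hB} => [x|k] /=.
    move=> /andP[/andP[xa xj] xB] B1 E1.
    apply: exec_add_var => //; rewrite ?E1 ?h1j // /h1 upd_neq // eq_sym //.
  by move=> _ B1 _; apply: exec_mvRs; rewrite h1j.
set h2 := upd h1 j _.
have h2j : h2 j = h j * b + dval h d by rewrite /h2 upd_same h1j E1.
have ds2 : [seq dval h2 d | d <- ds] = [seq dval h d | d <- ds].
  apply/eq_in_map => -[x|//] /(allP dsok) /= /andP[/andP[_ xj] _].
  by rewrite /h2 /h1 !upd_neq.
apply: exec_eq (IH h2 _ _ _ _); rewrite ?ds2 ?h2j //.
- by rewrite /h2 /h1 !upd_upd.
- by rewrite /h2 /h1 !upd_neq // eq_sym.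
- by rewrite /h2 /h1 !upd_neq // eq_sym.
apply/allP => -[x|//] /(allP dsok) /andP[/andP[xa xj] xB].
by rewrite /h2 /h1 !upd_neq // xa xj.
Qed.

End Goto.

Section Eval.
Variables (T : finType) (tb : T) (D nb : nat).

(** De Bruijn indices are turned into levels, so that a variable keeps its tape under further
    binders; an index without binder reads [zr], in agreement with the default 0 of [ev]. *)
Definition name (d k : nat) := if k < d then vart nb (d.-1 - k) else zr.

(** Both counters are lowered together, [aux] counting the rounds so that they can be restored. The
    case [x == y] is separate because a shared counter would be lowered twice per round. *)
Definition less x y :=
  if x == y then Skip else
  Seq (Wh (CAnd (nz x) (nz y)) (seqs [:: Mv x false; Mv y false; Mv aux true]))
 (Seq (If (nz y) (Mv res true) Skip)
      (Wh (nz aux) (seqs [:: Mv aux false; Mv x true; Mv y true]))).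

Definition lookup j cnd ds :=
  Seq (goto j cnd ds) (Seq (If (CSym j (Some true)) (Mv res true) Skip) (clr j)).

Fixpoint ifall (cs : seq cond) (p : prog) : prog :=
  if cs is c :: cs' then If c (ifall cs' p) Skip else p.

Definition bitdigits (d : nat) (t : T) (x : nat) (l : seq nat) : seq (nat + nat) :=
  if t == tb then inl (name d x) :: inr 1 :: nseq D.+1 (inr 0)
  else inl (name d x) :: inr 0 :: inr (enum_rank t : nat) ::
       [seq inl (name d i) | i <- l] ++ nseq (D - size l) (inr 0).

(** Tape [sz] reads [true] on the first [n] cells, [false] up to [N] and blank from there, so these
    two conditions measure [N] and [n] on the same tape. *)
Definition baseN := CNot (CSym sz None).
Definition basen := CSym sz (Some true).

(** [res] is 0 on entry and holds the truth value at the end. The loop for [Ex] ends at the first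
    witness or at the end of the tape of its variable. *)
Fixpoint evalp (d : nat) (f : fo T) : prog :=
  match f with
  | Atom ALt l => if l is [:: x; y] then less (name d x) (name d y) else Skip
  | Atom ASmall l =>
      if l is [:: x] then If (CSym (name d x) (Some true)) (Mv res true) Skip else Skip
  | Atom (ABlk b) l =>
      ifall [seq CSym (name d x) (Some true) | x <- l]
            (lookup (blkt b) basen [seq inl (name d x) | x <- l])
  | Atom (AX t) l => if l is x :: l' then lookup Xt baseN (bitdigits d t x l') else Skip
  | Neg f => Seq (evalp d f) (If (nz res) (Mv res false) (Mv res true))
  | Conj f g => Seq (evalp d f) (If (nz res) (Seq (Mv res false) (evalp d g)) Skip)
  | Ex f =>
      Seq (Wh (CAnd (CNot (CSym (vart nb d) None)) (CZero res))
              (Seq (evalp d.+1 f) (Mv (vart nb d) true)))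
          (clr (vart nb d))
  end.

Fixpoint qdepth (f : fo T) : nat :=
  match f with
  | Atom _ _ => 0
  | Neg f => qdepth f
  | Conj f g => maxn (qdepth f) (qdepth g)
  | Ex f => (qdepth f).+1
  end.

(** Bounds the number of digits of every address that the evaluation computes, and thereby the
    counters; [D + 3] is the length of an address in the word. *)
Fixpoint width (f : fo T) : nat :=
  match f with
  | Atom _ l => size l + D + 3
  | Neg f => width f
  | Conj f g => maxn (width f) (width g)
  | Ex f => width f
  end.

Fixpoint blk_bound (f : fo T) : nat :=
  match f with
  | Atom (ABlk b) _ => b.+1
  | Atom _ _ => 0
  | Neg f => blk_bound f
  | Conj f g => maxn (blk_bound f) (blk_bound g)
  | Ex f => blk_bound f
  end.

Variables (mono : bool) (B n N V : nat).
Hypotheses (nN : n <= N) (n1 : 1 < n) (NB : N < B) (TN : #|T| <= N).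
Notation exec := (exec mono B).

Definition sized_tape (t : nat -> option bool) : Prop :=
  forall p, t p = if p < n then Some true else if p < N then Some false else None.

Variable c : nat -> nat -> option bool.
Hypotheses (c_sz : sized_tape (c sz)) (c_zr : sized_tape (c zr)).
Hypothesis c_var : forall i, i < V -> sized_tape (c (vart nb i)).

Definition mem_blk (b : nat) (l : seq nat) : bool := c (blkt b) (val_of n l) == Some true.
Definition mem_rel (l : nat) (t : T) (args : seq nat) : bool :=
  c Xt (val_of N (word_index tb D t l args)) == Some true.

(** Between evaluations all counters other than the variables stand at 0, so the head positions are
    a function of the environment alone. *)
Definition henv (e : seq nat) (i : nat) : nat :=
  if i < vart nb 0 then 0 else nth 0 (rev e) (i - vart nb 0).

Lemma henv_name e k : henv e (name (size e) k) = nth 0 e k.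
Proof.
rewrite /name /henv; case: (ltnP k (size e)) => ke; last first.
  have -> : zr < vart nb 0 by rewrite /vart /zr; lia.
  by rewrite nth_default.
rewrite ifF; last by rewrite /vart; lia.
rewrite nth_rev; last by rewrite /vart; lia.
by congr nth; rewrite /vart; lia.
Qed.

Lemma henv_cons v e : henv (v :: e) = upd (henv e) (vart nb (size e)) v.
Proof.
apply: funext => i; rewrite /henv /upd rev_cons nth_rcons size_rev.
rewrite /vart; case: (ltnP i (9 + nb + 0)) => iv; first by rewrite ifF //; lia.
case: (i =P 9 + nb + size e) => Ei.
  by rewrite ifF ?ifT //; lia.
case: (ltnP (i - (9 + nb + 0)) (size e)) => // ie; rewrite ifF; last by lia.
by rewrite nth_default // size_rev.
Qed.

Lemma low_vart i : i < 9 -> i < vart nb 0.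
Proof. by rewrite /vart; lia. Qed.

Lemma henv_low e i : i < vart nb 0 -> henv e i = 0.
Proof. by rewrite /henv => ->. Qed.

Lemma henv_out e i : size e <= i -> henv e (vart nb i) = 0.
Proof.
by move=> ei; rewrite /henv /vart ltnNge leq_add2l leq0n /= nth_default // size_rev; lia.
Qed.

Lemma nth_ltN e k : all (gtn N) e -> nth 0 e k < N.
Proof. by move=> oke; apply: okenv_nth => //; lia. Qed.

Lemma name_low d k (j : nat) : j < vart nb 0 -> j != zr -> name d k != j.
Proof. by rewrite /name /vart; case: ifP => _ ? ?; lia. Qed.

Lemma name_sized (e : seq nat) k : size e <= V -> sized_tape (c (name (size e) k)).
Proof. by move=> eV; rewrite /name; case: ltnP => // ke; apply: c_var; lia. Qed.

Lemma sized_small t p : sized_tape t -> (t p == Some true) = (p < n).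
Proof. by move=> ->; case: ltnP => // _; case: ltnP. Qed.

Lemma sized_in t p : sized_tape t -> (t p == None) = (N <= p).
Proof. by move=> ->; case: ltnP => [pn|_]; [rewrite leqNgt (leq_trans pn nN)|case: ltnP]. Qed.

Lemma holds_basen h : h sz <= n -> holds basen (c, h) = (h sz < n).
Proof. by move=> hn /=; rewrite sized_small. Qed.

Lemma holds_baseN h : h sz <= N -> holds baseN (c, h) = (h sz < N).
Proof. by move=> hn /=; rewrite sized_in // ltnNge. Qed.

Lemma exec_set_res (b : bool) cnd h : h res = 0 -> holds cnd (c, h) = b ->
  exec (If cnd (Mv res true) Skip) (c, h) (c, upd h res (b : nat)).
Proof.
move=> r0 hb; apply: exec_if; rewrite hb; case: b {hb}.
  by apply: exec_eq (exec_mvR _ _ _); rewrite ?r0 //; lia.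
by apply: exec_eq (exec_skip _ _ _); rewrite upd_id.
Qed.

Lemma exec_less h (x y : nat) : x != res -> x != aux -> y != res -> y != aux ->
  h res = 0 -> h aux = 0 -> h x < N -> h y < N ->
  exec (less x y) (c, h) (c, upd h res (h x < h y)).
Proof.
move=> xr xa yr ya r0 a0 xN yN; rewrite /less; case: (x =P y) => [->|/eqP xy].
  by apply: exec_eq (exec_skip _ _ _); rewrite ltnn upd_id.
pose h1 k := upd (upd (upd h x (h x - k)) y (h y - k)) aux k.
pose m := minn (h x) (h y).
apply: exec_seq (_ : exec _ _ (c, h1 m)) _.
  apply: (@exec_wh _ _ _ _ _ _ (fun k => (c, h1 k)) m) => /=.
  - by rewrite /h1; upd_eq.
  - by [].
  - by move=> k; rewrite /m /h1 => km; upd_cases; lia.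
  - by rewrite /m /h1; upd_cases; lia.
  move=> k; rewrite /m => km; rewrite /h1.
  apply: exec_seq (exec_mvL _ _ _ _ _) _.
  apply: exec_seq (exec_mvL _ _ _ _ _) _.
  apply: exec_seq (exec_mvR _ _ _) _; first by upd_cases; lia.
  by apply: exec_eq (exec_skip _ _ _); upd_eq.
set r := nat_of_bool _.
apply: exec_seq (_ : exec _ _ (c, upd (h1 m) res r)) _.
  apply: exec_set_res; first by rewrite /h1; upd_cases; lia.
  by rewrite /= /h1 /m; upd_cases; lia.
apply: (@exec_wh _ _ _ _ _ _ (fun k => (c, upd (h1 (m - k)) res r)) m) => /=.
- by rewrite subn0.
- by rewrite subnn /h1; upd_eq.
- by move=> k; rewrite /m /h1 => km; upd_cases; lia.
- by rewrite /m /h1; upd_cases; lia.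
move=> k; rewrite /m => km; rewrite /h1.
apply: exec_seq (exec_mvL _ _ _ _ _) _.
apply: exec_seq (exec_mvR _ _ _) _; first by upd_cases; lia.
apply: exec_seq (exec_mvR _ _ _) _; first by upd_cases; lia.
by apply: exec_eq (exec_skip _ _ _); upd_eq.
Qed.

Lemma exec_lookup h (j : nat) cnd b ds (vals := [seq dval h d | d <- ds]) :
  j != aux -> j != sz -> j != res -> h j = 0 -> h aux = 0 -> h sz = 0 -> h res = 0 ->
  (forall h', h' sz <= b -> holds cnd (c, h') = (h' sz < b)) ->
  all (fun d => if d is inl x then (x != aux) && (x != j) && (h x < B) else true) ds ->
  0 < b -> b < B -> val_of b vals < B ->
  exec (lookup j cnd ds) (c, h) (c, upd h res (c j (val_of b vals) == Some true)).
Proof.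
move=> ja js jr hj ha hs hr hc ok b0 bB vB.
apply: exec_seq (_ : exec _ _ (c, upd h j (val_of b vals))) _.
  have := @exec_goto mono B c h j cnd b ds ja js ha hs hc ok b0 bB.
  by rewrite hj horner_val; apply.
apply: exec_seq (_ : exec _ _ (c, upd (upd h j (val_of b vals)) res
    (c j (val_of b vals) == Some true))) _.
  by apply: exec_set_res; rewrite /= ?upd_same // upd_neq // eq_sym.
by apply: exec_eq (exec_clr _ _ _ _ _); upd_eq.
Qed.

Lemma exec_ifall cs h p (b : bool) : h res = 0 ->
  (all (fun cnd => holds cnd (c, h)) cs -> exec p (c, h) (c, upd h res b)) ->
  exec (ifall cs p) (c, h) (c, upd h res (all (fun cnd => holds cnd (c, h)) cs && b)).
Proof.
move=> r0; elim: cs => [|cnd cs IH] /= H; first exact: H.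
apply: exec_if; case: holds H => H; first exact: IH.
by apply: exec_eq (exec_skip _ _ _); rewrite upd_id.
Qed.

Notation I := (lev n mem_blk mem_rel).

Lemma val_wide b (vals : seq nat) w : 0 < b -> b <= N -> all (gtn b) vals -> size vals <= w ->
  N ^ w < B -> val_of b vals < B.
Proof.
move=> b0 bN av sw; apply: leq_ltn_trans; apply: leq_trans (ltnW (val_of_lt av)) _.
apply: (@leq_trans (N ^ size vals)); first by case: (size vals) => [|k]; rewrite ?expn0 ?leq_exp2r.
by rewrite leq_pexp2l //; lia.
Qed.

Lemma exec_evalp f e : all (gtn N) e -> size e + qdepth f <= V ->
  N ^ width f < B -> blk_bound f <= nb ->
  exec (evalp (size e) f) (c, henv e) (c, upd (henv e) res (ev N I e f)).
Proof.
have z e' : [/\ henv e' res = 0, henv e' aux = 0, henv e' sz = 0 & henv e' Xt = 0].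
  by split; apply/henv_low/low_vart.
elim: f e => [a l|f IH|f IHf g IHg|f IH] e oke eV wB bB.
- have [r0 a0 s0 x0] := z e.
  have nB x : henv e (name (size e) x) < B.
    by rewrite henv_name; apply: ltn_trans NB; apply: nth_ltN.
  have skip : exec Skip (c, henv e) (c, upd (henv e) res false).
    by apply: exec_eq (exec_skip _ _ _); rewrite upd_id.
  rewrite ev_Atom; rewrite /= addn0 in eV; rewrite /= in wB.
  case: a bB => [||b|t] /= bB.
  + case: l wB => [|x [|y [|? ?]]] //= wB; rewrite -!henv_name.
    by apply: exec_less; rewrite ?name_low ?henv_name ?nth_ltN ?low_vart.
  + case: l wB => [|x [|? ?]] //= wB.
    by apply: exec_set_res => //=; rewrite sized_small ?henv_name //; apply: name_sized.
  + have E : [seq dval (henv e) d | d <- [seq inl (name (size e) x) | x <- l]] =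
             [seq nth 0 e i | i <- l].
      by rewrite -map_comp; apply: eq_map => x /=; rewrite henv_name.
    have A : all (gtn n) [seq nth 0 e i | i <- l] =
        all (fun cnd => holds cnd (c, henv e)) [seq CSym (name (size e) x) (Some true) | x <- l].
      rewrite !all_map; apply: eq_all => x /=.
      by rewrite sized_small ?henv_name //; apply: name_sized.
    rewrite A; apply: exec_ifall => //; rewrite -A => small.
    have blt : blkt b < vart nb 0 by rewrite /blkt /vart; lia.
    rewrite /mem_blk -E; apply: exec_lookup => //.
    * by apply: henv_low.
    * exact: holds_basen.
    * by apply/allP => _ /mapP[x _ ->]; rewrite nB !name_low // low_vart.
    * exact: ltnW.
    * exact: leq_ltn_trans NB.
    * rewrite E; apply: val_wide small _ wB => //; first exact: ltnW.
      by rewrite size_map -addnA leq_addr.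
  + case: l wB => [|x l] //= wB.
    have E : [seq dval (henv e) d | d <- bitdigits (size e) t x l] =
             word_index tb D t (nth 0 e x) [seq nth 0 e i | i <- l].
      rewrite /bitdigits /word_index; case: eqP => _ /=; rewrite henv_name ?map_nseq //.
      rewrite map_cat map_nseq size_map -map_comp /=; congr [:: _, _, _ & _ ++ _].
      by apply: eq_map => y /=; rewrite henv_name.
    rewrite /mem_rel -E; apply: exec_lookup => //.
    * exact: holds_baseN.
    * have H y : (name (size e) y != aux) && (name (size e) y != Xt) && (henv e (name (size e) y) < B).
        by rewrite nB !name_low // low_vart.
      rewrite /bitdigits; case: eqP => _; rewrite /= ?H /=; first by rewrite all_nseq orbT.
      rewrite all_cat all_nseq orbT andbT; apply/allP => _ /mapP[y _ ->]; exact: H.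
    * by lia.
    * rewrite E; apply: val_wide _ _ wB => //; first by lia.
        rewrite /word_index; case: eqP => _ /=; rewrite nth_ltN //= ?all_nseq /=; first by lia.
        rewrite all_cat all_nseq /= !(ltnW (leq_trans n1 nN)) orbT andbT /=.
        apply/andP; split; first by apply: leq_trans TN.
        by apply/allP => _ /mapP[y _ ->]; apply: nth_ltN.
      rewrite /word_index; case: eqP => _ /=; rewrite ?size_nseq ?size_cat ?size_nseq ?size_map; lia.
- have [r0 _ _ _] := z e.
  apply: exec_seq (IH e oke eV wB bB) _; rewrite ev_Neg.
  apply: exec_if; rewrite /= upd_same; case: ev => /=.
    by apply: exec_eq (exec_mvL _ _ _ _ _); upd_eq.
  by apply: exec_eq (exec_mvR _ _ _); [upd_eq|rewrite upd_same; lia].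
- have [r0 _ _ _] := z e.
  rewrite /= in wB; rewrite /= geq_max in bB; rewrite /= in eV; case/andP: bB => bf bg.
  have w1 : N ^ width f < B.
    by apply: leq_ltn_trans wB; rewrite leq_pexp2l ?leq_maxl //; lia.
  have w2 : N ^ width g < B.
    by apply: leq_ltn_trans wB; rewrite leq_pexp2l ?leq_maxr //; lia.
  apply: exec_seq (IHf e oke _ w1 bf) _; first by lia.
  rewrite ev_Conj; apply: exec_if; rewrite /= upd_same; case: ev => /=; last exact: exec_skip.
  apply: exec_seq (exec_mvL _ _ _ _ _) _; rewrite upd_same upd_upd upd_id //.
  by apply: IHg => //; lia.
have [r0 _ _ _] := z e.
rewrite /= in eV wB bB; set v := vart nb (size e).
pose P k := ev N I (k :: e) f.
(* The number of rounds: up to and including the first witness, or all [N] if there is none. *)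
pose m := if has P (iota 0 N) then (find P (iota 0 N)).+1 else N.
pose S k : memory := (c, upd (henv (k :: e)) res (has P (iota 0 k))).
have fN : find P (iota 0 N) <= N by have := find_size P (iota 0 N); rewrite size_iota.
have mN : m <= N.
  by rewrite /m; case: ifP => // ; rewrite has_find size_iota.
have hk k : k < m -> has P (iota 0 k) = false.
  move=> km; apply/negP => /hasP[i]; rewrite mem_iota add0n => /= ik Pi; move: km.
  rewrite /m; case: ifP => [_|/negbT/hasPn H].
    rewrite ltnS => kf; have ifd := leq_trans ik kf.
    have := before_find 0 ifd; rewrite nth_iota ?add0n; last exact: leq_trans fN.
    by rewrite Pi.
  move=> kN; have := H i; rewrite mem_iota add0n (ltn_trans ik kN) Pi.
  by move=> /(_ isT).
have hfind : has P (iota 0 N) -> has P (iota 0 (find P (iota 0 N)).+1).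
  move=> h; apply/hasP; exists (find P (iota 0 N)); first by rewrite mem_iota add0n /=.
  by have := nth_find 0 h; rewrite nth_iota ?add0n //; move: h; rewrite has_find size_iota.
have vres : v != res by rewrite /v /vart /res; lia.
have vV : sized_tape (c v) by apply: c_var; lia.
have Sv k : (S k).2 v = k.
  by rewrite /S /= upd_neq // henv_cons upd_same.
apply: exec_seq (_ : exec _ _ (S m)) _.
  apply: (@exec_wh _ _ _ _ _ _ S m).
  - rewrite /S henv_cons; congr pair; rewrite upd_id ?upd_id // ?upd_id //.
      exact: henv_out.
    by rewrite henv_out.
  - by [].
  - move=> k km; rewrite /= upd_same hk // upd_neq // henv_cons upd_same sized_in //.
    by rewrite -ltnNge (leq_trans km mN).
  - rewrite /= upd_same [upd _ _ _ v]Sv sized_in // /m.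
    case: ifP => h; last by rewrite leqnn.
    by rewrite (hfind h) andbF.
  - move=> k km; rewrite /S hk // upd_id; last by case: (z (k :: e)).
    have kN := leq_trans km mN.
    apply: exec_seq (IH (k :: e) _ _ wB bB) _; rewrite /= ?kN ?addSn -?addnS //.
    have := @exec_mvR mono B c (upd (henv (k :: e)) res (P k)) v.
    rewrite upd_neq // henv_cons upd_same => /(_ _)/exec_eq; apply; last by lia.
    rewrite -[P 0 || _]/(has P (iota 0 k.+1)); have -> : has P (iota 0 k.+1) = P k.
      by rewrite -addn1 iotaD has_cat hk //= orbF add0n.
    by rewrite !henv_cons; upd_eq.
apply: exec_eq (exec_clr _ _ _ _ _) => /=.
rewrite /S /= henv_cons; congr pair.
have -> : has P (iota 0 m) = ev N I e (Ex f).
  change (ev N I e (Ex f)) with (has P (iota 0 N)).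
  by rewrite /m; case: ifP => // h; rewrite hfind.
have rv : res != v by rewrite eq_sym.
by rewrite (upd_comm _ _ _ rv) upd_upd [upd _ v 0]upd_id // henv_out.
Qed.

End Eval.

(** ** Compiling programs to Turing machines *)

(** All stacks that can arise while [p] runs on top of [r]. The list is finite, which is what turns
    stacks into machine states. *)
Fixpoint pconts (p : prog) (r : seq prog) : seq (seq prog) :=
  (p :: r) :: match p with
  | Seq p q => pconts p (q :: r) ++ pconts q r
  | If c p q => pconts p r ++ pconts q r
  | Wh c q => pconts q (p :: r)
  | _ => [::]
  end.

Lemma pconts_head p r : List.In (p :: r) (pconts p r).
Proof. by case: p => *; left. Qed.

Lemma pconts_step p r g x s y s' : List.In x (pconts p r) ->
  step1 g (x, s) = Some (y, s') -> y = r \/ List.In y (pconts p r).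
Proof.
elim: p r x => [|i d|i b|i|p IHp q IHq|c p IHp q IHq|c p IHp] r x /=.
- by case=> // <- [<-]; left.
- by case=> // <- [<-]; left.
- by case=> // <- [<-]; left.
- by case=> // <- [<-]; left.
- case=> [<- [<- _]|].
    by right; right; apply/List.in_or_app; left; apply: pconts_head.
  move=> /(@List.in_app_or _ _ _ _) [/IHp H /H|/IHq H /H] [->|]; try by left.
  + by right; right; apply/List.in_or_app; right; apply: pconts_head.
  + by right; right; apply/List.in_or_app; left.
  + by right; right; apply/List.in_or_app; right.
- case=> [<- [<- _]|].
    by right; right; apply/List.in_or_app; case: holds; [left|right]; apply: pconts_head.
  move=> /(@List.in_app_or _ _ _ _) [/IHp H /H|/IHq H /H] [->|]; try by left.
  + by right; right; apply/List.in_or_app; left.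
  + by right; right; apply/List.in_or_app; right.
case=> [<- |/IHp H /H].
  by rewrite /step1 /=; case: holds => -[<- _]; [right; right; apply: pconts_head|left].
by case=> [->|]; right; [left|right].
Qed.

Fixpoint cond_lt (k : nat) (c : cond) : bool :=
  match c with
  | CZero i | CSym i _ => i < k
  | CNot c => cond_lt k c
  | CAnd c d => cond_lt k c && cond_lt k d
  end.

Fixpoint tapes_lt (k : nat) (p : prog) : bool :=
  match p with
  | Skip => true
  | Mv i _ | Wr i _ | Gs i => i < k
  | Seq p q => tapes_lt k p && tapes_lt k q
  | If c p q => [&& cond_lt k c, tapes_lt k p & tapes_lt k q]
  | Wh c p => cond_lt k c && tapes_lt k p
  end.

Fixpoint noguess (p : prog) : bool :=
  match p with
  | Gs _ => false
  | Seq p q | If _ p q => noguess p && noguess q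
  | Wh _ p => noguess p
  | _ => true
  end.

Lemma conts_all (P : pred prog) p r x :
  (forall p q, P (Seq p q) -> P p && P q) -> (forall c p q, P (If c p q) -> P p && P q) ->
  (forall c p, P (Wh c p) -> P p) ->
  P p -> all P r -> List.In x (pconts p r) -> all P x.
Proof.
move=> HS HI HW; elim: p r x => [|i d|i b|i|p IHp q IHq|c p IHp q IHq|c p IHp] r x /= Pp Pr.
- by case=> // <-; rewrite /= Pp.
- by case=> // <-; rewrite /= Pp.
- by case=> // <-; rewrite /= Pp.
- by case=> // <-; rewrite /= Pp.
- case=> [<-|]; first by rewrite /= Pp.
  have /andP[pp pq] := HS _ _ Pp.
  by move=> /(@List.in_app_or _ _ _ _) [/IHp|/IHq] H; apply: H; rewrite //= pq.
- case=> [<-|]; first by rewrite /= Pp.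
  have /andP[pp pq] := HI _ _ _ Pp.
  by move=> /(@List.in_app_or _ _ _ _) [/IHp|/IHq] H; apply: H; rewrite //= pq.
case=> [<-|/IHp H]; first by rewrite /= Pp.
by apply: H; rewrite ?(HW _ _ Pp) //= Pp.
Qed.

Section Compile.
Variables (p0 : prog) (acc : cond) (k : nat).
Hypotheses (pk : tapes_lt k.+1 p0) (acck : cond_lt k.+1 acc).

Definition stacks : seq (seq prog) := [::] :: pconts p0 [::].

Definition stack_index (x : seq prog) : 'I_(size stacks) :=
  inord (find (fun z => `[< z = x >]) stacks).

Lemma stack_indexK x : List.In x stacks -> nth [::] stacks (stack_index x) = x.
Proof.
move=> xs; have hx : has (fun z => `[< z = x >]) stacks.
  elim: stacks xs => //= z s IH [->|/IH ->]; last by rewrite orbT.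
  by rewrite (_ : `[< x = x >]) //; apply/asboolP.
rewrite inordK; last by move: hx; rewrite has_find.
by have /asboolP := nth_find [::] hx.
Qed.

Lemma stack_step g x s y s' : List.In x stacks -> step1 g (x, s) = Some (y, s') ->
  List.In y stacks.
Proof.
by case=> [<- //|xs /(pconts_step xs) [->|]]; [left|right].
Qed.

Lemma stack_tapes x : List.In x stacks -> all (tapes_lt k.+1) x.
Proof.
case=> [<- //|]; apply: conts_all => //.
- by move=> c p q /= /and3P[_ -> ->].
- by move=> c p /= /andP[].
Qed.

Lemma stack_noguess x : noguess p0 -> List.In x stacks -> all noguess x.
Proof. by move=> ng [<- //|]; apply: conts_all. Qed.

Definition qstate : finType := (bool + option 'I_(size stacks))%type.
(** The boolean marks cell 0, which a machine could not recognize otherwise; it implements the test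
    [CZero]. *)
Definition qsym : finType := (option bool * bool)%type.
Notation scan := {ffun 'I_k.+1 -> qsym}.

(** The memory seen through the scanned symbols: the mark tells whether a head
    is on cell 0, and any other position is as good as 1. *)
Definition vmem (s : scan) : memory :=
  (fun j _ => if insub j is Some i then (s i).1 else None,
   fun j => if insub j is Some i then (~~ (s i).2 : nat) else 0).

(** Comparing the abstract positions recovers the move: going from 1 to 0 is a left move, whereas a
    left move on cell 0 shows no change and becomes [Stay]. *)
Definition vmove (a b : nat) : move := if a < b then MoveR else if b < a then MoveL else Stay.

Definition stay : {ffun 'I_k.+1 -> move} := [ffun=> Stay].

Definition qaction := (qstate * scan * {ffun 'I_k.+1 -> move})%type.

Definition qact (x : seq prog) (s : scan) (g : bool) : qaction :=
  let m := vmem s in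
  if step1 g (x, m) is Some (y, m') then
    (inr (Some (stack_index y)), [ffun i : 'I_k.+1 => (m'.1 i (m.2 i), (s i).2)],
     [ffun i : 'I_k.+1 => vmove (m.2 i) (m'.2 i)])
  else (inl (holds acc m), s, stay).

(** [inr None] is the start state, whose single step writes the marks on the cells 0; [inl b] halts
    with verdict [b]; the other states run the program from a stack, once for each guessed bit. *)
Definition qtrans (q : qstate) (s : scan) : {set qaction} :=
  match q with
  | inl _ => set0
  | inr None => [set (inr (Some (stack_index [:: p0])), [ffun i => ((s i).1, true)], stay)]
  | inr (Some i) => [set qact (nth [::] stacks i) s g | g in [set: bool]]
  end.

Lemma qbit_inj : injective (fun b : bool => (Some b, false) : qsym).
Proof. by move=> b c [->]. Qed.

Definition machine : tm :=
  @TM k qstate qsym (None, false) (fun b => (Some b, false)) qbit_inj (fun=> erefl)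
      (inr None) (fun q => q == inl true) qtrans.

Definition conf_of (x : pconf) : config machine :=
  @Config machine (inr (Some (stack_index x.1))) (fun i p => (x.2.1 i p, p == 0))
    (fun i => x.2.2 i).

Definition final_of (m : memory) : config machine :=
  @Config machine (inl (holds acc m)) (fun i p => (m.1 i p, p == 0)) (fun i => m.2 i).

Definition mem0 (w : seq bool) : memory :=
  (fun i p => if i == 0 then nth None [seq Some b | b <- w] p else None, fun=> 0).

Lemma config_eq (c c' : config machine) : cstate c = cstate c' ->
  (forall i p, ctape c i p = ctape c' i p) -> (forall i, chead c i = chead c' i) -> c = c'.
Proof.
case: c c' => [q t h] [q' t' h'] /= -> tt hh; congr Config.
  by apply: funext => i; apply: funext => p.
exact: funext.
Qed.

Lemma tm_step_init w d : tm_step (init_config machine w) d <-> d = conf_of ([:: p0], mem0 w).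
Proof.
have E : conf_of ([:: p0], mem0 w) = Config
    (inr (Some (stack_index [:: p0])) : state machine)
    (fun i p => if p == 0 then ((scanned (init_config machine w) i).1, true)
                else ctape (init_config machine w) i p)
    (fun i => do_move (stay i) 0).
  apply: config_eq => //= [i p|i]; last by rewrite ffunE.
  rewrite ffunE /= (_ : (i == ord0) = (nat_of_ord i == 0)) //.
  case: (nat_of_ord i == 0); case: (p =P 0) => [pz|p0'] //=; rewrite ?pz //.
  - by case: w.
  - have [pw|pw] := ltnP p (size w); first by rewrite !(nth_map false).
    by rewrite !nth_default ?size_map.
split=> [[q [s [m []]]]|->].
  rewrite /= inE => /eqP [-> -> ->] ->; rewrite E; apply: config_eq => //= i p.
  by rewrite ffunE.
exists (inr (Some (stack_index [:: p0]))), [ffun i => ((scanned (init_config machine w) i).1, true)], stay.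
split; first by rewrite /= inE.
by rewrite E; apply: config_eq => *; rewrite /= ?ffunE.
Qed.

Lemma vmem_scan x (i : 'I_k.+1) :
  [/\ (vmem (scanned (conf_of x))).1 i ((vmem (scanned (conf_of x))).2 i) = x.2.1 i (x.2.2 i),
      (vmem (scanned (conf_of x))).2 i = (x.2.2 i != 0) &
      forall p, (vmem (scanned (conf_of x))).1 i p = x.2.1 i (x.2.2 i)].
Proof. by rewrite /vmem /= valK !ffunE. Qed.

Lemma holds_vmem c x : cond_lt k.+1 c -> holds c (vmem (scanned (conf_of x))) = holds c x.2.
Proof.
move: (vmem_scan x); move: (vmem _) => vm V.
elim: c => [i|i o|c IH|c IHc d IHd] /= ck.
- by have [_ E _] := V (Ordinal ck); rewrite -[i]/(nat_of_ord (Ordinal ck)) E; rewrite [nat_of_ord _]/=; case: (x.2.2 i).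
- by have [E _ _] := V (Ordinal ck); rewrite -[i]/(nat_of_ord (Ordinal ck)) E.
- by rewrite IH.
- by move: ck => /andP[ck dk]; rewrite IHc ?IHd.
Qed.

Lemma vstep x s g y s' : List.In x stacks -> step1 g (x, s) = Some (y, s') ->
  exists vm, step1 g (x, vmem (scanned (conf_of (x, s)))) = Some (y, vm) /\
  forall i : 'I_k.+1, let m := vmem (scanned (conf_of (x, s))) in
  [/\ vm.1 i (m.2 i) = s'.1 i (s.2 i),
      forall p, p != s.2 i -> s'.1 i p = s.1 i p &
      do_move (vmove (m.2 i) (vm.2 i)) (s.2 i) = s'.2 i].
Proof.
move=> xs; have := stack_tapes xs.
have := fun c => @holds_vmem c (x, s).
have := vmem_scan (x, s); move: (vmem _) => m; rewrite [(x, s).2]/= => V hm.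
have stayP a p : do_move (vmove a a) p = p by rewrite /vmove ltnn.
case: x xs => [//|[|j d|j b|j|p q|c p q|c p] r] _ /=.
- move=> _ [<- <-]; exists m; split=> // i; have [E1 E2 _] := V i.
  by split.
- move=> /andP[jk _] [<- <-]; eexists; split; first by [].
  move=> i /=; have [E1 E2 _] := V i; split=> //.
  rewrite /upd; case: eqP => [ij|_]; last exact: stayP.
  rewrite -ij E2 /=; case: d; first by rewrite /vmove ltnSn.
  by case: (s.2 i).
- move=> /andP[jk _] [<- <-]; eexists; split; first by [].
  move=> i /=; have [E1 E2 _] := V i; split; last exact: stayP.
    rewrite /upd; case: (nat_of_ord i =P j) => [<-|_]; last by rewrite E1.
    by rewrite !eqxx.
  by move=> p; rewrite /upd; case: (nat_of_ord i =P j) => [<-|//] /negbTE ->.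
- move=> /andP[jk _] [<- <-]; eexists; split; first by [].
  move=> i /=; have [E1 E2 _] := V i; split; last exact: stayP.
    rewrite /upd; case: (nat_of_ord i =P j) => [<-|_]; last by rewrite E1.
    by rewrite !eqxx.
  by move=> p; rewrite /upd; case: (nat_of_ord i =P j) => [<-|//] /negbTE ->.
- move=> _ [<- <-]; exists m; split=> // i; have [E1 E2 _] := V i.
  by split.
- move=> /andP[/and3P[ck _ _] _] [<- <-]; exists m; split; first by rewrite /step1 /= hm.
  move=> i.
  by have [E1 E2 _] := V i; split.
move=> /andP[/andP[ck _] _]; rewrite /step1 /= (hm _ ck) => -[<- <-]; exists m; split=> //= i.
by have [E1 E2 _] := V i; split.
Qed.

Lemma qactP x s g y s' : List.In x stacks -> step1 g (x, s) = Some (y, s') ->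
  exists t mv, qact x (scanned (conf_of (x, s))) g = (inr (Some (stack_index y)), t, mv) /\
   conf_of (y, s') = Config (inr (Some (stack_index y)) : state machine)
      (fun i p => if p == s.2 i then t i else ctape (conf_of (x, s)) i p)
      (fun i => do_move (mv i) (s.2 i)).
Proof.
move=> xs st; have [vm [E H]] := vstep xs st.
rewrite /qact E; eexists; eexists; split; first by [].
apply: config_eq => //= [i p|i]; have [E1 E2 E3] := H i; rewrite !ffunE //.
by have [->|ne] := eqVneq p (s.2 i); rewrite ?E1 ?ffunE ?(E2 _ ne).
Qed.

Lemma tm_step_conf x s d : List.In x stacks -> x <> [::] ->
  tm_step (conf_of (x, s)) d <-> exists g y, step1 g (x, s) = Some y /\ d = conf_of y.
Proof.
move=> xs xn; have tot g : exists y s', step1 g (x, s) = Some (y, s').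
  by case: x xn {xs} => [//|[|? ?|? ?|?|? ?|? ? ?|? ?] r] _; eexists; eexists.
rewrite /tm_step /= stack_indexK //; split=> [[q [t [mv [+ ->]]]]|[g [[y s'] [st ->]]]].
  move=> /imsetP[g _]; have [y [s' st]] := tot g.
  have [t' [mv' [-> E]]] := qactP xs st => -[-> -> ->].
  by exists g, (y, s').
have [t [mv [Eq E]]] := qactP xs st.
exists (inr (Some (stack_index y))), t, mv; split; last exact: E.
by apply/imsetP; exists g; rewrite ?inE.
Qed.

Lemma tm_step_nil s d : tm_step (conf_of ([::], s)) d <-> d = final_of s.
Proof.
have ns : List.In [::] stacks by left.
have E : final_of s = Config (inl (holds acc s) : state machine)
    (fun i p => if p == s.2 i then scanned (conf_of ([::], s)) i
                else ctape (conf_of ([::], s)) i p)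
    (fun i => do_move (stay i) (s.2 i)).
  apply: config_eq => //= [i p|i]; last by rewrite ffunE.
  by have [->|] := eqVneq p (s.2 i); rewrite ?ffunE.
have H g : qact [::] (scanned (conf_of ([::], s))) g =
    (inl (holds acc s), scanned (conf_of ([::], s)), stay).
  by rewrite /qact /= (@holds_vmem acc ([::], s)).
rewrite /tm_step [trans _ _]/= stack_indexK //; split=> [[q [t [mv [+ ->]]]]|->].
  by move=> /imsetP[g _]; rewrite H => -[-> -> ->].
exists (inl (holds acc s)), (scanned (conf_of ([::], s))), stay; split; last exact: E.
by apply/imsetP; exists true; rewrite ?inE ?H.
Qed.

Lemma tm_step_final s d : ~ tm_step (final_of s) d.
Proof. by move=> [q [t [mv []]]]; rewrite /= inE. Qed.

Lemma halted_final s : halted (final_of s).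
Proof. by []. Qed.

Lemma nth_In (A : Type) (d : A) (s : seq A) i : i < size s -> List.In (nth d s i) s.
Proof. by elim: s i => [|x s IH] [|i] //= => [_|/IH]; [left|right]. Qed.

Lemma machine_det : noguess p0 -> deterministic machine.
Proof.
move=> ng [b|[i|]] s /=; rewrite ?cards0 ?cards1 //.
have E : qact (nth [::] stacks i) s true = qact (nth [::] stacks i) s false.
  have : all noguess (nth [::] stacks i).
    by apply: stack_noguess => //; apply: nth_In.
  rewrite /qact; case: nth => [//|[|? ?|? ?|?|? ?|? ? ?|? ?] r] //=.
rewrite (_ : _ @: _ = [set qact (nth [::] stacks i) s true]) ?cards1 //.
apply/setP => z; rewrite inE; apply/imsetP/eqP => [[[] _ ->]|->] //.
by exists true; rewrite ?inE.
Qed.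

End Compile.

(** ** Polynomial bounds *)

Definition polyb (f : nat -> nat) : Prop := exists p : {poly nat}, forall x, f x = (p.[x])%R.

Lemma polyb_const c : polyb (fun=> c).
Proof. by exists (c%:P)%R => x; rewrite hornerC. Qed.

Lemma polyb_id : polyb id.
Proof. by exists 'X%R => x; rewrite hornerX. Qed.

Lemma polyb_add f g : polyb f -> polyb g -> polyb (fun x => f x + g x).
Proof. by move=> [p pf] [q qg]; exists (p + q)%R => x; rewrite hornerD pf qg. Qed.

Lemma polyb_mul f g : polyb f -> polyb g -> polyb (fun x => f x * g x).
Proof. by move=> [p pf] [q qg]; exists (p * q)%R => x; rewrite hornerM pf qg. Qed.

Lemma polyb_exp f e : polyb f -> polyb (fun x => f x ^ e).
Proof.
move=> pf; elim: e => [|e IH]; first exact: polyb_const.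
have [p H] := polyb_mul pf IH; exists p => x; by rewrite expnS H.
Qed.

(** * Runs of the compiled machines *)

Section Runs.
Variables (p0 : prog) (acc : cond) (k : nat).
Hypotheses (pk : tapes_lt k.+1 p0) (acck : cond_lt k.+1 acc).
Notation M := (machine p0 acc k).
Notation conf x := (conf_of p0 acc k x).
Notation start w := ([:: p0], mem0 w).

Definition pstep (x y : pconf) : Prop := exists g, step1 g x = Some y.

Lemma step1_total x s : x <> [::] -> forall g, exists y, step1 g (x, s) = Some y.
Proof. by case: x => [//|[|? ?|? ?|?|? ?|? ? ?|? ?] r] _ g; eexists. Qed.

Lemma start_in : List.In [:: p0] (stacks p0).
Proof. by right; apply: pconts_head. Qed.

Lemma pstep_in x y : List.In x.1 (stacks p0) -> pstep x y -> List.In y.1 (stacks p0).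
Proof. by case: x y => [x s] [y s'] /= xs [g]; apply: stack_step. Qed.

Lemma pstep_conf x y : List.In x.1 (stacks p0) -> pstep x y -> tm_step (conf x) (conf y).
Proof.
case: x => [x s] /= xs [g st]; apply/(@tm_step_conf p0 acc k pk) => //.
  by case: x st {xs}.
by exists g, y.
Qed.

Lemma psteps_conf j x y : List.In x.1 (stacks p0) -> nsteps pstep j x y ->
  nsteps (@tm_step M) j (conf x) (conf y).
Proof.
elim: j x => [|j IH] x xs /=; first by move=> ->.
by move=> [z [xz zy]]; exists (conf z); split; [apply: pstep_conf|apply: IH zy; apply: pstep_in xz].
Qed.

Lemma inv_nsteps (A : Type) (R : A -> A -> Prop) (P : A -> Prop) j x y :
  (forall x y, P x -> R x y -> P y) -> P x -> nsteps R j x y -> P y.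
Proof.
move=> H; elim: j x => [|j IH] x Px /=; first by move=> <-.
by move=> [z [xz]]; apply: IH; apply: H xz.
Qed.

Lemma psteps_accept w m : reaches pstep (start w) ([::], m) -> holds acc m ->
  tm_accepts M w.
Proof.
move=> [j jm] am; exists (final_of p0 acc k m); split; [|exact: halted_final|by rewrite /= am].
apply: (@reaches_trans _ _ _ (conf (start w))).
  by apply/reaches1/tm_step_init.
apply: (@reaches_trans _ _ _ (conf ([::], m))); last exact/reaches1/(tm_step_nil acck).
by exists j; apply: psteps_conf => //; apply: start_in.
Qed.

Lemma nstepsSr (A : Type) (R : A -> A -> Prop) j x y :
  nsteps R j.+1 x y <-> exists z, nsteps R j x z /\ R z y.
Proof.
rewrite -addn1; split=> [/nsteps_add [z [xz [y' [zy' /= <-]]]]|[z [xz zy]]]; first by exists z.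
by apply/nsteps_add; exists z; split=> //; exists y.
Qed.

Lemma start_inv w i y : nsteps pstep i (start w) y -> List.In y.1 (stacks p0).
Proof.
move=> iy; apply: (@inv_nsteps _ _ (fun y : pconf => List.In y.1 (stacks p0)) _ _ _ _ _ iy).
  by move=> u v; apply: pstep_in.
exact: start_in.
Qed.

(** The machine spends one extra step at the start, marking the cells 0, and one at the end,
    entering a halting state; in between it follows the program step by step. *)
Lemma tm_run_cases w j c : nsteps (@tm_step M) j (init_config M w) c ->
  [\/ c = init_config M w /\ j = 0,
      exists i y, [/\ c = conf y, nsteps pstep i (start w) y & j = i.+1] |
      exists i m, [/\ c = final_of p0 acc k m, nsteps pstep i (start w) ([::], m) & j = i.+2]].
Proof.
elim: j c => [|j IH] c; first by move=> /= cE; constructor 1; rewrite cE.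
move=> /nstepsSr [d [/IH [[-> ->]|[i [y [-> iy ->]]]|[i [m [-> im ->]]]] dc]].
- constructor 2; exists 0, (start w); split=> //.
  exact: (tm_step_init w c).1 dc.
- have yin : List.In y.1 (stacks p0) by apply: start_inv iy.
  case: y iy yin dc => [[|q r] s] iy yin dc.
    by constructor 3; exists i, s; split=> //; apply/(tm_step_nil acck).
  have qn : q :: r <> [::] by [].
  have [g [z [st ->]]] := (@tm_step_conf p0 acc k pk _ s c yin qn).1 dc.
  constructor 2; exists i.+1, z; split=> //.
  by apply/nstepsSr; exists (q :: r, s); split=> //; exists g.
- by case: (tm_step_final dc).
Qed.

Lemma pstep_total x s : x <> [::] -> exists y, pstep (x, s) y.
Proof. by move=> /(@step1_total x s) /(_ true) [y ?]; exists y, true. Qed.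

Lemma not_halted (c d : config M) : tm_step c d -> ~ halted c.
Proof. by move=> [q [s [m [+ _]]]] h; rewrite h inE. Qed.

Lemma halted_cases w j c : nsteps (@tm_step M) j (init_config M w) c -> halted c ->
  exists i m, [/\ c = final_of p0 acc k m, nsteps pstep i (start w) ([::], m) & j = i.+2].
Proof.
move=> /tm_run_cases [[-> _]|[i [y [-> iy _]]]|//] hc.
  by case: (@not_halted _ (conf (start w)) _ hc); apply/tm_step_init.
have yin : List.In y.1 (stacks p0) by apply: start_inv iy.
case: y iy yin hc => [[|q r] s] iy yin hc.
  by case: (@not_halted _ (final_of p0 acc k s) _ hc); apply/tm_step_nil.
have [z st] := @pstep_total (q :: r) s (fun H => ltac:(discriminate H)).
by case: (@not_halted _ (conf z) _ hc); apply: pstep_conf.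
Qed.

Lemma dstep_pstep mono B x y : dstep mono B x y -> pstep x y.
Proof. by move=> [/(_ true) H _]; exists true. Qed.

Lemma sub_reaches (A : Type) (R R' : A -> A -> Prop) x y :
  (forall x y, R x y -> R' x y) -> reaches R x y -> reaches R' x y.
Proof.
move=> H [j xy]; exists j; elim: j x xy => [|j IH] x //= [z [xz zy]].
by exists z; split; [apply: H|apply: IH].
Qed.

(** A halting run made of [dstep]s leaves no alternative, so every other run from the same state is
    a part of it. *)
Lemma det_path mono B j x y m : reaches (dstep mono B) x ([::], m) -> nsteps pstep j x y ->
  reaches (dstep mono B) x y /\ reaches (dstep mono B) y ([::], m).
Proof.
elim: j x => [|j IH] x xm /=; first by move=> <-; split=> //; apply: reaches_refl.
move=> [z [[g xz] zy]]; case: xm => [[|i] /= H]; first by rewrite H in xz.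
case: H => [z' [[st al] im]].
have E : z' = z by have := st g; rewrite xz => -[->].
subst z'; have [|zy' ym] := IH z _ zy; first by exists i.
by split=> //; apply: reaches_trans zy'; apply: reaches1.
Qed.

Lemma dstep_heads mono B x y : reaches (dstep mono B) x y ->
  (forall i, x.2.2 i < B) -> forall i, y.2.2 i < B.
Proof.
move=> [j xy] hx; apply: (@inv_nsteps _ _ (fun x : pconf => forall i, x.2.2 i < B) _ _ _ _ hx xy).
move=> {xy hx} {}x {}y hx [_ [al _]] i; have [//|le] := al i.
exact: leq_ltn_trans (hx i).
Qed.

Theorem machine_pspace (L : language) (Bf : nat -> nat) : noguess p0 -> polyb Bf ->
  (forall w, 0 < Bf (size w) /\ exists m,
     reaches (dstep false (Bf (size w))) (start w) ([::], m) /\ (L w <-> holds acc m)) ->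
  lang_PSPACE L.
Proof.
move=> ng [p pB] H; exists M, p; split; first exact: machine_det.
move=> w; have [B0 [m [sm Lm]]] := H w; rewrite -pB; set B := Bf (size w) in B0 sm *.
have hb j y : nsteps pstep j (start w) y -> forall i, y.2.2 i < B.
  by move=> /(det_path sm) [sy _]; apply: dstep_heads sy _.
split.
- move=> c [j jc] i; case: (tm_run_cases jc) => [[-> _ //]|[a [y [-> ay _]]]|[a [m' [-> am _]]]].
    exact: (hb _ _ ay i).
  exact: (hb _ _ am i).
- exists (final_of p0 acc k m); split; last exact: halted_final.
  apply: (@reaches_trans _ _ _ (conf (start w))); first by apply/reaches1/tm_step_init.
  apply: (@reaches_trans _ _ _ (conf ([::], m))); last exact/reaches1/(tm_step_nil acck).
  have [j jm] := sub_reaches (@dstep_pstep _ _) sm.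
  by exists j; apply: psteps_conf => //; apply: start_in.
- rewrite Lm; split=> [|[c [[j jc] hc]]].
    by apply: psteps_accept; apply: sub_reaches sm; apply: dstep_pstep.
  have [i [m' [-> im _]]] := halted_cases jc hc.
  have [_ [[|a] /= E]] := det_path sm im; first by case: E => -> /eqP; case.
  by case: E => z [[/(_ true)]].
Qed.

(** [must B Q x]: every run from [x] is monotone, has its heads below [B], and
    ends in a memory satisfying [Q]. *)
Inductive must (B : nat) (Q : memory -> Prop) : pconf -> Prop :=
  | must_end m : Q m -> must B Q ([::], m)
  | must_step x : x.1 <> [::] ->
      (forall y, pstep x y -> allowed true B x.2 y.2) ->
      (forall y, pstep x y -> must B Q y) -> must B Q x.

Lemma must_dstep B Q x y : reaches (dstep true B) x y -> must B Q y -> must B Q x.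
Proof.
move=> [j]; elim: j x => [|j IH] x /=; first by move=> ->.
move=> [z [[st al] zy]] my; have mz := IH z zy my.
have E u : pstep x u -> u = z by move=> [g]; rewrite st => -[].
apply: must_step => [|u /E ->|u /E ->] //.
by move=> x0; have := st true; rewrite /step1 x0.
Qed.

Lemma must_pstep B Q x y : must B Q x -> pstep x y -> allowed true B x.2 y.2 /\ must B Q y.
Proof. by case=> [m _ [g] //|{}x _ al mu xy]; split; [apply: al|apply: mu]. Qed.

(** [must] is inductive, hence well-founded along steps, while a cycle could be followed forever. *)
Lemma must_acyclic B Q x j : must B Q x -> ~ nsteps pstep j.+1 x x.
Proof.
move=> mx; elim: mx j => {x} [m _ j [y [[g] //]]|x _ _ _ IH j [y [xy yx]]].
by apply: (IH y xy j); apply/nstepsSr; exists x.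
Qed.

Lemma must_final B Q x m : must B Q x -> reaches pstep x ([::], m) -> Q m.
Proof.
move=> mx [j xm]; have : must B Q ([::], m).
  apply: (@inv_nsteps _ _ (must B Q) _ _ _ _ mx xm) => {xm mx} {}x y mx xy.
  by have [] := must_pstep mx xy.
by move E: (_, m) => u mu; case: mu E => [m' Qm [->] //|{}u un _ _ E]; case: un; rewrite -E.
Qed.

Lemma step_outside B x s g y s' : all (tapes_lt k.+1) x -> (forall i, s.2 i < B) ->
  step1 g (x, s) = Some (y, s') ->
  (forall i p, (k < i) || (B <= p) -> s'.1 i p = s.1 i p) /\ (forall i, k < i -> s'.2 i = s.2 i).
Proof.
move=> + hB; have wr i b : i < k.+1 -> forall j p, (k < j) || (B <= p) -> (write s i b).1 j p = s.1 j p.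
  move=> ik j p jp; rewrite /write /= /upd; case: (j =P i) => // E; case: (p =P s.2 i) => [E'|_]; last by rewrite E.
  by move: jp (hB i); rewrite E E'; lia.
case: x => [//|[|u d|u b0|u|q q'|c q q'|c q] r] /=.
- by move=> _ [_ <-].
- move=> /andP[uk _] [_ <-]; split=> // v kv; rewrite /= upd_neq //; lia.
- by move=> /andP[uk _] [_ <-]; split=> //; apply: wr.
- by move=> /andP[uk _] [_ <-]; split=> //; apply: wr.
- by move=> _ [_ <-].
- by move=> _ [_ <-].
by move=> _; rewrite /step1 /= => -[_ <-].
Qed.

Definition filled (B : nat) (s : memory) : {set 'I_k.+1 * 'I_B} :=
  [set u : 'I_k.+1 * 'I_B | s.1 u.1 u.2 != None].

Definition run_bound (B : nat) : nat :=
  size (stacks p0) * B.+1 ^ k.+1 * (k.+1 * B).+1.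

Lemma nsteps_segment (A : Type) (R : A -> A -> Prop) (f : nat -> A) j a b :
  (forall i, i < j -> R (f i) (f i.+1)) -> a + b <= j -> nsteps R b (f a) (f (a + b)).
Proof.
move=> H; elim: b a => [|b IH] a ab /=; first by rewrite addn0.
exists (f a.+1); split; first by apply: H; lia.
by rewrite -addSnnS; apply: IH; lia.
Qed.

(** Since nothing is overwritten, the set of filled cells only grows. Two moments with the same
    stack, the same head positions and the same number of filled cells therefore share the whole
    memory, which [must_acyclic] forbids; the bound counts such triples. *)
Lemma must_bounded B Q w j y : 0 < B -> must B Q (start w) ->
  nsteps pstep j (start w) y -> j < run_bound B.
Proof.
move=> B0 mw jy; have [f [f0 fj fs]] := nsteps_seq jy.
have seg a : a <= j -> nsteps pstep a (start w) (f a).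
  by move=> aj; have := @nsteps_segment _ pstep f j 0 a fs; rewrite f0 add0n; apply.
have fin a : a <= j -> List.In (f a).1 (stacks p0) by move=> /seg; apply: start_inv.
have fm a : a <= j -> must B Q (f a).
  elim: a => [|a IH] aj; first by rewrite f0.
  by have [] := must_pstep (IH (ltnW aj)) (fs a aj).
have fh a : a <= j -> forall i, (f a).2.2 i < B.
  elim: a => [|a IH] aj i; first by rewrite f0.
  have [[al _] _] := must_pstep (fm a (ltnW aj)) (fs a aj).
  by have [//|le] := al i; apply: leq_ltn_trans (IH (ltnW aj) i).
(* Outside the window of tapes up to [k] and cells below [B] the memory keeps its initial value, so
   it is enough to compare filled cells inside. *)
have fo a : a <= j -> (forall i p, (k < i) || (B <= p) -> (f a).2.1 i p = (mem0 w).1 i p) /\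
    (forall i, k < i -> (f a).2.2 i = 0).
  elim: a => [|a IH] aj; first by rewrite f0.
  have [g] := fs a aj; have := fh a (ltnW aj); have := stack_tapes pk (fin a (ltnW aj)).
  have [H1 H2] := IH (ltnW aj).
  case: (f a) H1 H2 => x s; case: (f a.+1) => y' s' H1 H2 xt sB st.
  have [/= K1 K2] := step_outside xt sB st.
  by split=> [i p ip|i ki]; [rewrite K1 // H1|rewrite K2 // H2].
have fmono a b : a + b <= j -> forall i p, (f a).2.1 i p != None ->
    (f (a + b)).2.1 i p = (f a).2.1 i p.
  elim: b => [|b IH] ab i p ne; first by rewrite addn0.
  rewrite addnS in ab *.
  have [[_ mo] _] := must_pstep (fm _ (ltnW ab)) (fs _ ab).
  have E := IH (ltnW ab) i p ne.
  by rewrite mo ?E.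
pose F (a : 'I_j.+1) := (stack_index p0 (f a).1,
  [ffun i : 'I_k.+1 => inord ((f a).2.2 i) : 'I_B.+1],
  inord #|filled B (f a).2| : 'I_(k.+1 * B).+1).
have cB s : #|filled B s| < (k.+1 * B).+1.
  by rewrite ltnS (leq_trans (max_card _)) // card_prod !card_ord.
have Finj (a b : 'I_j.+1) : a < b -> F a = F b -> False.
  move=> ab [E1 E2 E3].
  have aj : a <= j by rewrite -ltnS. have bj : b <= j by rewrite -ltnS.
  have Eb : (b : nat) = a + (b - a) by rewrite subnKC // ltnW.
  have S : (f a).1 = (f b).1.
    by rewrite -(stack_indexK (fin a aj)) -(stack_indexK (fin b bj)) E1.
  have Hh : (f a).2.2 = (f b).2.2.
    apply: funext => i; have [ik|ki] := ltnP i k.+1; last first.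
      by rewrite (fo a aj).2 ?(fo b bj).2.
    have := congr1 (fun h : {ffun 'I_k.+1 -> 'I_B.+1} => (h (Ordinal ik) : nat)) E2.
    by rewrite !ffunE /= !inordK ?ltnS ?(ltnW (fh _ _ _)).
  have sub : filled B (f a).2 \subset filled B (f b).2.
    by apply/subsetP => -[i p]; rewrite !inE /= Eb => ne; rewrite fmono -?Eb.
  have Es : filled B (f a).2 = filled B (f b).2.
    apply/eqP; rewrite eqEcard sub /=.
    by have := congr1 (@nat_of_ord _) E3; rewrite !inordK // => ->.
  have Hc : (f a).2.1 = (f b).2.1.
    apply: funext => i; apply: funext => p.
    case ip : ((k < i) || (B <= p)); first by rewrite (fo a aj).1 ?(fo b bj).1.
    move/negbT: ip; rewrite negb_or -leqNgt -ltnNge => /andP[ik pB].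
    have [aN|an] := eqVneq ((f a).2.1 i p) None; last first.
      by rewrite Eb fmono -?Eb.
    have := congr1 (fun X : {set _} => (Ordinal (ik : i < k.+1), Ordinal pB) \in X) Es.
    by rewrite !inE /= aN /=; case: ((f b).2.1 i p).
  have Efab : f a = f b by case: (f a) (f b) S Hh Hc => [x [c h]] [x' [c' h']] /= -> -> ->.
  have := @nsteps_segment _ pstep f j a (b - a) fs; rewrite -Eb => /(_ bj).
  rewrite -Efab (_ : b - a = (b - a).-1.+1); last by rewrite prednK // subn_gt0.
  exact: must_acyclic (fm a aj).
have : injective F.
  move=> a b E; apply: ord_inj; case: (ltngtP a b) => // lt.
    by case: (Finj a b lt E).
  by case: (Finj b a lt (esym E)).
move/leq_card. rewrite !card_prod. rewrite card_ffun !card_ord. exact.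
Qed.

Theorem machine_np (L : language) (Bf : nat -> nat) : polyb Bf ->
  (forall w, 0 < Bf (size w) /\
     must (Bf (size w)) (fun m => holds acc m -> L w) (start w) /\
     (L w -> exists m, reaches pstep (start w) ([::], m) /\ holds acc m)) ->
  lang_NP L.
Proof.
move=> pB H.
have [p pE] : polyb (fun x => run_bound (Bf x) + 1).
  apply: polyb_add (polyb_const 1); apply: polyb_mul.
    apply: polyb_mul (polyb_const _) _; apply: polyb_exp.
    have [q qE] := polyb_add pB (polyb_const 1); exists q => x; by rewrite -qE addn1.
  have [q qE] := polyb_add (polyb_mul (polyb_const k.+1) pB) (polyb_const 1).
  by exists q => x; rewrite -qE addn1.
exists M, p => w; have [B0 [mw acw]] := H w; split.
  move=> t c tc; rewrite -pE; case: (tm_run_cases tc) => [[_ ->] //|[i [y [_ iy ->]]]|[i [m [_ im ->]]]].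
    have := must_bounded B0 mw iy; lia.
  have := must_bounded B0 mw im; lia.
split=> [/acw [m [sm am]]|[c [[j jc] hc ac]]]; first exact: psteps_accept am.
have [i [m [Ec im _]]] := halted_cases jc hc.
apply: (must_final mw); first by exists i; apply: im.
by move: ac; rewrite Ec /= => /eqP [].
Qed.

End Runs.

(** ** Loops over tuples of counters *)

(** An odometer: the counters [vs] run through all tuples in lexicographic order, the end of each
    range being read off a tape by [cnd]. *)
Fixpoint forn (cnd : nat -> cond) (vs : seq nat) (body : prog) : prog :=
  if vs is v :: vs' then Seq (Wh (cnd v) (Seq (forn cnd vs' body) (Mv v true))) (clr v)
  else body.

Fixpoint setv (h : nat -> nat) (vs ds : seq nat) : nat -> nat :=
  match vs, ds with
  | v :: vs', d :: ds' => setv (upd h v d) vs' ds'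
  | _, _ => h
  end.

Definition setm (s : memory) vs ds : memory := (s.1, setv s.2 vs ds).

Definition otape (s : seq bool) : nat -> option bool := fun p => nth None [seq Some b | b <- s] p.

Lemma setv_out h vs ds i : i \notin vs -> setv h vs ds i = h i.
Proof.
elim: vs ds h => [|v vs IH] [|d ds] h //=.
by rewrite inE negb_or => /andP[iv ivs]; rewrite IH // upd_neq.
Qed.

Section Forn.
Variables (mono : bool) (B : nat).
Notation exec := (exec mono B).

(** [S k] is the memory after [k] executions of the body with the counters at 0; during the next
    execution the counters show the digits of [k]. *)
Lemma exec_forn cnd vs body b (S : nat -> memory) : b < B -> uniq vs ->
  (forall k, k <= b ^ size vs -> all (fun v => (S k).2 v == 0) vs) ->
  (forall v k h, v \in vs -> k <= b ^ size vs -> h v <= b ->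
     holds (cnd v) ((S k).1, h) = (h v < b)) ->
  (forall k, k < b ^ size vs ->
     exec body (setm (S k) vs (digits b (size vs) k)) (setm (S k.+1) vs (digits b (size vs) k))) ->
  exec (forn cnd vs body) (S 0) (S (b ^ size vs)).
Proof.
move=> bB; elim: vs S => [|v vs IH] S /=.
  move=> _ _ _ H; have := H 0; rewrite expn0 => /(_ isT); rewrite /setm /=.
  by case: (S 0) => ? ?; case: (S 1).
move=> /andP[vvs uvs] S0 Sc Sb; set m := b ^ size vs.
have Em : b ^ (size vs).+1 = b * m by rewrite expnS.
rewrite Em in S0 Sc Sb *.
have bm d : d <= b -> d * m <= b * m by move=> db; rewrite leq_mul2r db orbT.
have Sv k : k <= b * m -> (S k).2 v = 0 by move=> /S0 /andP[/eqP].
pose R d : memory := ((S (d * m)).1, upd (S (d * m)).2 v d).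
apply: exec_seq (_ : exec _ _ (R b)) _; last first.
  apply: exec_eq (exec_clr _ _ _ _ _); rewrite upd_upd upd_id ?Sv //.
  by case: (S _).
apply: (@exec_wh _ _ _ _ _ _ R b) => //.
- by rewrite /R mul0n upd_id ?Sv //; case: (S 0).
- by move=> d db; rewrite Sc ?inE ?eqxx ?bm ?upd_same // ltnW.
- by rewrite Sc ?inE ?eqxx ?upd_same ?ltnn.
move=> d db; have dm : d * m + m <= b * m by rewrite addnC -mulSn bm.
apply: exec_seq (_ : exec _ _ ((S (d.+1 * m)).1, upd (S (d.+1 * m)).2 v d)) _; last first.
  apply: exec_eq (exec_mvR _ _ _); rewrite upd_same ?upd_upd //.
  exact: leq_ltn_trans bB.
pose S' j : memory := ((S (d * m + j)).1, upd (S (d * m + j)).2 v d).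
have := IH S' uvs; rewrite /S' addn0 mulSn [m + _]addnC; apply.
- move=> j jm; have /andP[_ /allP H] := S0 (d * m + j) (leq_trans (leq_add (leqnn _) jm) dm).
  apply/allP => u uvs'; rewrite /= upd_neq; first exact: H.
  by apply: contraNneq vvs => <-.
- move=> u j h uvs' jm hu; apply: Sc => //; first by rewrite inE uvs' orbT.
  exact: leq_trans (leq_add (leqnn _) jm) dm.
move=> j jm.
have := Sb (d * m + j) (leq_trans _ dm); rewrite -addnS leq_add2l jm => /(_ isT).
rewrite /setm /= [X in setv _ vs X]/=.
have m0 : 0 < m by apply: leq_trans jm.
by rewrite -/m divnMDl // divn_small // addn0 modnMDl modn_small.
Qed.

Lemma exec_each (p : nat -> prog) F G (Pre : (nat -> option bool) -> nat -> Prop) ts c h :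
  uniq ts ->
  (forall t c h, t \in ts -> Pre (c t) (h t) ->
     exec (p t) (c, h) (upd c t (F (c t) (h t)), upd h t (G (c t) (h t)))) ->
  (forall t, t \in ts -> Pre (c t) (h t)) ->
  exec (seqs [seq p t | t <- ts]) (c, h)
   (fun i => if i \in ts then F (c i) (h i) else c i,
    fun i => if i \in ts then G (c i) (h i) else h i).
Proof.
elim: ts c h => [|t ts IH] c h /=; first by move=> _ _ _; apply: exec_skip.
move=> /andP[tts uts] H P; apply: exec_seq (H _ _ _ _ _) _; rewrite ?inE ?eqxx //.
  by apply: P; rewrite inE eqxx.
have ne u : u \in ts -> u != t by move=> uts'; apply: contraNneq tts => <-.
apply: exec_eq (IH _ _ uts _ _).
- congr pair; apply: funext => i; rewrite inE /upd; case: eqP => [->|_] //=.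
    by rewrite (negbTE tts).
  by rewrite (negbTE tts).
- by move=> u c' h' uts' Pu; apply: H => //; rewrite inE uts' orbT.
by move=> u uts'; rewrite !upd_neq ?ne //; apply: P; rewrite inE uts' orbT.
Qed.

Lemma exec_clrs ts c h : uniq ts ->
  exec (seqs [seq clr t | t <- ts]) (c, h) (c, fun i => if i \in ts then 0 else h i).
Proof.
move=> u; apply: exec_eq (@exec_each clr (fun t _ => t) (fun _ _ => 0) (fun _ _ => True) ts c h u _ _) => //.
  by congr pair; apply: funext => i; case: ifP.
by move=> t c' h' _ _; apply: exec_eq (exec_clr _ _ _ _ _); rewrite [upd c' _ _]upd_id.
Qed.

(** ** Reading the input *)

Definition ones_body ts := Seq (Mv 0 true) (seqs [seq Seq (Wr t true) (Mv t true) | t <- ts]).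

Definition ones ts := Wh (CSym 0 (Some true)) (ones_body ts).

Definition prefix_tape (o : option bool) (k : nat) : nat -> option bool :=
  fun p => if p < k then o else None.

Lemma exec_ones ts w (c : nat -> nat -> option bool) n (r : seq bool) : uniq ts -> 0 \notin ts ->
  w = nseq n true ++ r -> head false r = false -> (size w).+1 < B ->
  c 0 = otape w -> (forall t, t \in ts -> c t = fun=> None) ->
  exec (ones ts) (c, fun=> 0)
    (fun i => if i \in ts then prefix_tape (Some true) n else c i,
     fun i => if (i == 0) || (i \in ts) then n else 0).
Proof.
move=> u n0 Ew hr wB c0 ct.
pose S k : memory := (fun i => if i \in ts then prefix_tape (Some true) k else c i,
   fun i => if (i == 0) || (i \in ts) then k else 0).
have nw : n <= size w by rewrite Ew size_cat size_nseq leq_addr.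
have S1 k : (S k).1 0 = otape w by rewrite /= (negbTE n0).
have nk k : k < n -> otape w k = Some true.
  by move=> kn; rewrite /otape Ew map_cat map_nseq nth_cat size_nseq kn nth_nseq kn.
apply: (@exec_wh _ _ _ _ _ _ S n) => //.
- rewrite /S; congr pair; apply: funext => i; last by case: ifP.
  by case: ifP => // /ct ->; apply: funext => p; rewrite /prefix_tape ltn0.
- by move=> k kn; rewrite /= (negbTE n0) c0 nk.
- rewrite /= (negbTE n0) c0 /otape Ew map_cat map_nseq nth_cat size_nseq ltnn subnn.
  by case: r hr {Ew} => //= -[].
move=> k kn; apply: exec_seq (exec_mvR _ _ _) _; first by rewrite /=; lia.
have := @exec_each (fun t => Seq (Wr t true) (Mv t true))
  (fun _ p => prefix_tape (Some true) p.+1) (fun _ p => p.+1)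
  (fun tp p => tp = prefix_tape (Some true) k /\ p = k) ts (S k).1 (upd (S k).2 0 k.+1) u.
move=> H; apply: exec_eq (H _ _).
- have ne i : i \in ts -> i != 0 by move=> its; apply: contraNneq n0 => <-.
  congr pair; apply: funext => i; case its: (i \in ts); rewrite /= ?its //.
  + by rewrite upd_neq ?ne //= its orbT.
  + by rewrite upd_neq ?ne //= its orbT.
  + by rewrite /upd its orbF; case: eqP.
- move=> t c' h' tts [E1 E2].
  apply: exec_seq (exec_wr _ _ _) _.
    by move=> _; rewrite E1 E2 /prefix_tape ltnn.
  apply: exec_eq (exec_mvR _ _ _); last by rewrite /=; lia.
  rewrite /write /=; congr (upd c' t _, _); apply: funext => p.
  by rewrite E1 E2 /upd /prefix_tape [in RHS]ltnS [in RHS]leq_eqVlt; case: (p == k).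
move=> t tts; have t0 : t != 0 by apply: contraNneq n0 => <-.
by rewrite upd_neq //= tts orbT.
Qed.

Definition copy_bit t b := seqs [:: Wr t b; Mv t true; Mv 0 true].

(** A blank where a bit is expected raises [bad]; the test before it keeps that counter at most
    1. *)
Definition copy_body t :=
  If (CSym 0 (Some true)) (copy_bit t true)
    (If (CSym 0 (Some false)) (copy_bit t false)
      (If (CZero bad) (Mv bad true) Skip)).

Lemma setv_upd h vs ds i v : i \notin vs -> upd (setv h vs ds) i v = setv (upd h i v) vs ds.
Proof.
elim: vs ds h => [|u vs IH] [|d ds] h //=.
by rewrite inE negb_or => /andP[iu ivs]; rewrite IH // upd_comm // eq_sym.
Qed.

Lemma otape_rcons s b : upd (otape s) (size s) (Some b) = otape (rcons s b).
Proof.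
apply: funext => p; rewrite /otape /upd map_rcons nth_rcons size_map.
by case: ltngtP => // h; rewrite nth_default ?size_map // ltnW.
Qed.

Lemma exec_copy_bit c h t b : t != 0 -> (h t).+1 < B -> (h 0).+1 < B ->
  (mono -> c t (h t) = None) ->
  exec (copy_bit t b) (c, h)
    (upd c t (upd (c t) (h t) (Some b)), upd (upd h t (h t).+1) 0 (h 0).+1).
Proof.
move=> t0 tB oB m; apply: exec_seq (exec_wr _ _ _) _ => //.
apply: exec_seq (exec_mvR _ _ _) _ => //.
apply: exec_seq (exec_mvR _ _ _) _; first by rewrite upd_neq // eq_sym.
by apply: exec_eq (exec_skip _ _ _); rewrite [upd h t _ 0]upd_neq // eq_sym.
Qed.

Lemma exec_copy_block cnd vs n w c h t (u := drop (h 0) w) (q := minn (n ^ size vs) (size u)) :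
  n < B -> 1 < B -> uniq vs -> (size w).+1 < B -> h 0 <= size w ->
  t != 0 -> t != bad -> t \notin vs -> 0 \notin vs -> bad \notin vs ->
  all (fun v => h v == 0) vs -> h t = 0 -> h bad <= 1 ->
  c t = otape [::] -> c 0 = otape w ->
  (forall v c' h', v \in vs -> h' v <= n -> (forall i, i != t -> c' i = c i) ->
     holds (cnd v) (c', h') = (h' v < n)) ->
  exec (Seq (forn cnd vs (copy_body t)) (clr t)) (c, h)
    (upd c t (otape (take (n ^ size vs) u)),
     upd (upd h 0 (h 0 + q)) bad (if size u < n ^ size vs then 1 else h bad)).
Proof.
move=> nB B1 uvs wB h0 t0 tbad tvs zvs bvs hvs ht hbad ct c0 hc.
pose S k : memory := (upd c t (otape (take k u)),
  upd (upd (upd h t (minn k (size u))) 0 (h 0 + minn k (size u))) bad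
    (if size u < k then 1 else h bad)).
have su : size u = size w - h 0 by rewrite size_drop.
have bad0 : bad != 0 by [].
apply: exec_seq (_ : exec _ _ (S (n ^ size vs))) _; last first.
  apply: exec_eq (exec_clr _ _ _ _ _); congr pair; rewrite /q.
  by apply: funext => i; upd_cases => //; lia.
have -> : (c, h) = S 0.
  congr pair; first by rewrite take0 upd_id.
  by rewrite min0n ltn0 addn0; apply: funext => i; upd_cases.
apply: exec_forn => //.
- move=> k _; apply/allP => v vvs /=; rewrite !upd_neq ?(allP hvs) //.
  + by apply: contraNneq tvs => <-.
  + by apply: contraNneq zvs => <-.
  + by apply: contraNneq bvs => <-.
- by move=> v k h' vvs _ hv; apply: hc => // i it; rewrite /= upd_neq.
move=> k kn; set ds := digits _ _ _.
have Sh i : i \notin vs -> (setm (S k) vs ds).2 i = (S k).2 i by apply: setv_out.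
have E0 : (S k).2 0 = h 0 + minn k (size u) by rewrite /S /= upd_neq // upd_same.
have Et : (S k).2 t = minn k (size u) by rewrite /S /= (upd_neq _ _ tbad) (upd_neq _ _ t0) upd_same.
have Eb : (S k).2 bad = if size u < k then 1 else h bad by rewrite /S /= ?upd_same.
have c0' : (S k).1 0 = otape w by rewrite /S /= upd_neq // eq_sym.
have Hs o : holds (CSym 0 o) (setm (S k) vs ds) = (otape w (h 0 + minn k (size u)) == o).
  by rewrite -E0 -c0' -(Sh 0 zvs).
have Hb : holds (CZero bad) (setm (S k) vs ds) = ((if size u < k then 1 else h bad) == 0).
  by rewrite -Eb -(Sh bad bvs).
have [ku|uk] := ltnP k (size u); last first.
  have o : otape w (h 0 + minn k (size u)) = None.
    by rewrite /otape nth_default // size_map; lia.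
  apply: exec_if; rewrite Hs o.
  apply: exec_if; rewrite Hs o.
  have ES : setm (S k.+1) vs ds = (upd c t (otape (take k u)), upd (setm (S k) vs ds).2 bad 1).
    rewrite /setm /= setv_upd // upd_upd; congr (upd c t (otape _), setv _ _ _).
      by rewrite !take_oversize // ltnW.
    rewrite ltnS uk (minn_idPr uk) (minn_idPr (leqW uk)) //.
  rewrite ES -[upd c t _]/((setm (S k) vs ds).1).
  move: Hb (etrans (Sh bad bvs) Eb); case: (setm (S k) vs ds) => c1 h1 Hb Hbv.
  rewrite [_.2]/= [_.1]/= in Hbv *; apply: exec_if; rewrite Hb.
  case: ltnP Hbv => ukk Hbv; first by apply: exec_eq (exec_skip _ _ _); rewrite upd_id.
  case: eqP => hb; first by apply: exec_eq (exec_mvR _ _ _); rewrite Hbv hb.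
  by apply: exec_eq (exec_skip _ _ _); rewrite upd_id // Hbv; lia.
have kE : minn k (size u) = k by lia.
have ok : otape w (h 0 + k) = Some (nth false u k).
  by rewrite /otape (nth_map false) ?nth_drop //; lia.
have tk : (S k).1 t = otape (take k u) by rewrite /S /= upd_same.
have ES : setm (S k.+1) vs ds =
   (upd (S k).1 t (upd ((S k).1 t) ((setm (S k) vs ds).2 t) (Some (nth false u k))),
    upd (upd (setm (S k) vs ds).2 t ((setm (S k) vs ds).2 t).+1) 0 ((setm (S k) vs ds).2 0).+1).
  have stk : size (take k u) = k by rewrite size_takel // ltnW.
  have ot : upd (otape (take k u)) k (Some (nth false u k)) = otape (take k.+1 u).
    by have := otape_rcons (take k u) (nth false u k); rewrite stk -take_nth.
  rewrite (Sh t tvs) (Sh 0 zvs) E0 Et kE tk ot.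
  rewrite /setm !setv_upd //= upd_upd; congr (_, setv _ _ _).
  have [n1 n2] : (size u < k.+1) = false /\ (size u < k) = false by lia.
  have bt : bad != t by rewrite eq_sym.
  apply: funext => i; have [->|ib] := eqVneq i bad.
    by rewrite upd_same (upd_neq _ _ bad0) (upd_neq _ _ bt) upd_same n1 n2.
  rewrite (upd_neq _ _ ib); have [->|i0] := eqVneq i 0; first by rewrite !upd_same; lia.
  rewrite !(upd_neq _ _ i0); have [->|it] := eqVneq i t; first by rewrite !upd_same; lia.
  by rewrite !(upd_neq _ _ it) (upd_neq _ _ ib) !(upd_neq _ _ i0) !(upd_neq _ _ it).
have bitc b : nth false u k = b -> exec (copy_bit t b) (setm (S k) vs ds) (setm (S k.+1) vs ds).
  move=> eb; rewrite ES eb; have := @exec_copy_bit (S k).1 (setm (S k) vs ds).2 t b t0.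
  rewrite (Sh t tvs) (Sh 0 zvs) Et E0 tk kE; apply; try lia.
  by move=> _; rewrite /otape nth_default // size_map size_take; case: ltnP; lia.
apply: exec_if; rewrite Hs kE ok.
case eb : (nth false u k); first exact: bitc.
by apply: exec_if; rewrite Hs kE ok eb; apply: bitc.
Qed.

End Forn.

Lemma setv_ext h1 h2 vs ds i : h1 i = h2 i -> setv h1 vs ds i = setv h2 vs ds i.
Proof.
elim: vs ds h1 h2 => [|v vs IH] [|d ds] h1 h2 //= E; apply: IH.
by rewrite /upd; case: eqP.
Qed.

Lemma iotaM_map (A : Type) (f : nat -> A) a b :
  [seq f j | j <- iota 0 (a * b)] = flatten [seq [seq f (x * b + y) | y <- iota 0 b] | x <- iota 0 a].
Proof. by rewrite iotaM map_allpairs. Qed.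

Lemma minn_split x y s : minn x s + minn y (s - x) = minn (x + y) s.
Proof. by lia. Qed.

Lemma if_split x y s (e : nat) :
  (if s - x < y then 1 else if s < x then 1 else e) = if s < x + y then 1 else e.
Proof. by case: (ltnP s x) => h; case: (ltnP (s - x) y) => h'; case: ltnP => //; lia. Qed.

Lemma nseq_iota (A : Type) (x : A) m k : [seq x | _ <- iota m k] = nseq k x.
Proof. by elim: k m => //= k IH m; rewrite IH. Qed.

Section Prelude.
Variables (ars : seq nat) (V CN K D : nat) (px : bool) (body : prog).
Notation nb := (size ars).

(** Loop counters of the preparation live after the [V] variables and keep tapes of length [n],
    whereas the tapes in [ntapes] are extended to [n ^ K]. *)
Definition ctrs a := [seq vart nb (V + i) | i <- iota 0 a].
Definition ntapes := [:: sz, zr & [seq vart nb i | i <- iota 0 V]].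
Definition alltapes := ntapes ++ ctrs CN.

Definition is_small v := CSym v (Some true).

Fixpoint copyblocks (b : nat) (l : seq nat) : prog :=
  if l is a :: l' then
    Seq (Seq (forn is_small (ctrs a) (copy_body (blkt b))) (clr (blkt b))) (copyblocks b.+1 l')
  else Skip.

Definition extend1 t := Seq (If (CSym t None) (Wr t false) Skip) (Mv t true).

(** [K] nested loops up to [n] make [n ^ K] rounds. Each advances the tapes by one cell and writes
    [false] where the unary prefix has ended, so that they measure both [n] and [n ^ K]. *)
Definition extend :=
  Seq (forn is_small (ctrs K) (seqs [seq extend1 t | t <- ntapes])) (seqs [seq clr t | t <- ntapes]).

(** The loop runs through all addresses of the word; their second digit, on tape [vart nb 1], is 0
    exactly at the existential bits. [px] asks for an initial word of zeros on [Xt], which the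
    exhaustive search then overwrites. *)
Definition quant_body :=
  Seq (If (CZero (vart nb 1)) (Wr Qt false) (Wr Qt true))
 (Seq (Mv Qt true) (if px then Seq (Wr Xt false) (Mv Xt true) else Skip)).

Definition init_quants :=
  Seq (forn (fun v => CNot (CSym v None)) [seq vart nb i | i <- iota 0 D.+3] quant_body)
      (Seq (clr Qt) (clr Xt)).

(** A failed test leads to [Skip] with [res] at 0, which rejects: the unary prefix must be closed by
    a 0, [n] must be at least 2, and the tables must use up the input exactly. *)
Definition prelude :=
  Seq (ones alltapes)
  (If (CSym 0 (Some false))
    (Seq (Seq (Mv 0 true) (seqs [seq clr t | t <- alltapes]))
    (Seq (Mv sz true)
    (If (CSym sz (Some true))
      (Seq (Mv sz false)
      (Seq (copyblocks 0 ars)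
      (If (CAnd (CZero bad) (CSym 0 None))
        (Seq (clr 0) (Seq extend (Seq init_quants body))) Skip))) Skip))) Skip).

Variables (mono : bool) (B : nat).
Notation exec := (exec mono B).

(** Unlike [exec], this records how far control has come into a nest of conditionals; the program
    still to be run stays explicit. *)
Definition leads p s q s' := forall r, reaches (dstep mono B) (p :: r, s) (q :: r, s').

Lemma leads_seq p q s s' : exec p s s' -> leads (Seq p q) s q s'.
Proof.
move=> H r; apply: (@reaches_trans _ _ _ (p :: q :: r, s)); last exact: H.
by apply: reaches1; split=> //; apply: allowed_refl.
Qed.

Lemma leads_if c p q s : leads (If c p q) s (if holds c s then p else q) s.
Proof. by move=> r; apply: reaches1; split=> //; apply: allowed_refl. Qed.

Lemma leads_trans p s q s' t s'' : leads p s q s' -> leads q s' t s'' -> leads p s t s''.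
Proof. by move=> H1 H2 r; apply: reaches_trans (H1 r) (H2 r). Qed.

Lemma leads_exec p s q s' s'' : leads p s q s' -> exec q s' s'' -> exec p s s''.
Proof. by move=> H1 H2 r; apply: reaches_trans (H1 r) (H2 r). Qed.

Lemma ctr_notin a i : i < vart nb 0 -> i \notin ctrs a.
Proof. by move=> iv; apply/negP => /mapP[j _ E]; move: iv; rewrite E /vart; lia. Qed.

Lemma uniq_ctrs a : uniq (ctrs a).
Proof. by rewrite map_inj_uniq ?iota_uniq // => i j; rewrite /vart; lia. Qed.

Lemma size_ctrs a : size (ctrs a) = a.
Proof. by rewrite size_map size_iota. Qed.

Lemma mem_ctrs a v : v \in ctrs a -> a <= CN -> exists2 i, i < CN & v = vart nb (V + i).
Proof. by move=> /mapP[i]; rewrite mem_iota => ia -> aC; exists i => //; lia. Qed.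

Lemma exec_copyblocks n w l b c h (sh := [seq n ^ a | a <- l]) (u := drop (h 0) w) :
  n < B -> 1 < B -> (size w).+1 < B -> all (fun a => a <= CN) l -> b + size l <= nb ->
  h 0 <= size w -> h bad <= 1 -> (forall i, i != 0 -> i != bad -> h i = 0) ->
  (forall i, i < size l -> c (blkt (b + i)) = otape [::]) -> c 0 = otape w ->
  (forall i, i < CN -> c (vart nb (V + i)) = prefix_tape (Some true) n) ->
  exec (copyblocks b l) (c, h)
    (fun i => if (blkt b <= i) && (i < blkt (b + size l))
              then otape (nth [::] (reshape sh u) (i - blkt b)) else c i,
     upd (upd h 0 (h 0 + minn (sumn sh) (size u))) bad
         (if size u < sumn sh then 1 else h bad)).
Proof.
move=> nB B1 wB; rewrite {}/sh {}/u; elim: l b c h => [|a l IH] b c h /=.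
  move=> _ _ h0 hb hz _ _ _; apply: exec_eq (exec_skip _ _ _).
  congr pair; first by apply: funext => i; rewrite addn0; case: ifP => //; rewrite /blkt; lia.
  by rewrite min0n addn0 !upd_id.
move=> /andP[aC lC] bnb h0 hb hz hc c0 hct.
have bv : blkt b < vart nb 0 by rewrite /blkt /vart; lia.
have zv : 0 < vart nb 0 by rewrite /vart.
have badv : bad < vart nb 0 by rewrite /vart.
have B0 : blkt b != 0 by [].
have Bb : blkt b != bad by [].
apply: exec_seq (@exec_copy_block mono B is_small (ctrs a) n w c h (blkt b) nB B1 (uniq_ctrs a) wB h0 B0 Bb _ _ _ _ _ hb _ c0 _) _;
  rewrite ?ctr_notin //.
- apply/allP => v /mem_ctrs /(_ aC) [i iC ->].
  by rewrite hz // /vart /bad; lia.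
- exact: hz.
- by have := hc 0 isT; rewrite addn0.
- move=> v c' h' /mem_ctrs /(_ aC) [i iC ->] hv cc /=.
  rewrite cc; last by rewrite /blkt /vart; lia.
  by rewrite hct // /prefix_tape; case: ltnP.
rewrite size_ctrs; set u := drop (h 0) w; set q := minn _ _.
set c1 := upd c _ _; set h1 := upd (upd h 0 _) _ _.
have h10 : h1 0 = h 0 + q by rewrite /h1 upd_neq // upd_same.
have h1b : h1 bad = if size u < n ^ a then 1 else h bad by rewrite /h1 upd_same.
have su : size u = size w - h 0 by rewrite size_drop.
have Eu : drop (h1 0) w = drop (n ^ a) u.
  rewrite h10 /u drop_drop addnC /q; case: (leqP (n ^ a) (size u)) => le.
    by [].
  by rewrite !drop_oversize //; lia.
apply: exec_eq (IH b.+1 c1 h1 _ _ _ _ _ _ _ _) => //.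
- rewrite Eu h10 h1b size_drop; congr pair; apply: funext => i.
    rewrite /c1 /upd; case: (i =P blkt b) => [->|ib].
      by rewrite ltnn leqnn /= ifT ?subnn //; rewrite /blkt; lia.
    have -> : (blkt b.+1 <= i) = (blkt b <= i) by rewrite /blkt in ib *; lia.
    rewrite addSnnS; case: ifP => // /andP[bi _].
    by rewrite (_ : i - blkt b = (i - blkt b.+1).+1) //; rewrite /blkt in ib bi *; lia.
  have [->|ib] := eqVneq i bad.
    by rewrite !upd_same if_split.
  rewrite !(upd_neq _ _ ib); have [->|i0] := eqVneq i 0; first by rewrite !upd_same -addnA minn_split.
  by rewrite !(upd_neq _ _ i0) /h1 (upd_neq _ _ ib) (upd_neq _ _ i0).
- by lia.
- by rewrite h10 /q; lia.
- by rewrite h1b; case: ifP.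
- by move=> i i0 ib; rewrite /h1 !upd_neq //; apply: hz.
- move=> i il; rewrite /c1 upd_neq; last by rewrite /blkt; lia.
  by rewrite addSnnS; apply: hc.
by move=> i iC; rewrite /c1 upd_neq; [apply: hct|rewrite /blkt /vart; lia].
Qed.

Definition ext_tape (n k : nat) : nat -> option bool :=
  fun p => if p < n then Some true else if p < k then Some false else None.

Lemma ntapes_ctr v : v \in ntapes -> v \notin ctrs K.
Proof.
rewrite !inE => /or3P[/eqP ->|/eqP ->|/mapP[i + ->]]; try exact: ctr_notin.
rewrite mem_iota => iV; apply/negP => /mapP[j _]; rewrite /vart; lia.
Qed.

Lemma uniq_ntapes : uniq ntapes.
Proof.
rewrite /ntapes /= !inE /= map_inj_uniq ?iota_uniq; last by move=> i j; rewrite /vart; lia.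
by rewrite andbT; apply/andP; split; apply/mapP => -[i _]; rewrite /vart /sz /zr; lia.
Qed.

Lemma exec_extend n c h : K <= CN -> 0 < K -> 1 < n -> n ^ K < B ->
  (forall t, t \in ntapes -> c t = prefix_tape (Some true) n) ->
  (forall i, i < CN -> c (vart nb (V + i)) = prefix_tape (Some true) n) ->
  (forall i, h i = 0) ->
  exec extend (c, h) (fun i => if i \in ntapes then ext_tape n (n ^ K) else c i, h).
Proof.
move=> KCN K0 n1 NB cn cc h0; set N := n ^ K in NB *.
have nN : n <= N by rewrite /N -{1}[n]expn1 leq_pexp2l // ltnW.
pose S k : memory := (fun i => if i \in ntapes then ext_tape n k else c i,
                      fun i => if i \in ntapes then k else h i).
apply: exec_seq (_ : exec _ _ (S N)) _; last first.
  apply: exec_eq (exec_clrs _ _ _ _ uniq_ntapes).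
  by congr pair; apply: funext => i /=; case: ifP => // ->.
have -> : (c, h) = S 0.
  by congr pair; apply: funext => i; case: ifP => // /cn ->.
have EN : N = n ^ size (ctrs K) by rewrite size_ctrs.
rewrite EN; apply: exec_forn => //; rewrite ?uniq_ctrs -?EN //.
- exact: leq_ltn_trans NB.
- move=> k _; apply/allP => v vc /=; rewrite h0; case: ifP => // /ntapes_ctr; by rewrite vc.
- move=> v k h' vc _ hv /=; rewrite ifN; last by apply: contraTN vc; apply: ntapes_ctr.
  have [i iC ->] := mem_ctrs vc KCN.
  by rewrite cc // /prefix_tape; case: ltnP.
move=> k kN; set ds := digits _ _ _.
have := @exec_each mono B extend1
  (fun _ p => ext_tape n p.+1) (fun _ p => p.+1)
  (fun tp p => tp = ext_tape n k /\ p = k) ntapes (S k).1 (setm (S k) (ctrs K) ds).2 uniq_ntapes.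
have Sh i : i \in ntapes -> (setm (S k) (ctrs K) ds).2 i = k.
  by move=> it; rewrite /= setv_out ?ntapes_ctr //= it.
move=> H; apply: exec_eq (H _ _).
- congr pair; apply: funext => i.
    by case: ifP => it; rewrite ?Sh //= it.
  case: ifP => it.
    by rewrite Sh // /= setv_out ?ntapes_ctr //= it.
  by rewrite /=; apply: setv_ext; rewrite /= it.
- move=> t c' h' tt [E1 E2].
  apply: exec_seq (_ : exec _ _ (upd c' t (ext_tape n k.+1), h')) _.
    apply: exec_if; rewrite /= E1 E2 /ext_tape ltnn.
    case: (ltnP k n) => kn.
      apply: exec_eq (exec_skip _ _ _); rewrite upd_id // E1; apply: funext => p.
      by rewrite /ext_tape; case: ltnP => // np; rewrite !ifF //; lia.
    rewrite eqxx; apply: exec_eq (exec_wr _ _ _); last first.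
      by move=> _; rewrite E1 E2 /ext_tape ltnn ifF //; lia.
    rewrite /write /=; congr (upd c' t _, _); apply: funext => p; rewrite E1 E2 /upd.
    case: eqP => [->|pk]; rewrite /ext_tape; first by rewrite ltnNge kn /= ltnSn.
    by rewrite (_ : (p < k.+1) = (p < k)) //; lia.
  apply: exec_eq (exec_mvR _ _ _); rewrite E2 //; lia.
by move=> t tt; rewrite Sh //= tt.
Qed.

Definition quants_upto N k := [seq nth 0 (digits N D.+3 j) 1 != 0 | j <- iota 0 k].

(** Within a level the second digit is the quotient by [N ^ D.+1], which vanishes exactly on the
    first [mainlen] addresses. *)
Lemma quants_uptoE N : 1 < N -> quants_upto N (N ^ D.+3) = flatten (nseq N (quants N D)).
Proof.
move=> N1; have N0 := ltnW N1; rewrite /quants_upto expnS iotaM_map; congr flatten.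
rewrite -[RHS](nseq_iota _ 0); apply/eq_in_map => x; rewrite mem_iota add0n => /= xN.
have E y : y < N ^ D.+2 -> (nth 0 (digits N D.+3 (x * N ^ D.+2 + y)) 1 != 0) = (mainlen N D <= y).
  move=> yN; rewrite /= modnMDl modn_small // -lt0n divn_gt0 // expn_gt0 N0 //.
have -> : [seq nth 0 (digits N D.+3 (x * N ^ D.+2 + y)) 1 != 0 | y <- iota 0 (N ^ D.+2)] =
    [seq mainlen N D <= y | y <- iota 0 (N ^ D.+2)].
  by apply/eq_in_map => y; rewrite mem_iota add0n => /= yN; apply: E.
rewrite -(@block_len N D N1) iotaD map_cat add0n /quants; congr cat.
  rewrite -(nseq_iota _ 0); apply/eq_in_map => y; rewrite mem_iota add0n => /= yN.
  by rewrite leqNgt yN.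
by rewrite -(nseq_iota _ (mainlen N D)); apply/eq_in_map => y; rewrite mem_iota => /andP[-> _].
Qed.

Lemma quants_rcons N k : quants_upto N k.+1 = rcons (quants_upto N k) (nth 0 (digits N D.+3 k) 1 != 0).
Proof. by rewrite /quants_upto -[k.+1]addn1 iotaD map_cat cats1. Qed.

Lemma size_quants_upto N k : size (quants_upto N k) = k.
Proof. by rewrite size_map size_iota. Qed.

Lemma nth_setv h vs ds i v0 : uniq vs -> size vs = size ds -> i < size vs ->
  setv h vs ds (nth v0 vs i) = nth 0 ds i.
Proof.
elim: vs ds h i => [|v vs IH] [|d ds] h [|i] //= /andP[vvs uvs] [sd].
  by rewrite setv_out // upd_same.
by rewrite ltnS => il; apply: IH.
Qed.

Lemma exec_init_quants n N c h : D.+3 <= V -> 1 < n -> n <= N -> N ^ D.+3 < B ->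
  (forall i, i < V -> c (vart nb i) = ext_tape n N) -> c Qt = otape [::] -> c Xt = otape [::] ->
  (forall i, h i = 0) ->
  exec init_quants (c, h)
   (upd (upd c Qt (otape (flatten (nseq N (quants N D))))) Xt
        (otape (if px then nseq (N ^ D.+3) false else [::])), h).
Proof.
move=> DV n1 nN NB cv cQ cX h0; have N1 := leq_trans n1 nN.
set vs := [seq vart nb i | i <- iota 0 D.+3].
have svs : size vs = D.+3 by rewrite size_map size_iota.
have uvs : uniq vs by rewrite map_inj_uniq ?iota_uniq // => i j; rewrite /vart; lia.
have lowvs i : i < vart nb 0 -> i \notin vs.
  by move=> iv; apply/negP => /mapP[j _ E]; move: iv; rewrite E /vart; lia.
have Qvs : Qt \notin vs by apply: lowvs; rewrite /vart /Qt; lia.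
have Xvs : Xt \notin vs by apply: lowvs; rewrite /vart /Xt; lia.
pose S k : memory := (upd (upd c Qt (otape (quants_upto N k))) Xt (otape (if px then nseq k false else [::])),
  upd (upd h Qt k) Xt (if px then k else 0)).
have QX : Qt != Xt by []. have XQ : Xt != Qt by [].
apply: exec_seq (_ : exec _ _ (S (N ^ D.+3))) _; last first.
  rewrite /S quants_uptoE //; apply: exec_seq (exec_clr _ _ _ _ _) _.
  apply: exec_eq (exec_clr _ _ _ _ _); congr pair.
  by apply: funext => i; rewrite /upd; case: (i =P Xt); case: (i =P Qt); rewrite ?h0.
have -> : (c, h) = S 0.
  rewrite /S /quants_upto /=; congr pair.
    by rewrite upd_id ?upd_id //; rewrite ?upd_neq ?cX; case: px.
  by rewrite upd_id ?upd_id // ?upd_neq ?h0; case: px.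
rewrite -[in X in exec _ _ X]svs; apply: exec_forn => //; rewrite ?svs.
- by apply: leq_ltn_trans NB; rewrite -{1}[N]expn1 leq_pexp2l // ltnW.
- move=> k _; apply/allP => v vin /=; rewrite !upd_neq ?h0 //.
    by apply: contraNneq Qvs => <-.
  by apply: contraNneq Xvs => <-.
- move=> v k h' /mapP[i + ->] _ hv; rewrite mem_iota add0n => /= iD.
  rewrite !upd_neq ?cv; try (rewrite /vart /Qt /Xt; lia).
  rewrite /ext_tape; case: (ltnP (h' (vart nb i)) n) => hn; last by case: ltnP.
  by rewrite (leq_trans hn nN).
move=> k kN; set ds := digits _ _ _.
have sds : size ds = D.+3 by apply: size_digits.
have Sh i : i \notin vs -> (setm (S k) vs ds).2 i = (S k).2 i by apply: setv_out.
have g1 : (setm (S k) vs ds).2 (vart nb 1) = nth 0 ds 1.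
  have -> : vart nb 1 = nth 0 vs 1 by rewrite (nth_map 0) ?size_iota // nth_iota.
  by apply: (@nth_setv (S k).2 vs ds 1 0 uvs (etrans svs (esym sds))); rewrite svs.
have hQ : (setm (S k) vs ds).2 Qt = k by rewrite Sh // /S /= upd_neq // upd_same.
have hX : (setm (S k) vs ds).2 Xt = if px then k else 0 by rewrite Sh // /S /= upd_same.
have cQk : (setm (S k) vs ds).1 Qt = otape (quants_upto N k) by rewrite /S /= upd_neq // upd_same.
have cXk : (setm (S k) vs ds).1 Xt = otape (if px then nseq k false else [::]) by rewrite /S /= upd_same.
set s1 : memory := (upd (setm (S k) vs ds).1 Qt (otape (quants_upto N k.+1)), (setm (S k) vs ds).2).
have E : setm (S k.+1) vs ds = (upd s1.1 Xt (otape (if px then nseq k.+1 false else [::])),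
    upd (upd s1.2 Qt k.+1) Xt (if px then k.+1 else 0)).
  rewrite /s1 /setm /S !setv_upd //; congr (_, setv _ _ _).
    by apply: funext => i; rewrite /upd /=; case: (i =P Xt); case: (i =P Qt).
  by apply: funext => i; rewrite /upd /=; case: (i =P Xt); case: (i =P Qt).
rewrite -/vs; move: g1 hQ hX cQk cXk @s1 E {Sh}; case: (setm (S k) vs ds) => c1 h1.
rewrite ![_.1]/= ![_.2]/= => g1 hQ hX cQk cXk s1 ->.
apply: exec_seq (_ : exec _ _ s1) _.
  have wrq q : nth 0 ds 1 != 0 = q -> exec (Wr Qt q) (c1, h1) s1.
    move=> qE; apply: exec_eq (exec_wr _ _ _).
      rewrite /write /s1 [_.1]/= [_.2]/= hQ cQk quants_rcons -otape_rcons size_quants_upto.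
      by rewrite qE.
    by rewrite hQ cQk => _; rewrite /otape nth_default // size_map size_quants_upto.
  apply: exec_if; rewrite /holds [_.2]/= g1; case: eqP => g0; apply: wrq; rewrite ?g0 //.
  by apply/eqP.
apply: exec_seq (exec_mvR _ _ _) _; first by rewrite hQ; lia.
rewrite /s1 [_.1]/= [_.2]/= hQ; case: (px) hX cXk => hX cXk; last first.
  apply: exec_eq (exec_skip _ _ _); congr pair.
    by rewrite [RHS]upd_id // upd_neq.
  by rewrite [RHS]upd_id // upd_neq.
have hX' : upd h1 Qt k.+1 Xt = k by rewrite upd_neq.
apply: exec_seq (exec_wr _ _ _) _.
  by move=> _; rewrite hX' upd_neq // cXk /otape nth_default // size_map size_nseq.
apply: exec_eq (exec_mvR _ _ _); rewrite [_.2]/= hX'; last by lia.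
congr pair; rewrite [_.1]/= [upd _ _ _ Xt]upd_neq // cXk.
have -> : nseq k.+1 false = rcons (nseq k false) false by elim: (k) => //= i ->.
by rewrite -otape_rcons size_nseq.
Qed.

End Prelude.

(** * Correctness of the preparation *)

Section PreludeSpec.
Variables (ars : seq nat) (V CN K D : nat) (px : bool) (body : prog).
Notation nb := (size ars).
Notation alltapes := (alltapes ars V CN).
Notation ntapes := (ntapes ars V).
Notation prelude := (prelude ars V CN K D px body).

Definition blens n := [seq n ^ a | a <- ars].

(** Only lengths are prescribed here; that the table of a constant marks a single element is left to
    the formula [FWF]. *)
Definition wellformed w n u := [/\ w = nseq n true ++ false :: u, 1 < n & size u = sumn (blens n)].

Variables (mono : bool) (B : nat).
Notation exec := (exec mono B).
Notation leads := (leads mono B).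

Lemma low9 i : i < 9 -> i < vart nb 0.
Proof. by rewrite /vart; lia. Qed.

Lemma alltapesE i : i \in alltapes -> [\/ i = sz, i = zr | exists j, i = vart nb j].
Proof.
rewrite !inE mem_cat => /or3P[/eqP|/eqP|/orP[/mapP[j _ ->]|/mapP[j _ ->]]].
- by constructor 1.
- by constructor 2.
- by constructor 3; exists j.
- by constructor 3; exists (V + j).
Qed.

Lemma uniq_alltapes : uniq alltapes.
Proof.
rewrite cat_uniq uniq_ntapes uniq_ctrs andbT /=; apply/hasPn => v vc /=.
apply/negP; rewrite !inE => /or3P[/eqP E|/eqP E|/mapP[i + E]].
- by have := @ctr_notin ars V CN sz (@low9 sz isT); rewrite -E vc.
- by have := @ctr_notin ars V CN zr (@low9 zr isT); rewrite -E vc.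
by rewrite mem_iota => iV; case/mapP: vc => j _; rewrite E /vart; lia.
Qed.

Lemma otape_prefix n r : otape (nseq n true ++ r) n = otape r 0.
Proof. by rewrite /otape map_cat nth_cat size_map size_nseq ltnn subnn. Qed.

Lemma split_ones w : exists n r, w = nseq n true ++ r /\ head false r = false.
Proof.
elim: w => [|[] w [n [r [-> hr]]]]; first by exists 0, [::].
  by exists n.+1, r.
by exists 0, (false :: nseq n true ++ r).
Qed.

Lemma notin_all i : i != sz -> i != zr -> i < vart nb 0 -> i \notin alltapes.
Proof.
move=> /eqP isz /eqP izr iv; apply/negP => /alltapesE [//|//|[j E]].
by move: iv; rewrite E /vart; lia.
Qed.

Definition c_ones w n : nat -> nat -> option bool :=
  fun i => if i \in alltapes then prefix_tape (Some true) n else (mem0 w).1 i.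

Lemma exec_ones_mem0 w n r : w = nseq n true ++ r -> head false r = false -> (size w).+2 < B ->
  exec (ones alltapes) (mem0 w) (c_ones w n, fun i => if (i == 0) || (i \in alltapes) then n else 0).
Proof.
move=> Ew hr wB; apply: (exec_ones mono uniq_alltapes) Ew hr _ _ _ => //.
- by apply: notin_all.
- exact: ltnW.
- move=> t ta /=; case: (t =P 0) ta => // ->; have : 0 \notin alltapes by apply: notin_all.
  by move=> /negbTE ->.
Qed.

Lemma c_ones0 w n : c_ones w n 0 = otape w.
Proof. by rewrite /c_ones ifN //; apply: notin_all. Qed.

Definition part1 := Seq (Mv 0 true) (seqs [seq clr t | t <- alltapes]).

Lemma exec_part1 c n : n.+1 < B ->
  exec part1 (c, fun i => if (i == 0) || (i \in alltapes) then n else 0) (c, upd (fun=> 0) 0 n.+1).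
Proof.
move=> nB; apply: exec_seq (exec_mvR _ _ _) _ => //.
apply: exec_eq (exec_clrs _ _ _ _ uniq_alltapes); congr pair; apply: funext => i.
have n0 : 0 \notin alltapes by apply: notin_all.
rewrite /upd; case: (i =P 0) => [->|_]; first by rewrite (negbTE n0).
by case: (i \in alltapes).
Qed.

Lemma c_ones_blk w n i : i < nb -> c_ones w n (blkt i) = otape [::].
Proof.
move=> ib; rewrite /c_ones ifN /=; first by apply: funext => p; rewrite /otape nth_nil.
by apply: notin_all; rewrite /blkt /sz /zr /vart; lia.
Qed.

Lemma c_ones_ctr w n i : i < CN -> c_ones w n (vart nb (V + i)) = prefix_tape (Some true) n.
Proof.
move=> iC; rewrite /c_ones ifT // mem_cat orbC; apply/orP; left.
by apply/mapP; exists i => //; rewrite mem_iota.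
Qed.

Lemma c_ones_nt w n t : t \in ntapes -> c_ones w n t = prefix_tape (Some true) n.
Proof. by move=> tn; rewrite /c_ones mem_cat tn. Qed.

Hypotheses (arsCN : all (fun a => a <= CN) ars) (KCN : K <= CN) (K0 : 0 < K) (DV : D.+3 <= V).

Lemma parse_leads w n u : w = nseq n true ++ false :: u -> 1 < n -> (size w).+2 < B ->
  exists c h, [/\ leads prelude (mem0 w)
      (If (CAnd (CZero bad) (CSym 0 None))
        (Seq (clr 0) (Seq (extend ars V K) (Seq (init_quants ars D px) body))) Skip) (c, h),
    forall i, i != 0 -> i != bad -> h i = 0,
    holds (CAnd (CZero bad) (CSym 0 None)) (c, h) = (size u == sumn (blens n)),
    forall b, b < nb -> c (blkt b) = otape (nth [::] (reshape (blens n) u) b) &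
    forall t, t < blkt 0 \/ blkt nb <= t -> c t = c_ones w n t].
Proof.
move=> Ew n1 wB; have nw : n < size w by rewrite Ew size_cat size_nseq /=; lia.
have Ed : drop n.+1 w = u by rewrite Ew -cat_rcons drop_size_cat // size_rcons size_nseq.
pose h1 := upd (fun=> 0 : nat) 0 n.+1.
have h10 : h1 0 = n.+1 by rewrite /h1 upd_same.
have nB : n < B by lia. have B1 : 1 < B by lia.
have := @exec_copyblocks ars V CN mono B n w ars 0 (c_ones w n) h1 nB B1 (ltnW wB) arsCN (leqnn _).
rewrite h10 Ed -/(blens n) => H.
have {}H := H nw isT _ (fun i ib => c_ones_blk w n ib) (c_ones0 w n) (fun i iC => c_ones_ctr w n iC).
eexists; eexists; split.
- apply: leads_trans (leads_seq _ (exec_ones_mem0 Ew erefl wB)) _.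
  apply: leads_trans (leads_if _ _ _ _ _ _) _.
  rewrite [holds _ _]/= c_ones0 {1}Ew otape_prefix eqxx.
  apply: leads_trans (leads_seq _ (exec_part1 _ _)) _; first by lia.
  rewrite -/h1; have s0 : h1 sz = 0 by [].
  apply: leads_trans (leads_seq _ (exec_mvR _ _ _)) _; first by rewrite s0; lia.
  apply: leads_trans (leads_if _ _ _ _ _ _) _.
  rewrite [holds _ _]/= upd_same s0 c_ones_nt // /prefix_tape n1 eqxx.
  apply: leads_trans (leads_seq _ (exec_mvL _ _ _ _ _)) _.
  rewrite upd_same upd_upd [upd _ sz _]upd_id //.
  by apply: leads_seq; apply: H => i i0 _; rewrite /h1 upd_neq.
- by move=> i i0 ib; rewrite /h1 !upd_neq.
- rewrite /= upd_same upd_neq // upd_same c_ones0.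
  set m := sumn _; set k := size u.
  have wk : size w = n.+1 + k by rewrite Ew size_cat size_nseq /= -/k; lia.
  case: (ltnP k m) => km; first by rewrite andFb; apply/esym/negbTE; lia.
  rewrite /h1 [upd _ 0 _ bad]upd_neq // eqxx andTb.
  have [e|ne] := eqVneq k m.
    by rewrite -e /otape nth_default ?eqxx // size_map wk.
  rewrite /otape (nth_map false) //; lia.
- move=> b bb /=; rewrite ifT; last by rewrite /blkt; lia.
  by congr (otape (nth _ _ _)); rewrite /blkt; lia.
by move=> t tb /=; rewrite ifF //; apply/negbTE; rewrite /blkt in tb *; lia.
Qed.

Lemma prelude_valid w n u : wellformed w n u -> (size w).+2 < B -> (n ^ K) ^ D.+3 < B ->
  exists c, [/\ leads prelude (mem0 w) body (c, fun=> 0),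
    forall b, b < nb -> c (blkt b) = otape (nth [::] (reshape (blens n) u) b),
    forall t, t \in ntapes -> c t = ext_tape n (n ^ K),
    c Qt = otape (flatten (nseq (n ^ K) (quants (n ^ K) D))) &
    c Xt = otape (if px then nseq ((n ^ K) ^ D.+3) false else [::])].
Proof.
move=> [Ew n1 su] wB NB; have [c [h [L hz E cb co]]] := parse_leads Ew n1 wB.
set N := n ^ K in NB *.
have N1 : 1 < N by rewrite /N -{1}[1](exp1n K) ltn_exp2r.
have NN : N < B by apply: leq_ltn_trans NB; rewrite -{1}[N]expn1 leq_pexp2l // ltnW.
have nN : n <= N by rewrite /N -{1}[n]expn1 leq_pexp2l // ltnW.
have hb : h bad = 0.
  by move: E; rewrite su eqxx /= => /andP[/eqP].
have h00 : upd h 0 0 = fun=> 0.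
  apply: funext => i; rewrite /upd; case: (i =P 0) => // /eqP i0.
  by have [->|ib] := eqVneq i bad; [exact: hb|apply: hz].
have nt t : t \in ntapes -> t < blkt 0 \/ blkt nb <= t.
  rewrite !inE => /or3P[/eqP ->|/eqP ->|/mapP[i _ ->]]; [by left|by left|right].
  by rewrite /vart /blkt; lia.
have X := @exec_extend ars V CN K mono B n c (fun=> 0) KCN K0 n1 NN.
have {}X := X (fun t tt => etrans (co t (nt t tt)) (c_ones_nt w n tt)).
have ctr_far i : vart nb (V + i) < blkt 0 \/ blkt nb <= vart nb (V + i).
  by right; rewrite /vart /blkt; lia.
have {}X := X (fun i iC => etrans (co _ (ctr_far i)) (c_ones_ctr w n iC)) (fun=> erefl).
set c2 : nat -> nat -> option bool := (fun i => if i \in ntapes then _ else _) in X.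
have c2o i : i \notin ntapes -> c2 i = c i by rewrite /c2 => /negbTE ->.
have notnt i : i != sz -> i != zr -> i < vart nb 0 -> i \notin ntapes.
  by move=> h1 h2 h3; have := notin_all h1 h2 h3; rewrite mem_cat negb_or => /andP[].
have emp i : i != 0 -> i != sz -> i != zr -> i < blkt 0 -> c2 i = otape [::].
  move=> i0 isz izr i9; have iv : i < vart nb 0 by apply: low9.
  rewrite c2o ?notnt // co; last by left.
  rewrite /c_ones ifN ?notin_all //= (negbTE i0); apply: funext => p.
  by rewrite /otape nth_nil.
have := @exec_init_quants ars V D px mono B n N c2 (fun=> 0) DV n1 nN NB _
  (emp Qt isT isT isT isT) (emp Xt isT isT isT isT) (fun=> erefl).
move=> Y; eexists; split.
- apply: leads_trans L _.
  apply: leads_trans (leads_if _ _ _ _ _ _) _; rewrite E su eqxx.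
  apply: leads_trans (leads_seq _ (exec_clr _ _ _ _ _)) _; rewrite h00.
  apply: leads_trans (leads_seq _ X) _.
  apply: leads_seq; apply: Y => i iV; rewrite /c2 ifT // !inE; apply/or3P; constructor 3.
  by apply/mapP; exists i; rewrite ?mem_iota.
- move=> b bb; rewrite !upd_neq; try by rewrite /blkt /Qt /Xt; lia.
  by rewrite c2o ?cb // notnt // /blkt /sz /zr /vart; lia.
- move=> t tt; have [tX tQ] : t != Xt /\ t != Qt.
    by split; apply: contraTneq tt => ->; apply: notnt => //; apply: low9.
  by rewrite (upd_neq _ _ tX) (upd_neq _ _ tQ) /c2 tt.
- by rewrite upd_neq // upd_same.
by rewrite upd_same.
Qed.

Lemma prelude_invalid w : (forall n u, ~ wellformed w n u) -> (size w).+2 < B ->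
  exists s, exec prelude (mem0 w) s /\ s.2 res = 0.
Proof.
move=> nwf wB; have [n [r [Ew hr]]] := split_ones w.
have rn : res \notin alltapes by apply: notin_all => //; apply: low9.
have L1 := leads_seq (If (CSym 0 (Some false))
    (Seq part1 (Seq (Mv sz true) (If (CSym sz (Some true)) (Seq (Mv sz false)
      (Seq (copyblocks ars V 0 ars) (If (CAnd (CZero bad) (CSym 0 None))
        (Seq (clr 0) (Seq (extend ars V K) (Seq (init_quants ars D px) body))) Skip))) Skip))) Skip)
    (exec_ones_mem0 Ew hr wB).
case: r Ew hr L1 => [|[] u] // Ew hr L1.
  exists (c_ones w n, fun i => if (i == 0) || (i \in alltapes) then n else 0).
  split; last by rewrite /= (negbTE rn).
  apply: leads_exec L1 _; apply: exec_if.
  by rewrite [holds _ _]/= c_ones0 {1}Ew otape_prefix /=; apply: exec_skip.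
have nw : n < size w by rewrite Ew size_cat size_nseq /=; lia.
have [n1|n1] := leqP n 1.
  exists (c_ones w n, upd (upd (fun=> 0) 0 n.+1) sz 1); split; last by [].
  apply: leads_exec L1 _; apply: exec_if.
  rewrite [holds _ _]/= c_ones0 {1}Ew otape_prefix eqxx.
  apply: exec_seq (exec_part1 _ _) _; first by lia.
  apply: exec_seq (exec_mvR _ _ _) _; first by rewrite upd_neq //; lia.
  apply: exec_if; rewrite [holds _ _]/= upd_same [upd _ 0 _ sz]upd_neq // c_ones_nt //.
  by rewrite /prefix_tape ltnNge n1 /=; apply: exec_skip.
have [c [h [L hz E _ _]]] := parse_leads Ew n1 wB.
exists (c, h); split; last by rewrite /= hz.
apply: leads_exec L _; apply: exec_if; rewrite E ifN; first exact: exec_skip.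
by apply/negP => /eqP su; apply: (nwf n u).
Qed.

End PreludeSpec.

(** ** Guessing and exhaustively searching a word *)

(** [Qt] has the length of the word, so its end tells when enough bits have been guessed. *)
Definition guess_loop :=
  Wh (CNot (CSym Qt None)) (Seq (Gs Xt) (Seq (Mv Xt true) (Mv Qt true))).

Definition guess_body (p : prog) := Seq guess_loop (Seq (clr Xt) (Seq (clr Qt) p)).

(** The tried bit is [true], or the value found for the bit [false] already
    decides the quantifier. *)
Definition decided :=
  CNot (CAnd (CNot (CSym Xt (Some true)))
       (CAnd (CNot (CAnd (CSym Qt (Some false)) (nz res)))
             (CNot (CAnd (CSym Qt (Some true)) (CZero res))))).

(** Depth-first evaluation of the quantifiers. With [md] at 0 the word is complete and gets
    evaluated; with [md] at 1 the head retreats bit by bit, [res] holding the value of the formula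
    below the prefix before the head. A bit that is not decided is raised to [true] and the search
    goes forward again, all later bits having been reset to [false]. *)
Definition search_step (p : prog) :=
  If (CZero md)
    (Seq (clr res) (Seq p
      (Seq (Wh (CNot (CSym Xt None)) (Seq (Mv Xt true) (Mv Qt true))) (Mv md true))))
    (Seq (Mv Xt false) (Seq (Mv Qt false)
      (If decided (Wr Xt false)
        (Seq (Wr Xt true) (Seq (Mv md false) (Seq (clr Xt) (clr Qt))))))).

Definition search_cond := CNot (CAnd (nz md) (CZero Xt)).
Definition search_body (p : prog) := Wh search_cond (search_step p).

Lemma otape_nth W p : p < size W -> otape W p = Some (nth false W p).
Proof. by move=> pW; rewrite /otape (nth_map false). Qed.

Lemma otape_out W p : size W <= p -> otape W p = None.
Proof. by move=> pW; rewrite /otape nth_default // size_map. Qed.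

Lemma otape_true W p : (otape W p == Some true) = nth false W p.
Proof.
have [pW|pW] := ltnP p (size W); last by rewrite otape_out ?nth_default.
by rewrite otape_nth //; case: nth.
Qed.

Lemma otape_set u x b t : upd (otape (u ++ x :: t)) (size u) (Some b) = otape (u ++ b :: t).
Proof.
apply: funext => p; rewrite /otape /upd !map_cat /= !nth_cat size_map.
case: ltngtP => //= [pu|->]; last by rewrite subnn.
by rewrite -(subnSK pu).
Qed.

Lemma reaches_wh mono B c p r s : holds c s ->
  reaches (dstep mono B) (Wh c p :: r, s) (p :: Wh c p :: r, s).
Proof.
by move=> h; apply: reaches1; split; [rewrite /step1 /= h|apply: allowed_refl].
Qed.

Section Search.
Variables (B L : nat) (c : nat -> nat -> option bool) (p : prog) (phi : seq bool -> bool) (qs : seq bool).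
Definition zero : nat -> nat := fun=> 0.
Definition cW (W : seq bool) := upd c Xt (otape W).

Lemma cW_Q W : cW W Qt = c Qt. Proof. by rewrite /cW upd_neq. Qed.
Lemma cW_X W : cW W Xt = otape W. Proof. by rewrite /cW upd_same. Qed.

Definition at_pos (k : nat) : nat -> nat := upd (upd zero Xt k) Qt k.

Lemma at_pos0 : at_pos 0 = zero.
Proof. by rewrite /at_pos !upd_id. Qed.

Lemma guess_step mono b r W k : size W = k -> c Qt = otape qs -> size qs = L -> k < L -> L < B ->
  reaches (dstep mono B) (Seq (Mv Xt true) (Mv Qt true) :: r, write (cW W, at_pos k) Xt b)
                  (r, (cW (rcons W b), at_pos k.+1)).
Proof.
move=> sW cQ sq kL LB.
have -> : write (cW W, at_pos k) Xt b = (cW (rcons W b), at_pos k).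
  rewrite /write [_.1]/= [_.2]/= cW_X (_ : at_pos k Xt = size W); last first.
    by rewrite /at_pos upd_neq // upd_same.
  by rewrite otape_rcons /cW upd_upd.
apply: (exec_seq (s2 := (cW (rcons W b), upd (at_pos k) Xt k.+1))).
  apply: exec_eq (exec_mvR _ _ _); rewrite /at_pos [upd _ Qt _ Xt]upd_neq // upd_same //; lia.
apply: exec_eq (exec_mvR _ _ _); rewrite /at_pos upd_neq // upd_same; last by lia.
by congr pair; apply: funext => i; rewrite /upd; case: (i =P Xt) => [->|]; case: (i =P Qt).
Qed.

Lemma guess_test mono W k r : c Qt = otape qs -> size qs = L -> k < L ->
  reaches (dstep mono B) (guess_loop :: r, (cW W, at_pos k))
    (Gs Xt :: Seq (Mv Xt true) (Mv Qt true) :: guess_loop :: r, (cW W, at_pos k)).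
Proof.
move=> cQ sq kL.
apply: (@reaches_trans _ _ _ (Seq (Gs Xt) (Seq (Mv Xt true) (Mv Qt true)) :: guess_loop :: r, (cW W, at_pos k))).
  by apply: reaches_wh; rewrite /= cW_Q cQ /at_pos upd_same otape_nth ?sq.
by apply: reaches1; split=> //; apply: allowed_refl.
Qed.

Lemma guess_end mono W r : c Qt = otape qs -> size qs = L ->
  reaches (dstep mono B) (guess_loop :: r, (cW W, at_pos L)) (r, (cW W, at_pos L)).
Proof.
move=> cQ sq; apply: exec_wh_false.
by rewrite /= cW_Q cQ /at_pos upd_same otape_out ?sq.
Qed.

Lemma must_guess Q r W : c Qt = otape qs -> size qs = L -> L < B -> size W <= L ->
  (forall W', size W' = L -> must B Q (r, (cW W', at_pos L))) ->
  must B Q (guess_loop :: r, (cW W, at_pos (size W))).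
Proof.
move=> cQ sq LB + H; have [j] := ubnP (L - size W).
elim: j W => // j IH W jW; rewrite leq_eqVlt => /orP[/eqP sW|sW].
  by rewrite sW; apply: must_dstep (guess_end true W r cQ sq) (H _ sW).
apply: must_dstep (guess_test true W r cQ sq sW) _.
apply: must_step => // [y [g [<-]]|y [g [<-]]] /=.
  split=> [i|_ i q ne]; first by right.
  rewrite /write /= /upd; case: (i =P Xt) => // E; case: (q =P _) => [E'|_]; last by rewrite E.
  move: ne; rewrite E E' [_.1]/= cW_X /at_pos upd_neq // upd_same.
  by rewrite otape_out // leqnn.
apply: must_dstep (guess_step true g _ (erefl _) cQ sq sW LB) _.
have -> : (size W).+1 = size (rcons W g) by rewrite size_rcons.
by apply: IH; rewrite size_rcons; lia.
Qed.

Lemma may_guess r W : c Qt = otape qs -> size qs = L -> L < B -> size W = L ->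
  reaches pstep (guess_loop :: r, (cW [::], zero)) (r, (cW W, at_pos L)).
Proof.
move=> cQ sq LB sW.
have H k : k <= L -> reaches pstep (guess_loop :: r, (cW [::], zero))
    (guess_loop :: r, (cW (take k W), at_pos k)).
  elim: k => [|k IH] kL; first by rewrite take0 at_pos0; apply: reaches_refl.
  apply: reaches_trans (IH (ltnW kL)) _.
  have skW : size (take k W) = k by rewrite size_takel // sW ltnW.
  apply: reaches_trans (sub_reaches (@dstep_pstep _ _) (guess_test true (take k W) r cQ sq kL)) _.
  apply: (@reaches_trans _ _ _ (Seq (Mv Xt true) (Mv Qt true) :: guess_loop :: r,
     write (cW (take k W), at_pos k) Xt (nth false W k))).
    by apply: reaches1; exists (nth false W k).
  rewrite (take_nth false) ?sW //.
  exact: (sub_reaches (@dstep_pstep _ _) (guess_step true _ _ skW cQ sq kL LB)).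
apply: reaches_trans (H L (leqnn _)) _; rewrite take_oversize ?sW //.
exact: (sub_reaches (@dstep_pstep _ _) (guess_end true W r cQ sq)).
Qed.

Lemma exec_guess_tail mono W (v : nat) : exec mono B p (cW W, zero) (cW W, upd zero res v) ->
  exec mono B (Seq (clr Xt) (Seq (clr Qt) p)) (cW W, at_pos L) (cW W, upd zero res v).
Proof.
move=> H; apply: exec_seq (exec_clr _ _ _ _ _) _; apply: exec_seq (exec_clr _ _ _ _ _) _.
rewrite (_ : upd _ Qt 0 = zero) //; apply: funext => i; rewrite /at_pos /upd.
by case: (i =P Qt); case: (i =P Xt).
Qed.

Definition evaluating (W : seq bool) (v : nat) : memory := (cW W, upd zero res v).
Definition backtracking (j : nat) (W : seq bool) (v : nat) : memory :=
  (cW W, upd (upd (upd (upd zero res v) Xt j) Qt j) md 1).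

Hypothesis Hp : forall W, size W = L -> exec false B p (cW W, zero) (cW W, upd zero res (phi W)).
Hypotheses (cQ : c Qt = otape qs) (sq : size qs = L) (LB : L.+1 < B).

Lemma search_eval W v : size W = L ->
  exec false B (search_step p) (evaluating W v) (backtracking L W (phi W)).
Proof.
move=> sW; apply: exec_if; rewrite [holds _ _]/=.
apply: exec_seq (exec_clr _ _ _ _ _) _; rewrite upd_upd upd_id //.
apply: exec_seq (Hp sW) _.
apply: exec_seq (_ : exec _ _ _ _ (cW W, upd (upd (upd zero res (phi W)) Xt L) Qt L)) _.
  apply: (@exec_wh _ _ _ _ _ _ (fun k => (cW W, upd (upd (upd zero res (phi W)) Xt k) Qt k)) L) => //=.
  - by congr pair; rewrite [upd _ Xt _]upd_id ?[upd _ Qt _]upd_id.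
  - by move=> k kL; rewrite cW_X upd_neq // upd_same otape_nth ?sW.
  - by rewrite cW_X upd_neq // upd_same otape_out ?sW.
  move=> k kL; apply: exec_seq (exec_mvR _ _ _) _; first by rewrite upd_neq // upd_same; lia.
  apply: exec_eq (exec_mvR _ _ _); last by rewrite upd_neq // upd_same; lia.
  rewrite [upd (upd _ Qt _) Xt _ Qt]upd_neq // upd_same [upd _ Qt k Xt]upd_neq // upd_same.
  by congr pair; apply: funext => i; rewrite /upd; case: (i =P Qt); case: (i =P Xt).
have hmd : upd (upd (upd zero res (phi W)) Xt L) Qt L md = 0 by [].
by apply: exec_eq (exec_mvR _ _ _); rewrite hmd //; lia.
Qed.

Lemma holds_decided j W v : j < L -> size W = L ->
  holds decided (cW W, upd (upd (upd (upd zero res v) Xt j) Qt j) md 1) =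
  nth false W j || (if nth false qs j then v == 0 else v != 0).
Proof.
move=> jL sW; rewrite /= cW_X cW_Q cQ.
rewrite !(upd_neq _ _ (isT : Xt != md)) !(upd_neq _ _ (isT : Xt != Qt)) !upd_same.
rewrite !(upd_neq _ _ (isT : Qt != md)) !upd_same !(upd_neq _ _ (isT : res != md)).
rewrite !(upd_neq _ _ (isT : res != Qt)) !(upd_neq _ _ (isT : res != Xt)) !upd_same.
rewrite !otape_nth ?sW ?sq //.
by case: (nth false W j); case: (nth false qs j); case: (v == 0).
Qed.

Lemma search_back u b t v : size u + (size t).+1 = L -> v <= 1 ->
  exec false B (search_step p) (backtracking (size u).+1 (u ++ b :: t) v)
   (if b || (if nth false qs (size u) then v == 0 else v != 0)
    then backtracking (size u) (u ++ false :: t) v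
    else evaluating (u ++ true :: t) v).
Proof.
move=> su v1; set j := size u; set W := u ++ b :: t.
have sW : size W = L by rewrite size_cat /=.
have jL : j < L by rewrite /j; lia.
apply: exec_if; rewrite [holds _ _]/= upd_same [_ == 0]/=.
apply: exec_seq (exec_mvL _ _ _ _ _) _; apply: exec_seq (exec_mvL _ _ _ _ _) _.
set h := upd _ Qt _.
have Eh : h = upd (upd (upd (upd zero res v) Xt j) Qt j) md 1.
  apply: funext => i; rewrite /h /upd.
  by case: (i =P Qt) => [->|_] //=; case: (i =P Xt) => [->|_] //=; case: (i =P md).
rewrite Eh; apply: exec_if; rewrite holds_decided //.
have -> : nth false W j = b by rewrite /W nth_cat ltnn subnn.
have hX : upd (upd (upd (upd zero res v) Xt j) Qt j) md 1 Xt = j by [].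
have wr x : write (cW W, upd (upd (upd (upd zero res v) Xt j) Qt j) md 1) Xt x =
    (cW (u ++ x :: t), upd (upd (upd (upd zero res v) Xt j) Qt j) md 1).
  by rewrite /write [_.1]/= [_.2]/= hX cW_X /W otape_set /cW upd_upd.
case: ifP => _; first by apply: exec_eq (exec_wr _ _ _) => //; rewrite wr.
apply: exec_seq (exec_wr _ _ _) _ => //; rewrite wr.
apply: exec_seq (exec_mvL _ _ _ _ _) _; apply: exec_seq (exec_clr _ _ _ _ _) _.
apply: exec_eq (exec_clr _ _ _ _ _); congr pair; apply: funext => i; rewrite /upd.
by case: (i =P Qt) => [->|_] //; case: (i =P Xt) => [->|_] //; case: (i =P md) => [->|_].
Qed.

Definition search_it (s s' : memory) : Prop := holds search_cond s /\ exec false B (search_step p) s s'.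

Lemma search_loop s s' : reaches search_it s s' -> ~~ holds search_cond s' ->
  exec false B (search_body p) s s'.
Proof.
move=> [j]; elim: j s => [|j IH] s; first by move=> /= -> h; apply: exec_wh_false.
by move=> [s1 [[h e] ss]] ns; apply: exec_wh_true h e (IH _ ss ns).
Qed.

(** Induction on the number [k] of bits after the prefix [u]: these bits are [false] at the start
    and again when the search has come back to [u], which is what makes the second visit possible.
    [v0] is a leftover of an earlier evaluation. *)
Lemma search_reaches k u v0 : size u + k = L -> v0 <= 1 ->
  reaches search_it (evaluating (u ++ nseq k false) v0)
    (backtracking (size u) (u ++ nseq k false) (qval phi (drop (size u) qs) u)).
Proof.
elim: k u v0 => [|k IH] u v0 su v01.
  rewrite addn0 in su; rewrite cats0 su -sq drop_size sq; apply: reaches1; split=> //.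
  exact: search_eval.
have uL : size u < L by lia.
rewrite (drop_nth false) ?sq // -[nseq k.+1 false]/(false :: nseq k false) -cat_rcons.
have := IH (rcons u false) v0; rewrite size_rcons addSnnS => /(_ su v01) R0.
set q := nth false qs (size u); set rest := drop (size u).+1 qs in R0 *.
set v := qval phi rest (rcons u false) in R0.
have vle (b : bool) : b <= 1 by case: b.
have hc W x : holds search_cond (backtracking (size u).+1 W x) by [].
have S0 := @search_back u false (nseq k false) v; rewrite size_nseq in S0.
have {}S0 := S0 su (vle v); rewrite -!cat_rcons /= -/q in S0.
have Rb : reaches search_it (evaluating (rcons u false ++ nseq k false) v0)
  (if (if q then (v : nat) == 0 else (v : nat) != 0)
   then backtracking (size u) (rcons u false ++ nseq k false) v
   else evaluating (rcons u true ++ nseq k false) v).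
  by apply: reaches_trans R0 _; apply: reaches1; split; [apply: hc|apply: S0].
rewrite [qval _ _ _]/= -/v.
have R1 : reaches search_it (evaluating (rcons u true ++ nseq k false) v)
   (backtracking (size u) (rcons u false ++ nseq k false) (qval phi rest (rcons u true))).
  have := IH (rcons u true) v; rewrite size_rcons addSnnS => /(_ su (vle v)) R1.
  apply: reaches_trans R1 _; apply: reaches1; split; first exact: hc.
  have S1 := @search_back u true (nseq k false) (qval phi rest (rcons u true)).
  by rewrite size_nseq in S1; have {}S1 := S1 su (vle _); rewrite -!cat_rcons /= in S1.
clear S0; move: Rb R1; case: q; case: (v) => /= Rb R1 //; exact: reaches_trans Rb R1.
Qed.

Lemma exec_search : exec false B (search_body p) (cW (nseq L false), zero)
   (backtracking 0 (nseq L false) (qval phi qs [::])).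
Proof.
apply: search_loop => //.
have := @search_reaches L [::] 0; rewrite /= drop0 add0n => /(_ erefl isT).
by rewrite /evaluating (@upd_id _ zero res 0).
Qed.

End Search.

(** ** Deciding formulas by machines *)

Fixpoint maxcond (c : cond) : nat :=
  match c with
  | CZero i | CSym i _ => i
  | CNot c => maxcond c
  | CAnd c d => maxn (maxcond c) (maxcond d)
  end.

Fixpoint maxtape (p : prog) : nat :=
  match p with
  | Skip => 0
  | Mv i _ | Wr i _ | Gs i => i
  | Seq p q => maxn (maxtape p) (maxtape q)
  | If c p q => maxn (maxcond c) (maxn (maxtape p) (maxtape q))
  | Wh c p => maxn (maxcond c) (maxtape p)
  end.

Lemma cond_lt_max c k : maxcond c < k -> cond_lt k c.
Proof. by elim: c => [i|i o|c IH|c IHc d IHd] //=; rewrite gtn_max => /andP[/IHc -> /IHd]. Qed.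

Lemma tapes_lt_max p k : maxtape p < k -> tapes_lt k p.
Proof.
elim: p => [|i d|i b|i|p IHp q IHq|c p IHp q IHq|c p IHp] //=; rewrite ?gtn_max.
- by move=> /andP[/IHp -> /IHq].
- by move=> /and3P[/cond_lt_max -> /IHp -> /IHq].
- by move=> /andP[/cond_lt_max -> /IHp].
Qed.

Lemma noguess_seqs ps : noguess (seqs ps) = all noguess ps.
Proof. by elim: ps => //= p ps ->. Qed.

Lemma noguess_forn cnd vs body : noguess body -> noguess (forn cnd vs body).
Proof. by elim: vs => //= v vs IH /IH ->. Qed.

Lemma noguess_goto j cnd ds : noguess (goto j cnd ds).
Proof.
elim: ds => //= d ds ->; rewrite andbT; case: d => //= k.
by rewrite noguess_seqs all_nseq orbT.
Qed.

Lemma noguess_evalp (T : finType) (tb : T) D nb d (f : fo T) : noguess (evalp tb D nb d f).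
Proof.
elim: f d => [[||b|t] l|f IH|f IHf g IHg|f IH] d /=; rewrite ?IH ?IHf ?IHg //.
- case: l => [|x [|y [|z l]]] //=; rewrite /less; by case: eqP.
- by case: l => [|x [|y l]].
- elim: [seq CSym _ _ | x <- l] => [|c cs IH] /=; last by rewrite IH.
  by rewrite noguess_goto.
- by case: l => [|x l] //=; rewrite noguess_goto.
Qed.

Lemma noguess_map (I : Type) (g : I -> prog) s : (forall x, noguess (g x)) -> noguess (seqs [seq g x | x <- s]).
Proof. by move=> H; rewrite noguess_seqs all_map; elim: s => //= x s ->; rewrite andbT; apply: H. Qed.

Lemma noguess_prelude ars V CN K D px body : noguess body -> noguess (prelude ars V CN K D px body).
Proof.
move=> nb.
have nc b l : noguess (copyblocks ars V b l).
  by elim: l b => //= a l IH b; rewrite IH noguess_forn.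
have no : noguess (ones (alltapes ars V CN)) by rewrite /ones /ones_body /= noguess_map.
have ne : noguess (extend ars V K).
  by apply/andP; split; [apply: noguess_forn|]; apply: noguess_map.
have nq : noguess (init_quants ars D px).
  have qb : noguess (quant_body ars px) by case: (px).
  rewrite /init_quants; have := @noguess_forn (fun v => CNot (CSym v None)) [seq vart (size ars) i | i <- iota 0 D.+3] _ qb.
  by move: (forn _ _ _) => q /= ->.
have ncl := @noguess_map _ clr (alltapes ars V CN) (fun=> isT).
rewrite /prelude; move: no nc ne nq ncl nb; move: (ones _) (copyblocks _ _) (extend _ _ _) (init_quants _ _ _) (seqs _).
by move=> p1 p2 p3 p4 p5 /= -> H -> -> -> ->; rewrite H.
Qed.

Lemma eq_ev_blk (T : Type) N n Bk Bk' (X : T -> seq nat -> bool) f (bb := fun f : fo T =>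
   (fix bb f := match f with Atom (ABlk b) _ => b.+1 | Atom _ _ => 0 | Neg f => bb f
     | Conj f g => maxn (bb f) (bb g) | Ex f => bb f end) f) e :
  (forall b l, b < bb f -> Bk b l = Bk' b l) ->
  ev N (interp_atom n Bk X) e f = ev N (interp_atom n Bk' X) e f.
Proof.
elim: f e => [[||b|t] l|f IH|f IHf g IHg|f IH] e //= H.
- by rewrite !ev_Atom /= H.
- by rewrite !ev_Neg IH.
- by rewrite !ev_Conj IHf ?IHg // => b l bl; apply: H; rewrite leq_max bl ?orbT.
- by rewrite /ev -/ev; apply: eq_has => v; apply: IH.
Qed.

Section FormulaMachines.
Variables (ars : seq nat) (K D : nat) (T : finType) (tb : T) (f : fo T).
Hypotheses (K0 : 0 < K) (TK : #|T| <= 2 ^ K).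
Hypothesis fb : blk_bound f <= size ars.

Definition nvars := D.+3 + qdepth f.
Definition ncnts := maxn K (foldr maxn 0 ars).
Definition evalf := evalp tb D (size ars) 0 f.
Definition with_prelude px body := prelude ars nvars ncnts K D px body.

Definition tabblk (n : nat) (u : seq bool) (b : nat) (l : seq nat) : bool :=
  nth false (nth [::] (reshape (blens ars n) u) b) (val_of n l).

Definition phi n u W := ev (n ^ K) (lev n (tabblk n u) (word_rel tb (n ^ K) D W)) [::] f.

(** [D.+3] digits for addresses of the word and [width D f] for those of the formula, each in base
    [n ^ K]; the final 2 leaves room for the length of the input and for strict inequalities. *)
Definition head_exp := K * (D.+3 + width D f) + 2.
Definition head_bound s := (s + 3) ^ head_exp.

Lemma head_bound_poly : polyb head_bound.
Proof. by apply/polyb_exp/polyb_add; [apply: polyb_id|apply: polyb_const]. Qed.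

Lemma head_bound_size s : s.+2 < head_bound s.
Proof.
apply: (@leq_trans ((s + 3) ^ 1)); first by rewrite expn1; lia.
by apply: leq_pexp2l; rewrite /head_exp; lia.
Qed.

Lemma head_bound_exp n s e : n <= s -> e <= D.+3 + width D f -> ((n ^ K) ^ e).+1 < head_bound s.
Proof.
move=> ns ee; rewrite -expnM.
have H : n ^ (K * e) <= (s + 3) ^ (K * (D.+3 + width D f)).
  apply: (@leq_trans ((s + 3) ^ (K * e))).
    by case: (K * e) => // j; rewrite leq_exp2r //; lia.
  by rewrite leq_pexp2l ?leq_mul2l ?ee ?orbT //; lia.
rewrite /head_bound /head_exp expnD; set X := (s + 3) ^ _ in H *.
have X0 : 0 < X by rewrite expn_gt0; lia.
have : X * 9 <= X * (s + 3) ^ 2 by rewrite leq_mul2l; apply/orP; right; rewrite -[9]/(3 ^ 2) leq_exp2r //; lia.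
by lia.
Qed.

Lemma ncnts_all : all (fun a => a <= ncnts) ars.
Proof.
rewrite /ncnts; apply/allP => a aars; apply: leq_trans (leq_maxr _ _).
elim: (ars) aars => //= b l IH; rewrite inE => /orP[/eqP ->|/IH H]; first exact: leq_maxl.
exact: leq_trans H (leq_maxr _ _).
Qed.

Lemma wellformed_uniq w n u n' u' : wellformed ars w n u -> wellformed ars w n' u' -> n = n' /\ u = u'.
Proof. by move=> [-> _ _] [+ _ _]; apply: nseq_false_inj. Qed.

Lemma wellformed_lt w n u : wellformed ars w n u -> n < size w.
Proof. by move=> [-> _ _]; rewrite size_cat size_nseq /=; lia. Qed.

Section Valid.
Variables (mono : bool) (w : seq bool) (n : nat) (u : seq bool).
Hypothesis wf : wellformed ars w n u.
Notation N := (n ^ K).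
Notation B := (head_bound (size w)).
Variable c : nat -> nat -> option bool.
Hypothesis cblk : forall b, b < size ars -> c (blkt b) = otape (nth [::] (reshape (blens ars n) u) b).
Hypothesis cnt : forall t, t \in ntapes ars nvars -> c t = ext_tape n N.

Lemma exec_evalf W : exec mono B evalf (cW c W, zero) (cW c W, upd zero res (phi n u W)).
Proof.
have [_ n1 _] := wf; have nw := wellformed_lt wf.
have nN : n <= N by rewrite -{1}[n]expn1 leq_pexp2l // ltnW.
have TN : #|T| <= N by apply: leq_trans TK _; rewrite leq_exp2r.
have NB : N < B.
  by have := @head_bound_exp n (size w) 1 (ltnW nw) isT; rewrite expn1; apply: ltn_trans.
have wB : N ^ width D f < B.
  by apply: ltnW; apply: head_bound_exp (ltnW nw) _; apply: leq_addl.
have sz_tape t : t \in ntapes ars nvars -> t != Xt -> sized_tape n N (cW c W t).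
  by move=> tt tX p; rewrite /cW upd_neq // cnt.
have hz : henv (size ars) [::] = zero.
  by apply: funext => i; rewrite /henv; case: ifP => // _; rewrite nth_nil.
have := @exec_evalp T tb D (size ars) mono B n N nvars nN n1 NB TN (cW c W)
  (sz_tape sz _ isT) (sz_tape zr _ isT) _ f [::] isT _ wB fb.
rewrite hz !inE !eqxx orbT => /(_ isT isT) H.
have -> : phi n u W = ev N (lev n (mem_blk n (cW c W)) (mem_rel tb D N (cW c W))) [::] f.
  rewrite /phi; transitivity (ev N (lev n (mem_blk n (cW c W)) (word_rel tb N D W)) [::] f).
    apply: eq_ev_blk => b l bf.
    have bs : b < size ars by apply: leq_trans fb; exact: bf.
    rewrite /tabblk /mem_blk /cW upd_neq; last by rewrite /blkt /Xt; lia.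
    by rewrite cblk // otape_true.
  congr (ev _ (lev _ _ _) _ _); apply: funext => l; apply: funext => t; apply: funext => a.
  by rewrite /mem_rel /cW upd_same otape_true.
apply: H; last by rewrite /nvars /=; lia.
move=> i iV; apply: sz_tape; last by rewrite /vart /Xt; lia.
by apply: mem_behead; apply: mem_behead; apply: (map_f (vart (size ars))); rewrite mem_iota.
Qed.

End Valid.

(** One word of bits is guessed, each cell of [Xt] being written once, and the evaluation only moves
    heads; the run is therefore monotone, as [machine_np] demands. *)
Theorem formula_np (L : language) :
  (forall w, L w <-> exists n u, wellformed ars w n u /\
     exists2 W, size W = (n ^ K) ^ D.+3 & phi n u W) -> lang_NP L.
Proof.
move=> HL; pose p := with_prelude false (guess_body evalf).
have k1 : maxtape p < (maxn (maxtape p) (maxcond (nz res))).+1 by rewrite ltnS leq_maxl.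
have k2 : maxcond (nz res) < (maxn (maxtape p) (maxcond (nz res))).+1 by rewrite ltnS leq_maxr.
apply: (machine_np (tapes_lt_max k1) (cond_lt_max k2) head_bound_poly) => w.
set B := head_bound (size w).
have wB : (size w).+2 < B by apply: head_bound_size.
split; first by apply: ltn_trans wB.
case: (pselect (exists n u, wellformed ars w n u)) => [[n [u wf]]|nwf]; last first.
  have [|s [ex r0]] := @prelude_invalid ars nvars ncnts K D false (guess_body evalf) true B
      ncnts_all (leq_maxl _ _) K0 (leq_addr _ _) w _ wB; first by move=> n u wf; apply: nwf; exists n, u.
  split; last by move=> /HL [n [u [wf _]]]; case: nwf; exists n, u.
  by apply: must_dstep (ex [::]) _; apply: must_end; rewrite /= r0.
have nw := wellformed_lt wf; set N := n ^ K.
have [|c [Ld cb cn cQ cX]] := @prelude_valid ars nvars ncnts K D false (guess_body evalf) true B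
   ncnts_all (leq_maxl _ _) K0 (leq_addr _ _) w n u wf wB.
  by apply: ltnW; apply: head_bound_exp (ltnW nw) (leq_addr _ _).
rewrite -/N in cn cQ cX.
set qs := flatten _ in cQ.
have n1 : 1 < n by case: wf.
have N1 : 1 < N by rewrite /N -{1}[1](exp1n K) ltn_exp2r.
have sqs : size qs = N ^ D.+3 by rewrite /qs -quants_uptoE // size_quants_upto.
have LB : N ^ D.+3 < B by apply: ltnW; apply: head_bound_exp (ltnW nw) (leq_addr _ _).
have c0 : c = cW c [::] by rewrite /cW upd_id.
have tail W : exec true B (Seq (clr Xt) (Seq (clr Qt) evalf)) (cW c W, at_pos (N ^ D.+3))
    (cW c W, upd zero res (phi n u W)).
  by apply: exec_guess_tail; apply: (@exec_evalf true w n u wf c cb cn W).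
have start : reaches (dstep true B) ([:: p], mem0 w)
   ([:: guess_loop; Seq (clr Xt) (Seq (clr Qt) evalf)], (cW c [::], zero)).
  apply: reaches_trans (Ld [::]) _; rewrite {1}c0.
  by apply: reaches1; split=> //; apply: allowed_refl.
split.
  apply: must_dstep start _; rewrite -(at_pos0).
  apply: (@must_guess B (N ^ D.+3) c qs _ _ [::]) => // W sW.
  apply: must_dstep (tail W [::]) _; apply: must_end.
  rewrite /= upd_same eqb0 negbK => ph; apply/HL; exists n, u; split=> //; by exists W.
move=> /HL [n' [u' [wf' [W sW pW]]]]; have [En Eu] := wellformed_uniq wf wf'.
subst n' u'; exists (cW c W, upd zero res (phi n u W)); split; last by rewrite /= upd_same pW.
apply: reaches_trans (sub_reaches (@dstep_pstep _ _) start) _.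
apply: reaches_trans (@may_guess B (N ^ D.+3) c qs _ W cQ sqs LB sW) _.
exact: (sub_reaches (@dstep_pstep _ _) (tail W [::])).
Qed.

(** The search overwrites [Xt], so monotonicity fails; determinism and the bound on the heads are
    what [machine_pspace] asks for. *)
Theorem formula_pspace (L : language) :
  (forall w, L w <-> exists n u, wellformed ars w n u /\
     qval (phi n u) (flatten (nseq (n ^ K) (quants (n ^ K) D))) [::]) -> lang_PSPACE L.
Proof.
move=> HL; pose p := with_prelude true (search_body evalf).
have k1 : maxtape p < (maxn (maxtape p) (maxcond (nz res))).+1 by rewrite ltnS leq_maxl.
have k2 : maxcond (nz res) < (maxn (maxtape p) (maxcond (nz res))).+1 by rewrite ltnS leq_maxr.
have ng : noguess p by apply: noguess_prelude; rewrite /= noguess_evalp.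
apply: (machine_pspace (tapes_lt_max k1) (cond_lt_max k2) ng head_bound_poly) => w.
set B := head_bound (size w).
have wB : (size w).+2 < B by apply: head_bound_size.
split; first by apply: ltn_trans wB.
case: (pselect (exists n u, wellformed ars w n u)) => [[n [u wf]]|nwf]; last first.
  have [|s [ex r0]] := @prelude_invalid ars nvars ncnts K D true (search_body evalf) false B
      ncnts_all (leq_maxl _ _) K0 (leq_addr _ _) w _ wB; first by move=> n u wf; apply: nwf; exists n, u.
  exists s; split; first exact: (ex [::]).
  by rewrite /= r0 eqxx; split=> // /HL [n [u [wf _]]]; case: nwf; exists n, u.
have nw := wellformed_lt wf; set N := n ^ K.
have [|c [Ld cb cn cQ cX]] := @prelude_valid ars nvars ncnts K D true (search_body evalf) false B
   ncnts_all (leq_maxl _ _) K0 (leq_addr _ _) w n u wf wB.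
  by apply: ltnW; apply: head_bound_exp (ltnW nw) (leq_addr _ _).
rewrite -/N in cn cQ cX.
set qs := flatten _ in cQ.
have n1 : 1 < n by case: wf.
have N1 : 1 < N by rewrite /N -{1}[1](exp1n K) ltn_exp2r.
have sqs : size qs = N ^ D.+3 by rewrite /qs -quants_uptoE // size_quants_upto.
have LB : (N ^ D.+3).+1 < B by apply: head_bound_exp (ltnW nw) (leq_addr _ _).
have c0 : c = cW c (nseq (N ^ D.+3) false) by rewrite /cW upd_id.
have Se := @exec_search B (N ^ D.+3) c evalf (phi n u) qs
  (fun W _ => @exec_evalf false w n u wf c cb cn W) cQ sqs LB.
eexists; split.
  by apply: reaches_trans (Ld [::]) _; rewrite {1}c0; apply: Se.
have -> : holds (nz res) (backtracking c 0 (nseq (N ^ D.+3) false) (qval (phi n u) qs [::])) = qval (phi n u) qs [::].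
  by rewrite /holds /= /upd /= eqb0 negbK.
split=> [/HL [n' [u' [wf' q]]]|q]; last by apply/HL; exists n, u.
by have [En Eu] := wellformed_uniq wf wf'; subst n' u'.
Qed.

End FormulaMachines.

(** * Schemes as first-order transition systems *)

Section StepCases.
Variables (sg : signature) (A : structure sg) (z mx : A).
Variables (k m : nat) (dim : 'I_m -> nat).
Notation code := (seq (instr sg k dim)).

(** A form of [ps_step] that computes on the first instruction, so that inversion becomes
    simplification. *)
Definition exec_instr (r : code) (s : store A k dim) (c' : code * store A k dim) : Prop :=
  match r with
  | [::] => False
  | Assign x t :: r => c' = (r, set_var s x (eval_term z mx s t))
  | ReadArr x a ts :: r => c' = (r, set_var s x (s.2 (@cell sg A z mx k m dim s a ts)))
  | WriteArr a ts t :: r =>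
      c' = (r, set_cell s (@cell sg A z mx k m dim s a ts) (eval_term z mx s t))
  | Guess x :: r => exists u, c' = (r, set_var s x u)
  | While b l :: r => c' = (if eval_test z mx s b then l ++ While b l :: r else r, s)
  end.

Lemma ps_stepE c c' : @ps_step sg A z mx k m dim c c' <-> exec_instr c.1 c.2 c'.
Proof.
split; first by case=> //= *; eexists.
case: c => -[|[x t|x a ts|a ts t|x|b l] r] s //=; try by move=> ->; constructor.
by move=> [u ->]; constructor.
Qed.

End StepCases.

Section Continuations.
Variables (sg : signature) (k m : nat) (dim : 'I_m -> nat).
Notation code := (seq (instr sg k dim)).
Notation "x '\In' L" := (List.In x L) (at level 70).

(** The continuations met while executing [i] before [r]. *)
Fixpoint conts_of (i : instr sg k dim) (r : code) : seq code :=
  (i :: r) ::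
  match i with
  | While b l =>
      (fix inner (l' : code) : seq code :=
         if l' is j :: l'' then conts_of j (l'' ++ While b l :: r) ++ inner l'' else [::]) l
  | _ => [::]
  end.

Definition conts_seq (l r : code) : seq code :=
  (fix inner (l' : code) : seq code :=
     if l' is j :: l'' then conts_of j (l'' ++ r) ++ inner l'' else [::]) l.

Lemma conts_seq_cons j l r : conts_seq (j :: l) r = conts_of j (l ++ r) ++ conts_seq l r.
Proof. by []. Qed.

Lemma conts_of_while b l r :
  conts_of (While b l) r = (While b l :: r) :: conts_seq l (While b l :: r).
Proof. by []. Qed.

Definition closed_in (L M : seq code) : Prop :=
  forall i r, (i :: r) \In L ->
    r \In M /\ (forall b l, i = While b l -> (l ++ i :: r) \In M).

Lemma closed_in_cat L1 L2 M : closed_in L1 M -> closed_in L2 M -> closed_in (L1 ++ L2) M.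
Proof. by move=> H1 H2 i r H; case: (List.in_app_or _ _ _ H); [exact: H1|exact: H2]. Qed.

Lemma conts_seq_head l r M : r \In M -> List.incl (conts_seq l r) M -> (l ++ r) \In M.
Proof.
case: l => [//|j l] rM; rewrite conts_seq_cons /= => H; apply: H; apply: List.in_or_app; left.
by case: j => *; left.
Qed.

Lemma closed_conts_of i r M : List.incl (conts_of i r) M -> r \In M -> closed_in (conts_of i r) M.
Proof.
(* Loop bodies are lists nested in instructions, so the recursion on instructions is set up by hand,
   with an inner induction along the body. *)
move: i r; fix IH 1.
case=> [x t|x a ts|a ts t|x|b l] r H rM; try by move=> j r' /= [[<- <-]|//]; split.
rewrite !conts_of_while in H *.
have HM : (While b l :: r) \In M by apply: H; left.
have H' : List.incl (conts_seq l (While b l :: r)) M by move=> x xl; apply: H; right.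
have C : closed_in (conts_seq l (While b l :: r)) M.
  move: (While b l :: r) HM H'; elim: (l) => [|j l' IHl] r' HM; first by move=> _ i r0 [].
  rewrite conts_seq_cons => H'.
  have H2 : List.incl (conts_seq l' r') M by move=> x xl; apply: H'; apply: List.in_or_app; right.
  apply: closed_in_cat; last exact: IHl.
  apply: IH; first by move=> x xl; apply: H'; apply: List.in_or_app; left.
  exact: conts_seq_head.
move=> i r' /= [[<- <-]|ir]; last exact: (C i r' ir).
by split=> // b' l' [_ <-]; apply: conts_seq_head.
Qed.

Definition conts (l : code) : seq code := [::] :: conts_seq l [::].

Lemma closed_conts l : closed_in (conts l) (conts l).
Proof.
move=> i r [//|ir].
suff H l' : List.incl (conts_seq l' [::]) (conts l) -> closed_in (conts_seq l' [::]) (conts l).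
  by apply: (H l) => // x xl; right.
elim: l' => [|j l' IH]; first by move=> _ ? ? [].
rewrite conts_seq_cons => H.
have H2 : List.incl (conts_seq l' [::]) (conts l) by move=> x xl; apply: H; apply: List.in_or_app; right.
apply: closed_in_cat; last exact: IH.
apply: closed_conts_of; first by move=> x xl; apply: H; apply: List.in_or_app; left.
by apply: conts_seq_head => //; left.
Qed.

Lemma conts_start l : l \In conts l.
Proof. by rewrite -[X in X \In _](cats0 l); apply: conts_seq_head; [left|move=> x xl; right]. Qed.

Lemma closed_next (A : structure sg) (z mx : A) l r s c' :
  exec_instr z mx r s c' -> r \In conts l -> c'.1 \In conts l.
Proof.
case: r => [|i r] //= H /closed_conts[rl lr].
case: i H lr => [x t ->|x a ts ->|a ts t ->|x [u ->]|b l' ->] //= H.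
by case: eval_test => //; apply: H.
Qed.

End Continuations.

Section System.
Variables (sg : signature) (k m : nat) (dim : 'I_m -> nat).
Notation code := (seq (instr sg k dim)).
Variable prog : code.
Notation L := (conts prog).

(** A nullary relation for each continuation gives the point of execution, variables and arrays are
    given by their graphs, and [TB] is set aside for the side bit of Savitch's recursion. *)
Definition stag : finType := ('I_(size L) + 'I_k + 'I_m + unit)%type.
Definition PC (o : 'I_(size L)) : stag := inl (inl (inl o)).
Definition VR (x : 'I_k) : stag := inl (inl (inr x)).
Definition AR (a : 'I_m) : stag := inl (inr a).
Definition TB : stag := inr tt.

Definition sar (t : stag) : nat :=
  match t with
  | inl (inl (inl _)) => 0
  | inl (inl (inr _)) => 1
  | inl (inr a) => (dim a).+1
  | inr _ => 0
  end.
Definition srl : pred stag := fun t => if t is inr _ then false else true.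

(** 0 and max are taken to be the numbers 0 and 1, which the order defines; choice independence
    permits this. *)
Definition TermIs (lv : nat) (t : term sg k) (v : nat) : fo stag :=
  match t with
  | Var x => Atom (AX (VR x)) [:: lv; v]
  | Cst j => Atom (ABlk (nrel sg + j)) [:: v]
  | Zero => FFirst _ v
  | Max => FOne _ v
  end.

Definition TermsAre (lv d : nat) (ts : d.-tuple (term sg k)) : fo stag :=
  conjs [seq TermIs lv (tnth ts j) j | j <- enum 'I_d].

Fixpoint TestF (lv : nat) (b : test sg k) : fo stag :=
  match b with
  | TRel i ts =>
      exs (arity i) (Conj (TermsAre (lv + arity i) ts) (Atom (ABlk i) (iota 0 (arity i))))
  | TEq t u => Ex (Conj (TermIs lv.+1 t 0) (TermIs lv.+1 u 0))
  | TNot b => Neg (TestF lv b)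
  | TAnd b c => Conj (TestF lv b) (TestF lv c)
  | TOr b c => Disj (TestF lv b) (TestF lv c)
  end.

Definition keep (lv : nat) (r : code) (t : stag) : fo stag :=
  match t with
  | inl (inl (inl o)) => if `[< nth [::] L o = r >] then TT _ else FF _
  | _ => Atom (AX t) (lv + sar t :: iota 0 (sar t))
  end.

(** The value of variable [x] becomes the only element satisfying [f]. *)
Definition keep_but (lv : nat) (r : code) (x : 'I_k) (f : fo stag) (t : stag) : fo stag :=
  if t == VR x then f else keep lv r t.

Definition write_cell (lv : nat) (r : code) (a : 'I_m) (ts : (dim a).-tuple (term sg k))
    (t : term sg k) (tg : stag) : fo stag :=
  if tg == AR a then
    let lv' := lv + (dim a).+1 in
    Disj (Conj (TermsAre lv' ts) (TermIs lv' t (dim a)))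
         (Conj (Neg (TermsAre lv' ts)) (keep lv r tg))
  else keep lv r tg.

Notation FDef := (FDef sar srl).

(** In the case of a guess the new value is quantified, restricted by [FSmall] to the universe
    because quantifiers range up to [N]; the names [l] and [l'] move by one index. *)
Definition next_formula (r : code) (l l' : nat) : fo stag :=
  match r with
  | [::] => FF _
  | Assign x t :: r => FDef l' (keep_but l r x (TermIs l.+1 t 0))
  | ReadArr x a ts :: r =>
      FDef l' (keep_but l r x
        (exs (dim a) (Conj (TermsAre (l.+1 + dim a) ts)
                           (Atom (AX (AR a)) (l.+1 + dim a :: iota 0 (dim a).+1)))))
  | WriteArr a ts t :: r => FDef l' (write_cell l r ts t)
  | Guess x :: r => Ex (Conj (FSmall _ 0) (FDef l'.+1 (keep_but l.+1 r x (FEq _ 0 1))))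
  | While b w :: r =>
      Disj (Conj (TestF l b) (FDef l' (keep l (w ++ While b w :: r))))
           (Conj (Neg (TestF l b)) (FDef l' (keep l r)))
  end.

Definition init_formula (t : stag) : fo stag :=
  match t with
  | inl (inl (inl o)) => if `[< nth [::] L o = prog >] then TT _ else FF _
  | inl (inl (inr x)) => FFirst _ 0
  | inl (inr a) => Conj (conjs [seq FSmall _ i | i <- iota 0 (dim a)]) (FFirst _ (dim a))
  | inr _ => FF _
  end.

Definition scheme_sys : sysf stag := {|
  INIT := fun l => FDef l init_formula;
  STEP := fun l l' => disjs [seq Conj (Atom (AX (PC o)) [:: l]) (next_formula (nth [::] L o) l l')
                            | o : 'I_(size L) <- enum 'I_(size L)];
  FINAL := fun l => Conj (disjs [seq if `[< nth [::] L o = [::] >] then Atom (AX (PC o)) [:: l] else FF _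
                                | o : 'I_(size L) <- enum 'I_(size L)])
     (conjs [seq Ex (Conj (FOne _ 0) (Atom (AX (VR x)) [:: l.+1; 0])) | x <- enum 'I_k]) |}.

Section Simulation.
Variables (n N : nat) (ngt1 : 1 < #|'I_n|) (I : interp sg 'I_n).
Variable Bk : nat -> seq nat -> bool.
Let A : structure sg := @Structure sg 'I_n ngt1 I.
Variables z mx : 'I_n.
Hypotheses (z0 : z = 0 :> nat) (mx1 : mx = 1 :> nat) (nN : n <= N).
Hypothesis HBk : forall b l, b < nblk sg -> size l = ar_of sg b -> all (gtn n) l ->
  Bk b l = blk z I b l.
Notation stor := (store A k dim).
Notation conf := (code * stor)%type.

Definition index_of d (ds : seq nat) : d.-tuple 'I_n := [tuple ordn z (nth 0 ds i) | i < d].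

Lemma index_of_map d (t : d.-tuple 'I_n) : index_of d (map val t) = t.
Proof.
apply: eq_from_tnth => i; rewrite tnth_mktuple (nth_map z) ?size_tuple //.
by rewrite -tnth_nth ordn_val.
Qed.

Lemma map_index_of d ds : size ds = d -> all (gtn n) ds -> map val (index_of d ds) = ds.
Proof.
move=> sd ad; apply: (@eq_from_nth _ 0); first by rewrite size_map size_tuple.
move=> i; rewrite size_map size_tuple => id; rewrite (nth_map z) ?size_tuple //.
have -> : nth z (index_of d ds) i = tnth (index_of d ds) (Ordinal id) by rewrite (tnth_nth z).
by rewrite tnth_mktuple; apply: val_ordn; apply: (all_nthP 0 ad); rewrite sd.
Qed.

(** [index_of] forces arguments into the universe, hence the explicit test that the indices of a
    cell are small. *)
Definition sencf (c : conf) (t : stag) (ds : seq nat) : bool :=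
  match t with
  | inl (inl (inl o)) => `[< nth [::] L o = c.1 >]
  | inl (inl (inr x)) => nth 0 ds 0 == c.2.1 x
  | inl (inr a) => all (gtn n) (take (dim a) ds) &&
      (nth 0 ds (dim a) == c.2.2 (Tagged (fun a => (dim a).-tuple 'I_n) (index_of (dim a) ds)))
  | inr _ => false
  end.

Notation enc := (encodes sar srl N sencf).

Lemma N1 : 1 < N. Proof. by apply: leq_trans nN; rewrite -mx1. Qed.
Lemma N0 : 0 < N. Proof. exact: ltnW N1. Qed.
Local Hint Resolve N1 N0 : core.

Lemma ord_N (u : 'I_n) : u < N. Proof. exact: leq_trans (ltn_ord u) nN. Qed.

Lemma nth_ok e i : all (gtn N) e -> nth 0 e i < N. Proof. exact: okenv_nth. Qed.

Section Formulas.
Variable XX : nat -> stag -> seq nat -> bool.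
Notation It := (lev n Bk XX).

Lemma ev_TermIs e lv (t : term sg k) v c : all (gtn N) e -> enc c (XX (nth 0 e lv)) ->
  ev N It e (TermIs lv t v) = (nth 0 e v == eval_term (z : A) mx c.2 t :> nat).
Proof.
move=> ok ec; case: t => [x|j||] /=.
- by rewrite ev_Atom /= ec //= (nth_ok _ ok).
- rewrite ev_Atom /= andbT; case: ltnP => vn /=; last by rewrite gtn_eqF // (leq_trans (ltn_ord _)).
  by rewrite HBk ?ltn_add2l ?ar_cst //= ?vn // blk_cst.
- by rewrite ev_First // z0.
- by rewrite ev_One // mx1.
Qed.

Lemma ev_TermsAre ds e lv d (ts : d.-tuple (term sg k)) c : size ds >= d ->
  all (gtn N) (ds ++ e) -> enc c (XX (nth 0 (ds ++ e) lv)) ->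
  ev N It (ds ++ e) (TermsAre lv ts) =
  (take d ds == map val (map_tuple (eval_term (z : A) mx c.2) ts)).
Proof.
move=> sd ok ec; rewrite ev_conjs_map; apply/allP/eqP => [H|E i _].
  apply: (@eq_from_nth _ 0); first by rewrite size_takel // !size_map size_tuple.
  move=> i; rewrite size_takel // => id.
  have := H (Ordinal id) (mem_enum _ _); rewrite (ev_TermIs _ _ ok ec) /= => /eqP.
  rewrite nth_take // nth_cat (leq_trans id sd) => ->.
  by rewrite -map_comp (nth_map (tnth ts (Ordinal id))) ?size_tuple // -(tnth_nth _ ts (Ordinal id)).
rewrite (ev_TermIs _ _ ok ec) nth_cat (leq_trans (ltn_ord i) sd).
rewrite -(@nth_take d) // E -map_comp (nth_map (tnth ts i)) ?size_tuple // -tnth_nth.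
exact: eqxx.
Qed.

Lemma all_ord_N d (t : d.-tuple 'I_n) : all (gtn N) (map val t).
Proof. by apply/allP => x /mapP[u _ ->]; apply: ord_N. Qed.

Lemma all_ord_n d (t : d.-tuple 'I_n) : all (gtn n) (map val t).
Proof. by apply/allP => x /mapP[u _ ->]; apply: ltn_ord. Qed.

Lemma nth_shift_cat (ds e : seq nat) d lv : size ds = d -> nth 0 (ds ++ e) (lv + d) = nth 0 e lv.
Proof. exact: nth_env_shift. Qed.

Lemma ev_exs_terms e lv d (ts : d.-tuple (term sg k)) c f : all (gtn N) e ->
  enc c (XX (nth 0 e lv)) ->
  ev N It e (exs d (Conj (TermsAre (lv + d) ts) f)) =
  ev N It (map val (map_tuple (eval_term (z : A) mx c.2) ts) ++ e) f.
Proof.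
move=> ok ec; have E ds : size ds = d -> all (gtn N) ds ->
    ev N It (ds ++ e) (TermsAre (lv + d) ts) =
    (ds == map val (map_tuple (eval_term (z : A) mx c.2) ts)).
  move=> sd ad; rewrite (@ev_TermsAre _ _ _ _ _ c) ?sd ?nth_shift_cat ?all_cat ?ad //.
  by rewrite take_oversize ?sd.
apply/ev_exs/idP => [[ds [sd ad]]|H].
  by rewrite ev_Conj => /andP[]; rewrite E // => /eqP <-.
exists (map val (map_tuple (eval_term (z : A) mx c.2) ts)).
split; [by rewrite size_map size_tuple|exact: all_ord_N|].
by rewrite ev_Conj E ?eqxx ?size_map ?size_tuple //; apply: all_ord_N.
Qed.

Lemma ev_TestF e lv b c : all (gtn N) e -> enc c (XX (nth 0 e lv)) ->
  ev N It e (TestF lv b) = eval_test (z : A) mx c.2 b.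
Proof.
move=> ok ec; elim: b => [i ts|t u|b IH|b IHb d IHd|b IHb d IHd]; last first.
- by rewrite ev_Disj IHb IHd.
- by rewrite ev_Conj IHb IHd.
- by rewrite ev_Neg IH.
- rewrite [TestF _ _]/=; apply/ev_Ex/eqP => [[v vN]|E].
    rewrite ev_Conj !(@ev_TermIs _ _ _ _ c) //=; try by rewrite vN.
    by move=> /andP[/eqP -> /eqP /val_inj].
  exists (eval_term (z : A) mx c.2 t); first exact: ord_N.
  have ok' : all (gtn N) ((eval_term (z : A) mx c.2 t : nat) :: e) by rewrite /= ord_N.
  by rewrite ev_Conj !(@ev_TermIs _ _ _ _ c) // E eqxx.
rewrite [TestF _ _]/= (ev_exs_terms _ _ ok ec) ev_Atom.
rewrite nth_env_map ?size_map ?size_tuple //= all_ord_n /=.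
rewrite HBk ?ar_rel ?size_map ?size_tuple ?all_ord_n //; last first.
  by apply: leq_trans (leq_addr _ _).
by rewrite blk_rel -/(index_of _ _) index_of_map.
Qed.

Lemma ev_keep e lv r s ds t : all (gtn N) e -> (exists r0, enc (r0, s) (XX (nth 0 e lv))) ->
  srl t -> size ds = sar t -> all (gtn N) ds ->
  ev N It (ds ++ e) (keep lv r t) = sencf (r, s) t ds.
Proof.
move=> ok [r0 ec] rt sd ad; have := ev_AX N n Bk XX e lv sd; rewrite (ec _ _ rt sd ad).
case: t rt sd => [[[o|x]|a]|[]] //= rt sd E.
by case: asboolP; rewrite ?ev_TT ?ev_FF.
Qed.

Lemma ev_keep_but e lv r s x f (u : 'I_n) ds t : all (gtn N) e ->
  (exists r0, enc (r0, s) (XX (nth 0 e lv))) ->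
  (forall v, v < N -> ev N It (v :: e) f = (v == u :> nat)) ->
  srl t -> size ds = sar t -> all (gtn N) ds ->
  ev N It (ds ++ e) (keep_but lv r x f t) = sencf (r, set_var s x u) t ds.
Proof.
move=> ok ec Hf rt sd ad; rewrite /keep_but; case: eqP => [E|ne].
  subst t; case: ds sd ad => [|v [|]] //= _ /andP[vN _].
  by rewrite Hf // ffunE eqxx.
rewrite (@ev_keep _ _ _ s) //; case: t rt sd ne => [[[o|y]|a]|[]] //= rt sd ne.
by rewrite ffunE; case: (y =P x) => // E; case: ne; rewrite E.
Qed.

Lemma ev_write_cell e lv r0 r s a ts t ds tg : all (gtn N) e -> enc (r0, s) (XX (nth 0 e lv)) ->
  srl tg -> size ds = sar tg -> all (gtn N) ds ->
  ev N It (ds ++ e) (@write_cell lv r a ts t tg) =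
  sencf (r, set_cell s (@cell sg A z mx k m dim s a ts) (eval_term (z : A) mx s t)) tg ds.
Proof.
move=> ok ec rt sd ad; rewrite /write_cell; case: eqP => [E|ne].
  subst tg; have sda : size ds = (dim a).+1 by [].
  have sdd : dim a <= size ds by rewrite sda.
  have ok' : all (gtn N) (ds ++ e) by rewrite all_cat ad.
  have ec' : enc (r0, s) (XX (nth 0 (ds ++ e) (lv + (dim a).+1))) by rewrite nth_shift_cat.
  rewrite ev_Disj !ev_Conj ev_Neg (@ev_keep _ _ _ s) //; last by exists r0.
  rewrite (ev_TermIs _ _ ok' ec') (ev_TermsAre _ sdd ok' ec') nth_cat sda leqnn /=.
  rewrite ffunE /cell; set idx := index_of _ _; set ev_ts := map_tuple _ _.
  have -> : (take (dim a) ds == map val ev_ts) =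
            all (gtn n) (take (dim a) ds) && (idx == ev_ts).
    apply/eqP/andP => [E|[al /eqP <-]].
      split; first by rewrite E all_ord_n.
      apply/eqP; rewrite -[RHS](index_of_map) -E /idx /index_of.
      by apply: eq_from_tnth => i; rewrite !tnth_mktuple nth_take.
    rewrite -(@map_index_of (dim a) (take (dim a) ds)) ?size_takel //.
    congr map; congr tval; apply: eq_from_tnth => i; rewrite !tnth_mktuple nth_take //.
  rewrite -/idx.
  have -> : (Tagged (fun a0 => (dim a0).-tuple 'I_n) idx == Tagged (fun a0 => (dim a0).-tuple A) ev_ts) = (idx == ev_ts).
    by rewrite eq_Tagged.
  by case: (all _ _) => //=; case: eqP => //= _; rewrite ?orbF.
rewrite (@ev_keep _ _ _ s) //; last by exists r0.
case: tg rt sd ne => [[[o|y]|a']|[]] //= rt sd ne.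
rewrite ffunE; case: (_ =P @cell sg A z mx k m dim s a ts) => // E.
by case: ne; congr (inl (inr _)); apply: (congr1 (@tag _ _) E).
Qed.

Lemma ev_next_formula e l l' r s : all (gtn N) e -> enc (r, s) (XX (nth 0 e l)) ->
  ev N It e (next_formula r l l') <->
  exists c', exec_instr (z : A) mx r s c' /\ enc c' (XX (nth 0 e l')).
Proof.
move=> ok ec.
have ex : exists r0, enc (r0, s) (XX (nth 0 e l)) by exists r.
have D F c' : (forall t ds, srl t -> size ds = sar t -> all (gtn N) ds ->
     ev N It (ds ++ e) (F t) = sencf c' t ds) ->
   ev N It e (FDef l' F) <-> exists c, c = c' /\ enc c (XX (nth 0 e l')).
  move=> H; split=> [/(ev_FDef_enc _ H) ?|[c [-> ?]]]; first by exists c'.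
  exact/(ev_FDef_enc _ H).
case: r ec ex => [|[x t|x a ts|a ts t|x|b w] r] ec ex.
- by rewrite ev_FF; split=> // -[c' [[]]].
- apply: D => tg ds; apply: ev_keep_but => // v vN.
  by rewrite (@ev_TermIs _ _ _ _ (Assign x t :: r, s)) //= vN.
- apply: D => tg ds; apply: ev_keep_but => // v vN.
  have ok1 : all (gtn N) (v :: e) by rewrite /= vN.
  rewrite (@ev_exs_terms (v :: e) l.+1 _ _ _ _ ok1 ec).
  set as_ := map val _; have sa : size as_ = dim a by rewrite size_map size_tuple.
  rewrite -cat_rcons; have sr : size (rcons as_ v) = sar (AR a) by rewrite size_rcons sa.
  rewrite addSnnS -[iota 0 _]/(iota 0 (sar (AR a))) (ev_AX N n Bk XX e l sr) ec //; last first.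
    by rewrite all_rcons /= vN; apply: all_ord_N.
  rewrite /= -cats1 -{1}sa take_size_cat // all_ord_n nth_cat sa ltnn subnn /=.
  suff -> : index_of (dim a) (as_ ++ [:: v]) = map_tuple (eval_term (z : A) mx s) ts by [].
  rewrite -[RHS]index_of_map; apply: eq_from_tnth => i.
  by rewrite !tnth_mktuple nth_cat sa ltn_ord.
- by apply: D => tg ds *; apply: (ev_write_cell _ _ _ ok ec).
- split=> [/ev_Ex[u uN]|[_ [[u ->] eu]]].
    rewrite ev_Conj ev_Small /= => /andP[un].
    have oku : all (gtn N) (u :: e) by rewrite /= uN.
    have H t ds : srl t -> size ds = sar t -> all (gtn N) ds ->
      ev N It (ds ++ u :: e) (keep_but l.+1 r x (FEq stag 0 1) t) = sencf (r, set_var s x (Ordinal un)) t ds.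
      by move=> *; apply: ev_keep_but => // v vN; rewrite ev_Eq.
    by move=> /(ev_FDef_enc _ H) eu; eexists; split; [exists (Ordinal un)|].
  apply/ev_Ex; exists u; first exact: ord_N.
  rewrite ev_Conj ev_Small /= ltn_ord /=.
  have oku : all (gtn N) ((u : nat) :: e) by rewrite /= ord_N.
  have H t ds : srl t -> size ds = sar t -> all (gtn N) ds ->
    ev N It (ds ++ (u : nat) :: e) (keep_but l.+1 r x (FEq stag 0 1) t) = sencf (r, set_var s x u) t ds.
    by move=> *; apply: ev_keep_but => // v vN; rewrite ev_Eq.
  exact/(ev_FDef_enc _ H).
rewrite [next_formula _ _ _]/= ev_Disj !ev_Conj ev_Neg (@ev_TestF _ _ _ _ ok ec) /=.
case: eval_test; rewrite /= ?orbF; apply: D => tg ds; exact: ev_keep.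
Qed.

End Formulas.

Definition scheme_good (c : conf) := List.In c.1 L.
Definition scheme_fin (c : conf) := c.1 = [::] /\ forall x, c.2.1 x = mx.

Lemma In_nth (r : code) : List.In r L -> exists o : 'I_(size L), nth [::] L o = r.
Proof.
elim: L => //= a s IH [<-|/IH[o <-]]; first by exists ord0.
by exists (lift ord0 o).
Qed.

Theorem scheme_simulates :
  simulates sar srl N n Bk scheme_sys sencf
    (fun c => c = (prog, init_store (z : A) k dim)) scheme_fin scheme_good
    (@ps_step sg A z mx k m dim).
Proof.
split.
- by move=> c ->; apply: conts_start.
- by move=> c c' gc /ps_stepE H; apply: closed_next H gc.
- move=> XX e l ok.
  have H t ds : srl t -> size ds = sar t -> all (gtn N) ds ->
     ev N (lev n Bk XX) (ds ++ e) (init_formula t) = sencf (prog, init_store (z : A) k dim) t ds.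
    move=> rt sd ad; have ok' : all (gtn N) (ds ++ e) by rewrite all_cat ad.
    case: t rt sd => [[[o|x]|a]|[]] //= _ sd.
    - by case: asboolP; rewrite ?ev_TT ?ev_FF.
    - by case: ds sd ad ok' => [|v []] //= _ _ ok'; rewrite ev_First // ffunE z0.
    rewrite ev_Conj ev_First // nth_cat sd leqnn ffunE z0 ev_conjs_map; congr (_ && _).
    apply/allP/(all_nthP 0) => [P i|P i]; rewrite ?size_takel ?sd // ?mem_iota => ia.
      have := P i; rewrite mem_iota ia ev_Small nth_cat sd ltnS (ltnW ia) => /(_ isT).
      by rewrite nth_take.
    have := P i; rewrite ?size_takel ?sd // => /(_ ia).
    by rewrite nth_take // ev_Small nth_cat sd ltnS (ltnW ia).
  split=> [/(ev_FDef_enc _ H) E|[_ [-> E]]]; last exact/(ev_FDef_enc _ H).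
  by eexists; split; last exact: E.
- move=> XX e l l' [r s] ok gc ec; rewrite ev_disjs_map.
  have PCE o : ev N (lev n Bk XX) e (Atom (AX (PC o)) [:: l]) = `[< nth [::] L o = r >].
    by rewrite ev_Atom /= (ec (PC o) [::]).
  have NX := @ev_next_formula XX e l l' r s ok ec.
  split=> [/hasP[o _]|[c' [/ps_stepE st ec']]].
    rewrite ev_Conj PCE => /andP[/asboolP ->] /NX[c' [nc' ec']].
    by exists c'; split=> //; apply/ps_stepE.
  have [o Eo] := In_nth gc; apply/hasP; exists o; first exact: mem_enum.
  rewrite ev_Conj PCE Eo; apply/andP; split; first exact/asboolP.
  by apply/NX; exists c'.
- move=> XX e l [r s] ok gc ec; rewrite ev_Conj ev_disjs_map ev_conjs_map.
  have PCE o : ev N (lev n Bk XX) e (Atom (AX (PC o)) [:: l]) = `[< nth [::] L o = r >].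
    by rewrite ev_Atom /= (ec (PC o) [::]).
  have VE x : ev N (lev n Bk XX) e (Ex (Conj (FOne stag 0) (Atom (AX (VR x)) [:: l.+1; 0]))) = (s.1 x == mx).
    apply/ev_Ex/eqP => [[v vN]|E].
      have ok' : all (gtn N) (v :: e) by rewrite /= vN.
      rewrite ev_Conj ev_One // ev_Atom /= ec //= ?vN // => /andP[/eqP -> /eqP E].
      by apply/val_inj; rewrite /= -E mx1.
    have ok' : all (gtn N) (1 :: e) by rewrite /= N1.
    by exists 1 => //; rewrite ev_Conj ev_One // ev_Atom /= ec //= ?N1 // E mx1.
  split=> [/andP[/hasP[o _] H1 /allP H2]|[/= Er Es]].
    split=> [|x]; last by apply/eqP; rewrite -VE; apply: H2; rewrite mem_enum.
    by move: H1; case: asboolP => [E|_]; rewrite ?ev_FF // PCE => /asboolP <-.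
  apply/andP; split; last by apply/allP => x _; rewrite VE Es.
  have [o Eo] := In_nth gc; apply/hasP; exists o; first exact: mem_enum.
  case: asboolP => [_|]; first by rewrite PCE; apply/asboolP.
  by rewrite Eo.
Qed.

End Simulation.

End System.

(** * Recognizing encodings *)

Lemma eq_table n a F G : (forall l, size l = a -> all (gtn n) l -> F l = G l) ->
  table n a F = table n a G.
Proof.
move=> H; apply/eq_in_map => l /mapP[x]; rewrite mem_iota => /= xn ->.
by apply: H; [apply: size_digits|apply: digits_lt].
Qed.

Lemma table_nth n s a : 0 < n -> size s = n ^ a ->
  table n a (fun l => nth false s (val_of n l)) = s.
Proof.
move=> n0 sz; rewrite /table /tuples_lt -map_comp -[RHS](mkseq_nth false) sz.
by apply/eq_in_map => x; rewrite mem_iota => /= xn; rewrite val_digits.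
Qed.

Section Encodings.
Variables (sg : signature) (n : nat).
Notation ars := (arities sg).

Definition agrees (z : 'I_n) (I : interp sg 'I_n) (Bk : nat -> seq nat -> bool) : Prop :=
  forall b l, b < nblk sg -> size l = ar_of sg b -> all (gtn n) l -> Bk b l = blk z I b l.

Lemma encode_wellformed (z : 'I_n) (I : interp sg 'I_n) : 1 < n ->
  let u := flatten (tables sg n (blk z I)) in
  wellformed ars (encode I) n u /\ agrees z I (tabblk ars n u).
Proof.
move=> n1 u; split.
  by split=> //; [apply: encodeE|rewrite size_flatten shape_tables].
move=> b l bn sl al; rewrite /tabblk /blens -(shape_tables sg n (blk z I)) flattenK.
by rewrite (nth_map 0) ?size_iota // nth_iota // add0n nth_table.
Qed.

Lemma flatten_tables_tabblk u : 0 < n -> size u = sumn (blens ars n) ->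
  flatten (tables sg n (tabblk ars n u)) = u.
Proof.
move=> n0 su; rewrite -[RHS](reshapeKr (sh := blens ars n)) ?su //; congr flatten.
have sb : size (blens ars n) = nblk sg by rewrite size_map size_arities.
apply: (@eq_from_nth _ [::]) => [|b]; rewrite size_map size_iota ?size_reshape ?sb // => bn.
rewrite (nth_map 0) ?size_iota // nth_iota // add0n table_nth // -nth_shape reshapeKl ?su //.
by rewrite (nth_map 0) ?size_arities.
Qed.

(** Any bits of the right number are the table of a relation; only the blocks of constants are
    subject to a condition, and choosing the marked elements completes the interpretation. *)
Lemma wellformed_encode w u (z : 'I_n) : wellformed ars w n u ->
  (forall j : 'I_(ncst sg), exists x : 'I_n, forall y, y < n -> tabblk ars n u (nrel sg + j) [:: y] = (y == x)) ->
  exists I : interp sg 'I_n, w = encode I /\ agrees z I (tabblk ars n u).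
Proof.
move=> [-> n1 su] /choice[f Hf].
pose I := Interp (fun i (t : (arity i).-tuple 'I_n) => tabblk ars n u i (map val t)) f.
have ag : agrees z I (tabblk ars n u).
  move=> b l; case: (ltnP b (nrel sg)) => [bn _|bn bN].
    rewrite -[b]/(nat_of_ord (Ordinal bn)) ar_rel => sl al.
    by rewrite blk_rel -[in LHS](map_index_of z sl al).
  have bc : b - nrel sg < ncst sg by move: bN; rewrite /nblk; lia.
  have -> : b = nrel sg + Ordinal bc by rewrite /= subnKC.
  rewrite ar_cst; case: l => [|y [|]] //= _ /andP[yn _].
  by rewrite (Hf (Ordinal bc)) // (blk_cst z I (Ordinal bc)).
exists I; split=> //; rewrite (encodeE z) -{1}(flatten_tables_tabblk (ltnW n1) su).
congr (_ ++ _ :: flatten _); apply/eq_in_map => b; rewrite mem_iota => /= bn.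
by apply: eq_table => l sl al; apply: ag.
Qed.

(** The block of a constant must mark exactly one element, the one property of an encoding that is
    not a matter of lengths. *)
Definition FWF (T : Type) : fo T :=
  conjs [seq Ex (Conj (Atom (ABlk (nrel sg + j)) [:: 0])
                (All (Imp (Atom (ABlk (nrel sg + j)) [:: 0]) (FEq _ 0 1)))) | j : 'I_(ncst sg) <- enum 'I_(ncst sg)].

Lemma ev_FWF T N Bk X : n <= N -> ev N (interp_atom n Bk X) [::] (FWF T) <->
  forall j : 'I_(ncst sg), exists x : 'I_n, forall y, y < n -> Bk (nrel sg + j) [:: y] = (y == x).
Proof.
move=> nN; rewrite ev_conjs_map; split=> [/allP H j|H].
  have /ev_Ex[x xN] := H j (mem_enum _ _).
  rewrite ev_Conj ev_Atom /= andbT => /andP[/andP[xn Bx]] /ev_All Hy.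
  exists (Ordinal xn) => y yn; apply/idP/eqP => [By|-> //].
  have := Hy y (leq_trans yn nN); rewrite ev_Imp ev_Eq ev_Atom /= yn By => /eqP.
  by [].
apply/allP => j _; have [x Hx] := H j.
apply/ev_Ex; exists x; first exact: leq_trans (ltn_ord x) nN.
rewrite ev_Conj ev_Atom /= ltn_ord Hx // eqxx /=.
apply/ev_All => y yN; rewrite ev_Imp ev_Eq ev_Atom /= andbT; apply/implyP => /andP[yn].
by rewrite Hx.
Qed.

End Encodings.

(** [b] does not depend on the word, so it can be moved in front of all quantifiers. *)
Lemma qval_and P (b : bool) qs W : qval (fun V => b && P V) qs W = b && qval P qs W.
Proof.
elim: qs W => //= q qs IH W; rewrite !IH {IH}; case: b => //=.
by case: q.
Qed.

(** * Short runs *)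

Section ShortRuns.
Variables (C : Type) (R : C -> C -> Prop) (good : C -> Prop) (X : finType) (code : C -> X).
Hypothesis good_stp : forall c c', good c -> R c c' -> good c'.
Hypothesis code_inj : forall c c', good c -> reaches R c c' -> code c = code c' -> c = c'.

Lemma seq_nsteps (f : nat -> C) i d : (forall j, j < i + d -> R (f j) (f j.+1)) ->
  nsteps R d (f i) (f (i + d)).
Proof.
elim: d i => [|d IH] i H /=; first by rewrite addn0.
exists (f i.+1); split; first by apply: H; lia.
by rewrite -addSnnS; apply: IH => j jd; apply: H; lia.
Qed.

(** Loops are cut out until no code repeats. The code has to separate a configuration only from its
    own descendants, so for arrays that grow along a run a mere count of cells can do. *)
Lemma short_run k c c' : good c -> nsteps R k c c' -> exists2 j, j < #|X| & nsteps R j c c'.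
Proof.
elim/ltn_ind: k => k IH gc nk; case: (ltnP k #|X|) => [kX|Xk]; first by exists k.
have [f [f0 fk fs]] := nsteps_seq nk.
have gf i : i <= k -> good (f i).
  by elim: i => [|i IHi] ik; rewrite ?f0 //; apply: good_stp (fs i ik); apply: IHi; apply: ltnW.
pose g (i : 'I_k.+1) := code (f i).
have : ~~ injectiveb g.
  by apply/negP => /injectiveP /leq_card; rewrite card_ord leqNgt ltnS Xk.
move=> /injectivePn[i [j ne E]].
wlog ij : i j ne E / i < j.
  move=> W; case: (ltngtP i j) => [ij|ij|/val_inj ij]; first exact: (W i j).
    by apply: (W j i) => //; rewrite eq_sym.
  by rewrite ij eqxx in ne.
have jk : j <= k by rewrite -ltnS.
have Eij : f i = f j.
  apply: code_inj E; first by apply: gf; apply: leq_trans jk; apply: ltnW.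
  exists (j - i); have := @seq_nsteps f i (j - i); rewrite subnKC ?(ltnW ij) //; apply.
  by move=> l lj; apply: fs; apply: leq_trans jk.
apply: (IH (i + (k - j))) => //; first by lia.
apply/nsteps_add; exists (f i); split.
  have := @seq_nsteps f 0 i; rewrite f0 add0n; apply=> l li; apply: fs; lia.
rewrite Eij -fk; have := @seq_nsteps f j (k - j); rewrite subnKC //; apply=> l lk.
by apply: fs; lia.
Qed.

End ShortRuns.

(** * Words holding a sequence of configurations *)

(** The word consists of one block per level, beginning with the code of [f l] and filled up with
    zeros in place of side bits. *)
Lemma word_levels (T : finType) (ar : T -> nat) (rl : pred T) (tb : T) (N D : nat) (C : Type)
    (encf : C -> T -> seq nat -> bool) (f : nat -> C) :
  #|T| <= N -> (forall t, ar t <= D) -> 1 < N -> ~~ rl tb ->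
  exists2 W, size W = N ^ D.+3 &
    forall l, l < N -> encodes ar rl N encf (f l) (word_rel tb N D W l).
Proof.
move=> TN arD N1 tbrl.
suff H L : exists2 W, size W = L * N ^ D.+2 &
    forall l, l < L -> encodes ar rl N encf (f l) (word_rel tb N D W l).
  by have [W sW HW] := H N; exists W => //; rewrite sW expnS.
elim: L => [|L [W sW HW]]; first by exists [::].
exists (W ++ word_of ar N D (encf (f L)) ++ nseq (sidelen N D) false).
  rewrite !size_cat size_word_of size_nseq (block_len D N1) sW mulSn; lia.
move=> l; rewrite ltnS leq_eqVlt => /orP[/eqP ->|lL]; first exact: enc_word.
by apply/(enc_prefix rl tb encf TN arD N1 (f l) _ sW lL); apply: HW.
Qed.

(** * Blocks mentioned by the formulas *)

Section BlkBounds.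
Variable T : finType.
Implicit Types (f g : fo T) (B : nat).

Lemma blk_bound_Conj f g : blk_bound (Conj f g) = maxn (blk_bound f) (blk_bound g).
Proof. by []. Qed.

Lemma blk_bound_conjs (J : Type) (F : J -> fo T) s B :
  (forall x, blk_bound (F x) <= B) -> blk_bound (conjs [seq F x | x <- s]) <= B.
Proof. by move=> H; elim: s => //= x s IH; rewrite geq_max H. Qed.

Lemma blk_bound_disjs (J : Type) (F : J -> fo T) s B :
  (forall x, blk_bound (F x) <= B) -> blk_bound (disjs [seq F x | x <- s]) <= B.
Proof. by move=> H; elim: s => //= x s IH; rewrite geq_max H. Qed.

Lemma blk_bound_exs d f : blk_bound (exs d f) = blk_bound f.
Proof. by elim: d f => //= d IH f; rewrite IH. Qed.

Lemma blk_bound_FDef ar rl l (F : T -> fo T) B : (forall t, blk_bound (F t) <= B) ->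
  blk_bound (FDef ar rl l F) <= B.
Proof.
move=> H; apply: blk_bound_conjs => t; rewrite /alls /= blk_bound_exs /=.
by rewrite !geq_max !H.
Qed.

End BlkBounds.

Section SchemeBlkBound.
Variables (sg : signature) (k m : nat) (dim : 'I_m -> nat) (prog : seq (instr sg k dim)).
Notation B := (nblk sg).

Lemma blk_bound_TermIs lv (t : term sg k) v : blk_bound (TermIs prog lv t v) <= B.
Proof. by case: t => //= j; rewrite /nblk -addnS leq_add2l. Qed.

Lemma blk_bound_TermsAre lv d (ts : d.-tuple (term sg k)) : blk_bound (TermsAre prog lv ts) <= B.
Proof. by apply: blk_bound_conjs => j; apply: blk_bound_TermIs. Qed.

Lemma blk_bound_TestF lv b : blk_bound (TestF prog lv b) <= B.
Proof.
elim: b lv => [i ts|t u|b IH|b IHb d IHd|b IHb d IHd] lv //=; rewrite ?geq_max ?IHb ?IHd ?blk_bound_TermIs //.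
rewrite blk_bound_exs /= geq_max blk_bound_TermsAre /=.
by apply: leq_trans (leq_addr _ _).
Qed.

Lemma blk_bound_keep lv r t : blk_bound (keep (prog := prog) lv r t) <= B.
Proof. by case: t => [[[o|x]|a]|[]] //=; case: asboolP. Qed.

Lemma blk_bound_keep_but lv r x f t : blk_bound f <= B ->
  blk_bound (keep_but (prog := prog) lv r x f t) <= B.
Proof. by rewrite /keep_but; case: ifP => // _ _; apply: blk_bound_keep. Qed.

Lemma blk_bound_next_formula r l l' : blk_bound (next_formula prog r l l') <= B.
Proof.
case: r => [//|[x t|x a ts|a ts t|x|b w] r] /=.
- by apply: blk_bound_FDef => tg; apply: blk_bound_keep_but; apply: blk_bound_TermIs.
- apply: blk_bound_FDef => tg; apply: blk_bound_keep_but.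
  by rewrite blk_bound_exs /= geq_max blk_bound_TermsAre.
- apply: blk_bound_FDef => tg; rewrite /write_cell; case: ifP => _; last exact: blk_bound_keep.
  by rewrite /= !geq_max blk_bound_TermsAre blk_bound_TermIs blk_bound_keep.
- by rewrite max0n; apply: blk_bound_FDef => tg; apply: blk_bound_keep_but.
rewrite !geq_max blk_bound_TestF.
by apply/andP; split; apply: blk_bound_FDef => tg; apply: blk_bound_keep.
Qed.

Lemma blk_bound_scheme_sys :
  [/\ forall l, blk_bound (INIT (scheme_sys prog) l) <= B,
      forall l l', blk_bound (STEP (scheme_sys prog) l l') <= B
    & forall l, blk_bound (FINAL (scheme_sys prog) l) <= B].
Proof.
split=> [l|l l'|l].
- apply: blk_bound_FDef => -[[[o|x]|a]|[]] //=; first by case: asboolP.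
  by rewrite geq_max andbT; apply: blk_bound_conjs.
- apply: blk_bound_disjs => o.
  have H := blk_bound_next_formula (nth [::] (conts prog) o) l l'.
  by rewrite [blk_bound _]max0n; exact: H.
rewrite /= geq_max; apply/andP; split; last exact: blk_bound_conjs.
by apply: blk_bound_disjs => o; case: asboolP.
Qed.

End SchemeBlkBound.

Lemma blk_bound_FWF sg (T : finType) : blk_bound (FWF sg T) <= nblk sg.
Proof.
apply: blk_bound_conjs => j /=; rewrite !geq_max /= andbT.
by rewrite /nblk -addnS leq_add2l ltn_ord.
Qed.

Section SystemBlkBound.
Variables (T : finType) (S : sysf T) (B : nat).
Hypothesis BS : [/\ forall l, blk_bound (INIT S l) <= B,
  forall l l', blk_bound (STEP S l l') <= B & forall l, blk_bound (FINAL S l) <= B].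

Lemma blk_bound_psiB : blk_bound (psiB S) <= B.
Proof. by case: BS => Bi Bs Bf; rewrite /= !geq_max Bi Bs Bf. Qed.

Lemma blk_bound_psiA ar rl tb : blk_bound (psiA ar rl tb S) <= B.
Proof.
case: BS => Bi Bs Bf; rewrite /psiA /FSame /= !geq_max Bi Bs Bf /=.
by apply: blk_bound_FDef.
Qed.

End SystemBlkBound.

(** * From schemes to machines *)

Section RunBounds.
Variables (sg : signature) (k m : nat) (dim : 'I_m -> nat) (prog : seq (instr sg k dim)).
Variables (n : nat) (ngt1 : 1 < #|'I_n|) (I : interp sg 'I_n) (z mx : 'I_n).
Notation L := (conts prog).
Let A : structure sg := @Structure sg 'I_n ngt1 I.
Notation stor := (store A k dim).
Notation conf := (seq (instr sg k dim) * stor)%type.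
Notation cells := {a : 'I_m & (dim a).-tuple 'I_n}.
Notation step := (@ps_step sg A z mx k m dim).

Definition dmax := \max_(a < m) dim a.

Lemma card_cells : #|{: cells}| <= m * n ^ dmax.
Proof.
rewrite card_tagged -[m in X in _ <= X]size_enum_ord; elim: (enum 'I_m) => //= a s IH.
rewrite mulSn card_tuple card_ord leq_add // leq_pexp2l //; last exact: (leq_bigmax a).
by apply: leq_ltn_trans (ltn_ord z).
Qed.

Definition cont_index (r : seq (instr sg k dim)) : 'I_(size L) :=
  odflt ord0 [pick o : 'I_(size L) | `[< nth [::] L o = r >]].

Lemma cont_indexK r : List.In r L -> nth [::] L (cont_index r) = r.
Proof.
move=> /In_nth[o Eo]; rewrite /cont_index; case: pickP => [o' /asboolP //|/(_ o)].
by case: asboolP.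
Qed.

(** All configurations are counted; the arrays make the bound exponential, which Savitch's recursion
    can afford. *)
Lemma run_bound_all k' c c' : scheme_good prog c -> nsteps step k' c c' ->
  exists2 j, j < size L * (n ^ k * n ^ #|{: cells}|) & nsteps step j c c'.
Proof.
move=> gc nk.
pose code (c : conf) := (cont_index c.1, c.2 : {ffun 'I_k -> 'I_n} * {ffun cells -> 'I_n}).
have gs c1 c2 : scheme_good prog c1 -> step c1 c2 -> scheme_good prog c2.
  by move=> g1 /ps_stepE H; apply: closed_next H g1.
have gr c1 c2 : scheme_good prog c1 -> reaches step c1 c2 -> scheme_good prog c2.
  move=> g1 [j]; elim: j c1 g1 => [|j IH] c1 g1 /=; first by move=> <-.
  by move=> [c3 [s1 s2]]; apply: IH s2; apply: gs s1.
have [|j jX nj] := short_run (code := code) gs _ gc nk.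
  move=> [r1 s1] [r2 s2] g1 R12 [E ->].
  by have := @cont_indexK r1 g1; rewrite E (@cont_indexK r2 (gr _ _ g1 R12)) => ->.
by exists j => //; move: jX; rewrite !card_prod !card_ffun !card_ord.
Qed.

Notation wom := (@writes_only_max sg k m dim).

Definition max_good (c : conf) :=
  [/\ scheme_good prog c, all wom c.1 & forall d : cells, (c.2.2 d == z) || (c.2.2 d == mx)].

Lemma max_good_step c c' : max_good c -> step c c' ->
  max_good c' /\ forall d : cells, c.2.2 d = mx -> c'.2.2 d = mx.
Proof.
case: c => r s [gc wc vc] /ps_stepE H.
have gc' : scheme_good prog c' by apply: closed_next H gc.
case: r H wc gc vc => [//|[x t|x a ts|a ts t|x|b w] r] /= => [Ec|Ec|Ec|[u Ec]|Ec] wc gc vc; subst c' => //=.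
- case: t wc gc gc' => // wc gc gc'; split=> [|d E]; last by rewrite ffunE; case: eqP.
  by split=> //= e; rewrite ffunE; case: ifP => _; [rewrite eqxx orbT|exact: vc].
- split=> //; split=> //=; case: ifP => _; last by case/andP: wc.
  by move: wc; rewrite all_cat /= => /andP[-> ->].
Qed.

(** Cells hold 0 or max and the set of cells at max only grows, so along a run its cardinality
    determines the arrays; this leaves polynomially many codes. *)
Lemma run_bound_max k' c c' : max_good c -> nsteps step k' c c' ->
  exists2 j, j < size L * n ^ k * #|{: cells}|.+1 & nsteps step j c c'.
Proof.
move=> gc nk.
pose full (c : conf) : {set cells} := [set d | c.2.2 d == mx].
pose code (c : conf) := (cont_index c.1, c.2.1 : {ffun 'I_k -> 'I_n}, inord #|full c| : 'I_(#|{: cells}|.+1)).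
have gs c1 c2 : max_good c1 -> step c1 c2 -> max_good c2.
  by move=> g1 s1; have [] := max_good_step g1 s1.
have gr c1 c2 : max_good c1 -> reaches step c1 c2 -> max_good c2 /\ full c1 \subset full c2.
  move=> g1 [j]; elim: j c1 g1 => [|j IH] c1 g1 /=; first by move=> <-.
  move=> [c3 [s1 s2]]; have [g3 H3] := max_good_step g1 s1; have [g2 S2] := IH _ g3 s2.
  split=> //; apply: subset_trans S2; apply/subsetP => d; rewrite !inE => /eqP/H3 ->.
  exact: eqxx.
have [|j jX nj] := short_run (code := code) gs _ gc nk.
  move=> c1 c2 g1 R12; have [g2 S12] := gr _ _ g1 R12.
  move=> [E1 E2 /(congr1 val)]; rewrite /= !inordK ?ltnS ?max_card // => E3.
  have EF : full c1 = full c2 by apply/eqP; rewrite eqEcard S12 E3 /=.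
  case: c1 c2 g1 g2 E1 E2 EF {R12 S12 E3} => r1 [v1 a1] [r2 [v2 a2]] [g1 _ V1] [g2 _ V2] /= E1 -> EF.
  have := @cont_indexK r1 g1; rewrite E1 (@cont_indexK r2 g2) => ->; congr (_, (_, _)).
  apply/ffunP => d; have := congr1 (fun S : {set cells} => d \in S) EF; rewrite !inE /=.
  case: (a2 d =P mx) => [->|ne2 /eqP ne1]; first by move/eqP.
  move: (V1 d) (V2 d) => /=; rewrite (negbTE (introN eqP ne2)) orbF => + /eqP ->.
  by rewrite (negbTE (introN eqP ne1)) orbF => /eqP.
by exists j => //; move: jX; rewrite !card_prod !card_ffun !card_ord.
Qed.

End RunBounds.

(** * Placing a scheme in NP and in PSPACE *)

Section SchemeToMachine.
Variables (sg : signature) (P : scheme sg) (Om : problem sg).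
Hypothesis defP : defines P Om.
Notation ars := (arities sg).
Notation prog := (body P).
Notation tag := (stag prog).
Notation k := (nvar P).
Notation m := (narr P).
Notation d := (dmax (@adim _ P)).

(** One exponent for all demands: each summand [a] pays for a factor or a count [a], as [a < n ^ a];
    the 3 is slack for the successor of [d] and the two end levels of Savitch's recursion. *)
Definition scheme_exp := #|tag| + size (conts prog) + k + m + d + 3.
Notation K := scheme_exp.

Lemma scheme_exp_gt0 : 0 < K. Proof. by rewrite /K; lia. Qed.

Lemma card_tag_exp : #|tag| <= 2 ^ K.
Proof.
apply: leq_trans (ltnW (ltn_expl _ (ltnSn 1))) _; rewrite leq_exp2l // /K; lia.
Qed.

Lemma sar_le (t : tag) : sar t <= d.+1.
Proof. by case: t => [[[o|x]|a]|[]] //=; rewrite ltnS (leq_bigmax a). Qed.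

Lemma pow_le (n a : nat) : 1 < n -> a.+1 <= n ^ a.
Proof. by move=> n1; apply: ltn_expl. Qed.

Lemma short_bound n c : 1 < n -> c <= m * n ^ d -> size (conts prog) * n ^ k * c.+1 <= n ^ K.
Proof.
move=> n1 cm; apply: (@leq_trans (n ^ size (conts prog) * n ^ k * (n ^ m * n ^ d))).
  rewrite leq_mul ?leq_mul2r ?(ltnW (pow_le _ n1)) ?orbT //.
  apply: (@leq_trans (m.+1 * n ^ d)); last by rewrite leq_mul2r pow_le ?orbT.
  by rewrite mulSn addnC -addn1 leq_add // expn_gt0 ltnW.
by rewrite -!expnD leq_pexp2l ?(ltnW n1) // /K; lia.
Qed.

(** [n ^ K - 2] is the number of halvings that Savitch's recursion offers with [n ^ K] levels. *)
Lemma long_bound n c : 1 < n -> c <= m * n ^ d ->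
  size (conts prog) * (n ^ k * n ^ c) <= 2 ^ (n ^ K - 2).
Proof.
move=> n1 cm; set l := size _.
have nd e : n ^ e <= 2 ^ (n * e).
  by case: e => [|e]; rewrite ?muln0 // expnM leq_exp2r // ltnW // ltn_expl.
apply: (@leq_trans (2 ^ l * (2 ^ (n * k) * 2 ^ (n * c)))).
  by rewrite !leq_mul // ltnW // ltn_expl.
rewrite -!expnD leq_exp2l // leq_subRL; last first.
  by have := leq_pexp2l (ltnW n1) scheme_exp_gt0; rewrite expn1; apply: leq_trans n1.
apply: (@leq_trans ((l + k + m + 2) * n ^ d.+1)).
  have X0 : 0 < n ^ d by rewrite expn_gt0 ltnW.
  have nc : n * c <= n * (m * n ^ d) by rewrite leq_mul2l cm orbT.
  have nk : n * k <= k * n ^ d.+1 by rewrite expnS mulnC leq_mul2l; apply/orP; right; nia.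
  have nl : l + 2 <= (l + 2) * n ^ d.+1 by rewrite leq_pmulr // expn_gt0 ltnW.
  by rewrite expnS in nk nl *; nia.
apply: (@leq_trans (n ^ (l + k + m + 2) * n ^ d.+1)).
  by rewrite leq_mul2r (ltnW (pow_le _ n1)) orbT.
by rewrite -expnD leq_pexp2l ?(ltnW n1) // /K /l; lia.
Qed.

Section OneSize.
Variables (n : nat) (gt : 1 < #|'I_n|) (n1 : 1 < n) (I : interp sg 'I_n).
Let A : structure sg := @Structure sg 'I_n gt I.
Definition z0 : 'I_n := Ordinal (ltnW n1).
Definition mx1 : 'I_n := Ordinal n1.
Definition start_conf := (prog, init_store (z0 : A) k (@adim _ P)).

(** Choice independence fixes 0 and max as the elements 0 and 1 of the universe, which the formulas
    can define. *)
Lemma member_run : Om A <-> exists c c', [/\ c = start_conf,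
  reaches (@ps_step sg A z0 mx1 k m (@adim _ P)) c c' & scheme_fin (ngt1 := gt) (I := I) mx1 c'].
Proof.
have [ci dA] := defP; split=> [/dA [z [mx [ne acc]]]|[_ [c' [-> R12 [E F]]]]].
  have [s [R12 F]] := (ci A z mx z0 mx1 ne isT).1 acc.
  by exists start_conf, ([::], s); split.
apply/dA; exists z0, mx1; split=> //; exists c'.2; split=> //.
by case: c' E F R12 => r s /= -> _ R12.
Qed.

Variables (w u : seq bool).
Hypothesis ag : agrees z0 I (tabblk ars n u).
Notation N := (n ^ K).
Notation Bk := (tabblk ars n u).

Lemma n_le_N : n <= N.
Proof. by rewrite -[X in X <= _]expn1 leq_pexp2l ?(ltnW n1) ?scheme_exp_gt0. Qed.

Lemma N_gt1 : 1 < N. Proof. exact: leq_trans n1 n_le_N. Qed.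

Lemma tag_le_N : #|tag| <= N.
Proof. by apply: leq_trans card_tag_exp _; rewrite leq_exp2r // scheme_exp_gt0. Qed.

Lemma sim : simulates (@sar _ _ _ _ prog) (@srl _ _ _ _ prog) N n Bk (scheme_sys prog)
  (sencf (prog := prog) (ngt1 := gt) (I := I) z0) (eq^~ start_conf)
  (scheme_fin (ngt1 := gt) (I := I) mx1) (scheme_good prog (ngt1 := gt) (I := I))
  (@ps_step sg A z0 mx1 k m (@adim _ P)).
Proof. exact: (@scheme_simulates sg k m (@adim _ P) prog n N gt I Bk z0 mx1 erefl erefl n_le_N ag). Qed.

Lemma psiB_iff : all (@writes_only_max _ _ _ _) prog ->
  Om A <-> exists2 W, size W = N ^ d.+1.+3 &
    ev N (lev n Bk (word_rel (TB prog) N d.+1 W)) [::] (psiB (scheme_sys prog)).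
Proof.
move=> wm; rewrite member_run; split=> [[c [c' [Ec [k' Rk] F]]]|[W _ /(psiB_sound sim (ltnW N_gt1))] //].
have gc : max_good prog (ngt1 := gt) (I := I) z0 mx1 c.
  rewrite Ec; split=> //=; first exact: conts_start.
  by move=> e; rewrite ffunE eqxx.
have [j jb Rj] := run_bound_max gc Rk.
have jN : j < N by apply: leq_trans jb _; apply: short_bound => //; apply: (@card_cells _ _ _ z0).
have [f Hf] := psiB_complete sim (ltnW N_gt1) Ec Rj F jN.
have [W sW HW] := word_levels (sencf (prog := prog) (ngt1 := gt) (I := I) z0) f tag_le_N sar_le N_gt1
  (isT : ~~ srl (TB prog)).
by exists W => //; apply: Hf.
Qed.

Lemma psiA_iff : Om A <-> qval (phiA (@sar _ _ _ _ prog) (@srl _ _ _ _ prog) (TB prog) N d.+1 n Bk (scheme_sys prog))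
    (flatten (nseq N (quants N d.+1))) [::].
Proof.
rewrite member_run; split=> [[c [c' [Ec [k' Rk] F]]]|H]; last first.
  exact: (savitch_sound sim tag_le_N sar_le N_gt1 (isT : ~~ srl (TB prog)) erefl H).
have gc : scheme_good prog (ngt1 := gt) (I := I) c by rewrite Ec; apply: conts_start.
have [j jb Rj] := run_bound_all gc Rk.
apply: (savitch_complete sim tag_le_N sar_le N_gt1 (isT : ~~ srl (TB prog)) erefl Ec Rj F).
by apply: leq_trans (ltnW jb) _; apply: long_bound => //; apply: (@card_cells _ _ _ z0).
Qed.

End OneSize.

(** [FWF] speaks about blocks alone, so it is evaluated without second-order relations, over the
    tags [unit]. *)
Lemma encoding_wellformed (Q : nat -> seq bool -> Prop) :
  (forall n (gt : 1 < #|'I_n|) (n1 : 1 < n) I u, agrees (z0 n1) I (tabblk ars n u) ->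
     Om (@Structure sg 'I_n gt I) <-> Q n u) ->
  forall w, encoding Om w <-> exists n u, wellformed ars w n u /\
    (ev (n ^ K) (interp_atom n (tabblk ars n u) (fun (_ : unit) _ => false)) [::] (FWF sg unit) /\ Q n u).
Proof.
move=> H w; split=> [[n [gt [I [OI ->]]]]|[n [u [wf [wF q]]]]].
  have n1 : 1 < n by move: (gt); rewrite card_ord.
  have [wf ag] := @encode_wellformed sg n (z0 n1) I n1.
  eexists n, _; split; first exact: wf.
  split; last by apply/(H n gt n1 I).
  apply/ev_FWF; first exact: n_le_N.
  move=> j; exists (cst_of I j) => y yn; rewrite ag ?ltn_add2l ?ar_cst //= ?yn //.
  by rewrite blk_cst.
have n1 : 1 < n by case: wf.
have gt : 1 < #|'I_n| by rewrite card_ord.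
have [I [-> ag]] := wellformed_encode (z0 n1) wf ((ev_FWF _ _ _ (n_le_N n1)).1 wF).
by exists n, gt, I; split=> //; apply/(H n gt n1 I u ag).
Qed.

Lemma ev_FWF_indep (T T' : Type) N n Bk (X : T -> seq nat -> bool) (X' : T' -> seq nat -> bool) : n <= N ->
  ev N (interp_atom n Bk X) [::] (FWF sg T) = ev N (interp_atom n Bk X') [::] (FWF sg T').
Proof. by move=> nN; apply/idP/idP => /ev_FWF H; apply/ev_FWF => //; apply: H. Qed.

Theorem scheme_np : all (@writes_only_max _ _ _ _) prog -> NP Om.
Proof.
move=> wm; have bl : blk_bound (Conj (FWF sg tag) (psiB (scheme_sys prog))) <= size ars.
  rewrite size_arities blk_bound_Conj geq_max blk_bound_FWF.
  by apply: blk_bound_psiB; apply: blk_bound_scheme_sys.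
apply: (formula_np (K := K) (D := d.+1) (tb := TB prog) scheme_exp_gt0 card_tag_exp bl) => w.
rewrite (encoding_wellformed (fun n gt n1 I u ag => psiB_iff gt ag wm)).
split=> -[n [u [wf H]]]; exists n, u; split=> //; have n1 : 1 < n by case: wf.
  case: H => wF [W sW pW]; exists W => //; rewrite /phi ev_Conj pW andbT.
  by rewrite (ev_FWF_indep _ _ (fun (_ : unit) _ => false) (n_le_N n1)).
case: H => W sW; rewrite /phi ev_Conj => /andP[wF pW]; split; last by exists W.
by rewrite (ev_FWF_indep _ _ (fun (_ : unit) _ => false) (n_le_N n1)) in wF.
Qed.

Theorem scheme_pspace : PSPACE Om.
Proof.
pose f := psiA (@sar _ _ _ _ prog) (@srl _ _ _ _ prog) (TB prog) (scheme_sys prog).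
have bl : blk_bound (Conj (FWF sg tag) f) <= size ars.
  rewrite size_arities blk_bound_Conj geq_max blk_bound_FWF.
  by apply: blk_bound_psiA; apply: blk_bound_scheme_sys.
apply: (formula_pspace (K := K) (D := d.+1) (tb := TB prog) scheme_exp_gt0 card_tag_exp bl) => w.
rewrite (encoding_wellformed (fun n gt n1 I u ag => psiA_iff gt ag)).
have E n u : 1 < n -> qval (phi ars K d.+1 (TB prog) (Conj (FWF sg tag) f) n u)
    (flatten (nseq (n ^ K) (quants (n ^ K) d.+1))) [::] =
  ev (n ^ K) (interp_atom n (tabblk ars n u) (fun (_ : unit) _ => false)) [::] (FWF sg unit) &&
  qval (phiA (@sar _ _ _ _ prog) (@srl _ _ _ _ prog) (TB prog) (n ^ K) d.+1 n (tabblk ars n u) (scheme_sys prog))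
    (flatten (nseq (n ^ K) (quants (n ^ K) d.+1))) [::].
  move=> n1; rewrite -qval_and; congr (qval _ _ _); apply: funext => W; rewrite /phi ev_Conj.
  by rewrite (ev_FWF_indep _ _ (fun (_ : unit) _ => false) (n_le_N n1)).
split=> -[n [u [wf H]]]; exists n, u; split=> //; have n1 : 1 < n by case: wf.
  by rewrite E //; apply/andP.
by move: H; rewrite E // => /andP.
Qed.

End SchemeToMachine.

(** * Problems defined by schemes are closed under extensions *)

Section Extension.
Variables (sg : signature) (B : structure sg) (S : {set B}) (S_gt1 : 1 < #|S|).
Variable cS : forall j, cst_of (itp B) j \in S.
Let A := substructure S_gt1 cS.
Variables (z mx : A).
Variables (k m : nat) (dim : 'I_m -> nat).

(** Only cells indexed by tuples of the substructure are compared: the replayed run addresses no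
    others. *)
Definition extends (s : store A k dim) (t : store B k dim) : Prop :=
  (forall x, t.1 x = val (s.1 x)) /\
  forall a (d : (dim a).-tuple A),
    t.2 (Tagged (fun a => (dim a).-tuple B) (map_tuple val d)) = val (s.2 (Tagged (fun a => (dim a).-tuple A) d)).

Lemma eval_term_ext s t (u : term sg k) : extends s t ->
  eval_term (val z) (val mx) t u = val (eval_term z mx s u).
Proof. by move=> [E _]; case: u => //= x. Qed.

Lemma map_eval_ext s t d (ts : d.-tuple (term sg k)) : extends s t ->
  map_tuple (eval_term (val z) (val mx) t) ts = map_tuple val (map_tuple (eval_term z mx s) ts).
Proof. by move=> st; apply: eq_from_tnth => i; rewrite !tnth_map (eval_term_ext _ st). Qed.

(** Tests are quantifier-free, hence take the same value in a substructure and in its extension. *)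
Lemma eval_test_ext s t (b : test sg k) : extends s t ->
  eval_test (val z) (val mx) t b = eval_test z mx s b.
Proof.
move=> st; elim: b => [i ts|u v|b IH|b IHb c IHc|b IHb c IHc] //=; rewrite ?IH ?IHb ?IHc //.
  by rewrite (map_eval_ext _ st).
by rewrite !(eval_term_ext _ st) (inj_eq val_inj).
Qed.

Lemma extends_set s t x (u : A) : extends s t -> extends (set_var s x u) (set_var t x (val u)).
Proof. by move=> [E1 E2]; split=> // y; rewrite !ffunE E1; case: ifP. Qed.

Lemma next_ext r s t c : extends s t -> exec_instr z mx r s c ->
  exists2 c', exec_instr (val z) (val mx) r t c' & c'.1 = c.1 /\ extends c.2 c'.2.
Proof.
move=> st; have [E1 E2] := st.
case: r => [//|[x u|x a ts|a ts u|x|b w] r] /= => [->|->|->|[u ->]|->].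
- eexists; first by []; split=> //=; rewrite (eval_term_ext _ st); exact: extends_set.
- eexists; first by []; split=> //=; rewrite /cell (map_eval_ext _ st) E2; exact: extends_set.
- eexists; first by []; split=> //=; split=> //= a' d; rewrite !ffunE E2 (eval_term_ext _ st).
  rewrite /cell (map_eval_ext _ st).
  case: (eqVneq a' a) => [E|ne]; last first.
    case: eqP => [/(congr1 (@tag _ _)) /= E|_]; first by rewrite E eqxx in ne.
    by case: eqP => [/(congr1 (@tag _ _)) /= E|_] //; rewrite E eqxx in ne.
  subst a'; rewrite !eq_Tagged /= (inj_eq _) //; first by case: ifP.
  by move=> d1 d2 /(congr1 val) /= /(inj_map val_inj) /val_inj.
- exists (r, set_var t x (val u)); first by exists (val u).
  by split=> //=; exact: extends_set.
- by eexists; [by []|]; rewrite (eval_test_ext _ st).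
Qed.

Lemma run_ext j c c' t : extends c.2 t -> nsteps (@ps_step sg A z mx k m dim) j c c' ->
  exists2 t', nsteps (@ps_step sg B (val z) (val mx) k m dim) j (c.1, t) (c'.1, t') & extends c'.2 t'.
Proof.
elim: j c t => [|j IH] c t st /=; first by move=> <-; exists t.
move=> [c1 [/ps_stepE nc /(IH _ _) H]].
have [[r1 t1] nt [/= Er st1]] := next_ext st nc.
have [t' Rt st'] := H _ st1.
exists t' => //; exists (r1, t1); split; first exact/ps_stepE.
by rewrite Er.
Qed.

End Extension.

Theorem scheme_ext sg (P : scheme sg) (Om : problem sg) : defines P Om -> EXT Om.
Proof.
move=> [_ dP] B S S_gt1 cS /dP [z [mx [ne [s [[j Rj] F]]]]]; apply/dP.
exists (val z), (val mx); split; first by rewrite (inj_eq val_inj).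
have [|t' Rt [E _]] := run_ext (t := init_store (val z) (nvar P) (@adim _ P)) _ Rj.
  by split=> [x|a d]; rewrite !ffunE.
by exists t'; split; [exists j|move=> x; rewrite E F].
Qed.

(** * Turing machines as first-order transition systems *)

Lemma nsteps_rcons (A : Type) (R : A -> A -> Prop) k x y z : nsteps R k x y -> R y z -> nsteps R k.+1 x z.
Proof.
by move=> Rk yz; rewrite -addn1; apply/nsteps_add; exists y; split=> //; exists z.
Qed.

(** * Where the table entries stand in the encoding *)

Section EncodePositions.
Variables (sg : signature) (n : nat) (z : 'I_n) (I : interp sg 'I_n).
Notation w := (encode I).
Notation ar := (ar_of sg).

Definition blk_start (b : nat) : nat := n.+1 + sumn (take b [seq n ^ a | a <- arities sg]).

Lemma blk_start0 : blk_start 0 = n.+1.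
Proof. by rewrite /blk_start take0 addn0. Qed.

Lemma blk_startS b : b < nblk sg -> blk_start b.+1 = blk_start b + n ^ ar b.
Proof.
move=> bn; rewrite /blk_start (take_nth 0) ?size_map ?size_arities // sumn_rcons addnA.
by rewrite (nth_map 0) ?size_arities.
Qed.

Lemma nth_expn_ar b : b < nblk sg -> nth 0 [seq n ^ a | a <- arities sg] b = n ^ ar b.
Proof. by move=> bn; rewrite (nth_map 0) ?size_arities. Qed.

Lemma size_encode : size w = n.+1 + sumn [seq n ^ a | a <- arities sg].
Proof. by rewrite (encodeE z) size_cat size_nseq /= size_flatten shape_tables; lia. Qed.

Lemma nth_encode_low p : p <= n -> nth false w p = (p < n).
Proof.
rewrite (encodeE z) nth_cat size_nseq nth_nseq leq_eqVlt => /orP[/eqP ->|pn]; last by rewrite pn.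
by rewrite ltnn subnn.
Qed.

Lemma nth_encode b v : b < nblk sg -> v < n ^ ar b ->
  blk_start b + v < size w /\ nth false w (blk_start b + v) = blk z I b (digits n (ar b) v).
Proof.
move=> bn vn; have n0 : 0 < n by apply: leq_ltn_trans (ltn_ord z).
have vn' : v < nth 0 [seq n ^ a | a <- arities sg] b by rewrite nth_expn_ar.
have fl := flatten_indexP vn'; rewrite /flatten_index in fl.
split; first by rewrite size_encode /blk_start -addnA ltn_add2l.
rewrite (encodeE z) nth_cat size_nseq /blk_start ltnNge.
have -> : n <= n.+1 + sumn (take b [seq n ^ a | a <- arities sg]) + v by lia.
rewrite -addnA addSn -addnS addKn /=.
rewrite nth_flatten shape_tables (flatten_indexKl vn') (flatten_indexKr vn').
rewrite (nth_map 0) ?size_iota // nth_iota // add0n -{1}(val_digits n0 vn).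
by rewrite nth_table ?size_digits // digits_lt.
Qed.

Lemma encode_position p : n < p -> p < size w ->
  exists b v, [/\ b < nblk sg, v < n ^ ar b & p = blk_start b + v].
Proof.
move=> np; rewrite size_encode => pw; set sh := [seq n ^ a | a <- arities sg] in pw *.
have iS : p - n.+1 < sumn sh by lia.
exists (reshape_index sh (p - n.+1)), (reshape_offset sh (p - n.+1)).
have bn := reshape_indexP iS; rewrite size_map size_arities in bn.
split=> //; first by rewrite -nth_expn_ar //; apply: reshape_offsetP.
by rewrite /blk_start -addnA -[X in n.+1 + X]/(flatten_index sh _ _) reshape_indexK; lia.
Qed.

End EncodePositions.

(** * Numbers below [n ^ a] as tuples of small numbers *)

Section SmallTuples.
Variables (T : Type) (N n : nat) (Bk : nat -> seq nat -> bool) (X : T -> seq nat -> bool).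
Notation It := (interp_atom n Bk X).
Hypotheses (n0 : 0 < n) (nN : n <= N).

Definition Smalls (a : nat) : fo T := conjs [seq FSmall T i | i <- iota 0 a].
Definition exsmall (a : nat) (f : fo T) : fo T := exs a (Conj (Smalls a) f).

Lemma ev_Smalls ds e a : size ds = a -> ev N It (ds ++ e) (Smalls a) = all (gtn n) ds.
Proof.
move=> sd; rewrite ev_conjs_map -[in RHS](@nth_env_map ds e a) // all_map.
by apply: eq_all => i.
Qed.

Lemma ev_exsmall e a f :
  reflect (exists2 v, v < n ^ a & ev N It (digits n a v ++ e) f) (ev N It e (exsmall a f)).
Proof.
apply: (iffP (@ev_exs _ _ _ _ _ _ _ _)) => [[ds [sd ad]]|[v va fv]].
  rewrite ev_Conj ev_Smalls // => /andP[sm fd].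
  by exists (val_of n ds); rewrite -sd ?val_of_lt ?digits_val.
exists (digits n a v); rewrite size_digits ev_Conj fv ev_Smalls ?size_digits // digits_lt //.
split=> //; apply/allP => x /(allP (digits_lt va)) xn; exact: leq_trans xn nN.
Qed.

Definition ZeroT a xs : fo T := Neg (exsmall a (FLex T (iota 0 a) [seq x + a | x <- xs])).
Definition MaxT a xs : fo T := Neg (exsmall a (FLex T [seq x + a | x <- xs] (iota 0 a))).
Definition SuccT a xs ys : fo T :=
  Conj (FLex T xs ys)
       (Neg (exsmall a (Conj (FLex T [seq x + a | x <- xs] (iota 0 a))
                             (FLex T (iota 0 a) [seq y + a | y <- ys])))).

Lemma ev_Lex_digits e a xs ys v v' : v < n ^ a -> v' < n ^ a ->
  [seq nth 0 e x | x <- xs] = digits n a v -> [seq nth 0 e x | x <- ys] = digits n a v' ->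
  ev N It e (FLex T xs ys) = (v < v').
Proof.
move=> va va' Ex Ey; rewrite (@ev_Lex T N n Bk X n) ?Ex ?Ey ?digits_lt // ?val_digits //.
by have := congr1 size Ex; have := congr1 size Ey; rewrite !size_map !size_digits => -> ->.
Qed.

Lemma shift_digits e a xs v u : [seq nth 0 e x | x <- xs] = digits n a v ->
  [seq nth 0 (digits n a u ++ e) x | x <- [seq x + a | x <- xs]] = digits n a v.
Proof.
move=> <-; rewrite -map_comp; apply: eq_map => x /=.
by rewrite nth_env_shift // size_digits.
Qed.

Lemma head_digits e a u : [seq nth 0 (digits n a u ++ e) x | x <- iota 0 a] = digits n a u.
Proof. by rewrite nth_env_map // size_digits. Qed.

Lemma ev_ZeroT e a xs v : v < n ^ a -> [seq nth 0 e x | x <- xs] = digits n a v ->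
  ev N It e (ZeroT a xs) = (v == 0).
Proof.
move=> va Ev; rewrite ev_Neg; apply/idP/eqP => [/ev_exsmall H|E]; last first.
  subst v; apply/ev_exsmall => -[u ua].
  by rewrite (ev_Lex_digits ua va (head_digits _ _ _) (shift_digits _ Ev)).
case: v va Ev H => // v va Ev []; exists 0; first by rewrite expn_gt0 n0.
  by rewrite (ev_Lex_digits _ va (head_digits _ _ _) (shift_digits _ Ev)) // expn_gt0 n0.
Qed.

Lemma ev_MaxT e a xs v : v < n ^ a -> [seq nth 0 e x | x <- xs] = digits n a v ->
  ev N It e (MaxT a xs) = (v.+1 == n ^ a).
Proof.
move=> va Ev; rewrite ev_Neg; apply/idP/eqP => [/ev_exsmall H|E].
  apply/eqP; rewrite eqn_leq va /= leqNgt; apply/negP => lt; apply: H.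
  exists v.+1 => //; by rewrite (ev_Lex_digits va lt (shift_digits _ Ev) (head_digits _ _ _)).
apply/ev_exsmall => -[u ua].
rewrite (ev_Lex_digits va ua (shift_digits _ Ev) (head_digits _ _ _)); lia.
Qed.

Lemma ev_SuccT e a xs ys v v' : v < n ^ a -> v' < n ^ a ->
  [seq nth 0 e x | x <- xs] = digits n a v -> [seq nth 0 e x | x <- ys] = digits n a v' ->
  ev N It e (SuccT a xs ys) = (v' == v.+1).
Proof.
move=> va va' Ev Ev'; rewrite ev_Conj ev_Neg (ev_Lex_digits va va' Ev Ev').
apply/andP/eqP => [[lt /ev_exsmall H]|E].
  apply/eqP; rewrite eqn_leq lt andbT leqNgt; apply/negP => lt'; apply: H.
  have va1 : v.+1 < n ^ a by apply: ltn_trans lt' va'.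
  exists v.+1 => //; rewrite ev_Conj (ev_Lex_digits va va1 (shift_digits _ Ev) (head_digits _ _ _)).
  by rewrite (ev_Lex_digits va1 va' (head_digits _ _ _) (shift_digits _ Ev')) ltnS leqnn lt'.
split; [by rewrite E|apply/ev_exsmall => -[u ua]].
rewrite ev_Conj (ev_Lex_digits va ua (shift_digits _ Ev) (head_digits _ _ _)).
by rewrite (ev_Lex_digits ua va' (head_digits _ _ _) (shift_digits _ Ev')); lia.
Qed.

End SmallTuples.

(** * Machine configurations as relations *)

Section MachineSystem.
Variables (sg : signature) (M : tm).
Notation ar := (ar_of sg).
Notation tapes := 'I_(ntape M).+1.

Definition mtag : finType := (state M + tapes * sym M + tapes + 'I_(nblk sg))%type.
Definition St (q : state M) : mtag := inl (inl (inl q)).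
Definition Sy (i : tapes) (a : sym M) : mtag := inl (inl (inr (i, a))).
Definition Hd (i : tapes) : mtag := inl (inr i).
(** [Pos b] relates the tuples of the [b]-th block to their input positions. *)
Definition Pos (b : 'I_(nblk sg)) : mtag := inr b.

Definition mar (t : mtag) : nat :=
  match t with
  | inl (inl (inl _)) => 0
  | inl (inl (inr _)) => 1
  | inl (inr _) => 1
  | inr b => (ar b).+1
  end.

Definition FOld (l : nat) (t : mtag) : fo mtag := Atom (AX t) (l + mar t :: iota 0 (mar t)).

Definition FMove (m : move) (x y : nat) : fo mtag :=
  match m with
  | MoveL => Disj (Conj (FFirst _ x) (FEq _ x y)) (FSucc _ y x)
  | Stay => FEq _ x y
  | MoveR => FSucc _ x y
  end.

Definition FScan (l : nat) (i : tapes) (a : sym M) : fo mtag :=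
  Ex (Conj (Atom (AX (Hd i)) [:: l.+1; 0]) (Atom (AX (Sy i a)) [:: l.+1; 0])).

Definition FScanAll (l : nat) (q : state M) (s : {ffun tapes -> sym M}) : fo mtag :=
  Conj (Atom (AX (St q)) [:: l]) (conjs [seq FScan l i (s i) | i <- enum tapes]).

Definition FTrans (l : nat) (q : state M) (s : {ffun tapes -> sym M})
    (m : {ffun tapes -> move}) (t : mtag) : fo mtag :=
  match t with
  | inl (inl (inl q')) => if q' == q then TT _ else FF _
  | inl (inl (inr (i, a))) =>
      Disj (Cond (a == s i) (Atom (AX (Hd i)) [:: l.+1; 0]))
           (Conj (Neg (Atom (AX (Hd i)) [:: l.+1; 0])) (FOld l t))
  | inl (inr i) => Ex (Conj (Atom (AX (Hd i)) [:: l.+2; 0]) (FMove (m i) 0 1))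
  | inr _ => FOld l t
  end.

(** A block begins right after the last entry of the block before it. The first one begins after
    cell [n], which holds the 0 closing the unary prefix and is the least number that is not
    small. *)
Definition FBase (l : nat) (b : 'I_(nblk sg)) : fo mtag :=
  let a := ar b in
  let b0 := ordn b b.-1 in
  Ex (Conj (FSucc _ 0 a.+1)
    (if b == 0 :> nat then Conj (Neg (FSmall _ 0)) (All (Imp (FLt _ 0 1) (FSmall _ 0)))
     else exsmall (ar b0) (Conj (MaxT _ (ar b0) (iota 0 (ar b0)))
            (Atom (AX (Pos b0)) (l + a.+1 + (ar b0).+1 :: iota 0 (ar b0).+1))))).

(** [Pos] is specified through itself: along the lexicographic order of tuples the position grows by
    one. Every reference goes to a smaller position, so there is exactly one solution, and no
    arithmetic on block lengths is involved. *)
Definition FPos (l : nat) (b : 'I_(nblk sg)) : fo mtag :=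
  let a := ar b in
  Conj (Smalls _ a)
  (Disj (Conj (ZeroT _ a (iota 0 a)) (FBase l b))
    (Ex (Conj (FSucc _ 0 a.+1)
       (exsmall a (Conj (SuccT _ a (iota 0 a) (iota a.+1 a))
          (Atom (AX (Pos b)) (l + a.+1 + a.+1 :: iota 0 a.+1))))))).

Definition FInBlk (l : nat) (f : 'I_(nblk sg) -> fo mtag) : fo mtag :=
  disjs [seq exsmall (ar b) (Conj (Atom (AX (Pos b)) (l + (ar b).+1 :: iota 0 (ar b).+1)) (f b))
        | b : 'I_(nblk sg) <- enum 'I_(nblk sg)].

Definition FBit1 (l : nat) : fo mtag :=
  Disj (FSmall _ 0) (FInBlk l (fun b => Atom (ABlk b) (iota 0 (ar b)))).

(** This is not the negation of [FBit1]: beyond the input both are false, and the cell is blank. *)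
Definition FBit0 (l : nat) : fo mtag :=
  Disj (Conj (Neg (FSmall _ 0)) (All (Imp (FLt _ 0 1) (FSmall _ 0))))
       (FInBlk l (fun b => Neg (Atom (ABlk b) (iota 0 (ar b))))).

Definition FStart (l : nat) (t : mtag) : fo mtag :=
  match t with
  | inl (inl (inl q)) => if q == start M then TT _ else FF _
  | inl (inl (inr (i, a))) =>
      if i == ord0 then
        if a == bit M true then FBit1 l
        else if a == bit M false then FBit0 l
        else Cond (a == blank M) (Conj (Neg (FBit1 l)) (Neg (FBit0 l)))
      else if a == blank M then TT _ else FF _
  | inl (inr i) => FFirst _ 0
  | inr b => FPos l b
  end.

Notation trs := (state M * {ffun tapes -> sym M} * (state M * {ffun tapes -> sym M} * {ffun tapes -> move}))%type.

Definition machine_sys : sysf mtag := {|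
  INIT := fun l => FDef mar predT l (FStart l);
  STEP := fun l l' => disjs [seq
     (let: (q, s, (q', s', m)) := x in
      Cond ((q', s', m) \in trans q s)
        (Conj (FScanAll l q s) (FDef mar predT l' (FTrans l q' s' m)))) | x <- enum {: trs}];
  FINAL := fun l => disjs [seq Cond ((trans x.1 x.2 == set0) && accepting x.1) (FScanAll l x.1 x.2)
                          | x <- enum {: state M * {ffun tapes -> sym M}}] |}.

Section Simulation.
Variables (n N : nat) (z : 'I_n) (I : interp sg 'I_n).
Hypotheses (n1 : 1 < n) (nN : n <= N).
Notation w := (encode I).
Notation Bk := (blk z I).
Notation reachable := (reaches (@tm_step M) (init_config M w)).
Hypothesis heads : forall c, reachable c -> forall i, chead c i < N.

Definition mencf (c : config M) (t : mtag) (ds : seq nat) : bool :=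
  match t with
  | inl (inl (inl q)) => q == cstate c
  | inl (inl (inr (i, a))) => ctape c i (nth 0 ds 0) == a
  | inl (inr i) => nth 0 ds 0 == chead c i
  | inr b => all (gtn n) (take (ar b) ds) &&
             (nth 0 ds (ar b) == @blk_start sg n b + val_of n (take (ar b) ds))
  end.

Notation enc := (encodes mar predT N mencf).

Let n0 : 0 < n. Proof. exact: ltnW. Qed.
Let N1 : 1 < N. Proof. exact: leq_trans n1 nN. Qed.
Let N0 : 0 < N. Proof. exact: ltnW N1. Qed.

Section Formulas.
Variable XX : nat -> mtag -> seq nat -> bool.
Notation It := (lev n Bk XX).
Variables (e : seq nat) (l : nat).
Hypothesis ok : all (gtn N) e.
Notation R := (XX (nth 0 e l)).

Lemma ev_Old ds t : size ds = mar t -> ev N It (ds ++ e) (FOld l t) = R t ds.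
Proof. exact: ev_AX. Qed.

Lemma ev_not_small (e' : seq nat) p : p < N ->
  ev N It (p :: e') (Conj (Neg (FSmall mtag 0)) (All (Imp (FLt mtag 0 1) (FSmall mtag 0)))) = (p == n).
Proof.
move=> pN; rewrite ev_Conj ev_Neg ev_Small /= -leqNgt.
apply/andP/eqP => [[np /ev_All H]|->].
  apply/eqP; rewrite eqn_leq np andbT leqNgt; apply/negP => lt.
  have := H n (ltn_trans lt pN); rewrite ev_Imp ev_Lt ev_Small /= lt ltnn; by [].
split=> //; apply/ev_All => v vN; rewrite ev_Imp ev_Lt ev_Small /=; exact: implybb.
Qed.

Lemma digits_ltN a v : v < n ^ a -> all (gtn N) (digits n a v).
Proof. by move=> va; apply/allP => x /(allP (digits_lt va)) xn; apply: leq_trans xn nN. Qed.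

Definition prev_pos (b : 'I_(nblk sg)) (v h : nat) : bool := R (Pos b) (rcons (digits n (ar b) v) h).

Definition base_pos (b : 'I_(nblk sg)) (h : nat) : Prop :=
  if b == 0 :> nat then h = n.+1
  else exists h', h = h'.+1 /\ prev_pos (ordn b b.-1) (n ^ ar (ordn b b.-1)).-1 h'.

Lemma ev_Pos_atom (b b0 : 'I_(nblk sg)) x h h' u : size x = (ar b) ->
  ev N It (digits n (ar b0) u ++ h' :: rcons x h ++ e)
    (Atom (AX (Pos b0)) (l + (ar b).+1 + (ar b0).+1 :: iota 0 (ar b0).+1)) = prev_pos b0 u h'.
Proof.
move=> sx; rewrite -cat_rcons.
have sr : size (rcons (digits n (ar b0) u) h') = mar (Pos b0) by rewrite size_rcons size_digits.
rewrite (@ev_AX _ mar N n Bk XX _ (rcons x h ++ e) (Pos b0) (l + (ar b).+1) sr).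
by rewrite nth_env_shift // size_rcons sx.
Qed.

Lemma ev_FPos (b : 'I_(nblk sg)) v h : v < n ^ ar b -> h < N ->
  ev N It (rcons (digits n (ar b) v) h ++ e) (FPos l b) <->
  (v = 0 /\ base_pos b h) \/ (exists h' v', [/\ h = h'.+1, v = v'.+1 & prev_pos b v' h']).
Proof.
move=> va hN; set x := digits n (ar b) v.
have sx : size x = ar b by apply: size_digits.
have okx : all (gtn N) (rcons x h ++ e) by rewrite all_cat all_rcons /= hN digits_ltN.
have nh : nth 0 (rcons x h ++ e) (ar b) = h by rewrite cat_rcons nth_cat sx ltnn subnn.
have hx : [seq nth 0 (rcons x h ++ e) i | i <- iota 0 (ar b)] = x by rewrite cat_rcons nth_env_map.
have hx' h' : [seq nth 0 (h' :: rcons x h ++ e) i | i <- iota 1 (ar b)] = x.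
  by rewrite -[1]addn0 iotaDl -map_comp -[RHS]hx; apply: eq_map => i.
have hx'' h' u : [seq nth 0 (digits n (ar b) u ++ h' :: rcons x h ++ e) i | i <- iota (ar b).+1 (ar b)] = x.
  rewrite -[(ar b).+1]addn1 iotaDl -map_comp -[RHS](hx' h'); apply: eq_map => i /=.
  by rewrite addnC nth_env_shift // size_digits.
have Sc h' : h' < N -> ev N It (h' :: rcons x h ++ e) (FSucc mtag 0 (ar b).+1) = (h == h'.+1).
  by move=> h'N; rewrite ev_Succ //= ?h'N //= nh eq_sym.
have Eb : ev N It (rcons x h ++ e) (FBase l b) <-> base_pos b h.
  rewrite /FBase /base_pos; case: eqP => Eb.
    split=> [/ev_Ex[h' h'N]|E].
      by rewrite ev_Conj Sc // ev_not_small // => /andP[/eqP -> /eqP ->].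
    have nN' : n < N by rewrite -ltnS -E ltnS ltnW.
    by apply/ev_Ex; exists n => //; rewrite ev_Conj Sc // ev_not_small // E !eqxx.
  split=> [/ev_Ex[h' h'N]|[h' [E P]]].
    rewrite ev_Conj Sc // => /andP[/eqP E /(ev_exsmall _ _ nN)[u ua]].
    rewrite ev_Conj (ev_MaxT _ _ n0 nN ua (head_digits _ _ _ _)) ev_Pos_atom // => /andP[/eqP Eu P].
    by exists h'; split=> //; rewrite -Eu.
  have h'N : h' < N by rewrite E in hN; apply: ltnW.
  apply/ev_Ex; exists h' => //; rewrite ev_Conj Sc // E eqxx; apply/(ev_exsmall _ _ nN).
  have X0 : 0 < n ^ ar (ordn b b.-1) by rewrite expn_gt0 n0.
  exists (n ^ ar (ordn b b.-1)).-1; first by rewrite prednK.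
  by rewrite ev_Conj ev_Pos_atom // P andbT (ev_MaxT _ _ n0 nN _ (head_digits _ _ _ _)) prednK.
rewrite ev_Conj {1}cat_rcons ev_Smalls // digits_lt // andTb ev_Disj ev_Conj (ev_ZeroT _ _ n0 nN va hx).
split=> [/orP[/andP[/eqP -> /Eb]|/ev_Ex[h' h'N]]|[[-> /Eb ->] //|[h' [v' [Eh Ev P]]]]].
- by left.
- rewrite ev_Conj Sc // => /andP[/eqP E /(ev_exsmall _ _ nN)[u ua]].
  rewrite ev_Conj (ev_SuccT _ _ n0 nN ua va (head_digits _ _ _ _) (hx'' _ _)) ev_Pos_atom //.
  by move=> /andP[/eqP Ev P]; right; exists h', u.
have h'N : h' < N by rewrite Eh in hN; apply: ltnW.
apply/orP; right; apply/ev_Ex; exists h' => //; rewrite ev_Conj Sc // (introT eqP Eh) andTb.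
apply/(ev_exsmall _ _ nN); have v'a : v' < n ^ ar b by rewrite Ev in va; apply: ltnW.
exists v' => //; rewrite ev_Conj (ev_SuccT _ _ n0 nN v'a va (head_digits _ _ _ _) (hx'' _ _)).
by rewrite ev_Pos_atom // P Ev eqxx.
Qed.

Lemma pos_eqn (b : 'I_(nblk sg)) v h : v < n ^ ar b -> h < N ->
  (forall (b' : 'I_(nblk sg)) v' h', h = h'.+1 -> v' < n ^ ar b' ->
     prev_pos b' v' h' = (h' == @blk_start sg n b' + v')) ->
  ev N It (rcons (digits n (ar b) v) h ++ e) (FPos l b) = (h == @blk_start sg n b + v).
Proof.
move=> va hN IH.
have Eb : base_pos b h <-> h = @blk_start sg n b.
  rewrite /base_pos; case: eqP => Eb; first by rewrite Eb blk_start0.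
  have bn := ltn_ord b; set b0 := ordn b b.-1.
  have vb : b0.+1 = b :> nat by rewrite val_ordn; lia.
  have X0 : 0 < n ^ ar b0 by rewrite expn_gt0 n0.
  rewrite -vb blk_startS //; split=> [[h' [E]]|E].
    by rewrite IH ?prednK // => /eqP Eh; rewrite E Eh; lia.
  exists h.-1; have h0 : h = h.-1.+1 by lia.
  by split=> //; rewrite IH ?prednK //; apply/eqP; lia.
apply/idP/eqP => [/(ev_FPos va hN) [[-> /Eb ->]|[h' [v' [Eh Ev]]]]|E]; first by rewrite addn0.
  have v'a : v' < n ^ ar b by rewrite Ev in va; apply: ltnW.
  by rewrite IH // => /eqP E; lia.
apply/(ev_FPos va hN); case: v va E => [|v] va E; first by left; rewrite Eb E addn0.
right; exists (@blk_start sg n b + v), v; split=> //; first by rewrite E addnS.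
by rewrite IH ?eqxx ?E ?addnS // ltnW.
Qed.

Lemma mencf_Pos c (b : 'I_(nblk sg)) v h : v < n ^ ar b ->
  mencf c (Pos b) (rcons (digits n (ar b) v) h) = (h == @blk_start sg n b + v).
Proof.
move=> va; rewrite /= -cats1 take_size_cat ?size_digits // digits_lt // val_digits //.
by rewrite nth_cat size_digits ltnn subnn.
Qed.

Lemma pos_cases (b : 'I_(nblk sg)) ds : size ds = mar (Pos b) -> all (gtn N) ds ->
  (exists v h, [/\ v < n ^ ar b, h < N & ds = rcons (digits n (ar b) v) h]) \/
  (all (gtn n) (take (ar b) ds) = false).
Proof.
case/lastP: ds => [//|x h]; rewrite size_rcons => -[sx]; rewrite all_rcons => /andP[hN ax].
rewrite -cats1 take_size_cat //; case ax': (all (gtn n) x); last by right.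
left; exists (val_of n x), h; rewrite -sx digits_val ?val_of_lt //.
by split=> //; rewrite cats1.
Qed.

Lemma ev_FPos_not_small (b : 'I_(nblk sg)) ds : size ds = mar (Pos b) ->
  all (gtn n) (take (ar b) ds) = false -> ev N It (ds ++ e) (FPos l b) = false.
Proof.
move=> sd ns; rewrite ev_Conj -[ds](cat_take_drop (ar b)) -catA ev_Smalls ?ns //.
by rewrite size_takel // sd.
Qed.

(** Induction on the position: [FPos] at [h.+1] refers to [Pos] at [h] only, so a relation that
    satisfies it has no freedom. *)
Lemma FPos_sound c :
  (forall (b : 'I_(nblk sg)) ds, size ds = mar (Pos b) -> all (gtn N) ds -> R (Pos b) ds = ev N It (ds ++ e) (FPos l b)) ->
  forall (b : 'I_(nblk sg)) ds, size ds = mar (Pos b) -> all (gtn N) ds -> R (Pos b) ds = mencf c (Pos b) ds.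
Proof.
move=> H.
have P h : forall (b : 'I_(nblk sg)) v, h < N -> v < n ^ ar b -> prev_pos b v h = (h == @blk_start sg n b + v).
  elim: h => [|h IH] b v hN va; rewrite /prev_pos H ?size_rcons ?size_digits ?all_rcons ?digits_ltN /= ?hN //.
    by apply: pos_eqn.
  by apply: pos_eqn => // b' v' h' [<-]; apply: IH; apply: ltnW.
move=> b ds sd ad; case: (pos_cases sd ad) => [[v [h [va hN ->]]]|ns].
  by rewrite mencf_Pos //; apply: P.
by rewrite H // ev_FPos_not_small //= ns.
Qed.

Lemma FPos_true c :
  (forall (b : 'I_(nblk sg)) ds, size ds = mar (Pos b) -> all (gtn N) ds -> R (Pos b) ds = mencf c (Pos b) ds) ->
  forall (b : 'I_(nblk sg)) ds, size ds = mar (Pos b) -> all (gtn N) ds -> ev N It (ds ++ e) (FPos l b) = mencf c (Pos b) ds.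
Proof.
move=> H b ds sd ad; case: (pos_cases sd ad) => [[v [h [va hN ->]]]|ns]; last first.
  by rewrite ev_FPos_not_small //= ns.
rewrite mencf_Pos //; apply: pos_eqn => // b' v' h' Eh va'.
have h'N : h' < N by rewrite Eh in hN; apply: ltnW.
by rewrite /prev_pos H ?size_rcons ?size_digits ?all_rcons ?digits_ltN //= ?h'N // -[RHS](mencf_Pos c) .
Qed.

Section Bits.
Variable p : nat.
Hypothesis pN : p < N.
Hypothesis HP : forall (b : 'I_(nblk sg)) u, u < n ^ ar b -> prev_pos b u p = (p == @blk_start sg n b + u).

Lemma ev_InBlk f g : (forall (b : 'I_(nblk sg)) u, u < n ^ ar b ->
     ev N It (digits n (ar b) u ++ p :: e) (f b) = g b u) ->
  ev N It (p :: e) (FInBlk l f) <->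
  exists (b : 'I_(nblk sg)) u, [/\ u < n ^ ar b, p = @blk_start sg n b + u & g b u].
Proof.
move=> Hf.
have EA (b : 'I_(nblk sg)) u : ev N It (digits n (ar b) u ++ p :: e)
    (Atom (AX (Pos b)) (l + (ar b).+1 :: iota 0 (ar b).+1)) = prev_pos b u p.
  rewrite -cat_rcons; have sr : size (rcons (digits n (ar b) u) p) = mar (Pos b) by rewrite size_rcons size_digits.
  exact: (@ev_AX _ mar N n Bk XX _ e (Pos b) l sr).
rewrite ev_disjs_map; split=> [/hasP[b _ /(ev_exsmall _ _ nN)[u ua]]|[b [u [ua E gu]]]].
  by rewrite ev_Conj EA HP // Hf // => /andP[/eqP E gu]; exists b, u.
apply/hasP; exists b; first exact: mem_enum.
by apply/(ev_exsmall _ _ nN); exists u => //; rewrite ev_Conj EA HP // Hf // gu -E eqxx.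
Qed.

Lemma ev_ABlk_digits (b : 'I_(nblk sg)) u : u < n ^ ar b ->
  ev N It (digits n (ar b) u ++ p :: e) (Atom (ABlk b) (iota 0 (ar b))) = blk z I b (digits n (ar b) u).
Proof. by move=> ua; rewrite ev_Atom head_digits /= digits_lt. Qed.

Lemma start_gt b u : n < @blk_start sg n b + u.
Proof. by rewrite /blk_start; lia. Qed.

Lemma n_lt_size : n < size w.
Proof. by rewrite (size_encode z); lia. Qed.

Lemma ev_FBit1 : ev N It (p :: e) (FBit1 l) = (p < size w) && nth false w p.
Proof.
rewrite ev_Disj ev_Small /=; case: (ltnP p n) => [pn|np] /=.
  by rewrite (nth_encode_low z I (ltnW pn)) pn (ltn_trans pn) // n_lt_size.
have G := ev_InBlk (fun b u ua => ev_ABlk_digits ua).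
apply/idP/andP => [/G [b [u [ua E bu]]]|[pw wp]].
  by have [sw Ew] := nth_encode z I (ltn_ord b) ua; rewrite E Ew.
have pn : n < p.
  rewrite ltn_neqAle np andbT; apply/eqP => E; move: wp.
  by rewrite (nth_encode_low z I) -E ?ltnn.
have [b [u [bn ua E]]] := encode_position z pn pw.
apply/G; exists (Ordinal bn), u; split=> //.
by have [_ <-] := nth_encode z I bn ua; rewrite -E.
Qed.

Lemma ev_FBit0 : ev N It (p :: e) (FBit0 l) = (p < size w) && ~~ nth false w p.
Proof.
rewrite ev_Disj ev_not_small //; case: (ltngtP p n) => [pn|np|->] /=; last first.
- by rewrite (nth_encode_low z I (leqnn n)) ltnn n_lt_size.
- have G := ev_InBlk (f := fun b => Neg (Atom (ABlk b) (iota 0 (ar b)))) (fun b u ua => congr1 negb (ev_ABlk_digits ua)).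
  apply/idP/andP => [/G [b [u [ua E bu]]]|[pw wp]].
    by have [sw Ew] := nth_encode z I (ltn_ord b) ua; rewrite E Ew.
  have [b [u [bn ua E]]] := encode_position z np pw.
  apply/G; exists (Ordinal bn), u; split=> //.
  by have [_ <-] := nth_encode z I bn ua; rewrite -E.
have G := ev_InBlk (f := fun b => Neg (Atom (ABlk b) (iota 0 (ar b)))) (fun b u ua => congr1 negb (ev_ABlk_digits ua)).
rewrite (nth_encode_low z I (ltnW pn)) pn andbF; apply/negP => /G [b [u [_ E _]]].
by have := start_gt b u; rewrite -E; lia.
Qed.

End Bits.

End Formulas.

Lemma ctape0 p (i : tapes) a : (ctape (init_config M w) i p == a) =
  if i == ord0 then
    if a == bit M true then (p < size w) && nth false w p
    else if a == bit M false then (p < size w) && ~~ nth false w p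
    else (a == blank M) && ~~ (p < size w)
  else blank M == a.
Proof.
have b01 : (bit M true == bit M false) = false by apply/eqP => /(@bit_inj M).
rewrite /=; case: (i == ord0) => //; case: (ltnP p (size w)) => pw; last first.
  rewrite nth_default ?size_map // eq_sym; case: eqP => [->|_].
    have nb b : (blank M == bit M b) = false by rewrite eq_sym; apply/negbTE/bit_neq_blank.
    by rewrite !nb.
  by case: ifP => //; case: ifP.
rewrite (nth_map false) // eq_sym; case: (nth false w p) => /=.
  by case: eqP => [|ne]; last case: eqP => //; rewrite ?andbF.
case: (a =P bit M false) => [->|ne]; first by rewrite eq_sym b01.
by case: ifP; rewrite ?andbF.
Qed.

Lemma init_sound XX e l : all (gtn N) e ->
  ev N (lev n Bk XX) e (FDef mar predT l (FStart l)) <-> enc (init_config M w) (XX (nth 0 e l)).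
Proof.
move=> ok; set R := XX _.
(* The formulas for the input tape read [Pos] in the very relation that is being defined, so they
   are shown correct under the assumption that [Pos] is. *)
have step (HP : forall (b : 'I_(nblk sg)) ds, size ds = mar (Pos b) -> all (gtn N) ds ->
      R (Pos b) ds = mencf (init_config M w) (Pos b) ds) t ds : size ds = mar t -> all (gtn N) ds ->
    ev N (lev n Bk XX) (ds ++ e) (FStart l t) = mencf (init_config M w) t ds.
  move=> sd ad; case: t sd => [[[q|[i a]]|i]|b] sd; last first.
  - exact: (FPos_true ok HP).
  - case: ds sd ad => [|p []] //= _ /andP[pN _].
    by rewrite ev_First //= ?pN.
  - case: ds sd ad => [|p []] //= _ /andP[pN _].
    rewrite -/(ctape (init_config M w) i p) ctape0.
    have HP' (b : 'I_(nblk sg)) u : u < n ^ ar b ->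
        prev_pos XX e l b u p = (p == @blk_start sg n b + u).
      move=> ub; rewrite /prev_pos -/R HP ?size_rcons ?size_digits ?all_rcons ?digits_ltN //= ?pN //.
      exact: (mencf_Pos (init_config M w)).
    case: eqP => _; last by rewrite eq_sym; case: eqP; rewrite ?ev_TT ?ev_FF.
    case: eqP => _; first exact: ev_FBit1.
    case: eqP => _; first exact: ev_FBit0.
    rewrite ev_Cond -[ev N _ _ (Conj _ _)]/(~~ ev N (lev n Bk XX) (p :: e) (FBit1 l) &&
      ~~ ev N (lev n Bk XX) (p :: e) (FBit0 l)).
    by rewrite (ev_FBit1 ok pN HP') (ev_FBit0 ok pN HP'); case: (p < size w); case: (nth false w p).
  by rewrite /=; case: eqP; rewrite ?ev_TT ?ev_FF.
split=> [/ev_FDef H|E].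
  have HP := @FPos_sound XX e l ok (init_config M w) (fun b ds sd ad => H (Pos b) ds isT sd ad).
  by move=> t ds _ sd ad; rewrite /R H // step.
apply/ev_FDef => t ds _ sd ad; rewrite step //; first exact: E.
by move=> b ds' sd' ad'; apply: E.
Qed.

Definition mstep_to (c : config M) q (s : {ffun tapes -> sym M}) (m : {ffun tapes -> move}) : config M :=
  Config q (fun i p => if p == chead c i then s i else ctape c i p) (fun i => do_move (m i) (chead c i)).

Lemma ev_FScanAll XX e l c q s : all (gtn N) e -> reachable c -> enc c (XX (nth 0 e l)) ->
  ev N (lev n Bk XX) e (FScanAll l q s) = (q == cstate c) && (s == scanned c).
Proof.
move=> ok rc ec; rewrite ev_Conj ev_Atom /= ec //; congr (_ && _).
have Sc i : ev N (lev n Bk XX) e (FScan l i (s i)) = (s i == ctape c i (chead c i)).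
  apply/ev_Ex/eqP => [[p pN]|E].
    rewrite ev_Conj !ev_Atom /= !ec //= ?pN // => /andP[/eqP -> /eqP].
    by [].
  have hN := heads rc i; exists (chead c i) => //.
  by rewrite ev_Conj !ev_Atom /= !ec //= ?hN // E !eqxx.
rewrite ev_conjs_map; apply/allP/eqP => [H|Es i _]; last by rewrite /= Sc Es ffunE.
by apply/ffunP => i; rewrite ffunE; apply/eqP; rewrite -Sc; apply: H; rewrite mem_enum.
Qed.

Lemma ev_FMove XX e m p p' : p < N -> p' < N -> all (gtn N) e ->
  ev N (lev n Bk XX) (p :: p' :: e) (FMove m 0 1) = (p' == do_move m p).
Proof.
move=> pN p'N ok; have ok2 : all (gtn N) (p :: p' :: e) by rewrite /= pN p'N.
case: m => /=.
- rewrite ev_Disj ev_Conj ev_First // ev_Eq ev_Succ //=; case: p {pN ok2} => [|p] /=.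
    by rewrite orbF eq_sym.
  by rewrite eqSS eq_sym.
- by rewrite ev_Eq eq_sym.
by rewrite ev_Succ //= eq_sym.
Qed.

Lemma ev_FTrans XX e l c q s m t ds : all (gtn N) e -> reachable c -> enc c (XX (nth 0 e l)) ->
  size ds = mar t -> all (gtn N) ds ->
  ev N (lev n Bk XX) (ds ++ e) (FTrans l q s m t) = mencf (mstep_to c q s m) t ds.
Proof.
move=> ok rc ec sd ad; have EO := @ev_Old XX e l ds t sd; rewrite ec // in EO.
case: t sd EO => [[[q'|[i a]]|i]|b] sd EO /=.
- by case: eqP; rewrite ?ev_TT ?ev_FF.
- rewrite ev_Disj ev_Cond ev_Conj ev_Neg EO.
  case: ds sd ad {EO} => [|p []] //= _ /andP[pN _]; rewrite ev_Atom /= ec //= ?pN //.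
  by case: (p =P chead c i) => _ /=; rewrite ?andbT ?andbF ?orbF // eq_sym.
- case: ds sd ad {EO} => [|p []] //= _ /andP[pN _].
  apply/ev_Ex/eqP => [[p0 p0N]|E].
    rewrite ev_Conj ev_FMove // ev_Atom /= ec //= ?p0N // => /andP[/eqP <- /eqP].
    by [].
  have hN := heads rc i; exists (chead c i) => //.
  by rewrite ev_Conj ev_FMove // ev_Atom /= ec //= ?hN // E !eqxx.
by rewrite EO.
Qed.

Theorem machine_simulates : simulates mar predT N n Bk machine_sys mencf
  (eq^~ (init_config M w)) (fun c => halted c /\ accepting (cstate c)) reachable (@tm_step M).
Proof.
split=> [c ->|c c' rc st|XX e l ok|XX e l l' c ok rc ec|XX e l c ok rc ec].
- by exists 0.
- by case: rc => k Hk; exists k.+1; apply: nsteps_rcons Hk st.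
- rewrite [INIT _ _]/= init_sound //; split=> [E|[_ [-> E]] //].
  by exists (init_config M w).
- rewrite ev_disjs_map; split=> [/hasP[[[q s] [[q' s'] m]] _]|[c' [[q' [s' [m [tr ->]]]] ec']]].
    rewrite ev_Cond ev_Conj => /and3P[tr]; rewrite (ev_FScanAll _ _ ok rc ec) => /andP[/eqP Eq /eqP Es] F.
    exists (mstep_to c q' s' m); split.
      by exists q', s', m; rewrite -Eq -Es.
    by apply/ev_FDef_enc: F => t ds _ sd ad; apply: ev_FTrans.
  apply/hasP; exists (cstate c, scanned c, (q', s', m)); first exact: mem_enum.
  rewrite ev_Cond tr ev_Conj (ev_FScanAll _ _ ok rc ec) !eqxx /=.
  have H t ds : predT t -> size ds = mar t -> all (gtn N) ds ->
    ev N (lev n Bk XX) (ds ++ e) (FTrans l q' s' m t) = mencf (mstep_to c q' s' m) t ds.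
    by move=> _ sd ad; apply: ev_FTrans.
  exact/(ev_FDef_enc _ H).
rewrite ev_disjs_map; split=> [/hasP[[q s] _]|[hc ac]].
  rewrite ev_Cond (ev_FScanAll _ _ ok rc ec) => /andP[/andP[/eqP h a] /andP[/eqP Eq /eqP Es]].
  by rewrite /halted -Eq -Es.
apply/hasP; exists (cstate c, scanned c); first exact: mem_enum.
by rewrite ev_Cond (ev_FScanAll _ _ ok rc ec) !eqxx /= ac andbT; apply/andP; split=> //; apply/eqP.
Qed.

End Simulation.
End MachineSystem.

(** * Programming with schemes *)

Section Programs.
Variables (sg : signature) (F : finType) (k dd : nat).
Notation dim := (fun _ : 'I_#|F| => dd).
Notation instr := (instr sg k.+1 dim).
Notation term := (term sg k.+1).
Notation test := (test sg k.+1).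

Definition var (i : nat) : 'I_k.+1 := inord i.
Definition V (i : nat) : term := Var (var i).
(** All arrays share the dimension [dd]; missing coordinates are filled with 0. *)
Definition args (ts : seq term) : dd.-tuple term := [tuple nth Zero ts q | q < dd].

Definition SetV (i : nat) (t : term) : instr := Assign (var i) t.
Definition GuessV (i : nat) : instr := Guess (var i).
Definition Read (i : nat) (f : F) (ts : seq term) : instr :=
  @ReadArr sg k.+1 #|F| dim (var i) (enum_rank f) (args ts).
Definition Write (f : F) (ts : seq term) (t : term) : instr :=
  @WriteArr sg k.+1 #|F| dim (enum_rank f) (args ts) t.
(** A failed assertion loops forever. *)
Definition Assert (b : test) : instr := @While sg k.+1 #|F| dim (TNot b) [::].
(** Tests cannot mention arrays, so the cell is first read into variable [i]. Being different from
    max counts as false. *)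
Definition Ask (i : nat) (f : F) (ts : seq term) (b : bool) : seq instr :=
  [:: Read i f ts; Assert (if b then TEq (V i) Max else TNot (TEq (V i) Max))].

Section Runs.
Variables (B : structure sg) (z mx : B).
Notation stor := (store B k.+1 dim).
Notation step := (@ps_step sg B z mx k.+1 #|F| dim).
Notation ev_t := (eval_term z mx).
Notation ev_b := (eval_test z mx).
Implicit Types (s : stor) (p q : seq instr).

Definition run p s s' := reaches step (p, s) ([::], s').

Lemma exec_cat i p q s c : exec_instr z mx ((i :: p) ++ q) s c <->
  exists r, exec_instr z mx (i :: p) s (r, c.2) /\ c.1 = r ++ q.
Proof.
case: c => r s'; case: i => [x t|x a ts|a ts t|x|b l] /=.
1,2,3: by split=> [[-> ->]|[_ [[-> ->] ->]] //]; exists p.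
  by split=> [[u [-> ->]]|[_ [[u [-> ->]] ->]]]; [exists p; split=> //; exists u|exists u].
split=> [[-> ->]|[_ [[-> ->] ->]]]; last by case: ifP; rewrite // -catA.
eexists; split; first by [].
by case: ifP; rewrite // -catA.
Qed.

Lemma nsteps_cat j p q s s' : nsteps step j (p ++ q, s) ([::], s') <->
  exists i s1, [/\ i <= j, nsteps step i (p, s) ([::], s1) & nsteps step (j - i) (q, s1) ([::], s')].
Proof.
elim: j p s => [|j IH] p s.
  split=> [|[[|i] [s1 []]] //]; last by move=> _ [-> ->] [-> ->].
  by case: p => [|//] /= [-> ->]; exists 0, s'.
case: p => [|i p].
  split=> [H|[[|i] [s1 [_]]]]; first by exists 0, s.
    by move=> [->].
  by move=> [c [/ps_stepE []]].
split=> [[[r s2] [/ps_stepE /exec_cat[r1 [/= E1 ->]] /IH[i1 [s1 [ij R1 R2]]]]]|].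
  exists i1.+1, s1; split=> //; exists (r1, s2); split=> //; exact/ps_stepE.
move=> [[|i1] [s1 [ij]]]; first by case.
move=> [[r1 s2] [/ps_stepE E1 R1] R2]; exists (r1 ++ q, s2); split.
  by apply/ps_stepE/exec_cat; exists r1.
by apply/IH; exists i1, s1.
Qed.

Lemma run_nil s s' : run [::] s s' <-> s' = s.
Proof.
split=> [[[|j] /= H]|->]; first by case: H.
  by case: H => c [/ps_stepE []].
by exists 0.
Qed.

Lemma run_cat p q s s' : run (p ++ q) s s' <-> exists s1, run p s s1 /\ run q s1 s'.
Proof.
split=> [[j /nsteps_cat[i [s1 [_ R1 R2]]]]|[s1 [[i R1] [j R2]]]].
  by exists s1; split; [exists i|exists (j - i)].
by exists (i + j); apply/nsteps_cat; exists i, s1; rewrite leq_addr addKn.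
Qed.

Lemma run_cons i p s s' : run (i :: p) s s' <-> exists s1, run [:: i] s s1 /\ run p s1 s'.
Proof. exact: (run_cat [:: i]). Qed.

Lemma run1 i s s' : (forall b l, i <> @While sg k.+1 #|F| dim b l) ->
  run [:: i] s s' <-> exec_instr z mx [:: i] s ([::], s').
Proof.
move=> nw; split=> [[[|j] //= [[r s1] [/ps_stepE E R]]]|E]; last first.
  by exists 1, ([::], s'); split=> //; apply/ps_stepE.
suff r0 : r = [::] by subst r; case/run_nil: (ex_intro _ j R : run _ _ _) => ->.
case: i nw E {R} => [x t|x a ts|a ts t|x|b l] nw /=; try by case.
  by case=> u [].
by case: (nw b l).
Qed.

Definition get s i := s.1 (var i).

Lemma run_SetV i t s s' : run [:: SetV i t] s s' <-> s' = set_var s (var i) (ev_t s t).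
Proof. by rewrite run1 //=; split=> [[]|->]. Qed.

Lemma run_GuessV i s s' : run [:: GuessV i] s s' <-> exists u, s' = set_var s (var i) u.
Proof. by rewrite run1 //=; split=> [[u []]|[u ->]]; exists u. Qed.

(** The cell of the array [f] with coordinates [us], padded with [z]. *)
Definition key (f : F) (us : seq B) : {a : 'I_#|F| & dd.-tuple B} :=
  Tagged (fun _ => dd.-tuple B) (i := enum_rank f) [tuple nth z us q | q < dd].

Lemma map_args s ts : map_tuple (ev_t s) (args ts) = [tuple nth z (map (ev_t s) ts) q | q < dd].
Proof.
apply: eq_from_tnth => q; rewrite tnth_map !tnth_mktuple.
case: (ltnP q (size ts)) => qs; first by rewrite (nth_map Zero).
by rewrite !nth_default ?size_map.
Qed.

Lemma run_Read i f ts s s' :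
  run [:: Read i f ts] s s' <-> s' = set_var s (var i) (s.2 (key f (map (ev_t s) ts))).
Proof. by rewrite run1 //= /cell map_args; split=> [[]|->]. Qed.

Lemma run_Write f ts t s s' :
  run [:: Write f ts t] s s' <-> s' = set_cell s (key f (map (ev_t s) ts)) (ev_t s t).
Proof. by rewrite run1 //= /cell map_args; split=> [[]|->]. Qed.

Lemma run_while b l s s' : run [:: @While sg k.+1 #|F| dim b l] s s' <->
  if ev_b s b then exists s1, run l s s1 /\ run [:: @While sg k.+1 #|F| dim b l] s1 s' else s' = s.
Proof.
have E : run [:: @While sg k.+1 #|F| dim b l] s s' <->
    run (if ev_b s b then l ++ [:: @While sg k.+1 #|F| dim b l] else [::]) s s'.
  split=> [[[|j] //= [c [/ps_stepE /= -> R]]]|[j R]]; first by exists j.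
  by exists j.+1; eexists; split; [apply/ps_stepE|exact: R].
by rewrite E; case: ifP => _; [exact: run_cat|exact: run_nil].
Qed.

(** Partial correctness, by strong induction on the number of steps; it applies to loops that may
    run forever. *)
Lemma run_while_ind (P : stor -> Prop) b l s s' :
  (forall s1 s2, P s1 -> ev_b s1 b -> run l s1 s2 -> P s2) ->
  run [:: @While sg k.+1 #|F| dim b l] s s' -> P s -> P s' /\ ~~ ev_b s' b.
Proof.
move=> H [j R]; elim/ltn_ind: j s R => -[//|j] IH s /= [c [/ps_stepE /= -> R]] Ps.
case: ifP R => [sb|nb].
  move=> /nsteps_cat[i [s1 [ij R1 R2]]]; apply: (IH _ _ s1 R2); first by rewrite ltnS leq_subr.
  by apply: H Ps sb _; exists i.
move=> R; have /run_nil E : run [::] s s' by exists j.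
by rewrite E nb.
Qed.

Lemma run_Assert b s s' : run [:: Assert b] s s' <-> ev_b s b /\ s' = s.
Proof.
split=> [R|[sb ->]].
  have [|E] := run_while_ind (P := fun s1 => s1 = s) _ R erefl; last by rewrite /= negbK => H; split=> //; rewrite -E.
  by move=> s1 s2 -> _ /run_nil.
by apply/run_while; rewrite /= sb.
Qed.

Lemma get_set s i j u : i <= k -> j <= k -> get (set_var s (var j) u) i = if i == j then u else get s i.
Proof.
move=> ik jk; rewrite /get ffunE -val_eqE /= !inordK //.
Qed.

Lemma get_set_same s i u : get (set_var s (var i) u) i = u.
Proof. by rewrite /get ffunE eqxx. Qed.

Definition bits s c := s.2 c == mx.

Hypothesis zmx : z != mx.

Lemma run_Ask i f ts b s s' : run (Ask i f ts b) s s' <->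
  bits s (key f (map (ev_t s) ts)) = b /\ s' = set_var s (var i) (s.2 (key f (map (ev_t s) ts))).
Proof.
rewrite run_cons; split=> [[s1 [/run_Read -> /run_Assert]]|[Eb ->]].
  by rewrite -/(get _ _) /bits; case: b => /=; rewrite ffunE eqxx => -[+ ->]; [|move/negbTE].
eexists; split; first exact/run_Read.
by apply/run_Assert; split=> //; move: Eb; rewrite /bits; case: b => /=; rewrite ffunE eqxx => ->.
Qed.

(** Equal lengths are assumed because the padding could identify lists of different lengths. *)
Lemma key_inj f f' us us' : size us = size us' -> size us <= dd -> key f us = key f' us' ->
  f = f' /\ us = us'.
Proof.
move=> ss sd E; have Et : [tuple nth z us q | q < dd] = [tuple nth z us' q | q < dd].
  by have := congr1 (fun c : {a : 'I_#|F| & dd.-tuple B} => tagged c) E.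
split; first by apply: enum_rank_inj; exact: (congr1 (@tag _ _) E).
apply: (@eq_from_nth _ z) => // i iu; have id := leq_trans iu sd.
by have := congr1 (fun t => tnth t (Ordinal id)) Et; rewrite !tnth_mktuple.
Qed.

End Runs.
End Programs.

(** * Replacing each number below [n ^ K] by its digits *)

Section DigitTranslation.
Local Arguments digits : simpl never.
Local Arguments iota : simpl never.
Local Arguments FLex : simpl never.
Variables (T : Type) (K' : nat).
Notation K := K'.+1.

(** A number is below the base exactly when all digits but the last vanish. *)
Definition FSmallDigits (i : nat) : fo T := conjs [seq FFirst T x | x <- iota (i * K) K'].

(** Variable [i] becomes the [K] variables from [i * K] on. Blocks are given the last digit, at
    [i * K + K'], which for a small number is the number itself. *)
Definition dsub (a : atom T) (l : seq nat) : fo T :=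
  match a, l with
  | ALt, [:: i; j] => FLex T (iota (i * K) K) (iota (j * K) K)
  | ASmall, [:: i] => FSmallDigits i
  | ABlk b, l => Conj (conjs [seq FSmallDigits i | i <- l]) (Atom (ABlk b) [seq i * K + K' | i <- l])
  | AX t, i :: l' => Atom (AX t) (flatten [seq iota (j * K) K | j <- i :: l'])
  | _, _ => FF T
  end.

Variables (n : nat) (Bk : nat -> seq nat -> bool) (XX : nat -> T -> seq nat -> bool).
Variable X : T -> seq nat -> bool.
Hypotheses (n0 : 0 < n) (HX : forall x t l, X t (flatten [seq digits n K y | y <- x :: l]) = XX x t l).
Notation It := (interp_atom n Bk X).
Notation denv e := (flatten [seq digits n K x | x <- e]).

Lemma digits0 : digits n K 0 = nseq K 0.
Proof.
rewrite -[RHS](@digits_val n); first by rewrite size_nseq val_of_nseq0.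
by apply/allP => x /nseqP[->].
Qed.

Lemma denv_cons x e : denv (x :: e) = digits n K x ++ denv e.
Proof. by []. Qed.

Lemma nth_denv e i : [seq nth 0 (denv e) j | j <- iota (i * K) K] = digits n K (nth 0 e i).
Proof.
elim: e i => [|x e IH] [|i].
1,2: rewrite nth_nil digits0; apply: (@eq_from_nth _ 0) => [|j]; rewrite size_map size_iota ?size_nseq // => jK.
1,2: by rewrite (nth_map 0) ?size_iota // nth_nil nth_nseq jK.
  by rewrite denv_cons mul0n nth_env_map ?size_digits.
rewrite denv_cons mulSn iotaDl -map_comp -[RHS](IH i); apply: eq_map => j.
by rewrite [LHS]nth_cat size_digits ltnNge leq_addr addKn.
Qed.

Lemma all_denv e : all (gtn (n ^ K)) e -> all (gtn n) (denv e).
Proof. by elim: e => // x e IH /andP[xn /IH]; rewrite denv_cons all_cat (digits_lt xn) => ->. Qed.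

Lemma nth_digit e i : nth 0 (denv e) (i * K + K') = last 0 (digits n K (nth 0 e i)).
Proof.
by rewrite -nth_denv -nth_last size_map size_iota (nth_map 0) ?size_iota // nth_iota.
Qed.

Lemma ev_SmallDigits e i : all (gtn (n ^ K)) e ->
  ev n It (denv e) (FSmallDigits i) = (nth 0 e i < n).
Proof.
move=> oke; have okd := all_denv oke; rewrite ev_conjs_map.
have xN : nth 0 e i < n ^ K by apply: okenv_nth => //; rewrite expn_gt0 n0.
have Ei : iota (i * K) K = iota (i * K) K' ++ [:: i * K + K'].
  by rewrite -[X in iota (i * K) X = _]addn1 iotaD.
have E := nth_denv e i; rewrite Ei map_cat in E.
set x := nth 0 e i in xN E *.
have F j : j \in iota (i * K) K' -> ev n It (denv e) (FFirst T j) = (nth 0 (denv e) j == 0).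
  by move=> _; rewrite ev_First.
rewrite (eq_in_all F) -[all _ _]/(all (fun j => nth 0 (denv e) j == 0) _).
have -> : all (fun j => nth 0 (denv e) j == 0) (iota (i * K) K') =
    all (pred1 0) [seq nth 0 (denv e) j | j <- iota (i * K) K'] by rewrite all_map.
set p := [seq nth 0 (denv e) j | j <- iota (i * K) K'] in E *.
have sp : size p = K' by rewrite size_map size_iota.
apply/idP/idP => [/all_pred1P Ep|xn].
  rewrite -(val_digits n0 xN) -E Ep sp cats1 val_of_rcons val_of_nseq0 mul0n add0n.
  exact: okenv_nth.
rewrite digits_small // -cats1 in E; apply/all_pred1P; rewrite sp.
have := congr1 (take K') E.
by rewrite !take_size_cat ?size_nseq.
Qed.

Lemma ev_dsub a l e : all (gtn (n ^ K)) e ->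
  ev n It (denv e) (dsub a l) = interp_atom n Bk (leveled XX) a [seq nth 0 e i | i <- l].
Proof.
move=> oke; have N0 : 0 < n ^ K by rewrite expn_gt0 n0.
have xN i : nth 0 e i < n ^ K by apply: okenv_nth.
case: a => [||b|t]; rewrite [dsub _ _]/dsub.
- case: l => [|i [|j [|q l]]]; rewrite ?ev_FF //.
  by rewrite (@ev_Lex T n n Bk X n) ?size_iota // ?nth_denv ?digits_lt // !val_digits.
- case: l => [|i [|j l]]; rewrite ?ev_FF //; exact: ev_SmallDigits.
- rewrite ev_Conj ev_conjs_map ev_Atom /interp_atom.
  have -> : all (fun i => ev n It (denv e) (FSmallDigits i)) l = all (gtn n) [seq nth 0 e i | i <- l].
    by rewrite all_map; apply: eq_all => i; apply: ev_SmallDigits.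
  case al: (all _ _) => //=.
  have -> : [seq nth 0 (denv e) i | i <- [seq i * K + K' | i <- l]] = [seq nth 0 e i | i <- l].
    rewrite -map_comp; apply/eq_in_map => i il /=; rewrite nth_digit.
    have xn : nth 0 e i < n by apply: (allP al); apply: map_f.
    by rewrite digits_small // last_rcons.
  by rewrite al.
case: l => [|i l]; first by rewrite ev_FF.
rewrite ev_Atom -[RHS]/(XX (nth 0 e i) t [seq nth 0 e j | j <- l]) -HX.
rewrite -[interp_atom _ _ _ _ _]/(X t _); congr (X t _); rewrite map_flatten -map_comp.
rewrite -[nth 0 e i :: _]/[seq nth 0 e j | j <- i :: l] -[in RHS]map_comp.
by congr flatten; apply: eq_map => j; apply: nth_denv.
Qed.

Definition dtr (f : fo T) : fo T := tr K dsub f.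

Theorem ev_dtr f : ev n It [::] (dtr f) = ev (n ^ K) (interp_atom n Bk (leveled XX)) [::] f.
Proof. by rewrite -(@ev_tr T T n K dsub (interp_atom n Bk (leveled XX)) n Bk X f [::]) // => a l e; apply: ev_dsub. Qed.

End DigitTranslation.

(** * Evaluating formulas by schemes *)

Section Evaluator.
Variables (sg : signature) (T : finType) (k dd : nat).
Notation arr := (bool + T)%type.
Notation dim := (fun _ : 'I_#|{: arr}| => dd).
Notation code := (seq (instr sg k.+1 dim)).
Notation term := (term sg k.+1).
Notation SetV := (@SetV sg arr k dd).
Notation GuessV := (@GuessV sg arr k dd).
Notation Ask := (@Ask sg arr k dd).
Notation Assert := (@Assert sg arr k dd).
Notation V := (@V sg k).
Notation While_ := (@While sg k.+1 #|{: arr}| dim).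

(** [Used] is a set of elements ordered by the successor relation [Succ]. *)
Definition Used : arr := inl false.
Definition Succ : arr := inl true.
Definition XA (t : T) : arr := inr t.

Definition StepV (v : nat) : code :=
  GuessV v.+1 :: Ask v.+2 Succ [:: V v; V v.+1] true ++ [:: SetV v (V v.+1)].
Definition WalkTo (v : nat) (t : term) : code := [:: While_ (TNot (TEq (V v) t)) (StepV v)].
(** The body runs once before the loop and again after each step, so that the first and the last
    element of the chain are both visited. *)
Definition ForS (v : nat) (body : code) : code :=
  SetV v Zero :: body ++ [:: While_ (TNot (TEq (V v) Max)) (StepV v ++ body)].
(** A conditional made from a loop of at most one round: setting [v] to max makes the test fail
    afterwards. *)
Definition IfZero (v : nat) (p : code) : code := [:: While_ (TEq (V v) Zero) (p ++ [:: SetV v Max])].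
(** Guessing is the only nondeterminism, so two guessed flags decide which of the alternatives are
    executed; the assertion demands at least one. *)
Definition Or (v : nat) (p q : code) : code :=
  GuessV v :: GuessV v.+1 :: Assert (TOr (TEq (V v) Zero) (TEq (V v.+1) Zero))
  :: IfZero v p ++ IfZero v.+1 q.

(** Indices out of range denote 0, the first element of the chain, in agreement with the default of
    [ev]. *)
Definition vterm (rho : seq nat) (i : nat) : term :=
  if i < size rho then V (nth 0 rho i) else Zero.

Definition atom_test (a : atom T) (ts : seq term) : test sg k.+1 :=
  match a with
  | ABlk b =>
      if insub b is Some i then @TRel sg k.+1 i [tuple nth Zero ts q | q < arity i]
      else if insub (b - nrel sg) is Some j then TEq (nth Zero ts 0) (Cst j)
      else TNot (TEq Zero Zero)
  | ASmall => if ts is [:: x] then TEq Zero Zero else TNot (TEq Zero Zero)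
  | _ => TNot (TEq Zero Zero)
  end.

(** [check b f rho d] can terminate iff [f] has the truth value [b]; [rho] maps
    the free variables of [f] to scheme variables below [d]. *)
Fixpoint check (pol : bool) (f : fo T) (rho : seq nat) (d : nat) : code :=
  match f with
  | Atom ALt [:: x; y] =>
      if pol then SetV d (vterm rho x) :: StepV d ++ WalkTo d (vterm rho y)
      else SetV d (vterm rho y) :: WalkTo d (vterm rho x)
  | Atom (AX t) l => Ask d (XA t) [seq vterm rho i | i <- l] pol
  | Atom a l => let b := atom_test a [seq vterm rho i | i <- l] in [:: Assert (if pol then b else TNot b)]
  | Neg g => check (~~ pol) g rho d
  | Conj g h =>
      if pol then check true g rho d ++ check true h rho d
      else Or d (check false g rho d.+2) (check false h rho d.+2)
  | Ex g =>
      if pol then GuessV d :: Ask d.+1 Used [:: V d] true ++ check true g (d :: rho) d.+1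
      else ForS d (check false g (d :: rho) d.+1)
  end.

Fixpoint need (f : fo T) : nat :=
  match f with
  | Atom _ _ => 3
  | Neg g => need g
  | Conj g h => 2 + maxn (need g) (need h)
  | Ex g => 3 + need g
  end.

Section Semantics.
Variables (B : structure sg) (z mx : B).
Hypotheses (zmx : z != mx) (dd2 : 1 < dd).
Notation stor := (store B k.+1 dim).
Notation cells := {a : 'I_#|{: arr}| & dd.-tuple B}.
Notation run := (@run sg arr k dd B z mx).
Notation get := (@get sg arr k dd B).
Notation key := (@key sg arr dd B z).
Notation bits := (@bits sg arr k dd B mx).
Notation ev_t := (eval_term z mx).
Implicit Types (s : stor).

Record order_on (o : seq B) (bt : cells -> bool) : Prop := OrderOn {
  o_uniq : uniq o;
  o_head : nth z o 0 = z;
  o_last : nth z o (size o).-1 = mx;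
  o_size : 1 < size o;
  o_used : forall u, bt (key Used [:: u]) = (u \in o);
  o_succ : forall u v, bt (key Succ [:: u; v]) <->
     exists2 i, i.+1 < size o & u = nth z o i /\ v = nth z o i.+1;
  o_cst : forall j, cst_of (itp B) j \in o }.

Definition frame (d : nat) s s' := s'.2 = s.2 /\ forall i, i < d -> i <= k -> get s' i = get s i.

Lemma frame_refl d s : frame d s s. Proof. by []. Qed.

Lemma frame_trans d s1 s2 s3 : frame d s1 s2 -> frame d s2 s3 -> frame d s1 s3.
Proof. by move=> [E1 F1] [E2 F2]; split=> [|i id ik]; [rewrite E2|rewrite F2 // F1]. Qed.

Lemma frame_leq d d' s s' : d <= d' -> frame d' s s' -> frame d s s'.
Proof. by move=> dd' [E F]; split=> // i id; apply: F; apply: leq_trans dd'. Qed.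

Lemma frame_set d v s u : d <= v -> v <= k -> frame d s (set_var s (var k v) u).
Proof.
move=> dv vk; split=> // i id ik; rewrite get_set //.
by case: eqP => // E; move: id; rewrite E ltnNge dv.
Qed.

Lemma ev_V s i : ev_t s (V i) = get s i. Proof. by []. Qed.

Lemma map_V1 s i : [seq ev_t s t | t <- [:: V i]] = [:: get s i]. Proof. by []. Qed.

Lemma map_V2 s i j : [seq ev_t s t | t <- [:: V i; V j]] = [:: get s i; get s j]. Proof. by []. Qed.

Section Ordered.
Variable o : seq B.
Notation n := (size o).

Lemma run_StepV v s s' : v.+2 <= k -> order_on o (bits s) -> run (StepV v) s s' ->
  exists i, [/\ i.+1 < n, get s v = nth z o i, get s' v = nth z o i.+1 & frame v s s'].
Proof.
move=> vk ord /run_cons[s1 [/run_GuessV[u Es1] /run_cat[s2 [/run_Ask[bt Es2] /run_SetV Es']]]].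
have v1k : v.+1 <= k by apply: ltnW.
have v0k : v <= k by apply: ltnW.
have f1 : frame v s s1 by rewrite Es1; apply: frame_set.
have g1 : get s1 v = get s v by rewrite Es1 get_set // ltn_eqF.
have g1' : get s1 v.+1 = u by rewrite Es1 get_set_same.
move: bt; rewrite map_V2 g1 g1'.
have -> : bits s1 = bits s by rewrite Es1.
move=> /(o_succ ord)[i il [Ei Eu]]; exists i; split=> //.
  by rewrite Es' get_set_same ev_V Es2 get_set // ltn_eqF // g1'.
apply: frame_trans f1 _; apply: frame_trans (_ : frame v s1 s2) _.
  by rewrite Es2; apply: frame_set; rewrite // ltnW.
by rewrite Es'; apply: frame_set.
Qed.

Lemma run_StepV_ex v s i : v.+2 <= k -> order_on o (bits s) -> i.+1 < n -> get s v = nth z o i ->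
  exists s', run (StepV v) s s'.
Proof.
move=> vk ord il Ei; have v1k : v.+1 <= k by apply: ltnW.
have v0k : v <= k by apply: ltnW.
set s1 := set_var s (var k v.+1) (nth z o i.+1).
set s2 := set_var s1 (var k v.+2) (s1.2 (key Succ [seq ev_t s1 t | t <- [:: V v; V v.+1]])).
exists (set_var s2 (var k v) (ev_t s2 (V v.+1))); apply/run_cons; exists s1.
split; first by apply/run_GuessV; exists (nth z o i.+1).
apply/run_cat; exists s2; split; last by apply/run_SetV.
apply/run_Ask; split=> //.
rewrite map_V2 get_set_same get_set // ltn_eqF // Ei.
by apply/(o_succ ord); exists i.
Qed.

Lemma nth_o_inj i j : uniq o -> i < n -> j < n -> nth z o i = nth z o j -> i = j.
Proof. by move=> u il jl /eqP; rewrite nth_uniq // => /eqP. Qed.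

(** A walk only moves up the chain, where elements do not repeat, so it can stop at position [b]
    only if it began at or below it. *)
Lemma run_WalkTo v t s s' a b : v.+2 <= k -> order_on o (bits s) ->
  (forall s1, frame v s s1 -> ev_t s1 t = nth z o b) -> a < n -> b < n ->
  get s v = nth z o a -> run (WalkTo v t) s s' -> a <= b /\ frame v s s'.
Proof.
move=> vk ord Ht al bl Ea R.
have [] := run_while_ind (P := fun s1 => frame v s s1 /\ exists i, [/\ a <= i, i < n & get s1 v = nth z o i]) _ R.
- move=> s1 s2 [f1 [i [ai il Ei]]] _ R12.
  have ord1 : order_on o (bits s1) by rewrite /bits f1.1.
  have [i' [i'l E1 E2 f2]] := run_StepV vk ord1 R12.
  split; first exact: frame_trans f2.
  exists i'.+1; split=> //.
  have -> : i' = i by apply: nth_o_inj (o_uniq ord) _ il _; [apply: ltnW|rewrite -E1].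
  exact: ltnW.
- by split; [apply: frame_refl|exists a].
move=> [f [i [ai il Ei]]]; rewrite /= negbK Ht // -/(get _ _) => /eqP E.
split=> //; have <- : i = b by apply: nth_o_inj (o_uniq ord) il bl _; rewrite -Ei.
exact: ai.
Qed.

Lemma run_WalkTo_ex v t s a b : v.+2 <= k -> order_on o (bits s) ->
  (forall s1, frame v s s1 -> ev_t s1 t = nth z o b) -> b < n ->
  a <= b -> get s v = nth z o a -> exists s', run (WalkTo v t) s s'.
Proof.
move=> vk ord Ht bl ab; move Ej : (b - a) => j; elim: j a s ab Ej ord Ht => [|j IH] a s ab Ej ord Ht Ea.
  have E : a = b by lia.
  by exists s; apply/run_while; rewrite /= Ht ?Ea ?E //= -/(get s v) Ea E eqxx.
have il : a.+1 < n by lia.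
have [s1 R1] := run_StepV_ex vk ord il Ea.
have [i [i'l E1 E2 f1]] := run_StepV vk ord R1.
have Eia : i = a by apply: nth_o_inj (o_uniq ord) _ _ _; [apply: ltnW|apply: ltnW|rewrite -E1].
subst i; have ord1 : order_on o (bits s1) by rewrite /bits f1.1.
have [s' R'] := IH a.+1 s1 ltac:(lia) ltac:(lia) ord1 (fun s2 f2 => Ht s2 (frame_trans f1 f2)) E2.
exists s'; apply/run_while; rewrite /= Ht // -/(get s v) Ea.
have -> : (nth z o a == nth z o b) = false.
  apply/negbTE/eqP => E; have := nth_o_inj (o_uniq ord) _ bl E; lia.
by exists s1.
Qed.

Section Loop.
Variables (v : nat) (body : code) (Inv : nat -> stor -> Prop).
Hypotheses (vk : v.+2 <= k) (Iord : forall j s, Inv j s -> order_on o (bits s)).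
Hypothesis Istable : forall j s1 s2, Inv j s1 -> frame v s1 s2 -> Inv j s2.

Lemma run_ForS s s' :
  (forall j s1 s2, j < n -> Inv j s1 -> get s1 v = nth z o j -> run body s1 s2 ->
     Inv j.+1 s2 /\ get s2 v = nth z o j) ->
  Inv 0 s -> run (ForS v body) s s' -> Inv n s'.
Proof.
move=> H I0 /run_cons[s1 [/run_SetV Es1 /run_cat[s2 [R12 R2]]]].
have ord := Iord I0; have n0 : 0 < n by apply: ltnW; apply: o_size ord.
have v0k : v <= k by lia.
have [I1 g2] : Inv 1 s2 /\ get s2 v = nth z o 0.
  apply: H R12 => //; first by apply: (Istable I0); rewrite Es1; apply: frame_set.
  by rewrite Es1 get_set_same (o_head ord).
have [] := run_while_ind (P := fun s => exists j, [/\ j < n, Inv j.+1 s & get s v = nth z o j]) _ R2.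
- move=> s3 s4 [j [jn Ij gj]] _ /run_cat[s5 [R35 R54]].
  have [i [il E1 E2 f]] := run_StepV vk (Iord Ij) R35.
  have Eij : i = j by apply: nth_o_inj (o_uniq ord) (ltnW il) jn _; rewrite -E1.
  subst i; have [I2 g] := H j.+1 s5 s4 il (Istable Ij f) E2 R54.
  by exists j.+1.
- by exists 0.
move=> [j [jn Ij gj]]; rewrite /= negbK -/(get s' v) gj -(o_last ord) => /eqP E.
have Ej : j = n.-1 by apply: nth_o_inj (o_uniq ord) jn _ E; lia.
by rewrite Ej prednK in Ij.
Qed.

Lemma run_ForS_ex s :
  (forall j s1, j < n -> Inv j s1 -> get s1 v = nth z o j ->
     exists s2, [/\ run body s1 s2, Inv j.+1 s2 & get s2 v = nth z o j]) ->
  Inv 0 s -> exists s', run (ForS v body) s s' /\ Inv n s'.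
Proof.
move=> H I0; have ord := Iord I0; have n0 : 0 < n by apply: ltnW; apply: o_size ord.
have v0k : v <= k by lia.
set s1 := set_var s (var k v) z.
have [|s2 [R2 I2 g2]] := H 0 s1 n0 (Istable I0 (frame_set _ _ (leqnn v) v0k)).
  by rewrite get_set_same (o_head ord).
suff [s' [R' I']] : exists s', run [:: While_ (TNot (TEq (V v) Max)) (StepV v ++ body)] s2 s' /\ Inv n s'.
  exists s'; split=> //; apply/run_cons; exists s1; split; first exact/run_SetV.
  by apply/run_cat; exists s2.
move Er : n.-1 => r; have {Er} : 0 + r = n.-1 by [].
elim: r 0 s2 I2 g2 {R2} => [|r IH] j s2 I2 g2 jr.
  exists s2; have Ej : j = n.-1 by lia.
  split; last by rewrite Ej prednK in I2.
  by apply/run_while; rewrite /= -/(get s2 v) g2 Ej (o_last ord) eqxx.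
have j1n : j.+1 < n by lia.
have [s3 R3] := run_StepV_ex vk (Iord I2) j1n g2.
have [i [il E1 E2 f]] := run_StepV vk (Iord I2) R3.
have Eij : i = j by apply: nth_o_inj (o_uniq ord) (ltnW il) (ltnW j1n) _; rewrite -E1.
subst i; have [s4 [R4 I4 g4]] := H j.+1 s3 j1n (Istable I2 f) E2.
have [s' [R' I']] := IH j.+1 s4 I4 g4 ltac:(lia).
have R24 : run (StepV v ++ body) s2 s4 by apply/run_cat; exists s3.
exists s'; split=> //; apply/run_while; rewrite [eval_test _ _ _ _]/= -/(get s2 v) g2.
have -> : (nth z o j == mx) = false.
  apply/negbTE/eqP; rewrite -(o_last ord) => E.
  have := nth_o_inj (o_uniq ord) _ _ E; lia.
by exists s4.
Qed.

End Loop.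

Lemma run_IfZero v p s s' : run (IfZero v p) s s' <->
  if get s v == z then exists s1, run p s s1 /\ s' = set_var s1 (var k v) mx else s' = s.
Proof.
rewrite run_while /= -/(get s v); case: eqP => // _.
have E s1 s2 : run [:: While_ (TEq (V v) Zero) (p ++ [:: SetV v Max])] (set_var s1 (var k v) mx) s2 <->
    s2 = set_var s1 (var k v) mx.
  by rewrite run_while /= -/(get (set_var s1 (var k v) mx) v) get_set_same eq_sym (negbTE zmx).
split=> [[s2 [/run_cat[s1 [R1 /run_SetV ->]] /E ->]]|[s1 [R1 ->]]]; first by exists s1.
exists (set_var s1 (var k v) mx); split; last exact/E.
by apply/run_cat; exists s1; split=> //; apply/run_SetV.
Qed.

(** ** Checking formulas *)

Section Check.
Variable a0 : {ffun cells -> B}.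
Notation bt := (fun c => a0 c == mx).
Hypothesis ord : order_on o bt.
Variables (x0 : 'I_n) (I : interp sg 'I_n).
Hypothesis I_rel : forall i (t : (arity i).-tuple 'I_n),
  rel_of I t = rel_of (itp B) [tuple nth z o (tnth t q) | q < arity i].
Hypothesis I_cst : forall j, nth z o (cst_of I j) = cst_of (itp B) j.

Definition arr_rel (t : T) (l : seq nat) : bool := bt (key (XA t) [seq nth z o x | x <- l]).
Notation It := (interp_atom n (blk x0 I) arr_rel).

Definition env_ok (rho e : seq nat) (d : nat) s : Prop :=
  [/\ s.2 = a0, size rho = size e, all (gtn d) rho, all (gtn n) e &
      forall i, i < size rho -> get s (nth 0 rho i) = nth z o (nth 0 e i)].

Lemma env_frame rho e d d' s s' : d <= d' -> d <= k.+1 -> frame d s s' -> env_ok rho e d s -> env_ok rho e d' s'.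
Proof.
move=> dd' dk [Ea Ef] [Es sz ar ae E]; split=> //; first by rewrite Ea.
  by apply: sub_all ar => x /= xd; apply: leq_trans dd'.
move=> i ir; have id := all_nthP 0 ar i ir.
by rewrite Ef ?E //; rewrite -ltnS; apply: leq_trans dk.
Qed.

Lemma n_gt0 : 0 < n. Proof. exact: ltnW (o_size ord). Qed.

Lemma env_lt rho e d s i : env_ok rho e d s -> nth 0 e i < n.
Proof. by move=> [_ _ _ ae _]; apply: okenv_nth => //; apply: n_gt0. Qed.

Lemma ev_tm rho e d s i : env_ok rho e d s -> ev_t s (vterm rho i) = nth z o (nth 0 e i).
Proof.
move=> [_ sz _ _ E]; rewrite /vterm; case: ltnP => ir; first by rewrite ev_V E.
by rewrite [nth 0 e i]nth_default -?sz //= (o_head ord).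
Qed.

Lemma map_tm rho e d s l : env_ok rho e d s ->
  [seq ev_t s t | t <- [seq vterm rho i | i <- l]] = [seq nth z o x | x <- [seq nth 0 e i | i <- l]].
Proof. by move=> env; rewrite -!map_comp; apply: eq_map => i; exact: (ev_tm i env). Qed.

Lemma nth_tm rho e d s l q : env_ok rho e d s ->
  ev_t s (nth Zero [seq vterm rho i | i <- l] q) = nth z o (nth 0 [seq nth 0 e i | i <- l] q).
Proof.
move=> env; case: (ltnP q (size l)) => ql.
  by rewrite !(nth_map 0) // (ev_tm _ env).
rewrite [nth Zero _ _]nth_default ?size_map // [nth 0 _ q]nth_default ?size_map //=.
by rewrite (o_head ord).
Qed.

Lemma ev_atom_test rho e d s a l : env_ok rho e d s ->
  match a with ALt => False | AX _ => False | _ => True end ->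
  eval_test z mx s (atom_test a [seq vterm rho i | i <- l]) = ev n It e (Atom a l).
Proof.
move=> env; rewrite ev_Atom; case: a => [//||b|//] _ /=.
  by case: l => [|i [|j l]] /=; rewrite ?eqxx ?(env_lt i env).
have -> : all (gtn n) [seq nth 0 e i | i <- l] by apply/allP => x /mapP[i _ ->]; apply: env_lt env.
case: insubP => [i _ Ei|nb] /=.
  rewrite -Ei blk_rel I_rel; congr (rel_of _ _); apply: eq_from_tnth => q.
  rewrite tnth_map !tnth_mktuple (nth_tm _ _ env) val_ordn //.
  case: (ltnP q (size l)) => ql; first by rewrite (nth_map 0) //; apply: env_lt env.
  by rewrite nth_default ?size_map // n_gt0.
case: insubP => [j _ Ej|nc] /=.
  have -> : b = nrel sg + j by rewrite Ej subnKC // leqNgt.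
  rewrite blk_cst (nth_tm _ _ env) -I_cst nth_uniq ?(o_uniq ord) //.
  case: l => [|i l] /=; [exact: n_gt0|exact: env_lt env].
rewrite eqxx; apply/esym; rewrite /blk nth_default // size_blocks /nblk.
by move: nb nc; rewrite -!leqNgt; lia.
Qed.

(** The inequality is confirmed by walking from the successor of [x] up to [y], its negation by
    walking from [y] up to [x]; each walk can end exactly when the relation in question holds. *)
Lemma run_check_Lt pol x y rho e d s : env_ok rho e d s -> d.+2 <= k ->
  (forall s', run (check pol (Atom ALt [:: x; y]) rho d) s s' ->
     (nth 0 e x < nth 0 e y) = pol /\ frame d s s') /\
  ((nth 0 e x < nth 0 e y) = pol -> exists s', run (check pol (Atom ALt [:: x; y]) rho d) s s').
Proof.
move=> env dk; have Es : s.2 = a0 by case: env.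
have d0k : d <= k by lia.
pose s1 i := set_var s (var k d) (nth z o (nth 0 e i)).
have f1 i : frame d s (s1 i) by apply: frame_set.
have ord1 i : order_on o (bits (s1 i)) by rewrite /bits /= Es.
have tmE i s2 : frame d s s2 -> ev_t s2 (vterm rho i) = nth z o (nth 0 e i).
  by move=> f; apply: (@ev_tm _ _ d); apply: env_frame f env => //; lia.
have g1 i : get (s1 i) d = nth z o (nth 0 e i) by apply: get_set_same.
have lt i := env_lt i env.
have checkT : check true (Atom ALt [:: x; y]) rho d =
  SetV d (vterm rho x) :: (StepV d ++ WalkTo d (vterm rho y)) by [].
have checkF : check false (Atom ALt [:: x; y]) rho d =
  SetV d (vterm rho y) :: WalkTo d (vterm rho x) by [].
case: pol; rewrite ?checkT ?checkF; split=> [s'|H].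
- move=> /run_cons[s2 [/run_SetV Es2 /run_cat[s3 [R23 R3]]]].
  have E2 : s2 = s1 x by rewrite Es2 (tmE x s) //.
  rewrite E2 in R23; have [i [il Ei Ei1 f3]] := run_StepV dk (ord1 x) R23.
  have Ex : i = nth 0 e x by apply: nth_o_inj (o_uniq ord) (ltnW il) (lt x) _; rewrite -Ei g1.
  have f03 : frame d s s3 := frame_trans (f1 x) f3.
  have [||le f'] := run_WalkTo dk _ _ il (lt y) Ei1 R3; first by rewrite /bits f03.1 Es.
    by move=> s4 f4; apply: tmE; apply: frame_trans f4.
  by rewrite -Ex le; split=> //; apply: frame_trans f'.
- have x1n : (nth 0 e x).+1 < n by apply: leq_ltn_trans (lt y).
  have [s3 R3] := run_StepV_ex dk (ord1 x) x1n (g1 x).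
  have [i [il Ei Ei1 f3]] := run_StepV dk (ord1 x) R3.
  have Ex : i = nth 0 e x by apply: nth_o_inj (o_uniq ord) (ltnW il) (lt x) _; rewrite -Ei g1.
  have f03 : frame d s s3 := frame_trans (f1 x) f3.
  have ord3 : order_on o (bits s3) by rewrite /bits f03.1 Es.
  have Ht s4 : frame d s3 s4 -> ev_t s4 (vterm rho y) = nth z o (nth 0 e y).
    by move=> f4; apply: tmE; apply: frame_trans f4.
  have le : i.+1 <= nth 0 e y by rewrite Ex.
  have [s' R'] := run_WalkTo_ex dk ord3 Ht (lt y) le Ei1.
  exists s'; apply/run_cons; exists (s1 x); split; first by apply/run_SetV; rewrite (tmE x s).
  by apply/run_cat; exists s3.
- move=> /run_cons[s2 [/run_SetV Es2 R]].
  have E2 : s2 = s1 y by rewrite Es2 (tmE y s) //.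
  rewrite E2 in R; have [|le f'] := run_WalkTo dk (ord1 y) _ (lt y) (lt x) (g1 y) R.
    by move=> s4 f4; apply: tmE; apply: frame_trans f4.
  by split; [rewrite ltnNge le|apply: frame_trans f'].
have Ht s4 : frame d (s1 y) s4 -> ev_t s4 (vterm rho x) = nth z o (nth 0 e x).
  by move=> f4; apply: tmE; apply: frame_trans f4.
have le : nth 0 e y <= nth 0 e x by rewrite leqNgt H.
have [s' R'] := run_WalkTo_ex dk (ord1 y) Ht (lt x) le (g1 y).
by exists s'; apply/run_cons; exists (s1 y); split=> //; apply/run_SetV; rewrite (tmE y s).
Qed.

(** A terminating run certifies that the value is [pol], and a value [pol] yields a terminating run.
    Both polarities go through one induction, because negation exchanges them and a failed check
    gives no answer. *)
Theorem run_check f pol rho e d s : env_ok rho e d s -> d + need f <= k ->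
  (forall s', run (check pol f rho d) s s' -> ev n It e f = pol /\ frame d s s') /\
  (ev n It e f = pol -> exists s', run (check pol f rho d) s s').
Proof.
elim: f pol rho e d s => [a l|f IH|f IHf g IHg|f IH] pol rho e d s env dk.
- have d2k : d.+2 <= k by move: dk => /=; lia.
  have d0k : d <= k by lia.
  clear dk; have gen : match a with ALt => False | AX _ => False | _ => True end ->
      (forall s', run [:: Assert (if pol then atom_test a [seq vterm rho i | i <- l] else TNot (atom_test a [seq vterm rho i | i <- l]))] s s' ->
         ev n It e (Atom a l) = pol /\ frame d s s') /\
      (ev n It e (Atom a l) = pol -> exists s', run [:: Assert (if pol then atom_test a [seq vterm rho i | i <- l] else TNot (atom_test a [seq vterm rho i | i <- l]))] s s').
    move=> Ha; have E := ev_atom_test l env Ha.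
    split=> [s' /run_Assert[]|H].
      by case: pol => /=; rewrite E => H ->; split=> //; apply/negbTE.
    by exists s; apply/run_Assert; case: pol H => /=; rewrite E => ->.
  case: a gen => [||b|t] gen; [|exact: gen|exact: gen|].
    have bad : (forall s', run [:: Assert (if pol then TNot (TEq Zero Zero) else TNot (TNot (TEq Zero Zero)))] s s' ->
         false = pol /\ frame d s s') /\
      (false = pol -> exists s', run [:: Assert (if pol then TNot (TEq Zero Zero) else TNot (TNot (TEq Zero Zero)))] s s').
      split=> [s' /run_Assert[]|H]; first by case: (pol) => /=; rewrite eqxx // => _ ->.
      by exists s; apply/run_Assert; rewrite -H /= eqxx.
    case: l gen => [|x [|y [|w l]]] gen; try exact: bad.
    exact: (run_check_Lt pol x y env d2k).
  have E : bits s (key (XA t) [seq ev_t s i | i <- [seq vterm rho i | i <- l]]) = ev n It e (Atom (AX t) l).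
    by rewrite (map_tm _ env) /bits; case: env => ->.
  split=> [s' /run_Ask[]|H].
    by rewrite E => Ep ->; split=> //; apply: frame_set.
  by eexists; apply/run_Ask; rewrite E.
- have [H1 H2] := IH (~~ pol) rho e d s env dk; rewrite ev_Neg.
  split=> [s' /H1[-> ?]|H]; first by rewrite negbK.
  by apply: H2; rewrite -H negbK.
- rewrite /= in dk; rewrite ev_Conj; case: pol => /=.
    have dkf : d + need f <= k by lia.
    have dkg : d + need g <= k by lia.
    split=> [s' /run_cat[s1 [R1 R2]]|/andP[Ef Eg]].
      have [Ef f1] := (IHf true rho e d s env dkf).1 s1 R1.
      have env1 : env_ok rho e d s1 by apply: env_frame f1 env; lia.
      have [Eg f2] := (IHg true rho e d s1 env1 dkg).1 s' R2.
      by rewrite Ef Eg; split=> //; apply: frame_trans f2.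
    have [s1 R1] := (IHf true rho e d s env dkf).2 Ef.
    have [_ f1] := (IHf true rho e d s env dkf).1 s1 R1.
    have env1 : env_ok rho e d s1 by apply: env_frame f1 env; lia.
    have [s' R'] := (IHg true rho e d s1 env1 dkg).2 Eg.
    by exists s'; apply/run_cat; exists s1.
  have dkf : d.+2 + need f <= k by lia.
  have dkg : d.+2 + need g <= k by lia.
  have d1k : d.+1 <= k by lia.
  have d0k : d <= k by lia.
  pose s2 u w := set_var (set_var s (var k d) u) (var k d.+1) w.
  have f2 u w : frame d s (s2 u w) by apply: frame_trans (frame_set _ _ _ _) (frame_set _ _ _ _).
  have g2 u w : get (s2 u w) d = u by rewrite get_set // ltn_eqF // get_set_same.
  have g2' u w : get (s2 u w) d.+1 = w by rewrite get_set_same.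
  have TE u w : eval_test z mx (s2 u w) (TOr (TEq (V d) Zero) (TEq (V d.+1) Zero)) = (u == z) || (w == z).
    by rewrite /= -/(get (s2 u w) d) -/(get (s2 u w) d.+1) g2 g2'.
  have fw s3 s4 : frame d.+2 s3 s4 -> frame d s3 s4 by apply: frame_leq; lia.
  have envf s3 : frame d s s3 -> env_ok rho e d.+2 s3 by move=> f3; apply: env_frame f3 env; lia.
  have S u w s' : run (IfZero d (check false f rho d.+2) ++ IfZero d.+1 (check false g rho d.+2)) (s2 u w) s' ->
      [/\ frame d s s', u = z -> ev n It e f = false & w = z -> ev n It e g = false].
    move=> /run_cat[s3 [/run_IfZero R23 /run_IfZero R3]].
    have [fr3 Ef g3] : [/\ frame d s s3, u = z -> ev n It e f = false & get s3 d.+1 = w].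
      move: R23; rewrite g2; case: eqP => [_ [s4 [R4 ->]]|ne ->]; last by split=> // E; case: ne.
      have [Ef [a4 f4]] := (IHf false rho e d.+2 _ (envf _ (f2 u w)) dkf).1 s4 R4.
      split=> //; last by rewrite get_set // gtn_eqF // f4 // g2'.
      apply: frame_trans (f2 u w) _; apply: frame_trans (frame_set _ _ (leqnn d) d0k).
      exact: fw.
    move: R3; rewrite g3; case: eqP => [_ [s4 [R4 ->]]|ne ->]; last by split=> // E; case: ne.
    have [Eg f4] := (IHg false rho e d.+2 _ (envf _ fr3) dkg).1 s4 R4.
    split=> //; apply: frame_trans fr3 _; apply: frame_trans (fw _ _ f4) _.
    by apply: frame_set.
  split=> [s' /run_cons[s3 [/run_GuessV[u ->] /run_cons[s4 [/run_GuessV[w ->] /run_cons[s5 [/run_Assert[]]]]]]]|].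
    rewrite (TE u w) => uw -> /S [fr Ef Eg]; split=> //.
    by case/orP: uw => /eqP E; [rewrite Ef|rewrite Eg // andbF].
  have ex u w s6 : run (IfZero d (check false f rho d.+2) ++ IfZero d.+1 (check false g rho d.+2)) (s2 u w) s6 ->
      (u == z) || (w == z) -> exists s', run (Or d (check false f rho d.+2) (check false g rho d.+2)) s s'.
    move=> R uw; exists s6; apply/run_cons; eexists; split; first by apply/run_GuessV; exists u.
    apply/run_cons; eexists; split; first by apply/run_GuessV; exists w.
    apply/run_cons; eexists; split; last exact: R.
    by apply/run_Assert; rewrite (TE u w).
  move=> /negbT; rewrite negb_and => /orP[/negbTE Ef|/negbTE Eg].
    (* Flag [z] runs the check of the false conjunct; flag [mx] skips the other one, whose check
       might never end. *)
    have [s4 R4] := (IHf false rho e d.+2 _ (envf _ (f2 z mx)) dkf).2 Ef.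
    have [_ [a4 f4]] := (IHf false rho e d.+2 _ (envf _ (f2 z mx)) dkf).1 s4 R4.
    apply: (ex z mx (set_var s4 (var k d) mx)); last by rewrite eqxx.
    apply/run_cat; eexists; split; apply/run_IfZero; first by rewrite g2 eqxx; exists s4.
    by rewrite get_set // gtn_eqF // f4 // g2' eq_sym (negbTE zmx).
  have [s4 R4] := (IHg false rho e d.+2 _ (envf _ (f2 mx z)) dkg).2 Eg.
  apply: (ex mx z (set_var s4 (var k d.+1) mx)); last by rewrite eqxx orbT.
  apply/run_cat; exists (s2 mx z); split; apply/run_IfZero; first by rewrite g2 eq_sym (negbTE zmx).
  by rewrite g2' eqxx; exists s4.
rewrite /= in dk; have dkf : d.+1 + need f <= k by lia.
have d1k : d.+1 <= k by lia.
have d0k : d <= k by lia.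
have envx s3 x : frame d s s3 -> get s3 d = nth z o x -> x < n -> env_ok (d :: rho) (x :: e) d.+1 s3.
  move=> f3 g3 xn; have [Ea sz ar ae E] : env_ok rho e d.+1 s3 by apply: env_frame f3 env; lia.
  split=> //=; [by rewrite sz|by rewrite ltnSn|by rewrite xn|by case=> [|i] //= ir; apply: E].
have exT : check true (Ex f) rho d =
  GuessV d :: (Ask d.+1 Used [:: V d] true ++ check true f (d :: rho) d.+1) by [].
have exF : check false (Ex f) rho d = ForS d (check false f (d :: rho) d.+1) by [].
case: pol; rewrite ?exT ?exF.
  pose s1 u := set_var s (var k d) u.
  have f1 u : frame d s (s1 u) by apply: frame_set.
  have Es : s.2 = a0 by case: env.
  have U u : bits (s1 u) (key Used [seq ev_t (s1 u) i | i <- [:: V d]]) = (u \in o).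
    by rewrite map_V1 get_set_same /bits /= Es (o_used ord).
  split=> [s' /run_cons[s2 [/run_GuessV[u ->] /run_cat[s3 [/run_Ask[]]]]]|/ev_Ex[x xn Ef]].
    rewrite -/(s1 u) U => uo Es3 R.
    have un : index u o < n by rewrite index_mem.
    have f3 : frame d.+1 (s1 u) s3 by rewrite Es3; apply: frame_set.
    have f03 : frame d s s3 by apply: frame_trans (f1 u) (frame_leq _ f3).
    have g3 : get s3 d = nth z o (index u o) by rewrite f3.2 // get_set_same nth_index.
    have [Ef f'] := (IH true (d :: rho) _ d.+1 s3 (envx s3 _ f03 g3 un) dkf).1 s' R.
    split; last by apply: frame_trans f03 (frame_leq _ f').
    by apply/ev_Ex; exists (index u o).
  set u := nth z o x.
  pose s3 := set_var (s1 u) (var k d.+1) ((s1 u).2 (key Used [seq ev_t (s1 u) i | i <- [:: V d]])).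
  have f3 : frame d.+1 (s1 u) s3 by apply: frame_set.
  have f03 : frame d s s3 by apply: frame_trans (f1 u) (frame_leq _ f3).
  have g3 : get s3 d = nth z o x by rewrite f3.2 // get_set_same.
  have [s' R'] := (IH true (d :: rho) _ d.+1 s3 (envx s3 _ f03 g3 xn) dkf).2 Ef.
  exists s'; apply/run_cons; exists (s1 u); split; first by apply/run_GuessV; exists u.
  apply/run_cat; exists s3; split=> //; apply/run_Ask; split=> //.
  by rewrite U; apply: mem_nth.
pose Inv j s1 := frame d s s1 /\ forall x, x < j -> x < n -> ev n It (x :: e) f = false.
have Iord j s1 : Inv j s1 -> order_on o (bits s1).
  by move=> [[E _] _]; rewrite /bits E; case: env => ->.
have Ist j s1 s2 : Inv j s1 -> frame d s1 s2 -> Inv j s2.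
  by move=> [f1 H] f2; split=> //; apply: frame_trans f2.
have dk2 : d.+2 <= k by lia.
have body j s1 s2 : j < n -> Inv j s1 -> get s1 d = nth z o j -> run (check false f (d :: rho) d.+1) s1 s2 ->
     Inv j.+1 s2 /\ get s2 d = nth z o j.
  move=> jn [f1 H] g1 R.
  have [Ef f'] := (IH false (d :: rho) (j :: e) d.+1 s1 (envx s1 j f1 g1 jn) dkf).1 s2 R.
  split; last by rewrite f'.2.
  split; first by apply: frame_trans f1 (frame_leq _ f').
  by move=> x; rewrite ltnS leq_eqVlt => /orP[/eqP -> //|xj]; apply: H.
have I0 : Inv 0 s by split; [apply: frame_refl|].
split=> [s' R|Ef].
  have [fr H] := run_ForS dk2 Iord Ist body I0 R.
  split=> //; apply/negbTE/negP => /ev_Ex[x xn]; by rewrite H.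
have Hf x : x < n -> ev n It (x :: e) f = false.
  by move=> xn; apply/negbTE/negP => fx; move/negbT/negP: Ef; apply; apply/ev_Ex; exists x.
have bodyE j s1 : j < n -> Inv j s1 -> get s1 d = nth z o j -> exists s2,
    [/\ run (check false f (d :: rho) d.+1) s1 s2, Inv j.+1 s2 & get s2 d = nth z o j].
  move=> jn I1 g1.
  have [s2 R2] := (IH false (d :: rho) (j :: e) d.+1 s1 (envx s1 j I1.1 g1 jn) dkf).2 (Hf j jn).
  by exists s2; have [I2 g2] := body j s1 s2 jn I1 g1 R2.
have [s' [R' _]] := run_ForS_ex dk2 Iord Ist bodyE I0.
by exists s'.
Qed.

End Check.
End Ordered.
End Semantics.
End Evaluator.

(** * Guessing an order and relations *)

Section Guessing.
Variables (sg : signature) (T : finType) (k dd : nat).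
Notation arr := (bool + T)%type.
Notation dim := (fun _ : 'I_#|{: arr}| => dd).
Notation code := (seq (instr sg k.+1 dim)).
Notation term := (term sg k.+1).
Notation SetV := (@SetV sg arr k dd).
Notation GuessV := (@GuessV sg arr k dd).
Notation Ask := (@Ask sg arr k dd).
Notation Write := (@Write sg arr k dd).
Notation V := (@V sg k).
Notation While_ := (@While sg k.+1 #|{: arr}| dim).
Notation Used := (Used T).
Notation Succ := (Succ T).
Notation ForS := (@ForS sg T k dd).
Notation IfZero := (@IfZero sg T k dd).

(** Asking that the guessed element be new keeps the chain free of repetitions, so that successors
    on it are unique. *)
Definition next_elem : code :=
  GuessV 1 :: Ask 2 Used [:: V 1] false ++
  [:: Write Used [:: V 1] Max; Write Succ [:: V 0; V 1] Max; SetV 0 (V 1)].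

Definition ask_consts : code := flatten [seq Ask 2 Used [:: Cst j] true | j <- enum 'I_(ncst sg)].

Definition GuessOrder : code :=
  SetV 0 Zero :: Write Used [:: Zero] Max ::
  While_ (TNot (TEq (V 0) Max)) next_elem :: ask_consts.

(** Guessing 0 turns the cell to max, any other guess leaves it alone. The reset to 0 is reserved
    for schemes that may write other values than max. *)
Definition GuessCell (wz : bool) (t : T) (ts : seq term) (d : nat) : code :=
  (if wz then [:: Write (XA t) ts Zero] else [::]) ++
  GuessV d :: IfZero d [:: Write (XA t) ts Max].

(** Guesses the cells of [t] whose coordinates start with [ts]; the cells are
    first reset when [wz]. *)
Fixpoint GuessN (wz : bool) (t : T) (ts : seq term) (m d : nat) : code :=
  if m is m'.+1 then ForS d (GuessN wz t (rcons ts (V d)) m' d.+1) else GuessCell wz t ts d.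

Definition GuessAll (wz : bool) (pre : seq term) (len : T -> nat) (d : nat) (l : seq T) : code :=
  flatten [seq GuessN wz t pre (len t) d | t <- l].

Definition FinalMax : code := [seq SetV i Max | i <- iota 0 k.+1].

Section Semantics.
Variables (B : structure sg) (z mx : B).
Hypotheses (zmx : z != mx) (dd2 : 1 < dd).
Notation stor := (store B k.+1 dim).
Notation cells := {a : 'I_#|{: arr}| & dd.-tuple B}.
Notation run := (@run sg arr k dd B z mx).
Notation get := (@get sg arr k dd B).
Notation key := (@key sg arr dd B z).
Notation bits := (@bits sg arr k dd B mx).
Notation ev_t := (eval_term z mx).
Notation order_on := (@order_on sg T dd B z mx).
Implicit Types (s : stor).

Lemma key_arr f f' us us' : key f us = key f' us' -> f = f'.
Proof. by move=> E; apply: enum_rank_inj; exact: (congr1 (@tag _ _) E). Qed.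

Lemma eq_key1 f u u' : (key f [:: u] == key f [:: u']) = (u == u').
Proof.
apply/eqP/eqP => [E|-> //].
by have [_ [->]] := key_inj (erefl : size [:: u] = size [:: u']) (ltnW dd2) E.
Qed.

Lemma eq_key2 f u v u' v' : (key f [:: u; v] == key f [:: u'; v']) = (u == u') && (v == v').
Proof.
apply/eqP/andP => [E|[/eqP -> /eqP ->] //].
by have [_ [-> ->]] := key_inj (erefl : size [:: u; v] = size [:: u'; v']) dd2 E.
Qed.

Lemma neq_key f f' us us' : f != f' -> (key f us == key f' us') = false.
Proof. by move=> ne; apply/negbTE; apply: contra ne => /eqP/key_arr ->. Qed.

Lemma bits_set s c c' u : bits (set_cell s c u) c' = if c' == c then u == mx else bits s c'.
Proof. by rewrite /bits ffunE; case: ifP. Qed.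

Lemma get_cell s c u i : get (set_cell s c u) i = get s i. Proof. by []. Qed.

Definition is_path (o : seq B) s : Prop :=
  [/\ [/\ uniq o, nth z o 0 = z, 0 < size o & get s 0 = nth z o (size o).-1],
      forall u, bits s (key Used [:: u]) = (u \in o),
      forall u v, bits s (key Succ [:: u; v]) <->
        exists2 i, i.+1 < size o & u = nth z o i /\ v = nth z o i.+1
    & forall t us, bits s (key (XA t) us) = false].

Definition after_next s (y : B) : stor :=
  let s2 := set_var (set_var s (var k 1) y) (var k 2) (s.2 (key Used [:: y])) in
  set_var (set_cell (set_cell s2 (key Used [:: y]) mx) (key Succ [:: get s 0; y]) mx) (var k 0) y.

Hypothesis k2 : 1 < k.

Lemma run_next_elem s s' : run next_elem s s' <->
  exists y, bits s (key Used [:: y]) = false /\ s' = after_next s y.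
Proof.
have k1 : 0 < k by apply: ltnW.
have G u y : get (set_var (set_var s (var k 1) y) (var k 2) u) 1 = y by rewrite get_set // get_set_same.
have G0 u y : get (set_var (set_var s (var k 1) y) (var k 2) u) 0 = get s 0 by rewrite !get_set.
split=> [/run_cons[s1 [/run_GuessV[y ->] /run_cat[s2 [/run_Ask[]]]]]|[y [Uy ->]]].
  rewrite map_V1 get_set_same => Uy -> /run_cons[s3 [/run_Write -> /run_cons[s4 [/run_Write ->]]]].
  move=> /run_SetV ->; exists y; split=> //; rewrite map_V1 map_V2 !ev_V.
  by rewrite !get_cell !G !G0.
apply/run_cons; eexists; split; first by apply/run_GuessV; exists y.
apply/run_cat; eexists; split.
  by apply/run_Ask; split; [rewrite map_V1 get_set_same|].
apply/run_cons; eexists; split; first by apply/run_Write.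
apply/run_cons; eexists; split; first by apply/run_Write.
apply/run_SetV; rewrite !map_V1 map_V2 !ev_V !get_cell get_set_same.
by rewrite !G !G0.
Qed.

Lemma path_next o s y : is_path o s -> y \notin o -> is_path (rcons o y) (after_next s y).
Proof.
move=> [[uo h0 n0 g] HU HS HX] yo.
have nr i : i < size o -> nth z (rcons o y) i = nth z o i by move=> io; rewrite nth_rcons io.
have nl : nth z (rcons o y) (size o) = y by rewrite nth_rcons ltnn eqxx.
have bU u : bits (after_next s y) (key Used [:: u]) = (u \in rcons o y).
  rewrite -[LHS]/(bits (set_cell _ _ _) _) bits_set neq_key // bits_set eq_key1 mem_rcons inE eqxx.
  by case: eqP => //= _; apply: HU.
split=> //.
- split; [by rewrite rcons_uniq yo|by rewrite nr|by rewrite size_rcons|].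
  by rewrite size_rcons nl; apply: get_set_same.
- move=> u v; rewrite -[bits _ _]/(bits (set_cell _ _ _) _) bits_set eq_key2 bits_set neq_key // eqxx.
  have -> : (if (u == get s 0) && (v == y) then true else bits s (key Succ [:: u; v])) =
    ((u == get s 0) && (v == y)) || bits s (key Succ [:: u; v]) by case: ifP.
  rewrite size_rcons; split=> [/orP[/andP[/eqP -> /eqP ->]|/HS[i io [-> ->]]]|[i]].
  + by exists (size o).-1; rewrite ?prednK // nr ?prednK.
  + by exists i; [apply: ltnW|rewrite !nr // ltnW].
  rewrite ltnS leq_eqVlt => /orP[/eqP Ei|io] [-> ->].
    have ei : i = (size o).-1 by lia.
    by rewrite Ei nl g -ei nr ?eqxx //; lia.
  apply/orP; right; apply/HS; exists i => //.
  by rewrite !nr // ltnW.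
- move=> t us; rewrite -[LHS]/(bits (set_cell _ _ _) _) bits_set neq_key // bits_set neq_key //.
  exact: HX.
Qed.

Definition start_path s := set_cell (set_var s (var k 0) z) (key Used [:: z]) mx.

Lemma path_start s : (forall c, bits s c = false) -> is_path [:: z] (start_path s).
Proof.
move=> H; split=> //; first by split=> //; apply: get_set_same.
- by move=> u; rewrite bits_set eq_key1 inE eqxx; case: eqP => // _; apply: H.
- move=> u v; rewrite bits_set neq_key //.
  have -> : bits (set_var s (var k 0) z) (key Succ [:: u; v]) = false := H _.
  by split=> // -[[|i]].
- by move=> t us; rewrite bits_set neq_key //; apply: H.
Qed.

Lemma run_asks s s' (l : seq 'I_(ncst sg)) : run (flatten [seq Ask 2 Used [:: Cst j] true | j <- l]) s s' ->
  s'.2 = s.2 /\ forall j, j \in l -> bits s (key Used [:: cst_of (itp B) j]).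
Proof.
elim: l s => [|j l IH] s; first by move=> /run_nil ->.
move=> /run_cat[s1 [/run_Ask[bj Es] /IH[E H]]]; rewrite E Es; split=> // i.
by rewrite inE => /orP[/eqP ->|/H]; [exact: bj|rewrite Es].
Qed.

Lemma run_asks_ex s (l : seq 'I_(ncst sg)) : (forall j, bits s (key Used [:: cst_of (itp B) j])) ->
  exists s', run (flatten [seq Ask 2 Used [:: Cst j] true | j <- l]) s s'.
Proof.
elim: l s => [|j l IH] s H; first by exists s; apply/run_nil.
pose s1 := set_var s (var k 2) (s.2 (key Used [:: cst_of (itp B) j])).
have [s' R] := IH s1 H; exists s'; apply/run_cat; exists s1; split=> //.
by apply/run_Ask; split=> //; apply: H.
Qed.

Definition guessed_order (o : seq B) s := order_on o (bits s) /\ forall t us, bits s (key (XA t) us) = false.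

Lemma path_order o s s' : is_path o s -> get s 0 = mx -> s'.2 = s.2 ->
  (forall j, bits s (key Used [:: cst_of (itp B) j])) -> guessed_order o s'.
Proof.
move=> [[uo h0 n0 g] HU HS HX] gm E Hc; rewrite /guessed_order /bits E; split; last exact: HX.
split=> //; first by rewrite -g.
  case: (size o) n0 g (erefl (size o)) => [//|[|//]] _ g _.
  by rewrite /= h0 gm in g; move: zmx; rewrite -g eqxx.
by move=> j; rewrite -HU; apply: Hc.
Qed.

Lemma run_GuessOrder s s' : (forall c, bits s c = false) -> run GuessOrder s s' ->
  exists o, guessed_order o s'.
Proof.
move=> H /run_cons[s1 [/run_SetV Es1 /run_cons[s2 [/run_Write Es2 /run_cons[s3 [R3 R4]]]]]].
have P2 : is_path [:: z] s2 by rewrite Es2 Es1; apply: path_start.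
have [] := run_while_ind (P := fun s => exists o, is_path o s) _ R3.
- move=> s4 s5 [o Po] _ /run_next_elem[y [Uy ->]]; exists (rcons o y); apply: path_next => //.
  by case: Po => _ HU _ _; rewrite -HU Uy.
- by exists [:: z].
move=> [o Po] /=; rewrite negbK => /eqP gm; exists o.
have [E Hc] := run_asks R4; apply: path_order Po gm E _.
by move=> j; apply: Hc; rewrite mem_enum.
Qed.

(** Here the chain lists the whole universe, in any order from 0 to max; this is the case used to
    show that members are accepted. *)
Lemma run_GuessOrder_ex s o : (forall c, bits s c = false) -> uniq o -> (forall u, u \in o) ->
  nth z o 0 = z -> nth z o (size o).-1 = mx ->
  exists s', run GuessOrder s s' /\ guessed_order o s'.
Proof.
move=> H uo ao h0 hl; have n0 : 0 < size o by case: (o) (ao z).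
suff [s3 [R3 P3]] : exists s3, run [:: While_ (TNot (TEq (V 0) Max)) next_elem] (start_path s) s3 /\ is_path o s3.
  have gm : get s3 0 = mx by case: P3 => -[_ _ _ ->].
  have Hc j : bits s3 (key Used [:: cst_of (itp B) j]) by case: P3 => _ -> _ _; apply: ao.
  have [s4 R4] := run_asks_ex (enum 'I_(ncst sg)) Hc.
  have [E4 _] := run_asks R4.
  exists s4; split; last exact: path_order P3 gm E4 Hc.
  apply/run_cons; eexists; split; first by apply/run_SetV.
  apply/run_cons; eexists; split; first by apply/run_Write.
  by apply/run_cons; exists s3.
have P1 : is_path (take 1 o) (start_path s).
  by have -> : take 1 o = [:: z]; [case: (o) n0 h0 => //= u l _ ->; rewrite take0|apply: path_start].
suff H3 r i s1 : 0 < i -> i + r = size o -> is_path (take i o) s1 ->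
    exists s3, run [:: While_ (TNot (TEq (V 0) Max)) next_elem] s1 s3 /\ is_path o s3.
  by apply: (H3 (size o - 1) 1) P1 => //; lia.
elim: r i s1 {P1} => [|r IH] i s1 i0 ir P1.
  rewrite addn0 in ir; rewrite ir take_size in P1; exists s1; split=> //.
  by apply/run_while; case: P1 => -[_ _ _]; rewrite hl /get /= => -> _ _ _; rewrite eqxx.
have io : i < size o by lia.
have Et : take i.+1 o = rcons (take i o) (nth z o i) by rewrite -take_nth.
have yo : nth z o i \notin take i o.
  have := take_uniq i.+1 uo; rewrite Et rcons_uniq => /andP[] //.
have P2 := path_next P1 yo; rewrite -Et in P2.
have [s' [R' P']] := IH i.+1 _ isT ltac:(lia) P2.
exists s'; split=> //; apply/run_while.
have -> : eval_test z mx s1 (TNot (TEq (V 0) Max)) = true.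
  case: P1 => -[_ _ _]; rewrite /get /= => -> _ _ _; apply/negP; rewrite size_takel ?(ltnW io) //.
  rewrite nth_take ?prednK // -hl nth_uniq //; lia.
exists (after_next s1 (nth z o i)); split=> //; apply/run_next_elem; exists (nth z o i); split=> //.
by case: P1 => _ -> _ _; apply/negbTE.
Qed.

(** ** Guessing relations *)

Definition vframe (d : nat) s s' := forall i, i < d -> i <= k -> get s' i = get s i.

Definition region (t : T) (us : seq B) (m : nat) (c : cells) : Prop :=
  exists2 ws, size ws = m & c = key (XA t) (us ++ ws).

Definition keeps (t : T) us m s s' := forall c, ~ region t us m c -> s'.2 c = s.2 c.

Lemma order_keeps o t us m s s' : keeps t us m s s' -> order_on o (bits s) -> order_on o (bits s').
Proof.
move=> K [o1 o2 o3 o4 o5 o6 o7].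
have nr f vs : f = Used \/ f = Succ -> ~ region t us m (key f vs).
  by move=> Hf [ws _ /key_arr E]; case: Hf; rewrite E.
have rU u : ~ region t us m (key Used [:: u]) by apply: nr; left.
have rS u v : ~ region t us m (key Succ [:: u; v]) by apply: nr; right.
split=> // [u|u v]; first by rewrite /bits (K _ (rU u)); apply: o5.
by rewrite /bits (K _ (rS u v)); apply: o6.
Qed.

Lemma region_rcons t us x m c : region t (rcons us x) m c -> region t us m.+1 c.
Proof. by move=> [ws sw ->]; exists (x :: ws); rewrite /= ?sw // cat_rcons. Qed.

Section Ordered.
Variable o : seq B.
Notation n := (size o).

Lemma run_GuessCell wz t ts us d s s' : d <= k ->
  (forall s1, vframe d s s1 -> [seq ev_t s1 u | u <- ts] = us) ->
  run (GuessCell wz t ts d) s s' -> vframe d s s' /\ keeps t us 0 s s'.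
Proof.
move=> dk Hts R.
have reg : region t us 0 (key (XA t) us) by exists [::]; rewrite ?cats0.
have sc s1 u : keeps t us 0 s1 (set_cell s1 (key (XA t) us) u).
  by move=> c nc; rewrite ffunE; case: eqP => // E; case: nc; rewrite E.
have vf s1 u : vframe d s1 (set_var s1 (var k d) u).
  by move=> i id ik; rewrite get_set // ltn_eqF.
have [s1 [v1 k1 R1]] : exists s1, [/\ vframe d s s1, keeps t us 0 s s1 &
    run (GuessV d :: IfZero d [:: Write (XA t) ts Max]) s1 s'].
  case: wz R => [/run_cons[s1 [/run_Write -> R1]]|R1]; last by exists s.
  rewrite Hts // in R1; exists (set_cell s (key (XA t) us) z).
  by split; [|exact: sc|exact: R1].
move: R1 => /run_cons[s2 [/run_GuessV[u ->] /(run_IfZero zmx)]].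
have v2 : vframe d s (set_var s1 (var k d) u) by move=> i id ik; rewrite vf // v1.
case: ifP => _ => [[s3 [/run_Write -> ->]]|->].
  by split=> [i id ik|c nc]; [rewrite vf // -v2|rewrite /= Hts // sc // k1].
by split=> // c nc; apply: k1.
Qed.

(** The guessed contents are arbitrary; what matters is that the chain stays intact, since the loops
    themselves walk along it. *)
Lemma run_GuessN wz t ts us m d s s' : d + m.+2 <= k -> size us + m <= dd -> order_on o (bits s) ->
  (forall s1, vframe d s s1 -> [seq ev_t s1 u | u <- ts] = us) ->
  run (GuessN wz t ts m d) s s' -> vframe d s s' /\ keeps t us m s s'.
Proof.
elim: m ts us d s s' => [|m IH] ts us d s s' dk sd ord Hts /=.
  by apply: run_GuessCell => //; lia.
have dk2 : d.+2 <= k by lia.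
have d0k : d <= k by lia.
pose Inv (j : nat) s1 := vframe d s s1 /\ keeps t us m.+1 s s1.
have Iord j s1 : Inv j s1 -> order_on o (bits s1) by move=> [_ K1]; apply: order_keeps K1 ord.
have Ist j s1 s2 : Inv j s1 -> frame d s1 s2 -> Inv j s2.
  by move=> [v1 K1] [E F]; split=> [i id ik|c nc]; [rewrite F // v1|rewrite E K1].
have body j s1 s2 : j < n -> Inv j s1 -> get s1 d = nth z o j ->
    run (GuessN wz t (rcons ts (V d)) m d.+1) s1 s2 -> Inv j.+1 s2 /\ get s2 d = nth z o j.
  move=> jn [v1 K1] g1 R.
  have dkm : d.+1 + m.+2 <= k by lia.
  have sdm : size (rcons us (get s1 d)) + m <= dd by rewrite size_rcons; lia.
  have Hts1 s3 : vframe d.+1 s1 s3 -> [seq ev_t s3 u | u <- rcons ts (V d)] = rcons us (get s1 d).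
    move=> v3; rewrite map_rcons ev_V v3 ?ltnSn // Hts // => i id ik.
    by rewrite v3 ?v1 // ltnW.
  have [v2 K2] := IH _ _ d.+1 s1 s2 dkm sdm (order_keeps K1 ord) Hts1 R.
  split; last by rewrite v2 ?ltnSn.
  split=> [i id ik|c nc]; first by rewrite v2 ?v1 // ltnW.
  by rewrite K2 ?K1 // => /region_rcons.
have I0 : Inv 0 s by [].
by move=> R; have [] := run_ForS zmx dd2 dk2 Iord Ist body I0 R.
Qed.

Definition inside (ws : seq B) (m : nat) := size ws = m /\ {subset ws <= o}.

Lemma run_GuessCell_ex (wz : bool) t ts us d s (Y : seq B -> bool) : d <= k ->
  (forall s1, vframe d s s1 -> [seq ev_t s1 u | u <- ts] = us) ->
  wz \/ bits s (key (XA t) us) = false ->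
  exists s', run (GuessCell wz t ts d) s s' /\ bits s' (key (XA t) us) = Y us.
Proof.
move=> dk Hts Hz.
pose s1 := if wz then set_cell s (key (XA t) us) z else s.
have b1 : bits s1 (key (XA t) us) = false.
  rewrite /s1 {s1}; case: wz Hz => [_|[//|-> //]].
  by rewrite bits_set eqxx (negbTE zmx).
have v1 : vframe d s s1 by rewrite /s1; case: (wz).
have R1 q s' : run q s1 s' -> run ((if wz then [:: Write (XA t) ts Zero] else [::]) ++ q) s s'.
  move=> R; apply/run_cat; exists s1; split=> //; rewrite /s1; case: (wz); last exact/run_nil.
  by apply/run_Write; rewrite Hts.
pose s2 u := set_var s1 (var k d) u.
have v2 u : vframe d s (s2 u) by move=> i id ik; rewrite get_set // ltn_eqF // v1.
case EY: (Y us).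
  exists (set_var (set_cell (s2 z) (key (XA t) us) mx) (var k d) mx); split; last by rewrite /bits /= ffunE !eqxx.
  apply: R1; apply/run_cons; exists (s2 z); split; first by apply/run_GuessV; exists z.
  apply/(run_IfZero zmx); rewrite get_set_same eqxx; eexists; split; last by [].
  by apply/run_Write; rewrite Hts.
exists (s2 mx); split; last exact: b1.
apply: R1; apply/run_cons; exists (s2 mx); split; first by apply/run_GuessV; exists mx.
by apply/(run_IfZero zmx); rewrite get_set_same eq_sym (negbTE zmx).
Qed.

Lemma run_GuessN_ex (wz : bool) t ts us m d s (Y : seq B -> bool) : d + m.+2 <= k -> size us + m <= dd ->
  order_on o (bits s) ->
  (forall s1, vframe d s s1 -> [seq ev_t s1 u | u <- ts] = us) ->
  wz \/ (forall ws, inside ws m -> bits s (key (XA t) (us ++ ws)) = false) ->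
  exists s', run (GuessN wz t ts m d) s s' /\
    forall ws, inside ws m -> bits s' (key (XA t) (us ++ ws)) = Y (us ++ ws).
Proof.
elim: m ts us d s => [|m IH] ts us d s dk sd ord Hts Hz /=.
  have [||s' [R b]] := @run_GuessCell_ex wz t ts us d s Y _ Hts; first by lia.
    by case: Hz => [->|Hz]; [left|right; have := Hz [::]; rewrite cats0; apply].
  by exists s'; split=> // ws [/size0nil -> _]; rewrite cats0.
have dk2 : d.+2 <= k by lia.
have d0k : d <= k by lia.
(* The last clause says that cells not yet visited are unchanged, hence still false, which the
   variant without reset relies on. *)
pose Inv (j : nat) s1 := [/\ vframe d s s1, keeps t us m.+1 s s1,
  forall i ws, i < j -> i < n -> inside ws m -> bits s1 (key (XA t) (us ++ nth z o i :: ws)) = Y (us ++ nth z o i :: ws) &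
  forall i ws, j <= i -> i < n -> inside ws m -> bits s1 (key (XA t) (us ++ nth z o i :: ws)) = bits s (key (XA t) (us ++ nth z o i :: ws))].
have Iord j s1 : Inv j s1 -> order_on o (bits s1) by move=> [_ K1 _ _]; apply: order_keeps K1 ord.
have Ist j s1 s2 : Inv j s1 -> frame d s1 s2 -> Inv j s2.
  move=> [v1 K1 D1 U1] [E F]; rewrite /Inv /bits E; split=> //.
    by move=> i id ik; rewrite F // v1.
  by move=> c nc; rewrite E K1.
have body j s1 : j < n -> Inv j s1 -> get s1 d = nth z o j -> exists s2,
    [/\ run (GuessN wz t (rcons ts (V d)) m d.+1) s1 s2, Inv j.+1 s2 & get s2 d = nth z o j].
  move=> jn I1 g1; have ord1 := Iord _ _ I1; have [v1 K1 D1 U1] := I1.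
  have dkm : d.+1 + m.+2 <= k by lia.
  have sdm : size (rcons us (nth z o j)) + m <= dd by rewrite size_rcons; lia.
  have Hts1 s3 : vframe d.+1 s1 s3 -> [seq ev_t s3 u | u <- rcons ts (V d)] = rcons us (nth z o j).
    move=> v3; rewrite map_rcons ev_V v3 ?ltnSn // g1 Hts // => i id ik.
    by rewrite v3 ?v1 // ltnW.
  have Hz1 : wz \/ (forall ws, inside ws m -> bits s1 (key (XA t) (rcons us (nth z o j) ++ ws)) = false).
    case: Hz => [->|Hz]; [by left|right=> ws [sw ow]]; rewrite cat_rcons U1 //.
    apply: Hz; split; first by rewrite /= sw.
    by move=> u; rewrite inE => /orP[/eqP ->|/ow //]; apply: mem_nth.
  have [s2 [R2 b2]] := IH _ _ d.+1 s1 dkm sdm ord1 Hts1 Hz1.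
  have [v2 K2] := run_GuessN dkm sdm ord1 Hts1 R2.
  have other i ws : i != j -> i < n -> inside ws m ->
      bits s2 (key (XA t) (us ++ nth z o i :: ws)) = bits s1 (key (XA t) (us ++ nth z o i :: ws)).
    move=> ij il [sw ow]; rewrite /bits K2 // => -[ws' sw' E].
    rewrite cat_rcons in E.
    have E1 : size (us ++ nth z o i :: ws) = size (us ++ nth z o j :: ws') by rewrite !size_cat /= sw sw'.
    have E2 : size (us ++ nth z o i :: ws) <= dd by rewrite size_cat /= sw.
    have [_ /eqP] := key_inj E1 E2 E.
    rewrite eqseq_cat // eqxx /= eqseq_cons nth_uniq ?(o_uniq ord) // => /andP[/eqP Eij _].
    by rewrite Eij eqxx in ij.
  exists s2; split=> //; last by rewrite v2 ?ltnSn.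
  split.
  - by move=> i id ik; rewrite v2 ?v1 // ltnW.
  - by move=> c nc; rewrite K2 ?K1 // => /region_rcons.
  - move=> i ws; rewrite ltnS leq_eqVlt => /orP[/eqP ->|ij] il iw.
      by have := b2 ws iw; rewrite cat_rcons.
    by rewrite other ?D1 // ltn_eqF.
  - by move=> i ws ij il iw; rewrite other ?U1 ?gtn_eqF // ltnW.
have I0 : Inv 0 s by [].
have [s' [R [_ _ D _]]] := run_ForS_ex zmx dd2 dk2 Iord Ist body I0.
exists s'; split=> // -[|x ws] [] //= [sw] ow.
have xo : x \in o by apply: ow; rewrite inE eqxx.
have := D (index x o) ws; rewrite index_mem nth_index // => /(_ xo xo); apply; split=> // u uw.
by apply: ow; rewrite inE uw orbT.
Qed.

Section All.
Variables (wz : bool) (pre : seq term) (upre : seq B) (len : T -> nat) (d : nat).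
Hypothesis Hpre : forall s, [seq ev_t s u | u <- pre] = upre.
Hypothesis dk : forall t, d + (len t).+2 <= k.
Hypothesis sd : forall t, size upre + len t <= dd.

Lemma run_GuessAll l s s' : order_on o (bits s) -> run (GuessAll wz pre len d l) s s' ->
  order_on o (bits s') /\ forall c, (forall t, t \in l -> ~ region t upre (len t) c) -> s'.2 c = s.2 c.
Proof.
elim: l s => [|t l IH] s ord; first by move=> /run_nil ->.
move=> /run_cat[s1 [R1 R2]].
have [_ K1] := run_GuessN (dk t) (sd t) ord (fun s1 _ => Hpre s1) R1.
have [ord' K2] := IH s1 (order_keeps K1 ord) R2; split=> // c nc.
rewrite K2 ?K1 //; first by apply: nc; rewrite inE eqxx.
by move=> t' t'l; apply: nc; rewrite inE t'l orbT.
Qed.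

Lemma run_GuessAll_ex l s (Y : T -> seq B -> bool) : uniq l -> order_on o (bits s) ->
  wz \/ (forall t ws, t \in l -> inside ws (len t) -> bits s (key (XA t) (upre ++ ws)) = false) ->
  exists s', run (GuessAll wz pre len d l) s s' /\
    forall t ws, t \in l -> inside ws (len t) -> bits s' (key (XA t) (upre ++ ws)) = Y t (upre ++ ws).
Proof.
elim: l s => [|t l IH] s /=; first by exists s; split=> //; apply/run_nil.
move=> /andP[tl ul] ord Hz.
have [|s1 [R1 b1]] := @run_GuessN_ex wz t pre upre (len t) d s (Y t) (dk t) (sd t) ord (fun s1 _ => Hpre s1).
  by case: Hz => [->|Hz]; [left|right=> ws iw; apply: Hz; rewrite ?inE ?eqxx].
have [_ K1] := run_GuessN (dk t) (sd t) ord (fun s1 _ => Hpre s1) R1.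
have nr t' t'' us ws : t' != t'' -> ~ region t'' us (len t'') (key (XA t') ws).
  by move=> ne [ws' _ /key_arr [E]]; rewrite E eqxx in ne.
have [|s' [R' b']] := IH s1 ul (order_keeps K1 ord).
  case: Hz => [->|Hz]; [by left|right=> t' ws t'l iw]; rewrite /bits K1.
    by apply: Hz; rewrite ?inE ?t'l ?orbT.
  by apply: nr; apply: contraNneq tl => <-.
exists s'; split; first by apply/run_cat; exists s1.
move=> t' ws; rewrite inE => /orP[/eqP ->|t'l] iw; last exact: b'.
have [_ K2] := run_GuessAll (order_keeps K1 ord) R'.
rewrite /bits K2; first exact: b1.
by move=> t'' t''l; apply: nr; apply: contraNneq tl => ->.
Qed.

End All.
End Ordered.

Lemma run_FinalMax s : exists s', run FinalMax s s' /\ forall x, s'.1 x = mx.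
Proof.
suff H l s1 : exists s', run [seq SetV i Max | i <- l] s1 s' /\
    forall x, (x \in [seq var k i | i <- l]) || (s1.1 x == mx) -> s'.1 x = mx.
  have [s' [R E]] := H (iota 0 k.+1) s; exists s'; split=> // x; apply: E.
  by rewrite -(inord_val x) map_f // mem_iota ltn_ord.
elim: l s1 => [|i l IH] s1; first by exists s1; split=> [|x /eqP //]; apply/run_nil.
have [s' [R E]] := IH (set_var s1 (var k i) mx).
exists s'; split=> [|x H]; first by apply/run_cons; eexists; split; [apply/run_SetV|exact: R].
apply: E; rewrite ffunE; move: H; rewrite inE -orbA => /or3P[/eqP ->|->//|/eqP ->].
  by rewrite eqxx eqxx orbT.
by rewrite if_same eqxx orbT.
Qed.

End Semantics.
End Guessing.

(** * From machines to schemes *)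

(** The encoding determines the interpretation pointwise; closure under isomorphism, applied to the
    identity, bridges the gap to equality of functions. *)
Lemma member_encode sg (Om : problem sg) n (gt : 1 < #|'I_n|) (I : interp sg 'I_n) :
  encoding Om (encode I) <-> Om (@Structure sg 'I_n gt I).
Proof.
split=> [[n' [gt' [I' [OI E]]]]|OI]; last by exists n, gt, I.
have n0 : 0 < n by move: (gt); rewrite card_ord; apply: ltnW.
have n0' : 0 < n' by move: (gt'); rewrite card_ord; apply: ltnW.
have En : n = n'.
  by move: E; rewrite (encodeE (Ordinal n0)) (encodeE (Ordinal n0')) => /nseq_false_inj[].
subst n'; have [Er Ec] := encode_inj n0 E.
apply: iso_closed OI; exists id; split=> [|i t|j]; first by exists id.
  by rewrite /= Er; congr (rel_of _ _); apply: eq_from_tnth => q; rewrite tnth_map.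
by rewrite /= Ec.
Qed.

(** * Induced structures on initial segments *)

Section Copies.
Variables (sg : signature) (B : structure sg) (z : B) (o : seq B).
Hypotheses (uo : uniq o) (o1 : 1 < size o) (co : forall j, cst_of (itp B) j \in o).
Notation n := (size o).

Lemma index_cst j : index (cst_of (itp B) j) o < n. Proof. by rewrite index_mem. Qed.

(** The structure induced on the elements of [o], copied on their indices. *)
Definition copy : interp sg 'I_n :=
  Interp (fun i (t : (arity i).-tuple 'I_n) => rel_of (itp B) [tuple nth z o (tnth t q) | q < arity i])
         (fun j => Ordinal (index_cst j)).

Lemma card_ord_gt1 : 1 < #|'I_n|. Proof. by rewrite card_ord. Qed.

Lemma copy_cst j : nth z o (cst_of copy j) = cst_of (itp B) j.
Proof. exact: nth_index. Qed.

Definition elems : {set B} := [set u in o].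

Lemma elems_gt1 : 1 < #|elems|.
Proof. by rewrite cardsE (card_uniqP uo). Qed.

Lemma elems_cst j : cst_of (itp B) j \in elems. Proof. by rewrite inE. Qed.

Lemma nth_elems (i : 'I_n) : nth z o i \in elems. Proof. by rewrite inE mem_nth. Qed.

Lemma copy_iso : isomorphic (@Structure sg 'I_n card_ord_gt1 copy) (substructure elems_gt1 elems_cst).
Proof.
pose f (i : 'I_n) : {x | x \in elems} := exist _ (nth z o i) (nth_elems i).
exists f; split=> [|i t|j].
- apply: inj_card_bij => [i j /(congr1 val) /= /eqP|].
    by rewrite nth_uniq // => /eqP /val_inj.
  suff : #|{: {x | x \in elems}}| <= #|'I_n| by [].
  by rewrite card_sig card_ord -[X in X <= _]/#|elems| cardsE (card_uniqP uo).
- rewrite /=; congr (rel_of _ _); apply: eq_from_tnth => q.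
  by rewrite !tnth_map tnth_ord_tuple.
by apply: val_inj; rewrite /= copy_cst.
Qed.

Lemma iso_copy : (forall u, u \in o) -> isomorphic B (@Structure sg 'I_n card_ord_gt1 copy).
Proof.
move=> ao; have io u : index u o < n by rewrite index_mem.
exists (fun u => Ordinal (io u)); split=> [|i t|j].
- apply: inj_card_bij => [u v [E]|].
    by rewrite -(nth_index z (ao u)) E nth_index.
  by rewrite card_ord -(card_uniqP uo) max_card.
- rewrite /=; congr (rel_of _ _); apply: eq_from_tnth => q.
  by rewrite tnth_mktuple tnth_map /= nth_index.
exact: val_inj.
Qed.

End Copies.

Lemma enum_ends (B : finType) (z mx : B) : z != mx -> exists o : seq B,
  [/\ uniq o, forall u, u \in o, nth z o 0 = z & nth z o (size o).-1 = mx].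
Proof.
move=> ne; exists (z :: rcons [seq u <- enum B | (u != z) && (u != mx)] mx); split=> //.
- rewrite /= mem_rcons inE (negbTE ne) rcons_uniq !mem_filter !eqxx /= andbF /=.
  exact/filter_uniq/enum_uniq.
- move=> u; rewrite inE mem_rcons inE mem_filter mem_enum andbT.
  by case: (u == z); case: (u == mx).
by rewrite /= size_rcons /= nth_rcons ltnn eqxx.
Qed.

Lemma chead_nsteps M t (c c' : config M) i : nsteps (@tm_step M) t c c' -> chead c' i <= chead c i + t.
Proof.
elim: t c => [|t IH] c /=; first by move=> <-; rewrite addn0.
move=> [c1 [[q [s [m [_ ->]]]] /IH]] /=; case: (m i) => /=; lia.
Qed.

(** The base [s + 2] is at least 2, so coefficients and sums can be absorbed into the exponent. *)
Lemma poly_le_exp (p : {poly nat}) : exists c, forall s, (p.[s])%R <= (s + 2) ^ c.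
Proof.
elim/poly_ind: p => [|p a [c Hc]]; first by exists 0 => s; rewrite horner0.
exists (c + a + 2) => s; rewrite hornerMXaddC.
have H1 : (p.[s])%R * s <= (s + 2) ^ (c + a + 1).
  apply: (@leq_trans ((s + 2) ^ c * (s + 2) ^ 1)); first by rewrite leq_mul ?expn1 ?leq_addr.
  by rewrite -expnD leq_pexp2l; lia.
have H2 : a <= (s + 2) ^ (c + a + 1).
  apply: (@leq_trans (2 ^ a)); first exact: ltnW (ltn_expl _ _).
  apply: (@leq_trans ((s + 2) ^ a)); last by rewrite leq_pexp2l; lia.
  by case: (a) => // b; rewrite leq_exp2r //; lia.
have -> : c + a + 2 = (c + a + 1).+1 by lia.
rewrite expnS -[leqLHS]/((p.[s])%R * s + a); apply: leq_trans (leq_add H1 H2) _.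
by rewrite addnn -mul2n leq_mul2r leq_addl orbT.
Qed.

Lemma encode_size_exp sg : exists e, forall n (I : interp sg 'I_n), 1 < n -> size (encode I) + 2 <= n ^ e.
Proof.
pose A := foldr maxn 0 (arities sg).
exists (A + nblk sg + 4) => n I n1; rewrite (size_encode (Ordinal (ltnW n1))).
set S := sumn _; have HS : S <= nblk sg * n ^ A.
  rewrite /S -size_arities /A; elim: (arities sg) => //= a l IH.
  have l1 : n ^ a <= n ^ maxn a (foldr maxn 0 l) by rewrite leq_pexp2l ?leq_maxl // ltnW.
  have l2 : n ^ foldr maxn 0 l <= n ^ maxn a (foldr maxn 0 l) by rewrite leq_pexp2l ?leq_maxr // ltnW.
  rewrite mulSn leq_add //; apply: leq_trans IH _; by rewrite leq_mul2l l2 orbT.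
have X0 : 0 < n ^ A by rewrite expn_gt0 ltnW.
have Y : nblk sg < n ^ nblk sg by apply: ltn_expl.
rewrite (expnD n (A + nblk sg)) (expnD n A); set X := n ^ A in HS X0 *; set b := nblk sg in HS Y *; set Z := n ^ b in Y *.
have XZ : b * X + X <= X * Z by rewrite -mulSnr mulnC leq_mul2l Y orbT.
have n4 : n + 3 <= n ^ 4.
  have q : 4 <= n * n by apply: (leq_mul n1 n1).
  have q' : 2 * n <= n * n by rewrite leq_mul2r n1 orbT.
  have : 4 * (n * n) <= (n * n) * (n * n) by rewrite leq_mul2r q orbT.
  by rewrite !expnS expn0 muln1 mulnA; lia.
have W1 : S.+1 <= X * Z by apply: leq_trans XZ; rewrite -addn1 leq_add.
have : X * Z * (n + 3) <= X * Z * n ^ 4 by rewrite leq_mul2l n4 orbT.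
apply: leq_trans; move: W1; set W := X * Z => W1.
have : n + 2 <= W * (n + 2) by rewrite leq_pmull //; lia.
by rewrite -[n + 3]/(n + 2.+1) addnS mulnS; lia.
Qed.

(** * The two searching schemes *)

Section Assembly.
Variables (sg : signature) (Om : problem sg) (M : tm) (K' : nat).
Notation K := K'.+1.
Hypothesis heads : forall n (I : interp sg 'I_n), 1 < n -> forall c,
  reaches (@tm_step M) (init_config M (encode I)) c -> forall i, chead c i < n ^ K.
Hypothesis acc : forall n gt (I : interp sg 'I_n), Om (@Structure sg 'I_n gt I) <-> tm_accepts M (encode I).
Hypothesis ext : EXT Om.

Notation T := (mtag sg M).
Notation mar := (@mar sg M).
Notation sys := (machine_sys sg M).

Definition max_ar := \max_(t : T) mar t.
(** Each number below [n ^ K] takes [K] coordinates, and a relation has its level as one more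
    argument; the 2 makes room for [Succ]. *)
Definition cell_dim := 2 + K * max_ar.+1.
Notation dd := cell_dim.

Lemma len_le_dim (t : T) : K * (mar t).+1 <= dd.
Proof. by rewrite /dd (leq_trans _ (leq_addl _ _)) // leq_mul2l ltnS (leq_bigmax t) orbT. Qed.

Lemma dd2 : 1 < dd. Proof. by []. Qed.

Definition FLastE (x : nat) : fo T := Neg (Ex (FLt T x.+1 0)).
Definition fInit : fo T := Ex (Conj (FFirst _ 0) (INIT sys 0)).
Definition fFinal : fo T := Ex (Conj (FFirst _ 0) (FINAL sys 0)).
(** The two slots are level 0 and level [N.-1]: their digits are all the first or all the last
    element of the chain, so the terms [Zero] and [Max] address them directly. *)
Definition fStep : fo T := Ex (Ex (Conj (Conj (FFirst _ 1) (FLastE 0)) (STEP sys 1 0))).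
Definition fSame : fo T := Ex (Ex (Conj (Conj (FLastE 1) (FFirst _ 0)) (FSame mar predT 1 0))).

Definition needs (f : fo T) := need (dtr K' f).
Definition top_var := dd + 2 + needs (psiB sys) + needs fInit + needs fFinal + needs fStep + needs fSame.
Notation k := top_var.
Notation arr := (bool + T)%type.
Notation dim := (fun _ : 'I_#|{: arr}| => dd).
Notation code := (seq (instr sg k.+1 dim)).
Notation GuessV := (@GuessV sg arr k dd).
Notation V := (@V sg k).
Notation While_ := (@While sg k.+1 #|{: arr}| dim).
Notation chk f := (@check sg T k dd true (dtr K' f) [::] 0).

Definition searchB : code :=
  GuessAll (sg := sg) (k := k) dd false [::] (fun t => K * (mar t).+1) 0 (enum T) ++
  chk (psiB sys) ++ FinalMax sg T k dd.

Definition guess_level (u : term sg k.+1) : code :=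
  GuessAll (sg := sg) (k := k) dd true (nseq K u) (fun t => K * mar t) 0 (enum T).

(** A successor is guessed in the last slot and checked against the first; then the first slot is
    guessed anew and checked to agree with the last, which amounts to copying. *)
Definition next_config : code :=
  guess_level Max ++ chk fStep ++ guess_level Zero ++ chk fSame.

(** Variable 0 is guessed before every round; the value max ends the simulation, so the number of
    simulated steps is free. *)
Definition loopA : code := [:: GuessV 0; While_ (TNot (TEq (V 0) Max)) (next_config ++ [:: GuessV 0])].

Definition searchA : code :=
  guess_level Zero ++ chk fInit ++ loopA ++ chk fFinal ++ FinalMax sg T k dd.

Section Semantics.
Variables (B : structure sg) (z mx : B).
Hypothesis zmx : z != mx.
Notation stor := (store B k.+1 dim).
Notation run := (@run sg arr k dd B z mx).
Notation key := (@key sg arr dd B z).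
Notation bits := (@bits sg arr k dd B mx).
Notation order_on := (@order_on sg T dd B z mx).
Implicit Types (s : stor).

Lemma k2 : 1 < k. Proof. by rewrite /k /dd; lia. Qed.

Section Ordered.
Variable o : seq B.
Notation n := (size o).
Notation N := (n ^ K).
Notation denv e := (flatten [seq digits n K y | y <- e]).

Definition coords (e : seq nat) : seq B := [seq nth z o x | x <- denv e].

Definition XXof s (l : nat) (t : T) (args : seq nat) : bool := bits s (key (XA t) (coords (l :: args))).

Lemma size_denv e : size (denv e) = K * size e.
Proof. by elim: e => [|x e IH]; rewrite ?muln0 // mulnS -IH /= size_cat size_digits. Qed.

Lemma size_coords e : size (coords e) = K * size e.
Proof. by rewrite size_map size_denv. Qed.

Section WithOrder.
Hypotheses (uo : uniq o) (o1 : 1 < n) (co : forall j, cst_of (itp B) j \in o).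
Notation I := (copy z co).
Notation A := (@Structure sg 'I_n (card_ord_gt1 o1) I).
Notation w := (encode I).
Definition x0 : 'I_n := Ordinal (ltnW o1).
Notation Bk := (blk x0 I).
Notation init := (init_config M w).
Notation reachable := (reaches (@tm_step M) init).

Lemma n_le_N' : n <= N.
Proof. by rewrite -[X in X <= _]expn1 leq_pexp2l // ltnW. Qed.

Lemma N_gt1' : 1 < N. Proof. exact: leq_trans o1 n_le_N'. Qed.
Lemma N_gt0' : 0 < N. Proof. exact: ltnW N_gt1'. Qed.

Lemma simM : simulates mar predT N n Bk sys (@mencf sg M n) (eq^~ init)
  (fun c => halted c /\ accepting (cstate c)) reachable (@tm_step M).
Proof. by apply: machine_simulates (x0) I o1 n_le_N' _; apply: heads. Qed.

Notation enc c x := (encodes mar predT N (@mencf sg M n) c x).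

Lemma accepts_run : Om A <-> exists c c', [/\ c = init, reaches (@tm_step M) c c' & halted c' /\ accepting (cstate c')].
Proof.
rewrite acc; split=> [[c [R h a]]|[_ [c [-> R [h a]]]]]; last by exists c.
by exists init, c.
Qed.

Lemma denv_lt e : all (gtn N) e -> all (gtn n) (denv e).
Proof. by elim: e => // x e IH /andP[xn /IH H]; rewrite -[denv _]/(digits n K x ++ denv e) all_cat H andbT digits_lt. Qed.

Lemma coords_in e : all (gtn N) e -> {subset coords e <= o}.
Proof.
by move=> /denv_lt /allP H u /mapP[x /H xn ->]; apply: mem_nth.
Qed.

Lemma coords_inj e e' : size e = size e' -> all (gtn N) e -> all (gtn N) e' -> coords e = coords e' -> e = e'.
Proof.
move=> sz ae ae' E; have Ed : denv e = denv e'.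
  have := denv_lt ae; have := denv_lt ae'; move: E; rewrite /coords.
  elim: (denv e) (denv e') => [|x d IH] [|x' d'] //= [Ex /IH H] /andP[x'n /H{}H] /andP[xn /H ->].
  by move/eqP: Ex; rewrite nth_uniq // => /eqP ->.
have shE l : shape [seq digits n K y | y <- l] = nseq (size l) K.
  by elim: l => //= y l ->; rewrite size_digits.
have {}Ed : [seq digits n K y | y <- e] = [seq digits n K y | y <- e'].
  by apply: flatten_inj_shape Ed; rewrite !shE sz.
elim: e e' sz ae ae' Ed {E} => [|x e IH] [|x' e'] // [sz] /andP[xN ae] /andP[xN' ae'] Ed.
have [E1 E2] : digits n K x = digits n K x' /\ [seq digits n K y | y <- e] = [seq digits n K y | y <- e'].
  by split; [have := congr1 (head [::]) Ed|have := congr1 behead Ed].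
by rewrite (IH e') // -(val_digits (ltnW o1) xN) E1 val_digits // ltnW.
Qed.

Lemma coords0 : coords [:: 0] = nseq K (nth z o 0).
Proof. by rewrite /coords -[denv _]/(digits n K 0 ++ [::]) cats0 (@digits0 K' n (ltnW o1)) map_nseq. Qed.

Lemma val_of_nseq_max m : (val_of n (nseq m n.-1)).+1 = n ^ m.
Proof.
elim: m => [|m IH] //; rewrite -[nseq _ _]/([:: n.-1] ++ nseq m n.-1) val_of_cat size_nseq.
rewrite -addnS IH /= expn0 muln1 addn0 expnS.
by rewrite -mulSnr prednK // ltnW.
Qed.

Lemma coords_last : coords [:: N.-1] = nseq K (nth z o n.-1).
Proof.
have an : all (gtn n) (nseq K n.-1) by apply/allP => x /nseqP[-> _] /=; rewrite prednK // ltnW.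
have E : digits n K N.-1 = nseq K n.-1.
  have := digits_val an; rewrite size_nseq; apply: etrans.
  by rewrite -(val_of_nseq_max K).
by rewrite /coords -[denv _]/(digits n K N.-1 ++ [::]) cats0 E map_nseq.
Qed.

Section Run.
Variable s0 : stor.
Hypothesis ord : order_on o (bits s0).

Lemma run_chk (f : fo T) : needs f <= k ->
  (forall s', run (chk f) s0 s' -> ev N (lev n Bk (XXof s0)) [::] f /\ s'.2 = s0.2) /\
  (ev N (lev n Bk (XXof s0)) [::] f -> exists s', run (chk f) s0 s').
Proof.
move=> nk; have env : env_ok z o s0.2 [::] [::] 0 s0 by split.
have Irel i (t : (arity i).-tuple 'I_n) :
  rel_of I t = rel_of (itp B) [tuple nth z o (tnth t q) | q < arity i] by [].
have [H1 H2] := @run_check sg T k dd B z mx zmx dd2 o s0.2 ord x0 I Irel (copy_cst z co) (dtr K' f) true [::] [::] 0 s0 env nk.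
have E := @ev_dtr T K' n Bk (XXof s0) (arr_rel (dd := dd) z mx o s0.2) (ltnW o1) (fun _ _ _ => erefl) f.
split=> [s' /H1[Hev [fr _]]|Hev]; first by split=> //; apply: etrans (esym E) Hev.
by apply: H2; apply: etrans E Hev.
Qed.

End Run.

Lemma order_eq s s' : s'.2 = s.2 -> order_on o (bits s) -> order_on o (bits s').
Proof. by rewrite /bits => ->. Qed.

Lemma XXof_eq s s' : s'.2 = s.2 -> XXof s' = XXof s.
Proof. by rewrite /XXof /bits => ->. Qed.

(** The contents of the arrays that represent the configurations [f l]. *)
Definition contents (f : nat -> config M) (t : T) (us : seq B) : bool :=
  `[< exists l a, [/\ l < N, size a = mar t, all (gtn N) a, us = coords (l :: a) & @mencf sg M n (f l) t a] >].

Lemma contentsE f l t a : l < N -> size a = mar t -> all (gtn N) a ->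
  contents f t (coords (l :: a)) = @mencf sg M n (f l) t a.
Proof.
move=> lN sa aN; apply/asboolP/idP => [[l' [a' [lN' sa' aN' E]]]|H]; last by exists l, a.
by have [-> ->] : l :: a = l' :: a' by apply: coords_inj E; rewrite /= ?sa ?sa' ?lN ?lN'.
Qed.

Lemma coords_cons l a : coords (l :: a) = coords [:: l] ++ coords a.
Proof. by rewrite /coords -map_cat /= cats0. Qed.

Lemma inside_coords a (t : T) : size a = mar t -> all (gtn N) a -> inside o (coords a) (K * mar t).
Proof. by move=> sa aN; split; [rewrite size_coords sa|apply: coords_in]. Qed.

Lemma all_run_enc f s : (forall t ws, t \in enum T -> inside o ws (K * (mar t).+1) ->
    bits s (key (XA t) ([::] ++ ws)) = contents f t ([::] ++ ws)) ->
  forall l, l < N -> enc (f l) (XXof s l).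
Proof.
move=> H l lN t a _ sa aN; rewrite -contentsE // /XXof; apply: (H t (coords (l :: a)) (mem_enum _ _)).
by split; [rewrite size_coords /= sa|apply: coords_in; rewrite /= lN].
Qed.

Lemma level_enc c l s : l < N -> (forall t ws, t \in enum T -> inside o ws (K * mar t) ->
    bits s (key (XA t) (coords [:: l] ++ ws)) = contents (fun=> c) t (coords [:: l] ++ ws)) ->
  enc c (XXof s l).
Proof.
move=> lN H t a _ sa aN; rewrite -(@contentsE (fun=> c) l) // /XXof coords_cons; apply: H.
  exact: mem_enum.
exact: inside_coords.
Qed.

Lemma ev_LastE XX e x : all (gtn N) e -> ev N (lev n Bk XX) e (FLastE x) = (nth 0 e x == N.-1).
Proof.
move=> ok; have xN := okenv_nth x N_gt0' ok; have N0 := N_gt0'; rewrite ev_Neg.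
apply/idP/eqP => [/ev_Ex H|E].
  apply/eqP; rewrite eqn_leq -ltnS prednK // xN /= leqNgt; apply/negP => lt; apply: H.
  by exists N.-1; rewrite ?prednK // ev_Lt.
apply/ev_Ex => -[v vN]; rewrite ev_Lt /= E; lia.
Qed.

Lemma ev_Init s : ev N (lev n Bk (XXof s)) [::] fInit <-> enc init (XXof s 0).
Proof.
split=> [/ev_Ex[v vN]|E].
  have ok : all (gtn N) [:: v] by rewrite /= vN.
  rewrite ev_Conj ev_First ?N_gt0' // => /andP[/eqP /= -> H].
  have ok0 : all (gtn N) [:: 0] by rewrite /= N_gt0'.
  by have [c [-> //]] := (sim_init simM (XXof s) 0 ok0).1 H.
have ok : all (gtn N) [:: 0] by rewrite /= N_gt0'.
apply/ev_Ex; exists 0; first exact: N_gt0'.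
rewrite ev_Conj ev_First ?N_gt0' //=; apply: (sim_init simM (XXof s) 0 ok).2.
by exists init.
Qed.

Lemma ev_Final s c : reachable c -> enc c (XXof s 0) ->
  ev N (lev n Bk (XXof s)) [::] fFinal <-> halted c /\ accepting (cstate c).
Proof.
move=> rc ec; have ok : all (gtn N) [:: 0] by rewrite /= N_gt0'.
rewrite -(sim_final simM (XX := XXof s) (e := [:: 0]) (l := 0) ok rc ec).
split=> [/ev_Ex[v vN]|H].
  have ok' : all (gtn N) [:: v] by rewrite /= vN.
  by rewrite ev_Conj ev_First ?N_gt0' // => /andP[/eqP /= ->].
apply/ev_Ex; exists 0; first exact: N_gt0'.
by rewrite ev_Conj ev_First ?N_gt0'.
Qed.

Lemma ev_Step s c : reachable c -> enc c (XXof s 0) ->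
  ev N (lev n Bk (XXof s)) [::] fStep <-> exists c', tm_step c c' /\ enc c' (XXof s N.-1).
Proof.
have N0 := N_gt0'; have lN : N.-1 < N by rewrite prednK.
move=> rc ec; have ok : all (gtn N) [:: N.-1; 0] by rewrite /= lN N0.
have SS := sim_step simM (XX := XXof s) (e := [:: N.-1; 0]) (l := 1) 0 ok rc ec.
split=> [/ev_Ex[v vN] /ev_Ex[v' vN']|H].
  have ok' : all (gtn N) [:: v'; v] by rewrite /= vN vN'.
  by rewrite !ev_Conj ev_First // ev_LastE // => /andP[/andP[/eqP /= -> /eqP /= ->]] /SS.
apply/ev_Ex; exists 0 => //; apply/ev_Ex; exists N.-1 => //.
by rewrite !ev_Conj ev_First // ev_LastE //= eqxx; apply/SS.
Qed.

Lemma ev_Same s c : enc c (XXof s N.-1) ->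
  ev N (lev n Bk (XXof s)) [::] fSame <-> enc c (XXof s 0).
Proof.
have N0 := N_gt0'; have lN : N.-1 < N by rewrite prednK.
move=> ec; have ok : all (gtn N) [:: 0; N.-1] by rewrite /= lN N0.
have SS := @ev_FSame T mar predT N n Bk (XXof s) _ _ c [:: 0; N.-1] 1 0 ec.
split=> [/ev_Ex[v vN] /ev_Ex[v' vN']|H].
  have ok' : all (gtn N) [:: v'; v] by rewrite /= vN vN'.
  by rewrite !ev_Conj ev_First // ev_LastE // => /andP[/andP[/eqP /= -> /eqP /= ->]] /SS.
apply/ev_Ex; exists N.-1 => //; apply/ev_Ex; exists 0 => //.
by rewrite !ev_Conj ev_First // ev_LastE //= eqxx; apply/SS.
Qed.

Lemma room_pair t : 0 + (K * (mar t).+1).+2 <= k.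
Proof. by have := len_le_dim t; rewrite /k; lia. Qed.

Lemma room_level t : 0 + (K * mar t).+2 <= k.
Proof. by have := room_pair t; rewrite mulnS; lia. Qed.

Lemma no_prefix s : [seq eval_term z mx s u | u <- ([::] : seq (term sg k.+1))] = [::].
Proof. by []. Qed.

Lemma searchB_sound s s' : order_on o (bits s) -> run searchB s s' -> Om A.
Proof.
move=> ord /run_cat[s1 [R1 /run_cat[s2 [R2 _]]]].
have [ord1 _] := run_GuessAll zmx dd2 k2 no_prefix room_pair len_le_dim ord R1.
have nk : needs (psiB sys) <= k by rewrite /k; lia.
have [ev2 _] := (run_chk ord1 nk).1 s2 R2.
exact/accepts_run/(psiB_sound simM N_gt0' ev2).
Qed.

(** After the chain has been guessed the other arrays are still at 0, so every relation can be
    produced by writing max alone. *)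
Lemma searchB_complete s :
  (forall t c, nsteps (@tm_step M) t init c -> t < N) ->
  order_on o (bits s) -> (forall t us, bits s (key (XA t) us) = false) -> Om A ->
  exists s', run searchB s s' /\ forall x, s'.1 x = mx.
Proof.
move=> time ord X0 /accepts_run[_ [c' [-> [t Rt] a]]].
have [f Hf] := psiB_complete simM N_gt0' erefl Rt a (time _ _ Rt).
have HX : false \/ (forall t ws, t \in enum T -> inside o ws (K * (mar t).+1) ->
  bits s (key (XA t) ([::] ++ ws)) = false) by right.
have [s1 [R1 b1]] := run_GuessAll_ex zmx dd2 k2 no_prefix room_pair len_le_dim
  (contents f) (enum_uniq _) ord HX.
have [ord1 _] := run_GuessAll zmx dd2 k2 no_prefix room_pair len_le_dim ord R1.
have nk : needs (psiB sys) <= k by rewrite /k; lia.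
have [s2 R2] := (run_chk ord1 nk).2 (Hf (XXof s1) (all_run_enc b1)).
have [s3 [R3 m3]] := @run_FinalMax sg T k dd B z mx s2.
exists s3; split=> //; apply/run_cat; exists s1; split=> //.
by apply/run_cat; exists s2.
Qed.

Section Level.
Variables (u : term sg k.+1) (v : B) (l : nat).
Hypotheses (Hu : forall s, eval_term z mx s u = v) (lN : l < N) (lv : coords [:: l] = nseq K v).

Lemma eval_pre s : [seq eval_term z mx s w | w <- nseq K u] = coords [:: l].
Proof. by rewrite lv map_nseq Hu. Qed.

Lemma pre_room t : size (coords [:: l]) + K * mar t <= dd.
Proof. by rewrite size_coords muln1 -mulnS len_le_dim. Qed.

(** Levels differ in their first [K] coordinates, so refilling one slot leaves the other intact. *)
Lemma run_guess_level s s' : order_on o (bits s) -> run (guess_level u) s s' ->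
  order_on o (bits s') /\ forall l' c, l' < N -> l' != l -> enc c (XXof s l') -> enc c (XXof s' l').
Proof.
move=> ord R; have [ord' keep] := run_GuessAll zmx dd2 k2 eval_pre room_level pre_room ord R.
split=> // l' c l'N ne ec t a tr sa aN; rewrite -(ec t a tr sa aN) /XXof /bits keep // => t' _ [ws sw E].
have Et : t = t' by have [] := key_arr E.
subst t'; move: ne; rewrite coords_cons in E.
have sz l1 : size (coords [:: l1]) = K by rewrite size_coords muln1.
have sz1 : size (coords [:: l'] ++ coords a) = size (coords [:: l] ++ ws).
  by rewrite !size_cat !sz sw size_coords sa.
have sz2 : size (coords [:: l'] ++ coords a) <= dd.
  by rewrite size_cat sz size_coords sa -mulnS len_le_dim.
have [_ /eqP] := key_inj sz1 sz2 E.
rewrite eqseq_cat ?sz // => /andP[/eqP /coords_inj El _].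
move: (El erefl); rewrite /= l'N lN => /(_ isT isT) [->]; by rewrite eqxx.
Qed.

Lemma run_guess_level_ex s c : order_on o (bits s) ->
  exists s', run (guess_level u) s s' /\ enc c (XXof s' l).
Proof.
move=> ord.
have HX : true \/ (forall t ws, t \in enum T -> inside o ws (K * mar t) ->
  bits s (key (XA t) (coords [:: l] ++ ws)) = false) by left.
have [s' [R b]] := run_GuessAll_ex zmx dd2 k2 eval_pre room_level pre_room
  (contents (fun=> c)) (enum_uniq _) ord HX.
by exists s'; split=> //; apply: (level_enc lN b).
Qed.

End Level.

Definition holds_config c s := [/\ order_on o (bits s), reachable c & enc c (XXof s 0)].

Lemma lastN : N.-1 < N. Proof. by rewrite prednK // N_gt0'. Qed.
Lemma last_neq0 : 0 != N.-1. Proof. by have := N_gt1'; case: N => [|[]]. Qed.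

Lemma max_last s : order_on o (bits s) -> coords [:: N.-1] = nseq K mx.
Proof. by move=> ord; rewrite coords_last (o_last ord). Qed.

Lemma zero_first s : order_on o (bits s) -> coords [:: 0] = nseq K z.
Proof. by move=> ord; rewrite coords0 (o_head ord). Qed.

Lemma run_next_config s s' : (exists c, holds_config c s) -> run next_config s s' -> exists c, holds_config c s'.
Proof.
move=> [c [ord rc ec]] /run_cat[s1 [R1 /run_cat[s2 [R2 /run_cat[s3 [R3 R4]]]]]].
have [ord1 K1] := run_guess_level (fun _ => erefl : eval_term z mx _ Max = mx) lastN (max_last ord) ord R1.
have ec1 := K1 0 c N_gt0' last_neq0 ec.
have nk2 : needs fStep <= k by rewrite /k; lia.
have [ev2 E2] := (run_chk ord1 nk2).1 s2 R2.
have [c' [st ec1']] := (ev_Step rc ec1).1 ev2.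
have ord2 := order_eq E2 ord1.
have ec2 : enc c' (XXof s2 N.-1) by rewrite (XXof_eq E2).
have [ord3 K3] := run_guess_level (fun _ => erefl : eval_term z mx _ Zero = z) N_gt0' (zero_first ord2) ord2 R3.
have ne0 : N.-1 != 0 by rewrite eq_sym last_neq0.
have ec3 := K3 N.-1 c' lastN ne0 ec2.
have nk4 : needs fSame <= k by rewrite /k; lia.
have [ev4 E4] := (run_chk ord3 nk4).1 s' R4.
exists c'; split; [exact: order_eq E4 ord3|exact: (sim_good_stp simM) rc st|].
by rewrite (XXof_eq E4); apply/(ev_Same ec3).
Qed.

Lemma run_next_config_ex s c c' : holds_config c s -> tm_step c c' ->
  exists s', run next_config s s' /\ holds_config c' s'.
Proof.
move=> [ord rc ec] st.
have Zz s1 : eval_term z mx s1 (@Zero sg k.+1) = z by [].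
have Mm s1 : eval_term z mx s1 (@Max sg k.+1) = mx by [].
have [s1 [R1 e1]] := run_guess_level_ex Mm lastN (max_last ord) c' ord.
have [ord1 K1] := run_guess_level Mm lastN (max_last ord) ord R1.
have ec1 := K1 0 c N_gt0' last_neq0 ec.
have nk2 : needs fStep <= k by rewrite /k; lia.
have [s2 R2] := (run_chk ord1 nk2).2 ((ev_Step rc ec1).2 (ex_intro _ c' (conj st e1))).
have [_ E2] := (run_chk ord1 nk2).1 s2 R2.
have ord2 := order_eq E2 ord1.
have ec2 : enc c' (XXof s2 N.-1) by rewrite (XXof_eq E2).
have [s3 [R3 e3]] := run_guess_level_ex Zz N_gt0' (zero_first ord2) c' ord2.
have [ord3 K3] := run_guess_level Zz N_gt0' (zero_first ord2) ord2 R3.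
have ne0 : N.-1 != 0 by rewrite eq_sym last_neq0.
have ec3 := K3 N.-1 c' lastN ne0 ec2.
have nk4 : needs fSame <= k by rewrite /k; lia.
have [s4 R4] := (run_chk ord3 nk4).2 ((ev_Same ec3).2 e3).
have [_ E4] := (run_chk ord3 nk4).1 s4 R4.
exists s4; split; last first.
  by split; [exact: order_eq E4 ord3|exact: (sim_good_stp simM) rc st|rewrite (XXof_eq E4)].
apply/run_cat; exists s1; split=> //; apply/run_cat; exists s2; split=> //.
by apply/run_cat; exists s3.
Qed.

Lemma holds_guess c s u : holds_config c s -> holds_config c (set_var s (var k 0) u).
Proof. by []. Qed.

Lemma run_loopA s s' : (exists c, holds_config c s) -> run loopA s s' -> exists c, holds_config c s'.
Proof.
move=> [c Hc] /run_cons[s1 [/run_GuessV[u E1] R]].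
have H1 : exists c, holds_config c s1 by exists c; rewrite E1; apply: holds_guess.
have [] := run_while_ind (P := fun s => exists c, holds_config c s) _ R H1 => //.
move=> s2 s3 H2 _ /run_cat[s4 [R4 /run_GuessV[u' ->]]].
by have [c' H'] := run_next_config H2 R4; exists c'; apply: holds_guess.
Qed.

Lemma run_loopA_ex t c c' s : nsteps (@tm_step M) t c c' -> holds_config c s ->
  exists s', run loopA s s' /\ holds_config c' s'.
Proof.
elim: t c s => [|t IH] c s /=.
  move=> <- Hc; exists (set_var s (var k 0) mx); split; last exact: holds_guess.
  apply/run_cons; eexists; split; first by apply/run_GuessV; exists mx.
  by apply/run_while; rewrite /= ffunE !eqxx.
move=> [c1 [st R]] Hc.
have [s1 [R1 H1]] := run_next_config_ex (holds_guess z Hc) st.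
have [s' [/run_cons[s2 [R2 R3]] H']] := IH c1 s1 R H1.
exists s'; split=> //; apply/run_cons; eexists; split; first by apply/run_GuessV; exists z.
apply/run_while; rewrite [eval_test _ _ _ _]/= ffunE eqxx zmx.
exists s2; split=> //; apply/run_cat; exists s1; split=> //; exact: R2.
Qed.

Lemma searchA_sound s s' : order_on o (bits s) -> run searchA s s' -> Om A.
Proof.
move=> ord /run_cat[s1 [R1 /run_cat[s2 [R2 /run_cat[s3 [R3 /run_cat[s4 [R4 _]]]]]]]].
have [ord1 K1] := run_guess_level (fun _ => erefl : eval_term z mx _ Zero = z) N_gt0' (zero_first ord) ord R1.
have nk2 : needs fInit <= k by rewrite /k; lia.
have [ev2 E2] := (run_chk ord1 nk2).1 s2 R2.
have H2 : exists c, holds_config c s2.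
  exists init; split; [exact: order_eq E2 ord1|by exists 0|].
  by rewrite (XXof_eq E2); apply/ev_Init.
have [c [ord3 rc ec]] := run_loopA H2 R3.
have nk4 : needs fFinal <= k by rewrite /k; lia.
have [ev4 _] := (run_chk ord3 nk4).1 s4 R4.
by apply/accepts_run; exists init, c; split=> //; apply/(ev_Final rc ec).
Qed.

Lemma searchA_complete s : order_on o (bits s) -> Om A ->
  exists s', run searchA s s' /\ forall x, s'.1 x = mx.
Proof.
move=> ord /accepts_run[_ [c [-> [t Rt] a]]].
have Zz s1 : eval_term z mx s1 (@Zero sg k.+1) = z by [].
have [s1 [R1 e1]] := run_guess_level_ex Zz N_gt0' (zero_first ord) init ord.
have [ord1 K1] := run_guess_level Zz N_gt0' (zero_first ord) ord R1.
have nk2 : needs fInit <= k by rewrite /k; lia.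
have [s2 R2] := (run_chk ord1 nk2).2 ((ev_Init s1).2 e1).
have [_ E2] := (run_chk ord1 nk2).1 s2 R2.
have H2 : holds_config init s2.
  by split; [exact: order_eq E2 ord1|exists 0|rewrite (XXof_eq E2)].
have [s3 [R3 [ord3 rc ec]]] := run_loopA_ex Rt H2.
have nk4 : needs fFinal <= k by rewrite /k; lia.
have [s4 R4] := (run_chk ord3 nk4).2 ((ev_Final rc ec).2 a).
have [s5 [R5 m5]] := @run_FinalMax sg T k dd B z mx s4.
exists s5; split=> //; apply/run_cat; exists s1; split=> //; apply/run_cat; exists s2; split=> //.
apply/run_cat; exists s3; split=> //; by apply/run_cat; exists s4.
Qed.

End WithOrder.
End Ordered.

(** Soundness is asked for every chain, since any may have been guessed; completeness is applied to
    a chain through the whole universe, where [copy] is isomorphic to [B] itself. *)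
Lemma search_correct (search : code) :
  (forall o (o1 : 1 < size o) (co : forall j, cst_of (itp B) j \in o) s s',
     order_on o (bits s) -> run search s s' -> Om (Structure (card_ord_gt1 o1) (copy z co))) ->
  (forall o (o1 : 1 < size o) (co : forall j, cst_of (itp B) j \in o) s,
     order_on o (bits s) -> (forall t us, bits s (key (XA t) us) = false) ->
     Om (Structure (card_ord_gt1 o1) (copy z co)) ->
     exists s', run search s s' /\ forall x, s'.1 x = mx) ->
  (exists s, run (GuessOrder sg T k dd ++ search) (init_store z k.+1 dim) s /\ forall x, s.1 x = mx) <-> Om B.
Proof.
move=> sound complete.
have init0 c : bits (init_store z k.+1 dim) c = false by rewrite /bits ffunE (negbTE zmx).
split=> [[s [/run_cat[s1 [R1 R2]] _]]|OB].
  have [o [ord _]] := run_GuessOrder zmx dd2 k2 init0 R1.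
  have OA := sound o (o_size ord) (o_cst ord) s1 s ord R2.
  apply: (ext (S_gt1 := elems_gt1 (o_uniq ord) (o_size ord)) (cS := elems_cst (o_cst ord))).
  exact: iso_closed (copy_iso z (o_uniq ord) (o_size ord) (o_cst ord)) OA.
have [o [uo ao h0 hl]] := enum_ends zmx.
have o1 : 1 < size o.
  by rewrite ltnNge; apply: contra zmx => o1; rewrite -h0 -hl; case: (size o) o1 => [|[]].
have co j : cst_of (itp B) j \in o := ao _.
have [s1 [R1 [ord X0]]] := run_GuessOrder_ex zmx dd2 k2 init0 uo ao h0 hl.
have [s2 [R2 m2]] := complete o o1 co s1 ord X0 (iso_closed (iso_copy z uo o1 co ao) OB).
by exists s2; split=> //; apply/run_cat; exists s1.
Qed.

End Semantics.

Definition scheme_of (search : code) : scheme sg :=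
  @Scheme sg k.+1 isT #|{: arr}| dim (fun _ => isT) (GuessOrder sg T k dd ++ search).

(** Equivalence with membership for every choice of 0 and max gives choice independence at once;
    [univ_gt1] supplies one such choice. *)
Lemma defines_search (search : code) :
  (forall (B : structure sg) (z mx : B), z != mx -> ps_accepts (scheme_of search) z mx <-> Om B) ->
  defines (scheme_of search) Om.
Proof.
move=> H; split=> [B z mx z' mx' ne ne'|B]; first by rewrite !H.
split=> [OB|[z [mx [ne /H]]]]; last by apply.
by have /card_gt1P[z [mx [_ _ ne]]] := univ_gt1 B; exists z, mx; split=> //; apply/H.
Qed.

Lemma defines_searchA : defines (scheme_of searchA) Om.
Proof.
apply: defines_search => B z mx ne; rewrite -(search_correct ne (search := searchA)) //.
  by move=> o o1 co s s' ord R; apply: searchA_sound (ord) R => //; exact: o_uniq ord.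
by move=> o o1 co s ord _ OA; apply: searchA_complete (ord) OA => //; exact: o_uniq ord.
Qed.

Lemma defines_searchB :
  (forall n (I : interp sg 'I_n) t c, 1 < n -> nsteps (@tm_step M) t (init_config M (encode I)) c -> t < n ^ K) ->
  defines (scheme_of searchB) Om.
Proof.
move=> time; apply: defines_search => B z mx ne; rewrite -(search_correct ne (search := searchB)) //.
  by move=> o o1 co s s' ord R; apply: searchB_sound (ord) R => //; exact: o_uniq ord.
move=> o o1 co s ord X0 OA; apply: searchB_complete (ord) X0 OA => //; first exact: o_uniq ord.
by move=> t c; apply: time.
Qed.

End Assembly.

(** * The NP search writes only max *)

Section WritesOnlyMax.
Variables (sg : signature) (T : finType) (k dd : nat).
Notation arr := (bool + T)%type.
Notation dim := (fun _ : 'I_#|{: arr}| => dd).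
Notation code := (seq (instr sg k.+1 dim)).
Notation wom p := (all (@writes_only_max sg k.+1 #|{: arr}| dim) p).

Lemma wom_ForS v (p : code) : wom p -> wom (ForS v p).
Proof. by move=> H; rewrite /= !all_cat /= H. Qed.

Lemma wom_Or v (p q : code) : wom p -> wom q -> wom (Or v p q).
Proof. by move=> H1 H2; rewrite /= !all_cat H1 H2. Qed.

Lemma wom_check b (f : fo T) rho d : wom (@check sg T k dd b f rho d).
Proof.
elim: f b rho d => [a l|f IH|f IHf g IHg|f IH] b rho d; last 1 first.
- by case: b; [rewrite /= IH|apply/wom_ForS/IH].
- by case: a => [|||t]; case: b; case: l => [|x [|y [|w l]]].
- exact: IH.
by case: b; [rewrite /= all_cat IHf IHg|apply: wom_Or].
Qed.

Lemma wom_GuessN t ts m d : wom (@GuessN sg T k dd false t ts m d).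
Proof. by elim: m ts d => // m IH ts d; apply/wom_ForS/IH. Qed.

Lemma wom_GuessAll pre len d l : wom (@GuessAll sg T k dd false pre len d l).
Proof. by elim: l => //= t l IH; rewrite -[GuessAll _ _ _ _ _ _]/(GuessN _ _ _ _ _ _ ++ _) all_cat wom_GuessN. Qed.

Lemma wom_GuessOrder : wom (GuessOrder sg T k dd).
Proof. by rewrite /= /ask_consts; elim: (enum _). Qed.

Lemma wom_FinalMax : wom (FinalMax sg T k dd).
Proof. by rewrite /FinalMax; elim: (iota _ _). Qed.

End WritesOnlyMax.

Lemma wom_searchB sg M K' : all (@writes_only_max sg _ _ _)
  (GuessOrder sg (mtag sg M) (top_var sg M K') (cell_dim sg M K') ++ searchB sg M K').
Proof. by rewrite all_cat wom_GuessOrder /searchB all_cat wom_GuessAll all_cat wom_check wom_FinalMax. Qed.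

Lemma size_lt_exp (p : {poly nat}) sg : exists K', forall n (I : interp sg 'I_n), 1 < n ->
  (p.[size (encode I)])%R < n ^ K'.+1.
Proof.
have [c Hc] := poly_le_exp p; have [e He] := encode_size_exp sg.
exists (e * c) => n I n1; apply: leq_ltn_trans (Hc _) _.
apply: (@leq_ltn_trans (n ^ (e * c))); last by rewrite ltn_exp2l.
by rewrite expnM; case: c {Hc} => // c; rewrite leq_exp2r ?He.
Qed.

Theorem pspace_scheme sg (Om : problem sg) : PSPACE Om -> EXT Om -> NPSA1 Om.
Proof.
move=> [M [p [_ H]]] ext; have [K' HK] := size_lt_exp p sg.
exists (scheme_of (searchA sg M K')); apply: defines_searchA => // [n I n1 c R i|n gt I].
  have [heads _ _] := H (encode I); exact: leq_trans (heads c R i) (ltnW (HK n I n1)).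
by have [_ _ <-] := H (encode I); rewrite (member_encode Om gt I).
Qed.

Theorem np_scheme sg (Om : problem sg) : NP Om -> EXT Om -> NPSB1 Om.
Proof.
move=> [M [p H]] ext; have [K' HK] := size_lt_exp p sg.
have time n (I : interp sg 'I_n) t c : 1 < n -> nsteps (@tm_step M) t (init_config M (encode I)) c -> t < n ^ K'.+1.
  by move=> n1 R; apply: leq_ltn_trans (HK n I n1); apply: (H (encode I)).1 R.
exists (scheme_of (searchB sg M K')); split; first exact: wom_searchB.
apply: defines_searchB => // [n I n1 c [t R] i|n gt I].
  (* A head moves at most one cell per step, so the time bound also bounds the heads. *)
  by apply: leq_ltn_trans (time n I t c n1 R); have := chead_nsteps i R.
by rewrite -(H (encode I)).2 (member_encode Om gt I).
Qed.

Theorem theorem14 :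
  forall (sg : signature) (Om : problem sg),
    ((PSPACE Om /\ EXT Om) <-> NPSA1 Om) /\
    ((NP Om /\ EXT Om) <-> NPSB1 Om).
Proof.
move=> sg Om; split; split=> [[]|].
- exact: pspace_scheme.
- by move=> [P defP]; split; [exact: scheme_pspace defP|exact: scheme_ext defP].
- exact: np_scheme.
- by move=> [P [wP defP]]; split; [exact: scheme_np defP wP|exact: scheme_ext defP].
Qed.
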